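(* In the setting described in the context: (a) For every $2\le p<\infty$ there is a constant $c_p>0$, depending only on $p$, such that if $\lim_{T\to\infty}\|P_Tg\|_p=0$ for every $g\in L^p(m)$ (strong stability), then for every $f\in L^p(m)$ $$c_p\|f\|_p\le\|\widetilde G\|_p .$$ (b) For every $1<p\le 2$ there is a constant $C_p>0$, depending only on $p$, such that if $\lim_{T\to\infty}\|P_Tg\|_p=0$ for every $g\in L^p(m)$, then for every $f\in L^p(m)$ $$\|\widetilde G\|_p\le C_p\|f\|_p .$$ (c) For every $2<p<\infty$ there does not exist a universal constant $\widetilde C_p>0$ (that is, a constant depending only on $p$) such that $\|\widetilde G\|_p\le\widetilde C_p\|f\|_p$ holds for all choices of $E$, $m$ and Dirichlet form as in the context and all $f\in L^p(m)$.
   Context: Setting. $E$ is a locally compact separable metric space with Borel $\sigma$-algebra $\mathcal B(E)$, and $m$ is a Radon measure on $E$ with $\operatorname{supp} m=E$. $L^p(m)$ is the real $L^p$-space with norm $\|\cdot\|_p$. Let $d=\{(x,y)\in E\times E: x=y\}$. $(\mathcal E,\mathcal D(\mathcal E))$ is a regular (symmetric) Dirichlet form on $L^2(m)$ which is pure-jump: there is a symmetric jumping measure $J$ on $E\times E\setminus d$ such that $$\mathcal E(u,v)=\tfrac12\iint_{E\times E\setminus d}(u(y)-u(x))(v(y)-v(x))\,J(dx,dy)$$ for all $u,v\in\mathcal D(\mathcal E)$ (taken in quasi-continuous versions). It is assumed that $J$ is given by a kernel: $J(dx,dy)=J(x,dy)\,m(dx)$. $X=(X_t)$ is the associated $m$-symmetric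 Hunt process, with laws $\mathbb P_x$, expectations $\mathbb E_x$ and cemetery $\Delta$. Its semigroup $P_tg(x)=\mathbb E_x g(X_t)$ (with $g(\Delta)=0$) extends to a semigroup of sub-Markovian contractions on $L^p(m)$, $1\le p\le\infty$, strongly continuous for $1\le p<\infty$ and symmetric on $L^2(m)$. Square function. Let $\chi(s,t)=1$ if $|s|>|t|$, $\chi(s,t)=\tfrac12$ if $|s|=|t|$, $\chi(s,t)=0$ if $|s|<|t|$. For $f\in L^p(m)$, $1<p<\infty$, $$\widetilde G(x)=\Big(\int_0^\infty\int_{E\setminus\{x\}}(P_tf(y)-P_tf(x))^2\,\chi(P_tf(x),P_tf(y))\,J(x,dy)\,dt\Big)^{1/2}\in[0,\infty].$$ *)

(* Defs.v *)
From HB Require Import structures.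
From mathcomp Require Import all_boot all_order all_algebra.
From mathcomp Require Import all_classical all_reals all_analysis.

Set Implicit Arguments.
Unset Strict Implicit.
Unset Printing Implicit Defensive.

Import Order.TTheory GRing.Theory Num.Theory.
Import numFieldNormedType.Exports.

Local Open Scope classical_set_scope.
Local Open Scope ring_scope.

(* Measurable types are pointed in the library, hence the distinguished point
   of the metric space E. *)
#[short(type="pmetricType")]
HB.structure Definition PMetric (K : numDomainType) :=
  {M of Pointed M & Metric K M}.

(* The same points as T, with the Borel sigma-algebra. *)
Definition borel (T : ptopologicalType) := g_sigma_algebraType (@open T).

(* E with the cemetery Delta = None: the point at infinity of the one-point
   compactification (an isolated point when E is compact). *)
Notation with_cemetery := one_point_compactification.

(* A measure on the sigma-algebra M of T, restricted to the subset D of T, is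
   Radon: finite on compact sets and inner regular. *)
Definition radon_on (R : realType) (T : topologicalType) (D : set T)
    (M : set (set T)) (mu : set T -> \bar R) : Prop :=
  (forall K, compact K -> K `<=` D -> (mu K < +oo)%E) /\
  (forall A, M A -> A `<=` D ->
     mu A = ereal_sup [set mu K | K in [set K | compact K /\ K `<=` A]]).

Definition offdiag (T : Type) : set (T * T) := [set z | z.1 <> z.2].

Section dirichlet_forms.
Variables (R : realType) (E : pmetricType R).
Variable m : {measure set (borel E) -> \bar R}.

Definition L2 : set (E -> R) := [set u | (u : borel E -> R) \in Lfun m 2%:E].

Definition dot (u v : E -> R) : R := \int[m]_x (u x * v x).

(* Elements of L^2(m) are represented by Borel functions; df_ae says that the
   domain D and the form Ef only depend on m-a.e. classes. *)
Record dirichlet_form (D : set (E -> R)) (Ef : (E -> R) -> (E -> R) -> R)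
    : Prop := {
  df_L2 : D `<=` L2 ;
  df_ae : forall u v, D u -> measurable_fun [set: borel E] v ->
    ae_eq m setT u v -> D v /\ forall w, D w -> Ef u w = Ef v w ;
  df_lin : forall (a : R) u v, D u -> D v -> D (fun x => a * u x + v x) ;
  df_dense : forall f, L2 f -> forall e : R, 0 < e ->
    exists2 u, D u & ('N[m]_2%:E[(fun x => (f x - u x)%:E)] < e%:E)%E ;
  df_sym : forall u v, D u -> D v -> Ef u v = Ef v u ;
  df_linl : forall (a : R) u v w, D u -> D v -> D w ->
    Ef (fun x => a * u x + v x) w = a * Ef u w + Ef v w ;
  df_ge0 : forall u, D u -> 0 <= Ef u u ;
  df_closed : forall u_ : nat -> E -> R, (forall n, D (u_ n)) ->
    (forall e : R, 0 < e -> exists N, forall n k, (N <= n)%N -> (N <= k)%N ->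
       Ef (fun x => u_ n x - u_ k x) (fun x => u_ n x - u_ k x) +
       dot (fun x => u_ n x - u_ k x) (fun x => u_ n x - u_ k x) < e) ->
    exists2 u, D u &
      (Ef (fun x => u_ n x - u x) (fun x => u_ n x - u x) +
       dot (fun x => u_ n x - u x) (fun x => u_ n x - u x)) @[n --> \oo] --> 0 ;
  df_markov : forall u, D u ->
    D (fun x => Num.min (Num.max 0 (u x)) 1) /\
    Ef (fun x => Num.min (Num.max 0 (u x)) 1)
       (fun x => Num.min (Num.max 0 (u x)) 1) <= Ef u u }.

Section form.
Variables (D : set (E -> R)) (Ef : (E -> R) -> (E -> R) -> R).

Definition E1 (u : E -> R) : R := Ef u u + dot u u.

Definition continuous_compact_support : set (E -> R) :=
  [set u | continuous u /\ compact (closure [set x | u x <> 0])].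

Definition regular_form : Prop :=
  (forall u, D u -> forall e : R, 0 < e ->
     exists2 v, (D `&` continuous_compact_support) v &
       E1 (fun x => u x - v x) < e) /\
  (forall f, continuous_compact_support f -> forall e : R, 0 < e ->
     exists2 v, (D `&` continuous_compact_support) v &
       forall x, `|f x - v x| < e).

Definition open_capacity (G : set E) : \bar R :=
  ereal_inf [set (E1 u)%:E | u in
    [set u | D u /\ {ae m, forall x, G x -> 1 <= u x}]].

Definition quasi_continuous (u : E -> R) : Prop :=
  forall e : R, 0 < e -> exists G : set E,
    [/\ open G, (open_capacity G < e%:E)%E & {within ~` G, continuous u}].

Definition quasi_continuous_version (u u' : E -> R) : Prop :=
  [/\ measurable_fun [set: borel E] u', ae_eq m setT u u' &
      quasi_continuous u'].

(* The jumping measure J and the measures J(x, .) live on E * E minus the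
   diagonal and on E minus {x}; here they are measures on E * E and on E, and
   only their restrictions off the diagonal are ever used.  Every u in D has
   a quasi-continuous version, and any two give the same integral in
   pj_form. *)
Record pure_jump (J : {measure set (borel E * borel E) -> \bar R})
    (Jk : R.-ker borel E ~> borel E) : Prop := {
  pj_radon : @radon_on R (E * E)%type (@offdiag E)
    (measurable : set (set (borel E * borel E))) J ;
  pj_sym : forall C : set (borel E * borel E), measurable C ->
    C `<=` @offdiag E -> J [set z | C (z.2, z.1)] = J C ;
  pj_kernel : forall C : set (borel E * borel E), measurable C ->
    C `<=` @offdiag E -> J C = (\int[m]_x Jk x (xsection C x))%E ;
  pj_form : forall u v, D u -> D v -> exists u' v',
    [/\ quasi_continuous_version u u', quasi_continuous_version v v' &
      (Ef u v)%:E = (2^-1%:E * \int[J]_(z in @offdiag E)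
        ((u' z.2 - u' z.1) * (v' z.2 - v' z.1))%:E)%E] }.

(* P restricts to a strongly continuous semigroup of symmetric contractions
   on L^2(m). *)
Record L2_semigroup (P : R -> (E -> R) -> E -> R) : Prop := {
  sg_L2 : forall (t : R) f, 0 <= t -> L2 f -> L2 (P t f) ;
  sg_lin : forall (t a : R) f g, 0 <= t -> L2 f -> L2 g ->
    ae_eq m setT (P t (fun x => a * f x + g x))
                 (fun x => a * P t f x + P t g x) ;
  sg_contraction : forall (t : R) f, 0 <= t -> L2 f ->
    ('N[m]_2%:E[EFin \o P t f] <= 'N[m]_2%:E[EFin \o f])%E ;
  sg_0 : forall f, L2 f -> ae_eq m setT (P 0 f) f ;
  sg_add : forall (s t : R) f, 0 <= s -> 0 <= t -> L2 f ->
    ae_eq m setT (P (s + t) f) (P s (P t f)) ;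
  sg_sym : forall (t : R) f g, 0 <= t -> L2 f -> L2 g ->
    dot (P t f) g = dot f (P t g) ;
  sg_continuous : forall f, L2 f ->
    'N[m]_2%:E[(fun x => (P t f x - f x)%:E)]%E @[t --> 0^'+] --> 0%E }.

(* (Ef, D) is the Dirichlet form of the semigroup P:
   D = {u in L^2(m) : lim (u - P_t u, u) / t exists and is finite},
   Ef u v = lim (u - P_t u, v) / t, as t decreases to 0. *)
Definition form_of_semigroup (P : R -> (E -> R) -> E -> R) : Prop :=
  (forall u, D u <-> L2 u /\ exists l : R,
     dot (fun x => u x - P t u x) u / t @[t --> 0^'+] --> l) /\
  (forall u v, D u -> D v ->
     dot (fun x => u x - P t u x) v / t @[t --> 0^'+] --> Ef u v).

End form.
End dirichlet_forms.

(* Only times t >= 0 are relevant. *)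
Record process (R : realType) (E : pmetricType R) := Process {
  omega_display : measure_display ;
  omega : measurableType omega_display ;
  law : R.-pker borel (with_cemetery E) ~> omega ;
  sample_path : R -> omega -> with_cemetery E ;
  filtration : R -> set (set omega) }.
Arguments law {R E} p.
Arguments sample_path {R E} p _ _.
Arguments filtration {R E} p _.

Section hunt.
Variables (R : realType) (E : pmetricType R) (X : process E).

Definition stopping_time (s : omega X -> \bar R) : Prop :=
  (forall w, (0 <= s w)%E) /\
  forall t : R, 0 <= t -> filtration X t [set w | (s w <= t%:E)%E].

Definition stopped_sigma_algebra (s : omega X -> \bar R)
    : set (set (omega X)) :=
  [set A | measurable A /\ forall t : R, 0 <= t ->
    filtration X t (A `&` [set w | (s w <= t%:E)%E])].

(* Hunt process on E with cemetery None (absorbing, possibly unreached).  As law is a kernel and the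
   filtration does not depend on the starting point, stating hunt_markov and
   hunt_quasi_left for all starting points is the same as stating them for
   all initial distributions. *)
Record hunt : Prop := {
  hunt_sigma : forall t : R, 0 <= t -> sigma_algebra setT (filtration X t) ;
  hunt_sub : forall t : R, 0 <= t -> filtration X t `<=` measurable ;
  hunt_mono : forall s t : R, 0 <= s -> s <= t ->
    filtration X s `<=` filtration X t ;
  hunt_right : forall t : R, 0 <= t ->
    \bigcap_(s in [set s | t < s]) filtration X s `<=` filtration X t ;
  hunt_adapted : forall (t : R) (B : set (borel (with_cemetery E))), 0 <= t ->
    measurable B -> filtration X t (sample_path X t @^-1` B) ;
  hunt_start : forall x, law X x [set w | sample_path X 0 w = x] = 1%E ;
  hunt_cemetery : forall (s t : R) w, 0 <= s -> s <= t ->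
    sample_path X s w = None -> sample_path X t w = None ;
  hunt_shift : forall t : R, 0 <= t -> exists theta : omega X -> omega X,
    forall (s : R) w, 0 <= s ->
      sample_path X s (theta w) = sample_path X (t + s) w ;
  hunt_right_continuous : forall (t : R) (w : omega X), 0 <= t ->
    sample_path X s w @[s --> t^'+] --> sample_path X t w ;
  hunt_left_limits : forall (t : R) (w : omega X), 0 < t ->
    exists y : with_cemetery E, sample_path X s w @[s --> t^'-] --> y ;
  hunt_markov : forall s, stopping_time s ->
    forall A, stopped_sigma_algebra s A ->
    forall (x : with_cemetery E) (t : R) (B : set (borel (with_cemetery E))),
    0 <= t -> measurable B ->
    law X x (A `&` [set w | (s w < +oo)%E /\
      B (sample_path X (fine (s w) + t) w)]) =
    (\int[law X x]_(w in A `&` [set w | (s w < +oo)%E])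
       law X (sample_path X (fine (s w)) w) (sample_path X t @^-1` B))%E ;
  hunt_quasi_left : forall s_ : nat -> omega X -> \bar R,
    (forall n, stopping_time (s_ n)) ->
    (forall w, {homo s_ ^~ w : n k / (n <= k)%N >-> (n <= k)%E}) ->
    forall x : with_cemetery E,
    {ae law X x, forall w,
      (ereal_sup [set s_ n w | n in [set: nat]] < +oo)%E ->
      sample_path X (fine (s_ n w)) w @[n --> \oo] -->
      sample_path X (fine (ereal_sup [set s_ n w | n in [set: nat]])) w} }.

(* P_t g(x) = E_x g(X_t) with g(Delta) = 0, set to 0 where the expectation is
   not finite. *)
Definition Pt (t : R) (g : E -> R) (x : E) : R :=
  \int[law X (Some x)]_w oapp g 0 (sample_path X t w).

End hunt.
Arguments Pt {R E} X t g x.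

Record pure_jump_setting (R : realType) (E : pmetricType R)
    (m : {measure set (borel E) -> \bar R})
    (D : set (E -> R)) (Ef : (E -> R) -> (E -> R) -> R)
    (J : {measure set (borel E * borel E) -> \bar R})
    (Jk : R.-ker borel E ~> borel E) (X : process E) : Prop := {
  set_locally_compact : locally_compact [set: E] ;
  set_separable : exists S : set E, countable S /\ dense S ;
  set_radon : @radon_on R E setT (measurable : set (set (borel E))) m ;
  set_support : forall U : set E, open U -> U !=set0 -> (0 < m U)%E ;
  set_form : dirichlet_form m D Ef ;
  set_regular : regular_form m D Ef ;
  set_jump : pure_jump m D Ef J Jk ;
  set_hunt : hunt X ;
  set_semigroup : L2_semigroup m (Pt X) ;
  set_associated : form_of_semigroup m D Ef (Pt X) }.

Section square_function.
Variables (R : realType) (E : pmetricType R).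

Definition chi (s t : R) : R :=
  if `|t| < `|s| then 1 else if `|s| == `|t| then 2^-1 else 0.

Definition Gtilde (Jk : R.-ker borel E ~> borel E) (X : process E)
    (f : E -> R) (x : borel E) : \bar R :=
  ((\int[lebesgue_measure]_(t in `[0%R, +oo[)
      \int[Jk x]_(y in [set~ x])
        ((Pt X t f y - Pt X t f x) ^+ 2 * chi (Pt X t f x) (Pt X t f y))%:E)
   `^ 2^-1)%E.

Definition strongly_stable (m : {measure set (borel E) -> \bar R})
    (X : process E) (p : R) : Prop :=
  forall g : borel E -> R, g \in Lfun m p%:E ->
    'N[m]_p%:E[EFin \o Pt X T g]%E @[T --> +oo] --> 0%E.

End square_function.

(* Main.v *)
(** Write v_t for the signed power of P_t f with exponent p/2.  Comparing
    |b|^p - |a|^p - p |a|^(p-1) sgn(a) (b - a) with the squared difference of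
    the signed powers of a and b, and integrating against the sub-Markovian
    kernel P_h, squeezes the decrease of |P_t f|_p^p over [t, t+h] between
    multiples of |v_t|_2^2 - |P_h v_t|_2^2.  Along h = 2^-k the latter, divided
    by 2h, increases to E(v_t, v_t), so that the integral of E(v_t, v_t) over
    t >= 0 is comparable to |f|_p^p (Hardy-Stein; the bound from below needs
    p >= 2 and strong stability).  By symmetry of J only the pairs with
    |P_t f(y)| <= |P_t f(x)| matter in E(v_t, v_t); there the squared increment
    of v_t is comparable, in the direction that is needed, to
    |P_t f(x)|^(p-2) times that of P_t f, and |P_t f(x)| <= f*(x), where f* is
    the maximal function.  Young's inequality separates f* from the square
    function, and |f*|_p <= C |f|_p follows from a dynamic programming argument
    for the Markov chain with kernel P_(2^-n), using only the symmetry of P_t.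

    For (c), take the path graph on three points with masses 1, eps, 1 and unit
    conductances, and f = (0, 1, 2).  Then P_t f = (1 - e^-t, 1, 1 + e^-t), the
    square function at the centre is at least of order eps^(-1/2), and its L^p
    norm to the power p is at least of order eps^(1-p/2), which is unbounded
    when p > 2.  The associated Hunt process is run by exponential clocks read
    off a sequence of fair coins. *)
Require Import Defs.
From HB Require Import structures.
From mathcomp Require Import all_boot all_order all_algebra.
From mathcomp Require Import all_classical all_reals all_analysis.
From mathcomp Require Import measurable_realfun zify ring lra.

Set Implicit Arguments.
Unset Strict Implicit.
Unset Printing Implicit Defensive.

Import Order.TTheory GRing.Theory Num.Theory.
Import numFieldNormedType.Exports.

Local Open Scope classical_set_scope.
Local Open Scope ring_scope.

(** * Bregman divergences and signed powers *)

(** The obstacle is domains: [P_t f] need not lie in the form domain, and the [p]-mass of [P_t f] is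
    never differentiated in [t]. Only increments over dyadic steps occur; they telescope in time,
    and monotonicity in the step lets the limit pass under the integral over [t]. Finiteness of the
    limit then puts [v_t] into the domain for almost every [t]. The mass lost by a sub-Markovian
    kernel enters these estimates with a definite sign, provided the constant lies on the right side
    of [p - 1].

    Exchanging integrals requires joint measurability in time and space and an s-finite jump kernel,
    and neither is part of the setting. The paths supply a transition kernel on time and space
    together; compact rectangles off the diagonal, where [J] is finite, supply an s-finite version
    of the jump kernel at almost every point. The analysis is done for such abstract kernels and
    transferred afterwards.

    In the lower bound, Young's inequality leaves a small multiple of the [p]-th power of the norm
    of [f] on the wrong side; it is absorbed because that norm is finite. *)

Section signed_power.
Context {R : realType}.
Implicit Types (a b s r p : R).

Definition spow r a : R := Num.sg a * `|a| `^ r.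

Lemma spow0 r : spow r 0 = 0.
Proof. by rewrite /spow sgr0 mul0r. Qed.

Lemma spow_ge0 r a : 0 < a -> spow r a = a `^ r.
Proof. by move=> a0; rewrite /spow gtr0_sg// gtr0_norm// mul1r. Qed.

Lemma spowN r a : spow r (- a) = - spow r a.
Proof. by rewrite /spow sgrN normrN mulNr. Qed.

Lemma spowM r a b : spow r (a * b) = spow r a * spow r b.
Proof. by rewrite /spow sgrM normrM powRM// mulrACA. Qed.

Lemma sqr_spow p a : p != 0 -> spow (p / 2) a ^+ 2 = `|a| `^ p.
Proof.
move=> p0; have [->|a0] := eqVneq a 0.
  by rewrite spow0 expr0n/= normr0 powR0.
rewrite /spow exprMn sqr_sg a0 mul1r.
by rewrite -powR_mulrn ?powR_ge0// -powRrM mulfVK.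
Qed.

Lemma norm_spow r a : r != 0 -> `|spow r a| = `|a| `^ r.
Proof.
move=> r0; have [->|a0] := eqVneq a 0; first by rewrite spow0 normr0 powR0.
by rewrite /spow normrM normr_sg a0 mul1r ger0_norm// powR_ge0.
Qed.

Lemma spowK r a : r != 0 -> spow r (spow r^-1 a) = a.
Proof.
move=> r0; have [->|a0] := eqVneq a 0; first by rewrite !spow0.
rewrite /spow normrM normr_sg a0 mul1r (ger0_norm (powR_ge0 _ _)) sgrM sgr_id.
rewrite (@gtr0_sg _ (_ `^ _)) ?powR_gt0 ?normr_gt0//.
by rewrite mulr1 -powRrM mulVf// powRr1// mulr_sg_norm.
Qed.

(* The tangent line of [al |-> s `^ al] at [al = 0]. *)
Lemma powR_ge1Dln s al : 0 < s -> 1 + al * ln s <= s `^ al.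
Proof. by move=> s0; rewrite /powR gt_eqF// expR_ge1Dx. Qed.

(** Bernoulli's inequality without derivatives: weighting the tangent bounds for the exponents
    [1 - r] and [- r] by [r] and [1 - r] cancels [ln s], and multiplication by [s^r] gives the
    claim. *)
Lemma powR_le1D s r : 0 <= s -> 0 <= r -> r <= 1 -> s `^ r <= 1 + r * (s - 1).
Proof.
rewrite le_eqVlt => /predU1P[<-|s0] r0 r1.
  have [->|r00] := eqVneq r 0; first by rewrite powRr0; lra.
  by rewrite powR0//; lra.
have h1 := powR_ge1Dln (1 - r) s0; have h2 := powR_ge1Dln (- r) s0.
have Hp : 0 < s `^ r by rewrite powR_gt0.
have E1 : s `^ r * s `^ (1 - r) = s.
  by rewrite -powRD ?subrKC ?powRr1 ?(ltW s0)// (gt_eqF s0) implybT.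
have E2 : s `^ r * s `^ (- r) = 1.
  by rewrite -powRD ?subrr ?powRr0// (gt_eqF s0) implybT.
have h3 : 1 <= r * s `^ (1 - r) + (1 - r) * s `^ (- r) by nra.
have h4 : s `^ r <= r * (s `^ r * s `^ (1 - r)) + (1 - r) * (s `^ r * s `^ (- r)).
  rewrite [leRHS](_ : _ = s `^ r * (r * s `^ (1 - r) + (1 - r) * s `^ (- r))); last by ring.
  by rewrite -[leLHS]mulr1 ler_pM2l.
by rewrite E1 E2 in h4; lra.
Qed.

(** The concave case applied to [s^r] with the exponent [1/r], then solved for [s^r]. *)
Lemma powR_ge1D s r : 0 <= s -> 1 <= r -> 1 + r * (s - 1) <= s `^ r.
Proof.
move=> s0 r1; have r0 : 0 < r by lra.
have := @powR_le1D (s `^ r) r^-1 (powR_ge0 _ _).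
rewrite -powRrM divff ?gt_eqF// powRr1// invr_ge0 (ltW r0) invf_le1// => /(_ isT r1).
move=> h; have : r * s <= r * (1 + r^-1 * (s `^ r - 1)) by rewrite ler_pM2l.
by rewrite mulrDr mulrA divff ?gt_eqF//; lra.
Qed.

(* The remaining inequalities reduce by homogeneity to [a = 1]. *)
Lemma bregman1_ge p s : 1 < p ->
  Num.min 1 (p - 1) / 2 * (spow (p / 2) s - 1) ^+ 2 <= `|s| `^ p - 1 - p * (s - 1).
Proof.
move=> p1; set c := _ / 2.
have [c0 [c1 c2]] : 0 <= c /\ 2 * c <= 1 /\ 2 * c <= p - 1.
  by rewrite /c; case: (leP 1 (p - 1)) => H; split; lra.
have pn0 : p != 0 by rewrite gt_eqF//; lra.
have := sqr_spow s pn0; have [s0|s0|->] := ltrgt0P s.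
- rewrite spow_ge0// => Ep; set w := s `^ (p / 2) in Ep *.
  have w0 : 0 < w by rewrite powR_gt0.
  rewrite -Ep; have [p2|p2] := leP p 2.
  + have h1 := powR_ge1Dln (p - 1) s0; have h2 := powR_ge1Dln (p / 2 - 1) s0.
    have E1 : s * s `^ (p - 1) = w ^+ 2.
      rewrite Ep -[X in X * _](powRr1 (ltW s0)) -powRD ?subrKC//.
        by rewrite (gt_eqF s0) implybT.
    have E2 : s * s `^ (p / 2 - 1) = w.
      rewrite -[X in X * _](powRr1 (ltW s0)) -powRD ?subrKC//.
        by rewrite (gt_eqF s0) implybT.
    set l := ln s in h1 h2; set x := s `^ (p - 1) in h1 E1.
    set y := s `^ (p / 2 - 1) in h2 E2.
    (* The weights cancel [ln s] between [h1] and [h2]. Multiplied by [s] this reads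
       [p s <= (2 - p) w^2 + 2 (p - 1) w], which is the claim with the factor [p - 1]. *)
    have h3 : p <= (2 - p) * x + 2 * (p - 1) * y by nra.
    have h4 : p * s <= (2 - p) * (s * x) + 2 * (p - 1) * (s * y) by nra.
    rewrite E1 E2 in h4.
    have : c * (w - 1) ^+ 2 <= (p - 1) * (w - 1) ^+ 2.
      by rewrite ler_wpM2r ?sqr_ge0//; lra.
    by rewrite !expr2 in h4 *; lra.
  + have := @powR_ge1D s (p / 2) (ltW s0) ltac:(lra); rewrite -/w => h.
    have : c * (w - 1) ^+ 2 <= 1 * (w - 1) ^+ 2.
      by rewrite ler_wpM2r ?sqr_ge0//; lra.
    by rewrite expr2; lra.
- rewrite -[s]opprK spowN spow_ge0 ?oppr_gt0// opprK sqrrN => Ep.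
  set w := _ `^ (p / 2) in Ep *; rewrite -Ep.
  have w0 : 0 < w by rewrite powR_gt0// oppr_gt0.
  have h1 : 0 <= c * (w - 1) ^+ 2 by rewrite mulr_ge0 ?sqr_ge0.
  have h2 : 2 * c * w ^+ 2 <= 1 * w ^+ 2 by rewrite ler_wpM2r ?sqr_ge0.
  have h3 : p * s <= 0 by rewrite pmulr_rle0 ?ltW//; lra.
  by rewrite !expr2 in h1 h2 *; lra.
- by rewrite spow0 powR0// expr2; lra.
Qed.

(** For [s > 0] the weights [p - 2] and [p] cancel [ln s] between the exponents [p/2] and [1 - p/2],
    which even gives the factor [p - 1]. For [s < 0], Bernoulli bounds [p |s|] by [w^2 + p - 1], and
    [2 p] leaves ample room. *)
Lemma bregman1_le p s : 2 <= p ->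
  `|s| `^ p - 1 - p * (s - 1) <= 2 * p * (spow (p / 2) s - 1) ^+ 2.
Proof.
move=> p2; have pn0 : p != 0 by rewrite gt_eqF//; lra.
have := sqr_spow s pn0; have [s0|s0|->] := ltrgt0P s.
- rewrite spow_ge0// => Ep; set w := s `^ (p / 2) in Ep *.
  have w0 : 0 < w by rewrite powR_gt0.
  rewrite -Ep; have h1 := powR_ge1Dln (p / 2) s0.
  have h2 := powR_ge1Dln (1 - p / 2) s0; rewrite -/w in h1.
  have E1 : w * s `^ (1 - p / 2) = s.
    rewrite -powRD ?subrKC ?powRr1 ?(ltW s0)//.
    by rewrite (gt_eqF s0) implybT.
  set l := ln s in h1 h2; set x := s `^ (1 - p / 2) in h2 E1.
  have h3 : 2 * (p - 1) <= (p - 2) * w + p * x by nra.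
  have h4 : 2 * (p - 1) * w <= (p - 2) * w ^+ 2 + p * (w * x).
    rewrite expr2; nra.
  rewrite E1 in h4.
  have : (p - 1) * (w - 1) ^+ 2 <= 2 * p * (w - 1) ^+ 2.
    by rewrite ler_wpM2r ?sqr_ge0//; lra.
  by rewrite !expr2 in h4 *; lra.
- rewrite -[s]opprK spowN spow_ge0 ?oppr_gt0// opprK sqrrN => Ep.
  set w := _ `^ (p / 2) in Ep *; rewrite -Ep.
  have w0 : 0 < w by rewrite powR_gt0// oppr_gt0.
  have := @powR_ge1D (- s) p ltac:(lra) ltac:(lra); rewrite -Ep !expr2 => h.
  nra.
- by rewrite spow0 powR0// expr2; lra.
Qed.

Definition bregman p a b : R :=
  `|b| `^ p - `|a| `^ p - p * spow (p - 1) a * (b - a).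

Lemma bregmanE p a b : 1 < p -> a != 0 ->
  bregman p a b = `|a| `^ p * (`|b / a| `^ p - 1 - p * (b / a - 1)) /\
  (spow (p / 2) b - spow (p / 2) a) ^+ 2 =
    `|a| `^ p * (spow (p / 2) (b / a) - 1) ^+ 2.
Proof.
move=> p1 a0; have pn0 : p != 0 by rewrite gt_eqF//; lra.
have [s ->] : exists s, b = a * s by exists (b / a); rewrite mulrCA divff// mulr1.
rewrite mulrAC divff// mul1r; split; last first.
  by rewrite spowM -sqr_spow//; ring.
rewrite /bregman normrM powRM// /spow.
have -> : `|a| `^ p = a * (Num.sg a * `|a| `^ (p - 1)).
  rewrite mulrA -[X in X * Num.sg a]mulr_sg_norm [_ * Num.sg a]mulrAC.
  rewrite -expr2 sqr_sg a0 mul1r -[X in X * _](powRr1 (normr_ge0 a)) -powRD ?subrKC//.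
  by rewrite normr_eq0 (negbTE a0) implybT.
by ring.
Qed.

Lemma bregman_ge p a b : 1 < p ->
  Num.min 1 (p - 1) / 2 * (spow (p / 2) b - spow (p / 2) a) ^+ 2 <= bregman p a b.
Proof.
move=> p1; have pn0 : p != 0 by rewrite gt_eqF//; lra.
have [->|a0] := eqVneq a 0.
  rewrite /bregman !spow0 !(subr0, mulr0, mul0r) sqr_spow// normr0 powR0// subr0.
  rewrite ler_piMl ?powR_ge0//.
  by case: (leP 1 (p - 1)); lra.
have [-> ->] := bregmanE b p1 a0.
by rewrite mulrCA ler_wpM2l ?powR_ge0// bregman1_ge.
Qed.

Lemma bregman_le p a b : 2 <= p ->
  bregman p a b <= 2 * p * (spow (p / 2) b - spow (p / 2) a) ^+ 2.
Proof.
move=> p2; have p1 : 1 < p by lra.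
have pn0 : p != 0 by rewrite gt_eqF//; lra.
have [->|a0] := eqVneq a 0.
  rewrite /bregman !spow0 !(subr0, mulr0, mul0r) sqr_spow// normr0 powR0// subr0.
  by rewrite ler_peMl ?powR_ge0//; lra.
have [-> ->] := bregmanE b p1 a0.
by rewrite [leRHS]mulrCA ler_wpM2l ?powR_ge0// bregman1_le.
Qed.

(** After division by the larger value this is [1 - spow s <= p/2 (1 - s)] for [|s| <= 1]: convex
    Bernoulli for [s > 0], and [|s|^(p/2) <= |s|] for [s < 0]. *)
Lemma sqr_spowB_le p a b : 2 <= p -> `|a| <= `|b| ->
  (spow (p / 2) a - spow (p / 2) b) ^+ 2 <=
    (p / 2) ^+ 2 * (`|b| `^ (p - 2) * (a - b) ^+ 2).
Proof.
move=> p2 ab; have [b0|b0] := eqVneq b 0.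
  move: ab; rewrite b0 normr0 normr_le0 => /eqP ->.
  by rewrite subrr expr0n/= mulr_ge0 ?sqr_ge0// mulr_ge0 ?powR_ge0 ?sqr_ge0.
have [s E] : exists s, a = b * s by exists (a / b); rewrite mulrCA divff// mulr1.
have s1 : `|s| <= 1 by move: ab; rewrite E normrM ger_pMr ?normr_gt0.
have pn0 : p != 0 by rewrite gt_eqF//; lra.
have Eb : `|b| `^ p = `|b| `^ (p - 2) * b ^+ 2.
  rewrite -[b ^+ 2]real_normK ?num_real// -powR_mulrn// -powRD ?subrK//.
  by rewrite normr_eq0 (negbTE b0) implybT.
rewrite E spowM.
rewrite [leLHS](_ : _ = `|b| `^ p * (1 - spow (p / 2) s) ^+ 2); last first.
  by rewrite -(sqr_spow b pn0); ring.
rewrite Eb [leRHS](_ : _ = `|b| `^ (p - 2) * b ^+ 2 * (p / 2 * (1 - s)) ^+ 2); last by ring.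
rewrite ler_wpM2l//; first by rewrite mulr_ge0 ?powR_ge0 ?sqr_ge0.
have h1 : - s <= 1 by apply: le_trans s1; rewrite -normrN ler_norm.
have h2 : s <= 1 by apply: le_trans s1; rewrite ler_norm.
suff [] : 0 <= 1 - spow (p / 2) s /\ 1 - spow (p / 2) s <= p / 2 * (1 - s).
  by move=> ? ?; rewrite ler_pXn2r// nnegrE mulr_ge0//; lra.
have [s0|s0|->] := ltrgt0P s; last by rewrite spow0; split; lra.
- rewrite spow_ge0//; have := @powR_ge1D s (p / 2) (ltW s0) ltac:(lra) => h.
  by have := @ge1r_powR _ s (p / 2) ltac:(lra) ltac:(lra); split; lra.
- rewrite -[s]opprK spowN spow_ge0 ?oppr_gt0//.
  have h : (- s) `^ (p / 2) <= - s by rewrite ge1r_powR//; lra.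
  have := powR_ge0 (- s) (p / 2).
  by move=> h'; split; nra.
Qed.

(** The reverse comparison, by concave Bernoulli for [s > 0] and [|s| <= |s|^(p/2)] for [s < 0].
    Here and in [sqr_spowB_le] the extra power sits on the larger of the two values, the one that
    [chi] will single out. *)
Lemma sqr_spowB_ge p a b : 1 < p -> p <= 2 -> `|a| <= `|b| ->
  (a - b) ^+ 2 <=
    (2 / p) ^+ 2 * (`|b| `^ (2 - p) * (spow (p / 2) a - spow (p / 2) b) ^+ 2).
Proof.
move=> p1 p2 ab; have [b0|b0] := eqVneq b 0.
  move: ab; rewrite b0 normr0 normr_le0 => /eqP ->.
  by rewrite !subrr !expr0n/= !mulr0.
have [s E] : exists s, a = b * s by exists (a / b); rewrite mulrCA divff// mulr1.
have s1 : `|s| <= 1 by move: ab; rewrite E normrM ger_pMr ?normr_gt0.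
have pn0 : p != 0 by rewrite gt_eqF//; lra.
have Eb : b ^+ 2 = `|b| `^ (2 - p) * `|b| `^ p.
  rewrite -[b ^+ 2]real_normK ?num_real// -powR_mulrn// -powRD ?subrK//.
  by rewrite normr_eq0 (negbTE b0) implybT.
rewrite E spowM.
rewrite [leLHS](_ : _ = b ^+ 2 * (1 - s) ^+ 2); last by ring.
rewrite Eb [leRHS](_ : _ = `|b| `^ (2 - p) * `|b| `^ p *
    (2 / p * (1 - spow (p / 2) s)) ^+ 2); last first.
  by rewrite -(sqr_spow b pn0); ring.
rewrite ler_wpM2l ?mulr_ge0 ?powR_ge0//.
have h1 : - s <= 1 by apply: le_trans s1; rewrite -normrN ler_norm.
have h2 : s <= 1 by apply: le_trans s1; rewrite ler_norm.
suff : p / 2 * (1 - s) <= 1 - spow (p / 2) s.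
  move=> h; have h3 : 1 - s <= 2 / p * (1 - spow (p / 2) s).
    by rewrite mulrAC ler_pdivlMr; lra.
  by rewrite ler_pXn2r// nnegrE; lra.
have [s0|s0|->] := ltrgt0P s; last by rewrite spow0; lra.
- rewrite spow_ge0//.
  by have := @powR_le1D s (p / 2) (ltW s0) ltac:(lra) ltac:(lra); lra.
- rewrite -[s]opprK spowN spow_ge0 ?oppr_gt0//.
  have h : - s <= (- s) `^ (p / 2) by rewrite ger1_powR//; lra.
  nra.
Qed.

End signed_power.

Section measurability.
Context {R : realType}.

Lemma measurable_spow (r : R) : measurable_fun setT (spow r).
Proof.
rewrite /spow (_ : (fun a : R => _) = (fun a => (a `^ r) * \1_(`]0, +oo[%classic) a
    - ((- a) `^ r) * \1_(`]-oo, 0[%classic) a)).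
  apply: measurable_funB; apply: measurable_funM => //.
  by apply: (measurableT_comp (measurable_powR r)); exact: measurable_funN.
apply/funext => a; rewrite !indicE !mem_setE !in_itv/= andbT.
have [a0|a0|->] := ltrgt0P a.
- by rewrite gtr0_sg// mulr0 subr0 mulr1 mul1r.
- by rewrite ltr0_sg// mulr0 sub0r mulr1 mulN1r.
- by rewrite sgr0 mul0r !mulr0 subrr.
Qed.

Lemma measurable_norm_powR d (T : measurableType d) (f : T -> R) (p : R) :
  measurable_fun setT f -> measurable_fun setT (fun x => `|f x| `^ p).
Proof.
by move=> mf; apply: (measurableT_comp (measurable_powR p)); exact: measurableT_comp.
Qed.

Lemma measurable_fun_Rintegral_kernel d d' (X : measurableType d)
    (Y : measurableType d') (l : R.-sfker X ~> Y) (f : X * Y -> R) :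
  measurable_fun setT f -> measurable_fun setT (fun x => \int[l x]_y f (x, y)).
Proof.
move=> mf; apply: measurableT_comp => //.
have mf' : measurable_fun setT (fun z => (f z)%:E) by exact/measurable_EFinP.
under eq_fun do rewrite integralE.
apply: emeasurable_funB.
- have mp : measurable_fun setT (fun z => (f z)%:E)^\+%E by exact: measurable_funepos.
  have := (@measurable_fun_integral_sfinite_kernel _ _ _ _ _ (fun z => (f z)%:E)^\+%E l).
  move=> /(_ (funepos_ge0 _) mp); apply: eq_measurable_fun => x _.
  by apply: eq_integral => y _; rewrite !funeposE.
- have mn : measurable_fun setT (fun z => (f z)%:E)^\-%E by exact: measurable_funeneg.
  have := (@measurable_fun_integral_sfinite_kernel _ _ _ _ _ (fun z => (f z)%:E)^\-%E l).
  move=> /(_ (funeneg_ge0 _) mn); apply: eq_measurable_fun => x _.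
  by apply: eq_integral => y _; rewrite !funenegE.
Qed.

Lemma measurable_fun_Rintegral_kernel1 d d' (X : measurableType d)
    (Y : measurableType d') (l : R.-sfker X ~> Y) (f : Y -> R) :
  measurable_fun setT f -> measurable_fun setT (fun x => \int[l x]_y f y).
Proof.
move=> mf; apply: (measurable_fun_Rintegral_kernel l (f := f \o snd)).
exact: measurableT_comp.
Qed.

End measurability.

Lemma fin_Rintegral d (T : measurableType d) (R : realType)
    (mu : {measure set T -> \bar R}) (f : T -> R) :
  (forall x, 0 <= f x) -> (\int[mu]_x (f x)%:E < +oo)%E ->
  (\int[mu]_x f x)%:E = (\int[mu]_x (f x)%:E)%E.
Proof.
move=> f0 foo; rewrite fineK// ge0_fin_numE//.
by apply: integral_ge0 => x _; rewrite lee_fin.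
Qed.

Section real_integrable.
Context d (T : measurableType d) (R : realType).
Variables (mu : {measure set T -> \bar R}) (D : set T) (mD : measurable D).
Implicit Types f g : T -> R.

Lemma integrableDR f g : mu.-integrable D (EFin \o f) ->
  mu.-integrable D (EFin \o g) -> mu.-integrable D (EFin \o (fun x => f x + g x)).
Proof. by move=> hf hg; exact: (integrableD mD hf hg). Qed.

Lemma integrableBR f g : mu.-integrable D (EFin \o f) ->
  mu.-integrable D (EFin \o g) -> mu.-integrable D (EFin \o (fun x => f x - g x)).
Proof. by move=> hf hg; exact: (integrableB mD hf hg). Qed.

Lemma integrableZR c f : mu.-integrable D (EFin \o f) ->
  mu.-integrable D (EFin \o (fun x => c * f x)).
Proof. by move=> hf; exact: (integrableZl mD c hf). Qed.

End real_integrable.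

Lemma ge0_integrable d (T : measurableType d) (R : realType)
    (mu : {measure set T -> \bar R}) (f : T -> R) :
  measurable_fun setT f -> (forall x, 0 <= f x) ->
  (\int[mu]_x (f x)%:E < +oo)%E -> mu.-integrable setT (EFin \o f).
Proof.
move=> mf f0 foo; apply/integrableP; split; first exact/measurable_EFinP.
by under eq_integral do rewrite /= ger0_norm//.
Qed.

(** * Jensen's inequality with a quadratic remainder, for measures of mass at most one *)

Section subprobability_jensen.
Context d (T : measurableType d) (R : realType).
Variables (mu : {measure set T -> \bar R}) (p : R) (u : T -> R).
Hypothesis mu1 : (mu setT <= 1)%E.
Hypothesis p1 : 1 < p.
Hypothesis mu_ : measurable_fun setT u.
Hypothesis up_fin : (\int[mu]_x (`|u x| `^ p)%:E < +oo)%E.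

Local Notation v := (fun x => spow (p / 2) (u x)).
Local Notation th := (fine (mu setT)).

Let thE : (th%:E = mu setT)%E.
Proof. by rewrite fineK// ge0_fin_numE// (le_lt_trans mu1) ?ltry. Qed.

Let th01 : 0 <= th <= 1.
Proof. by rewrite -!lee_fin thE mu1 measure_ge0. Qed.

Let pn0 : p != 0. Proof. by have hp := p1; rewrite gt_eqF//; lra. Qed.

Let int_cst c : mu.-integrable setT (EFin \o (fun=> c : R)).
Proof.
apply/integrableP; split => //.
  exact/measurable_EFinP.
rewrite (_ : (fun x => _) = cst `|c|%:E)// integral_cst//.
by rewrite -thE -EFinM ltry.
Qed.

Let int_up : mu.-integrable setT (EFin \o (fun x => `|u x| `^ p)).
Proof.
by apply: ge0_integrable => //; exact: measurable_norm_powR.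
Qed.

Lemma le_integrable_powR (w : T -> R) : measurable_fun setT w ->
  (forall x, `|w x| <= 1 + `|u x| `^ p) -> mu.-integrable setT (EFin \o w).
Proof.
move=> mw wu; apply: (le_integrable _ _ _ (integrableD _ (int_cst 1) int_up)) => //.
- exact/measurable_EFinP.
- by move=> x _ /=; rewrite lee_fin [leRHS]ger0_norm// addr_ge0// powR_ge0.
Qed.

Lemma powR_le1D_powR (a r s : R) : 0 <= a -> 0 < r -> r <= s -> a `^ r <= 1 + a `^ s.
Proof.
move=> a0 r0 rs; have [a1|a1] := leP a 1.
  have : a `^ r <= 1 `^ r by rewrite ge0_ler_powR ?nnegrE// ltW.
  by rewrite powR1 => h; apply: (le_trans h); rewrite lerDl powR_ge0.
by apply: (le_trans (ler_powR (ltW a1) rs)); rewrite lerDr.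
Qed.

Let int_u : mu.-integrable setT (EFin \o u).
Proof.
apply: le_integrable_powR => // x.
by rewrite -[leLHS]powRr1// powR_le1D_powR// ltW.
Qed.

Let int_v : mu.-integrable setT (EFin \o v).
Proof.
apply: le_integrable_powR => [|x].
  exact: (measurableT_comp (measurable_spow _)).
by rewrite norm_spow ?powR_le1D_powR//; have hp := p1; lra.
Qed.

Let vE x : spow (p / 2) (u x) ^+ 2 = `|u x| `^ p. Proof. exact: sqr_spow. Qed.

(** The Bregman bound is integrated at the base point [a], the integral of [u], and the square in
    [V - k] is completed. What the missing mass [1 - th] leaves is [(p - 1 - c) k^2 (1 - th)],
    nonnegative because [c <= p - 1]. *)
Lemma jensen_ge (c : R) : 0 <= c -> c <= p - 1 ->
  (forall a b, c * (spow (p / 2) b - spow (p / 2) a) ^+ 2 <= bregman p a b) ->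
  `|\int[mu]_x u x| `^ p + c * (\int[mu]_x (`|u x| `^ p) - (\int[mu]_x spow (p / 2) (u x)) ^+ 2)
    <= \int[mu]_x (`|u x| `^ p).
Proof.
move=> c0 cp breg; have hp := p1; have /andP[ht1 ht2] := th01; set a := \int[mu]_x u x; set I := \int[mu]_x _.
set V := \int[mu]_x spow (p / 2) (u x); pose k := spow (p / 2) a; pose s := spow (p - 1) a.
have kE : k ^+ 2 = `|a| `^ p by exact: sqr_spow.
have sE : s * a = `|a| `^ p.
  rewrite /s /spow mulrAC -[X in Num.sg a * X]mulr_sg_norm mulrA -expr2 sqr_sg.
  have [a0|a0] := eqVneq a 0; first by rewrite a0 normr0 !mul0r powR0.
  by rewrite mul1r mulr_powRB1//; lra.
have : \int[mu]_x (c * `|u x| `^ p - 2 * c * k * spow (p / 2) (u x) + p * s * u x +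
    (c * k ^+ 2 + `|a| `^ p - p * s * a)) <= I.
  apply: le_Rintegral => //.
    by apply: integrableDR => //; apply: integrableDR => //; [apply: integrableBR => //; exact: integrableZR|exact: integrableZR].
  move=> x _; have := breg a (u x); rewrite /bregman -/k -/s -vE.
  by rewrite !expr2; lra.
rewrite RintegralD//; last first.
  by apply: integrableDR => //; [apply: integrableBR => //; exact: integrableZR|exact: integrableZR].
rewrite RintegralD//; [|by apply: integrableBR => //; exact: integrableZR|exact: integrableZR].
rewrite RintegralB//; [|exact: integrableZR|exact: integrableZR].
rewrite !RintegralZl// Rintegral_cst// -/I -/V -/a.
rewrite -kE in sE *; rewrite -(mulrA p s a) sE => h.
have h1 : 0 <= c * (V - k) ^+ 2 by rewrite mulr_ge0 ?sqr_ge0.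
have h2 : 0 <= (p - 1 - c) * (k ^+ 2 * (1 - th)).
  by rewrite mulr_ge0 ?subr_ge0// mulr_ge0 ?sqr_ge0// subr_ge0; case/andP: th01.
rewrite !expr2 in h h1 h2 *.
lra.
Qed.

(** Here the base point is the [a] whose signed power is [V], the integral of the signed powers, so
    that the square integrates to [I - V^2] up to lost mass. Nonnegativity of [bregman p a U] then
    trades [a] for [U], and [C >= p - 1] gives the mass defect its sign. *)
Lemma jensen_le (C : R) : p - 1 <= C ->
  (forall a b, bregman p a b <= C * (spow (p / 2) b - spow (p / 2) a) ^+ 2) ->
  \int[mu]_x (`|u x| `^ p) <=
  `|\int[mu]_x u x| `^ p + C * (\int[mu]_x (`|u x| `^ p) - (\int[mu]_x spow (p / 2) (u x)) ^+ 2).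
Proof.
move=> Cp breg; have hp := p1; have /andP[ht1 ht2] := th01; set U := \int[mu]_x u x; set I := \int[mu]_x _.
set V := \int[mu]_x spow (p / 2) (u x).
have p20 : p / 2 != 0 by rewrite mulf_neq0// invr_neq0.
pose a := spow (p / 2)^-1 V; have aV : spow (p / 2) a = V by exact: spowK.
pose s := spow (p - 1) a.
have aE : `|a| `^ p = V ^+ 2 by rewrite -sqr_spow// aV.
have sE : s * a = V ^+ 2.
  rewrite -aE /s /spow mulrAC -[X in Num.sg a * X]mulr_sg_norm mulrA -expr2 sqr_sg.
  have [a0|a0] := eqVneq a 0; first by rewrite a0 normr0 !mul0r powR0.
  by rewrite mul1r mulr_powRB1//; lra.
have : I <= \int[mu]_x (C * `|u x| `^ p - 2 * C * V * spow (p / 2) (u x) + p * s * u x +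
    (C * V ^+ 2 + `|a| `^ p - p * s * a)).
  apply: le_Rintegral => //.
    by apply: integrableDR => //; apply: integrableDR => //; [apply: integrableBR => //; exact: integrableZR|exact: integrableZR].
  move=> x _; have := breg a (u x); rewrite /bregman aV -/s -vE.
  by rewrite !expr2; lra.
rewrite RintegralD//; last first.
  by apply: integrableDR => //; [apply: integrableBR => //; exact: integrableZR|exact: integrableZR].
rewrite RintegralD//; [|by apply: integrableBR => //; exact: integrableZR|exact: integrableZR].
rewrite RintegralB//; [|exact: integrableZR|exact: integrableZR].
rewrite !RintegralZl// Rintegral_cst// -/I -/V -/U aE -(mulrA p s a) sE => h.
have h1 : 0 <= (C - (p - 1)) * (V ^+ 2 * (1 - th)).
  by rewrite mulr_ge0 ?subr_ge0// mulr_ge0 ?sqr_ge0// subr_ge0; case/andP: th01.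
have := bregman_ge a U p1; rewrite /bregman aE -/s => h2.
have h3 : 0 <= Num.min 1 (p - 1) / 2 * (spow (p / 2) U - spow (p / 2) a) ^+ 2.
  by rewrite mulr_ge0 ?sqr_ge0//; case: (leP 1 (p - 1)) => ?; lra.
have {h3}h2 := le_trans h3 h2.
rewrite mulrBr -(mulrA p s a) sE in h2.
rewrite !expr2 in h h1 h2 *; lra.
Qed.

Lemma jensen_powR : `|\int[mu]_x u x| `^ p <= \int[mu]_x (`|u x| `^ p).
Proof.
have := @jensen_ge 0 (lexx _); rewrite mul0r addr0; apply; first by rewrite subr_ge0 ltW.
move=> a b; have hp := p1; rewrite mul0r; apply: le_trans (bregman_ge _ _ p1).
by rewrite mulr_ge0 ?sqr_ge0//; case: (leP 1 (p - 1)) => ?; lra.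
Qed.

End subprobability_jensen.

(** * Energy estimates for a sub-Markovian kernel *)

Section submarkov_energy.
Context d (T : measurableType d) (R : realType).
Variables (Q : R.-sfker T ~> T) (m : {measure set T -> \bar R}).
Hypothesis Q1 : forall x, (Q x setT <= 1)%E.
Hypothesis Qexc : forall g : T -> \bar R, measurable_fun setT g ->
  (forall x, 0 <= g x)%E -> (\int[m]_x \int[Q x]_y g y <= \int[m]_x g x)%E.
Variables (p : R) (u : T -> R).
Hypothesis p1 : 1 < p.
Hypothesis mu_ : measurable_fun setT u.

Local Notation v := (fun x => spow (p / 2) (u x)).
Local Notation Iu x := (\int[Q x]_y (`|u y| `^ p)%:E)%E.
Local Notation Qu x := (\int[Q x]_y u y).
Local Notation Qv x := (\int[Q x]_y spow (p / 2) (u y)).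
Local Notation A := (\int[m]_x (`|u x| `^ p)%:E)%E.

Lemma powR_kernel_le x : ((`|Qu x| `^ p)%:E <= Iu x)%E.
Proof.
have [Ifin|] := ltP (Iu x) +oo%E; last by rewrite leye_eq => /eqP ->; rewrite leey.
rewrite -fin_Rintegral//.
by rewrite lee_fin; exact: jensen_powR.
Qed.

(** Both sides are sums, not differences, because [Iu x] may be infinite; in that case the right
    side is [+oo]. *)
Lemma energy_ge_pointwise x c : 0 <= c -> c <= p - 1 ->
  (forall a b, c * (spow (p / 2) b - spow (p / 2) a) ^+ 2 <= bregman p a b) ->
  ((`|Qu x| `^ p)%:E + c%:E * Iu x <= Iu x + c%:E * ((Qv x) ^+ 2)%:E)%E.
Proof.
move=> c0 cp hb; have [Ifin|] := ltP (Iu x) +oo%E; last first.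
  by rewrite leye_eq => /eqP ->; rewrite addye ?leey.
have := jensen_ge (Q1 x) p1 mu_ Ifin c0 cp hb.
rewrite -fin_Rintegral//.
by rewrite -!EFinM -!EFinD lee_fin; lra.
Qed.

Lemma energy_le_pointwise x C : 0 < C -> p - 1 <= C ->
  (forall a b, bregman p a b <= C * (spow (p / 2) b - spow (p / 2) a) ^+ 2) ->
  (Iu x + C%:E * ((Qv x) ^+ 2)%:E <= (`|Qu x| `^ p)%:E + C%:E * Iu x)%E.
Proof.
move=> c0 cp hb; have [Ifin|] := ltP (Iu x) +oo%E; last first.
  by rewrite leye_eq => /eqP ->; rewrite gt0_muley ?lte_fin// addey ?leey.
have := jensen_le (Q1 x) p1 mu_ Ifin cp hb.
rewrite -fin_Rintegral//.
by rewrite -!EFinM -!EFinD lee_fin; lra.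
Qed.

Let mup : measurable_fun setT (fun x => (`|u x| `^ p)%:E).
Proof. exact/measurable_EFinP/measurable_norm_powR. Qed.

Let mQu : measurable_fun setT (fun x => (`|Qu x| `^ p)%:E).
Proof.
exact/measurable_EFinP/measurable_norm_powR/measurable_fun_Rintegral_kernel1.
Qed.

Let mIu : measurable_fun setT (fun x => Iu x).
Proof.
apply: measurable_fun_integral_kernel => //; exact: measurable_kernel.
Qed.

Let mQv : measurable_fun setT (fun x => ((Qv x) ^+ 2)%:E).
Proof.
apply/measurable_EFinP/measurable_funX/measurable_fun_Rintegral_kernel1.
exact: (measurableT_comp (measurable_spow _)).
Qed.

Let Iu_ge0 x : (0 <= Iu x)%E.
Proof. by apply: integral_ge0 => y _; rewrite lee_fin powR_ge0. Qed.

Lemma powR_contraction : (\int[m]_x (`|Qu x| `^ p)%:E <= A)%E.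
Proof.
apply: le_trans (Qexc mup _) => [|x]; last by rewrite lee_fin powR_ge0.
apply: ge0_le_integral => //.
by move=> x _; exact: powR_kernel_le.
Qed.

Lemma powR_contraction_v : (\int[m]_x ((Qv x) ^+ 2)%:E <= A)%E.
Proof.
apply: le_trans (Qexc mup _) => [|x]; last by rewrite lee_fin powR_ge0.
apply: ge0_le_integral => //.
- by move=> x _; rewrite lee_fin sqr_ge0.
move=> x _; have [Ifin|] := ltP (Iu x) +oo%E; last by rewrite leye_eq => /eqP ->; rewrite leey.
  rewrite -fin_Rintegral//.
  have pn0 : p != 0 by have hp := p1; rewrite gt_eqF//; lra.
  have := @jensen_powR _ _ _ (Q x) 2 v (Q1 x) ltac:(lra)
    (measurableT_comp (measurable_spow _) mu_).
  rewrite !powR_mulrn// real_normK ?num_real// lee_fin.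
  have E y : `|spow (p / 2) (u y)| `^ 2 = `|u y| `^ p.
    by rewrite powR_mulrn// real_normK ?num_real// sqr_spow.
  under eq_integral do rewrite E; move=> /(_ Ifin).
  by have -> : \int[Q x]_y (`|spow (p / 2) (u y)| `^ 2) = \int[Q x]_y (`|u y| `^ p) by apply: eq_Rintegral => y _.
Qed.

Hypothesis Afin : (A < +oo)%E.

(** Integration yields the inequality with the integral of [Iu] in place of [A]. Excessiveness makes
    that integral at most [A], and since its net coefficient on the right is [1 - c >= 0] it may be
    replaced by [A]. *)
Lemma energy_ge c : 0 <= c -> c <= 1 -> c <= p - 1 ->
  (forall a b, c * (spow (p / 2) b - spow (p / 2) a) ^+ 2 <= bregman p a b) ->
  (\int[m]_x (`|Qu x| `^ p)%:E + c%:E * A <= A + c%:E * \int[m]_x ((Qv x) ^+ 2)%:E)%E.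
Proof.
move=> c0 c1 cp hb.
have J1 : (\int[m]_x Iu x <= A)%E by apply: Qexc => // x; rewrite lee_fin powR_ge0.
have J0 : (0 <= \int[m]_x Iu x)%E by exact: integral_ge0.
have h : (\int[m]_x (`|Qu x| `^ p)%:E + c%:E * \int[m]_x Iu x <=
    \int[m]_x Iu x + c%:E * \int[m]_x ((Qv x) ^+ 2)%:E)%E.
  rewrite -!ge0_integralZl_EFin//; last by move=> x _; rewrite lee_fin sqr_ge0.
  rewrite -!ge0_integralD//; try exact: measurable_funeM;
    try by move=> x _; rewrite mule_ge0// ?lee_fin ?sqr_ge0.
  apply: ge0_le_integral => //.
  - by move=> x _; rewrite adde_ge0 ?lee_fin ?powR_ge0// mule_ge0.
  - by apply: emeasurable_funD => //; exact: measurable_funeM.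
  - by apply: emeasurable_funD => //; exact: measurable_funeM.
  - by move=> x _; exact: energy_ge_pointwise.
have B1 := powR_contraction; have W1 := powR_contraction_v.
have B0 : (0 <= \int[m]_x (`|Qu x| `^ p)%:E)%E.
  by apply: integral_ge0 => x _; rewrite lee_fin powR_ge0.
have W0 : (0 <= \int[m]_x ((Qv x) ^+ 2)%:E)%E.
  by apply: integral_ge0 => x _; rewrite lee_fin sqr_ge0.
move: h J1 J0 B1 W1 B0 W0.
move: (integral _ _ (fun x => Iu x)) (integral _ _ (fun x => (Qv x ^+ 2)%:E)).
move: (integral _ _ (fun x => (`|Qu x| `^ p)%:E)) Afin.
case: (integral _ _ _) => [a||]// [b||]// _ [j||]// [w||]//; rewrite ?lee_fin => h J1 *.
by have : 0 <= (1 - c) * (a - j); [rewrite mulr_ge0 ?subr_ge0|lra].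
Qed.

(** As for [energy_ge]; the net coefficient of the integral of [Iu] on the right is now [C - 1],
    hence the condition [1 <= C]. *)
Lemma energy_le C : 1 <= C -> p - 1 <= C ->
  (forall a b, bregman p a b <= C * (spow (p / 2) b - spow (p / 2) a) ^+ 2) ->
  (A + C%:E * \int[m]_x ((Qv x) ^+ 2)%:E <= \int[m]_x (`|Qu x| `^ p)%:E + C%:E * A)%E.
Proof.
move=> c1 cp hb; have c0 : 0 <= C by lra.
have J1 : (\int[m]_x Iu x <= A)%E by apply: Qexc => // x; rewrite lee_fin powR_ge0.
have J0 : (0 <= \int[m]_x Iu x)%E by exact: integral_ge0.
have h : (\int[m]_x Iu x + C%:E * \int[m]_x ((Qv x) ^+ 2)%:E <=
    \int[m]_x (`|Qu x| `^ p)%:E + C%:E * \int[m]_x Iu x)%E.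
  rewrite -!ge0_integralZl_EFin//; last by move=> x _; rewrite lee_fin sqr_ge0.
  rewrite -!ge0_integralD//; try exact: measurable_funeM;
    try by move=> x _; rewrite mule_ge0// ?lee_fin ?sqr_ge0.
  apply: ge0_le_integral => //.
  - by move=> x _; rewrite adde_ge0// -EFinM lee_fin mulr_ge0 ?sqr_ge0.
  - by apply: emeasurable_funD => //; exact: measurable_funeM.
  - by apply: emeasurable_funD => //; exact: measurable_funeM.
  - by move=> x _; apply: energy_le_pointwise => //; lra.
have B1 := powR_contraction; have W1 := powR_contraction_v.
have B0 : (0 <= \int[m]_x (`|Qu x| `^ p)%:E)%E.
  by apply: integral_ge0 => x _; rewrite lee_fin powR_ge0.
have W0 : (0 <= \int[m]_x ((Qv x) ^+ 2)%:E)%E.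
  by apply: integral_ge0 => x _; rewrite lee_fin sqr_ge0.
move: h J1 J0 B1 W1 B0 W0.
move: (integral _ _ (fun x => Iu x)) (integral _ _ (fun x => (Qv x ^+ 2)%:E)).
move: (integral _ _ (fun x => (`|Qu x| `^ p)%:E)) Afin.
case: (integral _ _ _) => [a||]// [b||]// _ [j||]// [w||]//; rewrite ?lee_fin => h J1 *.
by have : 0 <= (C - 1) * (a - j); [rewrite mulr_ge0 ?subr_ge0|lra].
Qed.

End submarkov_energy.

(** * The maximal inequality for symmetric Markov operators *)

Section max_powR.
Context {R : realType}.
Implicit Types (p s x : R).

(** The graph of the power lies above its tangent at [s]: this is [bregman p s x >= 0]. *)
Lemma young_powR p s x : 1 < p -> 0 <= s -> 0 <= x ->
  p * x * s `^ (p - 1) <= (p - 1) * s `^ p + x `^ p.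
Proof.
move=> p1 s0 x0; have [->|sn0] := eqVneq s 0.
  by rewrite !powR0 ?mulr0 ?add0r ?powR_ge0// gt_eqF//; lra.
have sp : 0 < s by rewrite lt_neqAle eq_sym sn0.
have := bregman_ge s x p1.
have h : 0 <= Num.min 1 (p - 1) / 2 * (spow (p / 2) x - spow (p / 2) s) ^+ 2.
  by rewrite mulr_ge0 ?sqr_ge0//; case: (leP 1 (p - 1)) => ?; lra.
move=> /(le_trans h); rewrite /bregman spow_ge0// !ger0_norm//.
have E : s * s `^ (p - 1) = s `^ p by rewrite mulr_powRB1//; lra.
by nra.
Qed.

(** The pathwise form of Doob's inequality, controlling one update of a running maximum [s] by a new
    value [x]. Only [x > s] matters, and then it is [young_powR]. *)
Lemma max_powR_le p s x : 1 < p -> 0 <= s -> 0 <= x ->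
  (p - 1) * (Num.max s x `^ p - s `^ p) <=
    p * x * (Num.max s x `^ (p - 1) - s `^ (p - 1)).
Proof.
move=> p1 s0 x0; have [xs|sx] := leP x s.
  by rewrite !subrr !mulr0.
have := young_powR p1 s0 x0.
have E : x * x `^ (p - 1) = x `^ p by rewrite mulr_powRB1//; lra.
by nra.
Qed.

Lemma max_powR_affine p s x : 1 < p -> 0 <= s -> 0 <= x ->
  p * x * s `^ (p - 1) - (p - 1) * s `^ p <=
  p * x * Num.max s x `^ (p - 1) - (p - 1) * Num.max s x `^ p.
Proof. by move=> p1 s0 x0; have := max_powR_le p1 s0 x0; lra. Qed.

End max_powR.

Section bounded_measurable.
Context d (T : measurableType d) (R : realType).
Implicit Types f g : T -> R.

(** On such functions a subprobability kernel acts with finite real values, so the operator algebra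
    below carries no integrability conditions. *)
Definition bmeas f := [/\ measurable_fun setT f, (forall x, 0 <= f x) &
  exists C, forall x, f x <= C].

Lemma bmeas_cst (a : R) : 0 <= a -> bmeas (fun=> a).
Proof. by move=> a0; split => //; exists a. Qed.

Lemma bmeasD f g : bmeas f -> bmeas g -> bmeas (fun x => f x + g x).
Proof.
move=> [mf f0 [C fC]] [mg g0 [D gD]]; split.
- exact: measurable_funD.
- by move=> x; rewrite addr_ge0.
- by exists (C + D) => x; rewrite lerD.
Qed.

Lemma bmeasM f g : bmeas f -> bmeas g -> bmeas (fun x => f x * g x).
Proof.
move=> [mf f0 [C fC]] [mg g0 [D gD]]; split.
- exact: measurable_funM.
- by move=> x; rewrite mulr_ge0.
- by exists (C * D) => x; rewrite ler_pM.
Qed.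

Lemma bmeas_powR f (r : R) : 0 <= r -> bmeas f -> bmeas (fun x => f x `^ r).
Proof.
move=> r0 [mf f0 [C fC]]; split.
- exact: (measurableT_comp (measurable_powR r)).
- by move=> x; exact: powR_ge0.
- exists (C `^ r) => x; rewrite ge0_ler_powR// nnegrE//.
  exact: le_trans (f0 x) (fC x).
Qed.

Lemma bmeas_max f g : bmeas f -> bmeas g -> bmeas (fun x => Num.max (f x) (g x)).
Proof.
move=> [mf f0 [C fC]] [mg g0 [D gD]]; split.
- exact: measurable_maxr.
- by move=> x; rewrite le_max f0.
- exists (Num.max C D) => x; rewrite ge_max !le_max fC gD ?orbT//.
Qed.

Lemma bmeas_sum (h : nat -> T -> R) a b : (forall j, bmeas (h j)) ->
  bmeas (fun x => \sum_(a <= j < b) h j x).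
Proof.
move=> bh; have [ba|ab] := leqP b a.
  by under eq_fun do rewrite big_geq//; exact: bmeas_cst.
elim: b ab => // b IH; rewrite leq_eqVlt => /predU1P[[->]|ab].
  by under eq_fun do rewrite big_nat1.
rewrite ltnS in ab; have -> : (fun x => \sum_(a <= j < b.+1) h j x) =
    (fun x => \sum_(a <= j < b) h j x + h b x).
  by apply/funext => x; rewrite big_nat_recr// ltnW.
by apply: bmeasD => //; exact: IH.
Qed.

End bounded_measurable.

Section symmetric_markov_maximal.
Context d (T : measurableType d) (R : realType).
Variable m : {measure set T -> \bar R}.
Variable S : (T -> R) -> T -> R.
Hypothesis S_bmeas : forall f, bmeas f -> bmeas (S f).
Hypothesis SD : forall f g, bmeas f -> bmeas g ->
  forall x, S (fun y => f y + g y) x = S f x + S g x.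
Hypothesis SZ : forall (a : R) f, 0 <= a -> bmeas f ->
  forall x, S (fun y => a * f y) x = a * S f x.
Hypothesis S_le : forall f g, bmeas f -> bmeas g -> (forall x, f x <= g x) ->
  forall x, S f x <= S g x.
Hypothesis S1 : forall x, S (fun=> 1) x = 1.
Hypothesis S_sym : forall f g, bmeas f -> bmeas g ->
  (\int[m]_x (f x * S g x)%:E = \int[m]_x (g x * S f x)%:E)%E.

Local Notation "S ^[ k ]" := (iter k S) (at level 2, format "S ^[ k ]").

Lemma iter_bmeas k f : bmeas f -> bmeas (S^[k] f).
Proof. by move=> bf; elim: k => //= k IH; exact: S_bmeas. Qed.

Lemma iter_op_add k f g : bmeas f -> bmeas g ->
  S^[k] (fun y => f y + g y) = (fun x => S^[k] f x + S^[k] g x).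
Proof.
move=> bf bg; elim: k => //= k ->; apply/funext => x.
by rewrite SD//; exact: iter_bmeas.
Qed.

Lemma S_cst (a : R) : 0 <= a -> S (fun=> a) = fun=> a.
Proof.
move=> a0; apply/funext => x; rewrite -[in LHS](mulr1 a) SZ ?S1 ?mulr1//.
exact: bmeas_cst.
Qed.

Lemma integral_iter k f : bmeas f ->
  (\int[m]_x (S^[k] f x)%:E = \int[m]_x (f x)%:E)%E.
Proof.
move=> bf; elim: k => //= k <-.
have := S_sym (bmeas_cst T (@ler01 R)) (iter_bmeas k bf).
under eq_integral do rewrite mul1r.
by move=> ->; apply: eq_integral => x _; rewrite S1 mulr1.
Qed.

Lemma iter_sym k f g : bmeas f -> bmeas g ->
  (\int[m]_x (f x * S^[k] g x)%:E = \int[m]_x (g x * S^[k] f x)%:E)%E.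
Proof.
elim: k f g => [|k IH] f g bf bg.
  by apply: eq_integral => x _; rewrite mulrC.
rewrite [in LHS]iterS S_sym//; last exact: iter_bmeas.
rewrite iterSr -IH//; last exact: S_bmeas.
by apply: eq_integral => x _; rewrite mulrC.
Qed.

Section bellman.
Variables (p q : R) (f : T -> R) (h : nat -> T -> R) (N : nat).
Hypothesis p1 : 1 < p.
Hypothesis qE : q = p / (p - 1).
Hypothesis bf : bmeas f.
Hypothesis bh : forall j, bmeas (h j).

Local Notation M k := (S^[k] f).
Let H k x := \sum_(k <= j < N.+1) h j x.
Fixpoint paid k : T -> R :=
  if k is k'.+1 then S (fun y => paid k' y + M k' y * S^[k'] (h k') y)
  else fun=> 0.

Let q1 : 1 < q. Proof. by have hp := p1; rewrite qE ltr_pdivlMr; lra. Qed.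

Let bH k : bmeas (H k). Proof. exact: bmeas_sum. Qed.

Let bpaid k : bmeas (paid k).
Proof.
elim: k => /= [|k IH]; first exact: bmeas_cst.
by apply/S_bmeas/bmeasD => //; apply: bmeasM; exact: iter_bmeas.
Qed.

(* [paid k] is the part of the reward [sum_j h_j(X_0) M_j(X_j)] of the chain
   started at [X_k] that is due for [j < k]; the remaining part is estimated by
   [s * H k(X_0)], where [s] is the running maximum of [M_j(X_j)], [j >= k]. *)
Lemma bellman_bound k : (k <= N)%N -> forall x s, M k x <= s ->
  paid k x + s * S^[k] (H k) x + p * q * s `^ (p - 1) * M k x <=
  q `^ p * S^[k] (fun y => f y `^ p) x + p * s `^ p +
    S^[k] (fun y => H 0 y `^ q) x.
Proof.
have hp := p1; have hq := q1.
have pq : p * (q - 1) = q by rewrite qE; field; lra.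
have H0 k' x : 0 <= H k' x by have [] := bH k'.
elim: k => [_ x s Ms|k IH kN x s Ms] /=.
  (* Two Young inequalities: [s * H] is at most [s^p + H^q], and the tangent bound at [q * f]
     contributes [(p - 1) s^p + q^p f^p]. Together they produce the coefficient [p] of [s^p]. *)
  have f0 : 0 <= f x by have [] := bf.
  have s0 : 0 <= s by exact: le_trans Ms.
  have qf0 : 0 <= q * f x by rewrite mulr_ge0//; lra.
  have := young_powR p1 s0 qf0; rewrite powRM//; last lra.
  have := @conjugate_powR _ s (H 0 x) p q s0 (H0 _ _).
  have -> : p^-1 + q^-1 = 1 by rewrite qE; field; lra.
  move=> /(_ ltac:(lra) ltac:(lra) erefl) hy.
  have h1 : s `^ p / p <= s `^ p by rewrite ler_pdivrMr ?ler_peMr ?powR_ge0//; lra.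
  have h2 : H 0 x `^ q / q <= H 0 x `^ q by rewrite ler_pdivrMr ?ler_peMr ?powR_ge0//; lra.
  lra.
have bfp : bmeas (fun y => f y `^ p) by apply: bmeas_powR => //; lra.
have bHq : bmeas (fun y => H 0 y `^ q) by apply: bmeas_powR => //; lra.
have s0 : 0 <= s by apply: le_trans Ms; have [] := iter_bmeas k.+1 bf.
have bMk := iter_bmeas k bf.
have -> : p * q * s `^ (p - 1) * S (M k) x = S (fun y => p * q * s `^ (p - 1) * M k y) x.
  by rewrite SZ// !mulr_ge0 ?powR_ge0//; lra.
have -> : s * S (S^[k] (H k.+1)) x = S (fun y => s * S^[k] (H k.+1) y) x.
  by rewrite SZ//; exact: iter_bmeas.
have -> : q `^ p * S (S^[k] (fun y => f y `^ p)) x =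
    S (fun y => q `^ p * S^[k] (fun y => f y `^ p) y) x.
  by rewrite SZ ?powR_ge0//; exact: iter_bmeas.
have -> : p * s `^ p = S (fun=> p * s `^ p) x.
  by rewrite S_cst// mulr_ge0 ?powR_ge0//; lra.
have b1 : bmeas (fun y => M k y * S^[k] (h k) y) by apply: bmeasM; exact: iter_bmeas.
have b2 : bmeas (fun y => s * S^[k] (H k.+1) y).
  by apply: bmeasM; [exact: bmeas_cst|exact: iter_bmeas].
have b3 : bmeas (fun y => p * q * s `^ (p - 1) * M k y).
  by apply: bmeasM => //; apply: bmeas_cst; rewrite !mulr_ge0 ?powR_ge0//; lra.
have b4 : bmeas (fun y => q `^ p * S^[k] (fun y => f y `^ p) y).
  by apply: bmeasM; [apply: bmeas_cst; exact: powR_ge0|exact: iter_bmeas].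
have b5 : @bmeas _ T R (fun=> p * s `^ p).
  by apply: bmeas_cst; rewrite mulr_ge0 ?powR_ge0//; lra.
have b6 := iter_bmeas k bHq.
rewrite -!SD//; try by do ?[exact: bmeasD|apply: bmeasD].
apply: S_le => [||y]; [by do ?[apply: bmeasD]|by do ?[apply: bmeasD]|].
have My0 : 0 <= M k y by have [] := bMk.
(* At the next position [y] the running maximum becomes [Num.max s (M k y)], which bounds both the
   reward due at [k] and the remaining ones. The change of the terms in [s] is controlled by
   [max_powR_affine], scaled by [q] with [q (p - 1) = p]. *)
have := IH (ltnW kN) y (Num.max s (M k y)); rewrite le_max lexx orbT => /(_ isT).
have -> : S^[k] (H k) y = S^[k] (h k) y + S^[k] (H k.+1) y.
  rewrite -[RHS]/((fun x => S^[k] (h k) x + S^[k] (H k.+1) x) y) -iter_op_add//.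
  by congr (S^[k] _ y); apply/funext => z; rewrite /H big_ltn// ltnW.
have h1 : M k y * S^[k] (h k) y <= Num.max s (M k y) * S^[k] (h k) y.
  by rewrite ler_wpM2r ?le_max ?lexx ?orbT//; have [] := iter_bmeas k (bh k).
have h2 : s * S^[k] (H k.+1) y <= Num.max s (M k y) * S^[k] (H k.+1) y.
  by rewrite ler_wpM2r ?le_max ?lexx//; have [] := iter_bmeas k (bH k.+1).
have := max_powR_affine p1 s0 My0; set a := s `^ (p - 1); set b := s `^ p.
set a' := _ `^ (p - 1); set b' := _ `^ p => h3.
have : q * (p * M k y * a - (p - 1) * b) <= q * (p * M k y * a' - (p - 1) * b').
  by rewrite ler_wpM2l//; lra.
have E c : q * (p * M k y * c.1 - (p - 1) * c.2) = p * q * c.1 * M k y - p * c.2.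
  rewrite mulrBr (mulrA q (p - 1)) (_ : q * (p - 1) = p); first by ring.
  by rewrite qE; field; lra.
rewrite (E (a, b)) (E (a', b'))/= mulrDr; lra.
Qed.

(** The Bellman bound at [k = N] with [s = M N x] is integrated, using that [S] preserves integrals.
    Symmetry moves [S^j] from [h j] onto [M j], which turns [M j] into the even iterate of order
    [j + j]: this is the duality behind Rota's dilation of a symmetric Markov operator. *)
Lemma maximal_dual :
  (\sum_(0 <= j < N.+1) \int[m]_x (h j x * S^[j + j] f x)%:E <=
   (q `^ p)%:E * \int[m]_x (f x `^ p)%:E + \int[m]_x (H 0 x `^ q)%:E)%E.
Proof.
have hp := p1; have hq := q1.
have bfp : bmeas (fun y => f y `^ p) by apply: bmeas_powR => //; lra.
have bHq : bmeas (fun y => H 0 y `^ q) by apply: bmeas_powR => //; lra.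
have b1 k : bmeas (fun y => M k y * S^[k] (h k) y) by apply: bmeasM; exact: iter_bmeas.
have mE (g : T -> R) : bmeas g -> measurable_fun setT (fun x => (g x)%:E).
  by move=> [? _ _]; exact/measurable_EFinP.
have pE (g : T -> R) : bmeas g -> forall x, setT x -> (0 <= (g x)%:E)%E.
  by move=> [_ ? _] x _; rewrite lee_fin.
have intpaid k : (\int[m]_x (paid k x + M k x * S^[k] (h k) x)%:E =
    \sum_(0 <= j < k.+1) \int[m]_x (h j x * S^[j + j] f x)%:E)%E.
  have E j : (\int[m]_x (M j x * S^[j] (h j) x)%:E = \int[m]_x (h j x * S^[j + j] f x)%:E)%E.
    by rewrite (iter_sym j (iter_bmeas j bf) (bh j)) iterD.
  elim: k => [|k IH].
    by rewrite big_nat1 -E; apply: eq_integral => x _; rewrite add0r.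
  rewrite big_nat_recr//= -IH -E; under eq_integral do rewrite EFinD.
  rewrite ge0_integralD//; [|exact: (pE _ (bpaid k.+1))|exact: (mE _ (bpaid k.+1))|exact: (pE _ (b1 k.+1))|exact: (mE _ (b1 k.+1))].
  by congr (_ + _)%E; rewrite (@integral_iter 1)//; exact: bmeasD.
rewrite -intpaid.
rewrite -(integral_iter N bfp) -(integral_iter N bHq).
rewrite -ge0_integralZl_EFin ?powR_ge0//; [|exact: (pE _ (iter_bmeas N bfp))|exact: (mE _ (iter_bmeas N bfp))].
rewrite -ge0_integralD//; first last.
- exact: (mE _ (iter_bmeas N bHq)).
- exact: (pE _ (iter_bmeas N bHq)).
- by apply: measurable_funeM; exact: (mE _ (iter_bmeas N bfp)).
- by move=> x _; rewrite mule_ge0 ?lee_fin ?powR_ge0//; exact: (pE _ (iter_bmeas N bfp)).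
have b2 : bmeas (fun x => paid N x + M N x * S^[N] (h N) x) by exact: bmeasD.
apply: ge0_le_integral => //.
- exact: (pE _ b2).
- exact: (mE _ b2).
- apply: emeasurable_funD; last exact: (mE _ (iter_bmeas N bHq)).
  by apply: measurable_funeM; exact: (mE _ (iter_bmeas N bfp)).
move=> x _; rewrite -EFinM -EFinD lee_fin.
have := bellman_bound (leqnn N) (lexx (M N x)).
have -> : H N = h N by apply/funext => y; rewrite /H big_nat1.
have M0 : 0 <= M N x by have [] := iter_bmeas N bf.
have E : M N x * M N x `^ (p - 1) = M N x `^ p by rewrite mulr_powRB1//; lra.
have h0 := powR_ge0 (M N x) p.
have -> : p * q * M N x `^ (p - 1) * M N x = p * q * M N x `^ p by rewrite -E; ring.
have : p * M N x `^ p <= p * q * M N x `^ p by rewrite ler_wpM2r// ler_peMr; lra.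
lra.
Qed.

End bellman.

End symmetric_markov_maximal.

Section finite_max.
Context (T : Type) (R : realType).
Implicit Type g : nat -> T -> R.

Fixpoint maxs g n (x : T) : R :=
  if n is n'.+1 then Num.max (maxs g n' x) (g n' x) else 0.

Lemma maxs_ge0 g n x : 0 <= maxs g n x.
Proof. by elim: n => //= n IH; rewrite le_max IH. Qed.

Lemma le_maxs g n j x : (j < n)%N -> g j x <= maxs g n x.
Proof.
elim: n => //= n IH; rewrite ltnS leq_eqVlt => /predU1P[->|/IH h].
  by rewrite le_max lexx orbT.
by rewrite le_max h.
Qed.

Lemma maxs_le_sum g n x : (forall j, 0 <= g j x) ->
  maxs g n x <= \sum_(0 <= j < n) g j x.
Proof.
move=> g0; elim: n => [|n IH]; first by rewrite big_nil.
rewrite big_nat_recr//= ge_max; apply/andP; split.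
  by rewrite (le_trans IH)// lerDl.
by rewrite lerDr sumr_ge0.
Qed.

Lemma le_maxs2 g g' n x : (forall j, g j x <= g' j x) -> maxs g n x <= maxs g' n x.
Proof. by move=> gg'; elim: n => //= n IH; rewrite ge_max !le_max IH gg' orbT. Qed.

End finite_max.

(** The factor [q^p] is Doob's constant in [maximal_dual], [(2 q)^(p - 1)] is the inverse of the
    scale [e] of the test functions in [markov_maximal], and [2 q] is what remains after half of the
    left side has been absorbed. *)
Definition maximal_const {R : realType} (p : R) : R :=
  let q := p / (p - 1) in 2 * q * (2 * q) `^ (p - 1) * q `^ p.

Section markov_maximal_inequality.
Context d (T : measurableType d) (R : realType).
Variable m : {measure set T -> \bar R}.
Variable S : (T -> R) -> T -> R.
Hypothesis S_bmeas : forall f, bmeas f -> bmeas (S f).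
Hypothesis SD : forall f g, bmeas f -> bmeas g ->
  forall x, S (fun y => f y + g y) x = S f x + S g x.
Hypothesis SZ : forall (a : R) f, 0 <= a -> bmeas f ->
  forall x, S (fun y => a * f y) x = a * S f x.
Hypothesis S_le : forall f g, bmeas f -> bmeas g -> (forall x, f x <= g x) ->
  forall x, S f x <= S g x.
Hypothesis S1 : forall x, S (fun=> 1) x = 1.
Hypothesis S_sym : forall f g, bmeas f -> bmeas g ->
  (\int[m]_x (f x * S g x)%:E = \int[m]_x (g x * S f x)%:E)%E.

Lemma bmeas_maxs (g : nat -> T -> R) n : (forall j, bmeas (g j)) -> bmeas (maxs g n).
Proof. by move=> bg; elim: n => /= [|n IH]; [exact: bmeas_cst|exact: bmeas_max]. Qed.

(** Linearization: [maximal_dual] is tested with the increments of the power [p - 1] of the running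
    maximum. Their sum telescopes, and its [q]-th power is the [p]-th power of the maximum because
    [(p - 1) q = p]. *)
Lemma markov_maximal (p : R) (f : T -> R) N : 1 < p -> bmeas f ->
  (\int[m]_x (f x)%:E < +oo)%E ->
  (\int[m]_x (maxs (fun j => iter (j + j) S f) N.+1 x `^ p)%:E <=
   (maximal_const p)%:E * \int[m]_x (f x `^ p)%:E)%E.
Proof.
move=> p1 bf f1.
set g := fun j => iter (j + j) S f.
have bg j : bmeas (g j) by exact: iter_bmeas.
have g0 j x : 0 <= g j x by have [] := bg j.
pose q := p / (p - 1); have q1 : 1 < q by rewrite ltr_pdivlMr; lra.
have bM n : bmeas (maxs g n) by exact: bmeas_maxs.
(* Solves [e^q = e / (2 q)]: the term coming from the sum of the test functions is then half of the
   left side and can be absorbed. *)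
pose e := (2 * q) `^ (- (p - 1)).
have e0 : 0 < e by rewrite powR_gt0; lra.
have eq : e `^ q = e / (2 * q).
  rewrite /e -powRrM -(powR_inv1 (a := 2 * q)); last lra.
  rewrite -powRD; last by apply/implyP => _; rewrite gt_eqF//; lra.
  by congr (_ `^ _); rewrite /q; field; lra.
pose h j x := e * (maxs g j.+1 x `^ (p - 1) - maxs g j x `^ (p - 1)).
have bh j : bmeas (h j).
  have [m1 m10 [C1 hC1]] : bmeas (fun x => maxs g j.+1 x `^ (p - 1)) by apply: bmeas_powR => //; lra.
  have [m2 m20 _] : bmeas (fun x => maxs g j x `^ (p - 1)) by apply: bmeas_powR => //; lra.
  split.
  - by apply: measurable_funM => //; exact: measurable_funB.
  - move=> x; rewrite mulr_ge0 ?(ltW e0)// subr_ge0.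
    rewrite ge0_ler_powR ?nnegrE ?maxs_ge0//=; first lra.
    by rewrite le_max lexx.
  - exists (e * C1) => x; rewrite ler_pM2l//.
    by rewrite (le_trans _ (hC1 x))// gerBl.
have Hsum n x : \sum_(0 <= j < n) h j x = e * maxs g n x `^ (p - 1).
  rewrite -mulr_sumr telescope_sumr// /= powR0 ?subr0//.
  by rewrite gt_eqF//; lra.
have := maximal_dual S_bmeas SD SZ S_le S1 S_sym N p1 (erefl q) bf bh.
under [X in (_ <= _ + X)%E -> _]eq_integral do rewrite Hsum.
set I := (\int[m]_x (maxs g N.+1 x `^ p)%:E)%E.
set F := (\int[m]_x (f x `^ p)%:E)%E.
have bMp n : bmeas (fun x => maxs g n x `^ p) by apply: bmeas_powR => //; lra.
have -> : (\int[m]_x ((e * maxs g N.+1 x `^ (p - 1)) `^ q)%:E = (e / (2 * q))%:E * I)%E.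
  rewrite -ge0_integralZl_EFin//.
  - apply: eq_integral => x _; rewrite powRM ?powR_ge0 ?(ltW e0)// -powRrM.
    by rewrite -/q eq -EFinM (_ : (p - 1) * q = p)// /q; field; lra.
  - by move=> x _; rewrite lee_fin powR_ge0.
  - by have [mp _ _] := bMp N.+1; exact/measurable_EFinP.
  - by rewrite divr_ge0//; lra.
have hI : ((e / q)%:E * I <= \sum_(0 <= j < N.+1) \int[m]_x (h j x * g j x)%:E)%E.
  rewrite -ge0_integralZl_EFin//; first last.
  - by rewrite divr_ge0//; lra.
  - by have [mp _ _] := bMp N.+1; exact/measurable_EFinP.
  - by move=> x _; rewrite lee_fin powR_ge0.
  have bhg j : bmeas (fun x => h j x * g j x) by exact: bmeasM.
  rewrite -ge0_integral_sum//; last 2 first.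
  - by move=> j; have [mp _ _] := bhg j; exact/measurable_EFinP.
  - by move=> j x _; have [_ mp _] := bhg j; rewrite lee_fin.
  apply: ge0_le_integral => //.
  - by move=> x _; rewrite -EFinM lee_fin mulr_ge0 ?powR_ge0// divr_ge0//; lra.
  - by apply: measurable_funeM; have [mp _ _] := bMp N.+1; exact/measurable_EFinP.
  - apply: emeasurable_sum => j.
    by have [mp _ _] := bhg j; exact/measurable_EFinP.
  move=> x _; rewrite -EFinM sumEFin lee_fin.
  rewrite mulrAC ler_pdivrMr; last lra.
  elim: N.+1 => [|n IH]; first by rewrite big_nil mul0r /= powR0 ?mulr0// gt_eqF//; lra.
  rewrite big_nat_recr//= mulrDl; apply: le_trans (lerD IH (lexx _)).
  have := max_powR_le p1 (maxs_ge0 g n x) (g0 n x) => hm.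
  rewrite /h /q -/(maxs g n.+1 x) -lerBlDl -mulrBr.
  have -> : e * (maxs g n.+1 x `^ (p - 1) - maxs g n x `^ (p - 1)) * g n x * (p / (p - 1))
     = e * ((p * g n x * (maxs g n.+1 x `^ (p - 1) - maxs g n x `^ (p - 1))) / (p - 1)) by ring.
  by rewrite ler_pM2l// ler_pdivlMr ?(mulrC _ (p - 1))//; lra.
(* Absorption requires a finite left side. The maximum is bounded, so its [p]-th power is at most a
   constant times the sum of the [g j], each of which has the integral of [f]. *)
have Ifin : (I < +oo)%E.
  have [_ _ [C hC]] := bM N.+1.
  apply: (@le_lt_trans _ _ (\int[m]_x ((C `^ (p - 1)) * \sum_(0 <= j < N.+1) g j x)%:E)%E).
    have bs : bmeas (fun x => C `^ (p - 1) * \sum_(0 <= j < N.+1) g j x).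
      by apply: bmeasM; [apply: bmeas_cst; exact: powR_ge0|exact: bmeas_sum].
    apply: ge0_le_integral => //.
    - by move=> x _; rewrite lee_fin powR_ge0.
    - by have [mp _ _] := bMp N.+1; exact/measurable_EFinP.
    - by have [mp _ _] := bs; exact/measurable_EFinP.
    move=> x _; rewrite lee_fin -mulr_powRB1 ?maxs_ge0//; last lra.
    rewrite mulrC ler_pM ?powR_ge0 ?maxs_ge0//; last exact: maxs_le_sum.
    rewrite ge0_ler_powR ?nnegrE ?maxs_ge0//; first lra.
    exact: le_trans (maxs_ge0 _ _ x) (hC x).
  under eq_integral do rewrite EFinM.
  have mg j : measurable_fun setT (fun x => (g j x)%:E).
    by have [mp _ _] := bg j; exact/measurable_EFinP.
  rewrite ge0_integralZl_EFin ?powR_ge0//; last 2 first.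
  - by move=> x _; rewrite lee_fin sumr_ge0.
  - by have [mp _ _] := bmeas_sum 0 N.+1 bg; exact/measurable_EFinP.
  under eq_integral do rewrite -sumEFin.
  rewrite ge0_integral_sum//; last by move=> j x _; rewrite lee_fin.
  rewrite lte_mul_pinfty ?lee_fin ?powR_ge0//.
  rewrite lte_sum_pinfty// => j _.
  by rewrite (integral_iter S_bmeas S1 S_sym).
move=> /(le_trans hI) {hI}.
have I0 : (0 <= I)%E by apply: integral_ge0 => x _; rewrite lee_fin powR_ge0.
have F0 : (0 <= F)%E by apply: integral_ge0 => x _; rewrite lee_fin powR_ge0.
have Cp0 : 0 < maximal_const p.
  rewrite /maximal_const -/q.
  have : 0 < q `^ p by rewrite powR_gt0; lra.
  have : 0 < (2 * q) `^ (p - 1) by rewrite powR_gt0; lra.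
  have q2 : 0 < 2 * q by lra.
  by move=> h1 h2; exact: mulr_gt0 (mulr_gt0 q2 h1) h2.
case: F F0 => [F||]// F0; last by move=> _; rewrite gt0_muley ?lte_fin// leey.
case: I I0 Ifin => [I||]// I0 _ hh; rewrite -?EFinM lee_fin.
rewrite -!EFinM -EFinD !lee_fin in I0 hh.
have : e / (2 * q) * I <= q `^ p * F.
  have E : e / q = 2 * (e / (2 * q)) by field; lra.
  by rewrite E in hh; lra.
rewrite mulrAC ler_pdivrMr; last lra.
rewrite /maximal_const -/q.
have -> : (2 * q) `^ (p - 1) = e^-1 by rewrite /e powRN invrK.
move=> hh2; rewrite (_ : 2 * q * _ * _ * _ = (q `^ p * F * (2 * q)) / e); last by ring.
by rewrite ler_pdivlMr// mulrC.
Qed.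

End markov_maximal_inequality.

Section kernel_maximal_inequality.
Context d (T : measurableType d) (R : realType).
Variables (Q : R.-sfker T ~> T) (m : {measure set T -> \bar R}).
Hypothesis Q1 : forall x, (Q x setT <= 1)%E.

Definition kop (f : T -> R) x : R := \int[Q x]_y f y.

Hypothesis Q_sym : forall f g, bmeas f -> bmeas g ->
  (\int[m]_x (f x * kop g x)%:E = \int[m]_x (g x * kop f x)%:E)%E.

Local Notation th x := (fine (Q x setT)).

Let thE x : ((th x)%:E = Q x setT)%E.
Proof. by rewrite fineK// ge0_fin_numE// (le_lt_trans (Q1 x)) ?ltry. Qed.

Let th0 x : 0 <= th x. Proof. by rewrite -lee_fin thE measure_ge0. Qed.
Let th1 x : th x <= 1. Proof. by rewrite -lee_fin thE. Qed.

Lemma bmeas_integrable f x : bmeas f -> (Q x).-integrable setT (EFin \o f).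
Proof.
move=> [mf f0 [C fC]].
apply: ge0_integrable => //.
apply: (@le_lt_trans _ _ (\int[Q x]_y (cst C%:E y))%E).
  by apply: ge0_le_integral => //; try exact/measurable_EFinP; move=> y _; rewrite lee_fin.
by rewrite integral_cst// -thE -EFinM ltry.
Qed.

Lemma kop_cst (a : R) x : kop (fun=> a) x = a * th x.
Proof. by rewrite /kop Rintegral_cst. Qed.

Lemma kop_le f g : bmeas f -> bmeas g -> (forall x, f x <= g x) ->
  forall x, kop f x <= kop g x.
Proof.
by move=> bf bg fg x; apply: le_Rintegral => //; exact: bmeas_integrable.
Qed.

Lemma kop_bmeas f : bmeas f -> bmeas (kop f).
Proof.
move=> bf; have [mf f0 [C fC]] := bf; split.
- exact: measurable_fun_Rintegral_kernel1.
- by move=> x; exact: Rintegral_ge0.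
- exists C => x; have C0 : 0 <= C by exact: le_trans (f0 x) (fC x).
  apply: (@le_trans _ _ (kop (fun=> C) x)).
    by apply: kop_le => //; exact: bmeas_cst.
  by rewrite kop_cst ler_piMr.
Qed.

(** The mass missing from [Q] is returned to the starting point. The resulting operator preserves
    constants, is still symmetric and dominates [kop], so the maximal inequality passes to the
    sub-Markovian kernel. *)
Definition conservative (f : T -> R) x : R := kop f x + (1 - th x) * f x.
Local Notation S := conservative.

Let bth : bmeas (fun x => 1 - th x).
Proof.
split; [|by move=> x; rewrite subr_ge0|by exists 1 => x; rewrite gerBl].
apply: measurable_funB => //; apply: measurableT_comp => //.
exact: measurable_kernel.
Qed.

Lemma conservative_bmeas f : bmeas f -> bmeas (S f).
Proof. by move=> bf; apply: bmeasD; [exact: kop_bmeas|exact: bmeasM]. Qed.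

Lemma conservative_le f g : bmeas f -> bmeas g -> (forall x, f x <= g x) ->
  forall x, S f x <= S g x.
Proof. by move=> bf bg fg x; rewrite lerD ?kop_le// ler_wpM2l ?subr_ge0. Qed.

Lemma kop_le_conservative k f : bmeas f ->
  forall x, iter k kop f x <= iter k S f x.
Proof.
move=> bf; elim: k => //= k IH x.
have b1 : bmeas (iter k kop f) by elim: k {IH} => //= k; exact: kop_bmeas.
have b2 : bmeas (iter k S f) by elim: k {IH b1} => //= k; exact: conservative_bmeas.
apply: (@le_trans _ _ (kop (iter k S f) x)); first exact: kop_le.
by rewrite lerDl mulr_ge0 ?subr_ge0//; have [] := b2.
Qed.

Lemma kernel_maximal (p : R) (f : T -> R) N : 1 < p -> bmeas f ->
  (\int[m]_x (f x)%:E < +oo)%E ->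
  (\int[m]_x (maxs (fun j => iter (j + j) kop f) N.+1 x `^ p)%:E <=
   (maximal_const p)%:E * \int[m]_x (f x `^ p)%:E)%E.
Proof.
move=> p1 bf f1.
have ES f' g' : bmeas f' -> bmeas g' -> (\int[m]_x (f' x * S g' x)%:E =
    \int[m]_x (f' x * kop g' x)%:E + \int[m]_x ((1 - th x) * (f' x * g' x))%:E)%E.
  move=> bf' bg'.
  have [m1 p1' _] : bmeas (fun x => f' x * kop g' x) by apply: bmeasM => //; exact: kop_bmeas.
  have [m2 p2' _] : bmeas (fun x => (1 - th x) * (f' x * g' x)) by do 2?apply: bmeasM.
  rewrite -ge0_integralD//; try exact/measurable_EFinP;
    try by move=> x _; rewrite lee_fin.
  by apply: eq_integral => x _; rewrite -EFinD /S; congr EFin; ring.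
apply: le_trans (@markov_maximal _ _ _ m S conservative_bmeas _ _ conservative_le _ _ p f N p1 bf f1).
- have bk j : bmeas (iter (j + j) kop f) by elim: (j + j)%N => //= k; exact: kop_bmeas.
  have bS j : bmeas (iter (j + j) S f) by elim: (j + j)%N => //= k; exact: conservative_bmeas.
  have p0 : 0 <= p by lra.
  have [m1 _ _] := bmeas_powR p0 (bmeas_maxs N.+1 bk).
  have [m2 _ _] := bmeas_powR p0 (bmeas_maxs N.+1 bS).
  apply: ge0_le_integral => //; try exact/measurable_EFinP.
    by move=> x _; rewrite lee_fin powR_ge0.
  move=> x _; rewrite lee_fin ge0_ler_powR ?nnegrE ?maxs_ge0//.
  by apply: le_maxs2 => j; exact: kop_le_conservative.
- move=> f' g' bf' bg' x; rewrite /S /kop RintegralD//; try exact: bmeas_integrable.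
  by ring.
- move=> a f' a0 bf' x; rewrite /S /kop RintegralZl//; last exact: bmeas_integrable.
  by ring.
- by move=> x; rewrite /S kop_cst; ring.
- move=> f' g' bf' bg'; rewrite !ES// Q_sym//; congr (_ + _)%E.
  by apply: eq_integral => x _; congr EFin; ring.
Qed.

End kernel_maximal_inequality.

Definition image_measure d1 d2 (T1 : measurableType d1) (T2 : measurableType d2)
    (R : realType) (mu : {measure set T1 -> \bar R}) (f : T1 -> T2)
    (mf : measurable_fun setT f) : {measure set T2 -> \bar R} :=
  measure_function_pushforward__canonical__measure_function_Measure mu mf.

Lemma ge0_integral_image d1 d2 (T1 : measurableType d1) (T2 : measurableType d2)
    (R : realType) (mu : {measure set T1 -> \bar R}) (phi : T1 -> T2)
    (mphi : measurable_fun setT phi) (f : T2 -> \bar R) :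
  measurable_fun setT f -> (forall y, 0 <= f y)%E ->
  (\int[image_measure mu mphi]_y f y = \int[mu]_x f (phi x))%E.
Proof.
by move=> mf f0; rewrite ge0_integral_pushforward// preimage_setT.
Qed.

Section affine_change_of_variable.
Context {R : realType}.
Variables (a b : R).
Hypothesis a0 : 0 < a.
Local Notation mu := (@lebesgue_measure R).
Local Notation phi := (fun x : measurableTypeR R => (a * x + b : measurableTypeR R)).

Let mphi : measurable_fun [set: measurableTypeR R] phi.
Proof. by apply: measurable_funD => //; exact: measurable_funM. Qed.

Lemma lebesgue_measure_affine (A : set R) : measurable A ->
  (a%:E * mu [set x | A (a * x + b)%R] = mu A)%E.
Proof.
move=> mA.
pose a' : {nonneg R} := NngNum (ltW a0).
pose nu := mscale a' (image_measure mu mphi).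
suff : forall B, measurable B -> mu B = nu B by move=> /(_ _ mA) ->.
apply: lebesgue_measure_unique => //= _ [[u v]] _ <-.
rewrite /nu /mscale/= /pushforward/=.
rewrite (_ : _ @^-1` _ = `]((u - b) / a), ((v - b) / a)]%classic); last first.
  apply/seteqP; split => x /=; rewrite !in_itv/= ltr_pdivrMr// ler_pdivlMr//;
    by rewrite ltrBlDr lerBrDr mulrC.
rewrite !lebesgue_measure_itv/= !lte_fin ltr_pM2r ?invr_gt0// ltrD2r.
case: ifPn => // uv; last by rewrite mule0.
rewrite -!EFinB -EFinM; congr EFin; field.
by rewrite gt_eqF.
Qed.

Lemma ge0_integral_affine (f : R -> \bar R) : measurable_fun setT f ->
  (forall x, 0 <= f x)%E ->
  (\int[mu]_x f x = a%:E * \int[mu]_x f (a * x + b)%R)%E.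
Proof.
move=> mf f0.
pose a' : {nonneg R} := NngNum (ltW a0).
have -> : (\int[mu]_x f x = \int[mscale a' (image_measure mu mphi)]_x f x)%E.
  apply: eq_measure_integral => A mA _ /=.
  by rewrite /mscale/= -[LHS]lebesgue_measure_affine.
by rewrite ge0_integral_mscale// ge0_integral_image.
Qed.

End affine_change_of_variable.

(** * Time increments of a nonincreasing function *)

Section time_differences.
Context {R : realType}.
Variables (a : R -> R) (h : R).
Hypothesis ma : measurable_fun setT a.
Hypothesis a0 : forall t, 0 <= a t.
Hypothesis a_ni : forall s t, 0 <= s -> s <= t -> a t <= a s.
Hypothesis h0 : 0 < h.
Local Notation mu := (@lebesgue_measure R).

Lemma nonincreasing_integrable (u v : R) (b b' : bool) : 0 <= u ->
  mu.-integrable [set` Interval (BSide b u) (BSide b' v)] (EFin \o a).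
Proof.
move=> u0; have [uv|vu] := leP u v; last first.
  rewrite set_itv_ge; first exact: integrable_set0.
  by rewrite -leNgt; case: b; case: b'; rewrite bnd_simp// ltW.
apply: (@le_integrable _ _ _ mu _ _ _ (EFin \o cst (a u))) => //.
- exact/measurable_EFinP/measurable_funTS.
- move=> x /=; rewrite in_itv => /andP[ux _]; rewrite !ger0_norm// lee_fin a_ni//.
  by case: b ux => //= /ltW.
- apply/integrableP; split => //=; first exact/measurable_EFinP.
  rewrite (_ : (fun x => _) = cst `|a u|%:E)//.
  rewrite integral_cst//= lebesgue_measure_itv/= lte_fin.
  by case: ifPn => _; rewrite ?mule0// -EFinB -EFinM ltry.
Qed.

Lemma Rintegral_shift (u v : R) :
  \int[mu]_(t in `]u, v]) a (t + h) = \int[mu]_(t in `](u + h), (v + h)]) a t.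
Proof.
rewrite /Rintegral; congr fine; rewrite integral_mkcond [RHS]integral_mkcond.
rewrite [RHS](@ge0_integral_affine _ 1 h ltr01); last 2 first.
- apply/(measurable_restrictT _ _).1 => //.
  by apply: measurable_funTS; exact/measurable_EFinP.
- by move=> x; rewrite patchE; case: ifPn => // _; rewrite lee_fin.
rewrite mul1e; apply: eq_integral => x _; rewrite !patchE mul1r !mem_setE !in_itv/=.
by rewrite ltrD2r lerD2r.
Qed.

(** The shifted integral cancels on the overlap and leaves one window of length [h] at each end. *)
Lemma Rintegral_differences (N : R) : 0 <= N ->
  \int[mu]_(t in `]0, N]) (a t - a (t + h)) =
  \int[mu]_(t in `]0, h]) a t - \int[mu]_(t in `]N, (N + h)]) a t.
Proof.
move=> N0; rewrite RintegralB//; last 2 first.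
- exact: nonincreasing_integrable.
- apply: (@le_integrable _ _ _ mu _ _ _ (EFin \o a)) => //.
  + apply/measurable_EFinP/measurable_funTS.
    by apply: measurableT_comp => //; exact: measurable_funD.
  + move=> x /=; rewrite in_itv/= => /andP[x0 _]; rewrite !ger0_norm// lee_fin a_ni ?lerDl//.
      exact: ltW.
    exact: ltW.
  + exact: nonincreasing_integrable.
rewrite Rintegral_shift add0r.
have i0 : mu.-integrable `]0, (N + h)] (EFin \o a) by exact: nonincreasing_integrable.
have := Rintegral_itvB i0 (x := N); rewrite !bnd_simp N0 lerDl (ltW h0) => /(_ isT isT) <-.
have := Rintegral_itvB i0 (x := h); rewrite !bnd_simp (ltW h0) lerDr N0 => /(_ isT isT) <-.
by ring.
Qed.

Lemma Rintegral_itv_bound (u : R) : 0 <= u ->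
  h * a (u + h) <= \int[mu]_(t in `]u, (u + h)]) a t <= h * a u.
Proof.
move=> u0.
have E c : h * c = \int[mu]_(t in `]u, (u + h)]) c.
  rewrite Rintegral_cst//= lebesgue_measure_itv/= lte_fin ltrDl h0.
  by rewrite -EFinB/= addrAC subrr add0r mulrC.
have ic c : mu.-integrable `]u, (u + h)] (EFin \o (fun=> c : R)).
  apply/integrableP; split => //=; first exact/measurable_EFinP.
  rewrite (_ : (fun x => _) = cst `|c|%:E)// integral_cst//= lebesgue_measure_itv/= lte_fin.
  by rewrite ltrDl h0 -EFinB -EFinM ltry.
rewrite !E; apply/andP; split; apply: le_Rintegral => //;
  try exact: nonincreasing_integrable;
  move=> x /=; rewrite in_itv/= => /andP[ux xu]; rewrite a_ni//.
- exact: le_trans u0 (ltW ux).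
- exact: ltW.
Qed.

Lemma time_differences_le N : 0 <= N ->
  \int[mu]_(t in `]0, N]) (a t - a (t + h)) <= h * a 0.
Proof.
move=> N0; rewrite Rintegral_differences//.
have /andP[_] := Rintegral_itv_bound (lexx 0); rewrite add0r => h1.
have /andP[h2 _] := Rintegral_itv_bound N0.
have h3 : 0 <= h * a (N + h) by rewrite mulr_ge0// ltW.
lra.
Qed.

(** The first window is bounded below by the value at its right end, so [a h] stands where [a 0] is
    wanted; the passage to time [0] is made later by continuity in L^p. *)
Lemma time_differences_ge N : 0 <= N ->
  h * (a h - a N) <= \int[mu]_(t in `]0, N]) (a t - a (t + h)).
Proof.
move=> N0; rewrite Rintegral_differences//.
have /andP[] := Rintegral_itv_bound (lexx 0); rewrite add0r => h1 _.
have /andP[_ h2] := Rintegral_itv_bound N0.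
lra.
Qed.

Lemma integrable_differences N : 0 <= N ->
  mu.-integrable `]0, N] (EFin \o (fun t => a t - a (t + h))).
Proof.
move=> N0; apply: (@le_integrable _ _ _ mu _ _ _ (EFin \o a)) => //.
- apply/measurable_EFinP/measurable_funTS; apply: measurable_funB => //.
  by apply: measurableT_comp => //; exact: measurable_funD.
- move=> x /=; rewrite in_itv/= => /andP[x0 _]; rewrite lee_fin.
  have : a (x + h) <= a x by rewrite a_ni ?lerDl// ltW.
  by move=> h1; rewrite !ger0_norm ?subr_ge0// gerBl.
- exact: nonincreasing_integrable.
Qed.

End time_differences.

(** * Kernels composed with a measurable map *)

Section precomposition.
Context d1 d2 d3 (X : measurableType d1) (Y : measurableType d2)
  (Z : measurableType d3) (R : realType).
Variables (phi : Z -> X) (mphi : measurable_fun setT phi).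

(** The proof of measurability is an argument so that the kernel structures can be attached to the
    term itself. *)
Definition kprecomp (l : X -> {measure set Y -> \bar R}) of measurable_fun setT phi :=
  fun z => l (phi z).

Section kernel.
Variable l : R.-ker X ~> Y.

Let kprecomp_measurable U : measurable U -> measurable_fun setT (kprecomp l mphi ^~ U).
Proof. by move=> mU; exact: (measurableT_comp (measurable_kernel l U mU) mphi). Qed.

HB.instance Definition _ := isKernel.Build _ _ Z Y R (kprecomp l mphi) kprecomp_measurable.
End kernel.

(** A separate copy for finite kernels, the members of the series that shows [kprecomp] to be
    s-finite. *)
Definition kprecomp_finite (l : X -> {measure set Y -> \bar R}) of measurable_fun setT phi :=
  fun z => l (phi z).

Section finite.
Variable l : R.-fker X ~> Y.

Let measurable_kprecomp_finite U : measurable U ->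
  measurable_fun setT (kprecomp_finite l mphi ^~ U).
Proof. by move=> mU; exact: (measurableT_comp (measurable_kernel l U mU) mphi). Qed.

HB.instance Definition _ :=
  isKernel.Build _ _ Z Y R (kprecomp_finite l mphi) measurable_kprecomp_finite.

Let kprecomp_finite_uub : measure_fam_uub (kprecomp_finite l mphi).
Proof. by have [r hr] := measure_uub l; exists r => z; exact: hr. Qed.

HB.instance Definition _ :=
  Kernel_isFinite.Build _ _ Z Y R (kprecomp_finite l mphi) kprecomp_finite_uub.

End finite.

Section sfinite.
Variable l : R.-sfker X ~> Y.

Let kprecomp_sfinite : exists s : (R.-fker Z ~> Y)^nat,
  forall x U, measurable U -> kprecomp l mphi x U = kseries s x U.
Proof.
have [s hs] := sfinite_kernel l.
by exists (fun n => kprecomp_finite (s n) mphi) => z U mU; rewrite /kprecomp hs.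
Qed.

HB.instance Definition _ :=
  Kernel_isSFinite.Build _ _ Z Y R (kprecomp l mphi) kprecomp_sfinite.

End sfinite.

End precomposition.

(** * The Hardy-Stein estimate *)

Lemma ge0_integral_ltyae d (T : measurableType d) (R : realType)
    (mu : {measure set T -> \bar R}) (g : T -> \bar R) :
  measurable_fun setT g -> (forall x, 0 <= g x)%E -> (\int[mu]_x g x < +oo)%E ->
  {ae mu, forall x, g x \is a fin_num}.
Proof.
move=> mg g0 goo.
have ig : mu.-integrable setT g.
  by apply/integrableP; split => //; under eq_integral do rewrite gee0_abs//.
by apply: filterS (integrable_ae measurableT ig) => x; exact.
Qed.

(** * Semigroups given by a kernel on time and space *)

Section kernel_semigroup.
Context d (T : measurableType d) (R : realType).
Variables (m : {sigma_finite_measure set T -> \bar R}) (K : R.-sfker (R * T) ~> T).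
Hypothesis K1 : forall z, (K z setT <= 1)%E.
Hypothesis K_semi : forall (s t : R) x (g : T -> \bar R), 0 <= s -> 0 <= t ->
  measurable_fun setT g -> (forall y, 0 <= g y)%E ->
  (\int[K ((s + t)%R, x)]_y g y = \int[K (s, x)]_y \int[K (t, y)]_z g z)%E.
Hypothesis K_sym : forall (t : R) (f g : T -> \bar R), 0 <= t ->
  measurable_fun setT f -> (forall y, 0 <= f y)%E ->
  measurable_fun setT g -> (forall y, 0 <= g y)%E ->
  (\int[m]_x (f x * \int[K (t, x)]_y g y) = \int[m]_x (g x * \int[K (t, x)]_y f y))%E.

Definition ksem (t : R) (f : T -> R) (x : T) : R := \int[K (t, x)]_y f y.

Definition kslice (t : R) : R.-sfker T ~> T :=
  kprecomp K (measurable_pair1 t : measurable_fun setT (pair t)).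

Lemma measurable_ksem_joint (f : T -> R) : measurable_fun setT f ->
  measurable_fun setT (fun z : R * T => ksem z.1 f z.2).
Proof.
move=> mf; have := measurable_fun_Rintegral_kernel1 K mf.
by apply: eq_measurable_fun => -[t x] _.
Qed.

Lemma measurable_ksem t (f : T -> R) : measurable_fun setT f ->
  measurable_fun setT (ksem t f).
Proof. exact: (measurable_fun_Rintegral_kernel1 (kslice t)). Qed.

Lemma measurable_kint t (g : T -> \bar R) : measurable_fun setT g ->
  (forall x, 0 <= g x)%E -> measurable_fun setT (fun x => \int[K (t, x)]_y g y)%E.
Proof.
move=> mg g0; apply: (measurable_fun_integral_kernel (l := kslice t)) => //.
by move=> U mU; exact: measurable_kernel.
Qed.

(** Duality against the constant [1], whose image under the kernel is at most [1]. *)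
Lemma kslice_excessive t (g : T -> \bar R) : 0 <= t -> measurable_fun setT g ->
  (forall x, 0 <= g x)%E -> (\int[m]_x \int[kslice t x]_y g y <= \int[m]_x g x)%E.
Proof.
move=> t0 mg g0.
have := K_sym t0 (measurable_cst 1%E) (fun=> lee01) mg g0.
under eq_integral do rewrite mul1e; move=> ->.
apply: ge0_le_integral => //.
- by move=> x _; rewrite mule_ge0// integral_ge0.
- by apply: emeasurable_funM => //; exact: measurable_kint.
- move=> x _; rewrite integral_cst// mul1e -[leRHS]mule1.
  by rewrite lee_pmul// measure_ge0.
Qed.

Let int_K_ltyP z (f : T -> R) (p : R) : 1 <= p -> measurable_fun setT f ->
  (\int[K z]_y (`|f y| `^ p)%:E < +oo)%E -> (\int[K z]_y (`|f y|)%:E < +oo)%E.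
Proof.
move=> p1 mf fp; have mfp := measurable_norm_powR p mf.
have fp0 x : 0 <= `|f x| `^ p by exact: powR_ge0.
apply: (@le_lt_trans _ _ (\int[K z]_y (1 + (`|f y| `^ p)%:E))%E).
  apply: ge0_le_integral => //.
  - by apply/measurable_EFinP; exact: measurableT_comp.
  - by apply: emeasurable_funD => //; exact/measurable_EFinP.
  - move=> y _; rewrite -EFinD lee_fin -[leLHS]powRr1//.
    by apply: powR_le1D_powR => //.
rewrite ge0_integralD//; last exact/measurable_EFinP.
rewrite (_ : (fun x => _) = cst 1%E)// integral_cst// mul1e lte_add_pinfty//.
by rewrite (le_lt_trans (K1 z)) ?ltry.
Qed.

(** Positive and negative parts are treated as extended-valued functions. Finiteness at time [s + t]
    makes both inner integrals finite at almost every point under [K (s, x)], and there [fine]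
    commutes with the subtraction. *)
Lemma ksem_semigroup s t (f : T -> R) x : 0 <= s -> 0 <= t -> measurable_fun setT f ->
  (\int[K ((s + t)%R, x)]_y (`|f y|)%:E < +oo)%E ->
  ksem (s + t) f x = ksem s (ksem t f) x.
Proof.
move=> s0 t0 mf foo; rewrite /ksem /Rintegral; congr fine.
pose fp := ((fun y => (f y)%:E)^\+)%E; pose fn := ((fun y => (f y)%:E)^\-)%E.
have mfE : measurable_fun setT (fun y => (f y)%:E) by exact/measurable_EFinP.
have mfp : measurable_fun setT fp by exact: measurable_funepos.
have mfn : measurable_fun setT fn by exact: measurable_funeneg.
have fp0 y : (0 <= fp y)%E by exact: funepos_ge0.
have fn0 y : (0 <= fn y)%E by exact: funeneg_ge0.
have mEp := measurable_kint t mfp fp0; have mEn := measurable_kint t mfn fn0.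
have Ep0 y : (0 <= \int[K (t, y)]_z fp z)%E by exact: integral_ge0.
have En0 y : (0 <= \int[K (t, y)]_z fn z)%E by exact: integral_ge0.
have fpoo : (\int[K ((s + t)%R, x)]_y fp y < +oo)%E.
  apply: le_lt_trans foo; apply: ge0_le_integral => //.
    by apply/measurable_EFinP; exact: measurableT_comp.
  by move=> y _; rewrite /fp funeposE ge_max !lee_fin ler_norm normr_ge0.
have fnoo : (\int[K ((s + t)%R, x)]_y fn y < +oo)%E.
  apply: le_lt_trans foo; apply: ge0_le_integral => //.
    by apply/measurable_EFinP; exact: measurableT_comp.
  by move=> y _; rewrite /fn funenegE ge_max !lee_fin -normrN ler_norm normr_ge0.
rewrite integralE -/fp -/fn !K_semi//.
rewrite K_semi// in fpoo; rewrite K_semi// in fnoo.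
have intK (g : T -> \bar R) : measurable_fun setT g -> (forall y, 0 <= g y)%E ->
    (\int[K (s, x)]_y g y < +oo)%E -> (K (s, x)).-integrable setT g.
  move=> mg g0 goo; apply/integrableP; split; first exact: mg.
  by under eq_integral do rewrite gee0_abs//.
have ip := intK _ mEp Ep0 fpoo; have in_ := intK _ mEn En0 fnoo.
rewrite -integralB//; apply: ae_eq_integral => //.
- exact: emeasurable_funB.
- by apply/measurable_EFinP; exact: measurable_ksem.
have hp := ge0_integral_ltyae mEp Ep0 fpoo.
have hn := ge0_integral_ltyae mEn En0 fnoo.
apply: filterS2 hp hn => y hpy hny _.
rewrite [in RHS]integralE -/fp -/fn fineK//.
by rewrite fin_numB hpy hny.
Qed.

Lemma ksem_semigroup_ae s t (f : T -> R) (p : R) : 1 <= p -> 0 <= s -> 0 <= t ->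
  measurable_fun setT f -> (\int[m]_x (`|f x| `^ p)%:E < +oo)%E ->
  {ae m, forall x, ksem (s + t) f x = ksem s (ksem t f) x}.
Proof.
move=> p1 s0 t0 mf fp; have st0 : 0 <= s + t by rewrite addr_ge0.
have mfp : measurable_fun setT (fun x => (`|f x| `^ p)%:E).
  exact/measurable_EFinP/measurable_norm_powR.
have fp0 x : (0 <= (`|f x| `^ p)%:E)%E by rewrite lee_fin powR_ge0.
have := kslice_excessive st0 mfp fp0 => /le_lt_trans/(_ fp).
move=> /(ge0_integral_ltyae (measurable_kint _ mfp fp0)) h.
have {}h := h (fun x => integral_ge0 _ (fun y _ => fp0 y)).
apply: filterS h => x hx; apply: ksem_semigroup => //.
apply: (int_K_ltyP p1) => //.
by rewrite ltey_eq hx.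
Qed.

Lemma ksem_contraction t (f : T -> R) (p : R) : 1 < p -> 0 <= t ->
  measurable_fun setT f ->
  (\int[m]_x (`|ksem t f x| `^ p)%:E <= \int[m]_x (`|f x| `^ p)%:E)%E.
Proof.
move=> p1 t0 mf.
apply: (powR_contraction (Q := kslice t)) => // [x|g mg g0]; first exact: K1.
exact: kslice_excessive.
Qed.

Lemma ksem_bmeas t (f : T -> R) : bmeas f -> bmeas (ksem t f).
Proof. by move=> bf; apply: (kop_bmeas (Q := kslice t)) => // x; exact: K1. Qed.

Lemma ksem_bmeas_semigroup s t (f : T -> R) x : 0 <= s -> 0 <= t -> bmeas f ->
  ksem (s + t) f x = ksem s (ksem t f) x.
Proof.
move=> s0 t0 bf; have [mf f0 _] := bf; apply: ksem_semigroup => //.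
have K1' y : (kslice (s + t) y setT <= 1)%E by exact: K1.
have /integrableP[_] := bmeas_integrable K1' x bf.
by [].
Qed.

(** Zero steps are singled out: the semigroup law alone does not make [ksem K 0] the identity. *)
Lemma iter_ksem k t (f : T -> R) x : 0 <= t -> bmeas f ->
  iter k (kop (kslice t)) f x = if k is 0%N then f x else ksem (t *+ k) f x.
Proof.
move=> t0 bf; elim: k x => // k IH x; rewrite iterS.
have -> : iter k (kop (kslice t)) f = if k is 0%N then f else ksem (t *+ k) f.
  by apply/funext => y; rewrite IH; case: k {IH}.
case: k {IH} => [|k]; first by rewrite mulr1n.
transitivity (ksem t (ksem (t *+ k.+1) f) x) => //.
by rewrite -ksem_bmeas_semigroup// ?mulrn_wge0// -mulrS.
Qed.

End kernel_semigroup.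

Lemma mulr_le_of_eq (R : realDomainType) (a b c d e w : R) :
  2 * d * e = a - w -> b + c * a <= a + c * w -> 2 * d * c * e <= a - b.
Proof.
move=> h1 h2; rewrite (_ : 2 * d * c * e = c * (2 * d * e)); last by ring.
by rewrite h1; lra.
Qed.

Lemma mulr_ge_of_eq (R : realDomainType) (a b c d e w : R) :
  2 * d * e = a - w -> a + c * w <= b + c * a -> a - b <= c * (2 * d * e).
Proof. by move=> -> h2; lra. Qed.

Lemma ereal_nondecreasing_le_cvg (R : realType) (u : nat -> \bar R) (l : \bar R) k :
  {homo u : n m / (n <= m)%N >-> (n <= m)%E} -> u n @[n --> \oo] --> l -> (u k <= l)%E.
Proof.
move=> ndu ul; have h := ereal_nondecreasing_cvgn ndu.
rewrite (cvg_unique (@ereal_hausdorff R) ul h).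
by apply: ereal_sup_ubound; exists k.
Qed.

Section hardy_stein.
Context d (T : measurableType d) (R : realType).
Variables (m : {sigma_finite_measure set T -> \bar R}) (K : R.-sfker (R * T) ~> T)
  (Jk : R.-sfker T ~> T).
Hypothesis K1 : forall z, (K z setT <= 1)%E.
Hypothesis K_semi : forall (s t : R) x (g : T -> \bar R), 0 <= s -> 0 <= t ->
  measurable_fun setT g -> (forall y, 0 <= g y)%E ->
  (\int[K ((s + t)%R, x)]_y g y = \int[K (s, x)]_y \int[K (t, y)]_z g z)%E.
Hypothesis K_sym : forall (t : R) (f g : T -> \bar R), 0 <= t ->
  measurable_fun setT f -> (forall y, 0 <= f y)%E ->
  measurable_fun setT g -> (forall y, 0 <= g y)%E ->
  (\int[m]_x (f x * \int[K (t, x)]_y g y) = \int[m]_x (g x * \int[K (t, x)]_y f y))%E.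

Definition dyad (k : nat) : R := 2^-1 ^+ k.+1.

(* (v - P_(2h) v, v) / 2h with h = dyad k, by symmetry of P_h *)
Definition approx_energy (k : nat) (v : T -> R) : R :=
  (fine (\int[m]_x ((v x) ^+ 2)%:E) -
   fine (\int[m]_x ((ksem K (dyad k) v x) ^+ 2)%:E)) / (2 * dyad k).

Definition jump_energy (v : T -> R) : \bar R :=
  (\int[m]_x \int[Jk x]_y ((v y - v x) ^+ 2)%:E)%E.

(** What is used of the Dirichlet form. Boundedness of the approximate energies stands for
    membership in the form domain, which cannot be asserted in advance of the functions to which
    this is applied. *)
Hypothesis H_form : forall v : T -> R, measurable_fun setT v ->
  (\int[m]_x ((v x) ^+ 2)%:E < +oo)%E ->
  (forall k, approx_energy k v <= approx_energy k.+1 v) /\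
  (forall C : R, (forall k, approx_energy k v <= C) ->
    (approx_energy k v)%:E @[k --> \oo] --> (2^-1%:E * jump_energy v)%E).

Variables (p : R) (f : T -> R).
Hypothesis p1 : 1 < p.
Hypothesis mf : measurable_fun setT f.
Hypothesis fp : (\int[m]_x (`|f x| `^ p)%:E < +oo)%E.

Definition pow_half (t : R) (x : T) : R := spow (p / 2) (ksem K t f x).
Local Notation v := pow_half.
Local Notation A0 := (\int[m]_x (`|f x| `^ p)%:E)%E.
Definition pmass (t : R) : R := fine (\int[m]_x (`|ksem K t f x| `^ p)%:E).

Lemma dyad_gt0 k : 0 < dyad k. Proof. by rewrite exprn_gt0// invr_gt0. Qed.

Lemma measurable_pow_half_joint : measurable_fun setT (fun z : R * T => v z.1 z.2).
Proof.
exact: (measurableT_comp (measurable_spow _) (measurable_ksem_joint K mf)).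
Qed.

Lemma measurable_pow_half t : measurable_fun setT (v t).
Proof. exact: (measurableT_comp (measurable_spow _) (measurable_ksem K t mf)). Qed.

Let pn0 : p != 0. Proof. by have hp := p1; rewrite gt_eqF//; lra. Qed.

Lemma sqr_pow_half t x : v t x ^+ 2 = `|ksem K t f x| `^ p.
Proof. exact: sqr_spow. Qed.

Lemma integral_sqr_pow_half t :
  (\int[m]_x ((v t x) ^+ 2)%:E = \int[m]_x (`|ksem K t f x| `^ p)%:E)%E.
Proof. by apply: eq_integral => x _; rewrite sqr_pow_half. Qed.

Lemma pmass_le t : 0 <= t -> (\int[m]_x (`|ksem K t f x| `^ p)%:E <= A0)%E.
Proof. by move=> t0; exact: ksem_contraction. Qed.

Let pint_ge0 (g : T -> R) : (0 <= \int[m]_x (`|g x| `^ p)%:E)%E.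
Proof. by apply: integral_ge0 => x _; rewrite lee_fin powR_ge0. Qed.

Lemma pmassE t : 0 <= t ->
  ((pmass t)%:E = \int[m]_x (`|ksem K t f x| `^ p)%:E)%E.
Proof.
move=> t0; rewrite /pmass fineK; first by [].
by rewrite ge0_fin_numE; [exact: (le_lt_trans (pmass_le t0) fp)|exact: pint_ge0].
Qed.

Lemma pmass_ge0 t : 0 <= pmass t. Proof. exact: fine_ge0. Qed.

Lemma measurable_pmass : measurable_fun setT pmass.
Proof.
apply: (measurableT_comp (@fine_measurable R setT measurableT)).
apply: (@measurable_fun_fubini_tonelli_F _ _ _ _ _ m (fun z : R * T => (`|ksem K z.1 f z.2| `^ p)%:E)).
- by apply/measurable_EFinP/measurable_norm_powR; exact: measurable_ksem_joint.
- by move=> z; rewrite lee_fin powR_ge0.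
Qed.

Lemma pmass_sqr t : pmass t = fine (\int[m]_x ((v t x) ^+ 2)%:E).
Proof. by rewrite integral_sqr_pow_half. Qed.

Local Opaque pmass.

Lemma pmassD t h : 0 <= t -> 0 <= h ->
  ((pmass (t + h))%:E = \int[m]_x (`|ksem K h (ksem K t f) x| `^ p)%:E)%E.
Proof.
move=> t0 h0; have th : 0 <= t + h by exact: addr_ge0.
rewrite (pmassE th); apply: ae_eq_integral; first exact: measurableT.
- by apply/measurable_EFinP/measurable_norm_powR; exact: (measurable_ksem K _ mf).
- by apply/measurable_EFinP/measurable_norm_powR; do 2 apply: measurable_ksem.
- have := ksem_semigroup_ae K1 K_semi K_sym (ltW p1) h0 t0 mf fp.
  by apply: filterS => x hx _; rewrite addrC hx.
Qed.

Lemma pmass_ni s t : 0 <= s -> s <= t -> pmass t <= pmass s.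
Proof.
move=> s0 st; have [h [h0 ->]] : exists h, 0 <= h /\ t = s + h.
  by exists (t - s); rewrite subr_ge0 subrKC.
rewrite -lee_fin [X in (X <= _)%E](pmassD s0 h0) [X in (_ <= X)%E](pmassE s0).
exact: (ksem_contraction K1 K_sym p1 h0 (measurable_ksem K s mf)).
Qed.

Lemma measurable_approx_energy k :
  measurable_fun setT (fun t => approx_energy k (v t)).
Proof.
apply: measurable_funM => //; apply: measurable_funB.
- by under eq_fun do rewrite -pmass_sqr; exact: measurable_pmass.
- apply: (measurableT_comp (@fine_measurable R setT measurableT)).
  apply: (@measurable_fun_fubini_tonelli_F _ _ _ _ _ m (fun z : R * T => ((ksem K (dyad k) (v z.1) z.2) ^+ 2)%:E)); last first.
    by move=> z; rewrite lee_fin sqr_ge0.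
  apply/measurable_EFinP/measurable_funX.
  have mphi : measurable_fun setT (fun z : R * T => (dyad k, z.2)).
    exact: measurable_fun_pair.
  apply: (measurable_fun_Rintegral_kernel (kprecomp K mphi)
    (f := fun z : (R * T) * T => v z.1.1 z.2)).
  have mpsi : measurable_fun setT (fun z : (R * T) * T => (z.1.1, z.2)).
    by apply: measurable_fun_pair => //; exact: measurableT_comp.
  exact: (measurableT_comp measurable_pow_half_joint mpsi).
Qed.

Let cp := Num.min 1 (p - 1) / 2.

Let K1s h x : (kslice K h x setT <= 1)%E. Proof. exact: K1. Qed.

Let W_le h t : 0 <= h -> 0 <= t ->
  (\int[m]_x ((ksem K h (v t) x) ^+ 2)%:E <= (pmass t)%:E)%E.
Proof.
move=> h0 t0; rewrite pmassE//.
apply: (powR_contraction_v (Q := kslice K h)) => // [g mg g0|].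
  exact: kslice_excessive.
exact: measurable_ksem.
Qed.

Let W_fin h t : 0 <= h -> 0 <= t ->
  ((fine (\int[m]_x ((ksem K h (v t) x) ^+ 2)%:E))%:E =
    \int[m]_x ((ksem K h (v t) x) ^+ 2)%:E)%E.
Proof.
move=> h0 t0; rewrite fineK// ge0_fin_numE; first by rewrite (le_lt_trans (W_le h0 t0)) ?ltry.
by apply: integral_ge0 => x _; rewrite lee_fin sqr_ge0.
Qed.

Let approxE k t : 0 <= t -> 2 * dyad k * approx_energy k (v t) =
  pmass t - fine (\int[m]_x ((ksem K (dyad k) (v t) x) ^+ 2)%:E).
Proof.
move=> t0; rewrite /approx_energy mulrC divfK; last first.
  by rewrite mulf_neq0// gt_eqF// dyad_gt0.
by rewrite pmass_sqr.
Qed.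

Lemma approx_energy_ge0 k t : 0 <= t -> 0 <= approx_energy k (v t).
Proof.
move=> t0; rewrite -(pmulr_rge0 (x := 2 * dyad k)) ?mulr_gt0 ?dyad_gt0//.
by rewrite approxE// subr_ge0 -lee_fin W_fin// ?W_le// ltW ?dyad_gt0.
Qed.

(** One step of Hardy-Stein: [energy_ge] for the kernel at time [h = dyad k] and the function
    [ksem K t f]. The decrease of the squared norm of [v t] under one step [h] is a slope over
    [2 h], whence the factor [2 * dyad k]. *)
Lemma approx_energy_le_pmass k t : 0 <= t ->
  2 * dyad k * cp * approx_energy k (v t) <= pmass t - pmass (t + dyad k).
Proof.
move=> t0; have hp := p1; have dk := ltW (dyad_gt0 k).
have [c0 [c1 c2]] : 0 <= cp /\ cp <= 1 /\ cp <= p - 1.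
  by rewrite /cp; case: (leP 1 (p - 1)) => H; split; lra.
have mu_ := measurable_ksem K t mf.
have ufin : (\int[m]_x (`|ksem K t f x| `^ p)%:E < +oo)%E.
  by rewrite (le_lt_trans (pmass_le t0)).
apply: (mulr_le_of_eq (approxE k t0)).
rewrite -lee_fin !EFinD !EFinM [X in (X + _ <= _)%E](pmassD t0 dk).
rewrite [X in (_ + _ * X <= _)%E](pmassE t0) [X in (_ <= X + _)%E](pmassE t0).
rewrite [X in (_ <= _ + _ * X)%E](W_fin dk t0).
exact: (@energy_ge _ _ _ (kslice K (dyad k)) m (K1s _)
  (fun g mg g0 => kslice_excessive K1 K_sym dk mg g0) p _ p1 mu_ ufin cp c0 c1 c2
  (fun a b => bregman_ge a b p1)).
Qed.

Lemma pmass_le_approx_energy k t : 2 <= p -> 0 <= t ->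
  pmass t - pmass (t + dyad k) <= 2 * p * (2 * dyad k * approx_energy k (v t)).
Proof.
move=> p2 t0; have dk := ltW (dyad_gt0 k).
have mu_ := measurable_ksem K t mf.
have ufin : (\int[m]_x (`|ksem K t f x| `^ p)%:E < +oo)%E.
  by rewrite (le_lt_trans (pmass_le t0)).
have [c1 c2] : 1 <= 2 * p /\ p - 1 <= 2 * p by split; lra.
apply: (mulr_ge_of_eq (approxE k t0)).
rewrite -lee_fin !EFinD !(EFinM (2 * p)) [X in (_ <= X + _)%E](pmassD t0 dk).
rewrite [X in (_ <= _ + _ * X)%E](pmassE t0) [X in (X + _ <= _)%E](pmassE t0).
rewrite [X in (_ + _ * X <= _)%E](W_fin dk t0).
exact: (@energy_le _ _ _ (kslice K (dyad k)) m (K1s _)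
  (fun g mg g0 => kslice_excessive K1 K_sym dk mg g0) p _ p1 mu_ ufin (2 * p) c1 c2
  (fun a b => bregman_le a b p2)).
Qed.

Local Notation mu := (@lebesgue_measure R).

Let integrable_approx k N : 0 <= N ->
  mu.-integrable `]0, N] (EFin \o (fun t => approx_energy k (v t))).
Proof.
move=> N0; have hp := p1.
have c0 : 0 < 2 * dyad k * cp.
  by rewrite !mulr_gt0 ?dyad_gt0//; case: (leP 1 (p - 1)) => ?; lra.
have mN : measurable (`]0, N]%classic : set (measurableTypeR R)) by exact: measurable_itv.
have /(integrableZR mN (2 * dyad k * cp)^-1) := integrable_differences measurable_pmass
  pmass_ge0 pmass_ni (dyad_gt0 k) N0.
apply: (le_integrable mN).
- by apply: measurable_funTS; apply/measurable_EFinP; exact: measurable_approx_energy.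
- move=> t /=; rewrite in_itv/= => /andP[/ltW t0 _]; rewrite lee_fin.
  rewrite ger0_norm ?approx_energy_ge0// ler_normr; apply/orP; left.
  by rewrite mulrC ler_pdivlMr// mulrC approx_energy_le_pmass.
Qed.

(** The bound is uniform in [k] because [time_differences_le] produces a factor [dyad k] that
    cancels the one of the step estimate. *)
Lemma time_approx_energy_le k :
  ((2 * cp)%:E * \int[mu]_(t in `[0%R, +oo[) (approx_energy k (v t))%:E <= A0)%E.
Proof.
have hp := p1; have dk := dyad_gt0 k.
have c0 : 0 < 2 * cp by rewrite /cp; case: (leP 1 (p - 1)) => ?; lra.
(* Truncation at [0] changes nothing for [t >= 0] and makes the integrand nonnegative for every real
   [t]; the half-line is then exhausted by bounded intervals. *)
pose g t := Num.max 0 (approx_energy k (v t)).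
have mg : measurable_fun setT g by apply: measurable_maxr => //; exact: measurable_approx_energy.
have g0 t : 0 <= g t by rewrite le_max lexx.
have gE t : 0 <= t -> g t = approx_energy k (v t).
  by move=> t0; rewrite /g max_r// approx_energy_ge0.
rewrite (_ : (\int[mu]_(t in _) _)%E = (\int[mu]_(t in `[0%R, +oo[) (g t)%:E)%E); last first.
  by apply: eq_integral => t; rewrite inE/= in_itv/= andbT => t0; rewrite gE.
rewrite muleC -lee_pdivlMr// ge0_integral_ereal_sup//.
apply: ge_ereal_sup => _ [n _ <-]; rewrite lee_pdivlMr//.
rewrite -integral_itv_obnd_cbnd; last by apply: measurable_funTS; exact/measurable_EFinP.
have ig := integrable_approx k (ler0n R n.+1).
rewrite (_ : (\int[mu]_(t in _) _)%E =
    (\int[mu]_(t in `]0%R, n.+1%:R]) approx_energy k (v t))%:E); last first.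
  rewrite /Rintegral fineK ?integrable_fin_num//.
  by apply: eq_integral => t; rewrite inE/= in_itv/= => /andP[/ltW t0 _]; rewrite gE.
rewrite -EFinM; apply: (@le_trans _ _ (pmass 0)%:E); last by rewrite (pmassE (lexx 0)) pmass_le.
rewrite lee_fin.
have hN := time_differences_le measurable_pmass pmass_ge0 pmass_ni dk (ler0n R n.+1).
have : \int[mu]_(t in `]0, n.+1%:R]) (2 * dyad k * cp * approx_energy k (v t)) <= dyad k * pmass 0.
  apply: le_trans hN; apply: le_Rintegral => //.
  - exact: integrableZR.
  - exact: (integrable_differences measurable_pmass pmass_ge0 pmass_ni dk (ler0n R n.+1)).
  - move=> t /=; rewrite in_itv/= => /andP[/ltW t0 _]; exact: approx_energy_le_pmass.
rewrite RintegralZl// (_ : 2 * dyad k * cp * _ = dyad k * (Rintegral mu `]0, n.+1%:R] (fun t => approx_energy k (v t)) * (2 * cp))); last by ring.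
by rewrite ler_pM2l.
Qed.

Let ev_fin t : 0 <= t -> (\int[m]_x ((v t x) ^+ 2)%:E < +oo)%E.
Proof.
by move=> t0; rewrite integral_sqr_pow_half (le_lt_trans (pmass_le t0)).
Qed.

Let en_mono t : 0 <= t -> {homo (fun k => approx_energy k (v t)) : k l / (k <= l)%N >-> k <= l}.
Proof.
move=> t0; apply/nondecreasing_seqP => k.
by have [h _] := H_form (measurable_pow_half t) (ev_fin t0); exact: h.
Qed.

Lemma measurable_jump_energy : measurable_fun setT (fun t => jump_energy (v t)).
Proof.
apply: (@measurable_fun_fubini_tonelli_F _ _ _ _ _ m (fun z : R * T => (\int[Jk z.2]_y ((v z.1 y - v z.1 z.2) ^+ 2)%:E)%E)); last first.
  by move=> z; apply: integral_ge0 => y _; rewrite lee_fin sqr_ge0.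
apply: (measurable_fun_integral_sfinite_kernel
  (fun z : (R * T) * T => ((v z.1.1 z.2 - v z.1.1 z.1.2) ^+ 2)%:E)
  (kprecomp Jk (measurable_snd : measurable_fun setT (@snd R T)))).
  by move=> z; rewrite lee_fin sqr_ge0.
apply/measurable_EFinP/measurable_funX/measurable_funB.
- have mpsi : measurable_fun setT (fun z : (R * T) * T => (z.1.1, z.2)).
    by apply: measurable_fun_pair => //; exact: measurableT_comp.
  exact: (measurableT_comp measurable_pow_half_joint mpsi).
- exact: (measurableT_comp measurable_pow_half_joint measurable_fst).
Qed.

(** Monotone convergence in [k]. The uniform bound makes the pointwise limit finite for almost every
    [t]; at such a [t] it bounds the whole sequence, so [H_form] identifies it with half the jump
    energy. *)
Lemma time_jump_energy_lim :
  (\int[mu]_(t in `[0%R, +oo[) (approx_energy k (v t))%:E @[k --> \oo] -->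
   2^-1%:E * \int[mu]_(t in `[0%R, +oo[) jump_energy (v t))%E.
Proof.
have hp := p1; have c0 : 0 < 2 * cp by rewrite /cp; case: (leP 1 (p - 1)) => ?; lra.
pose DD : set (measurableTypeR R) := [set` `[0%R, +oo[].
have mDD : measurable DD by exact: measurable_itv.
have D0 (t : R) : DD t -> 0 <= t by rewrite /DD/= in_itv/= andbT.
pose en k t := (approx_energy k (v t))%:E.
have men k : measurable_fun DD (en k).
  by apply: measurable_funTS; apply/measurable_EFinP; exact: measurable_approx_energy.
have en0 k t : DD t -> (0 <= en k t)%E.
  by move=> /D0 t0; rewrite lee_fin approx_energy_ge0.
have nden t : DD t -> nondecreasing_seq (en ^~ t).
  by move=> /D0 t0 k l kl; rewrite lee_fin en_mono.
have cv := @cvg_monotone_convergence _ _ _ mu _ mDD en men en0 nden.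
pose E t := limn (en ^~ t).
have mE : measurable_fun DD E.
  apply: (emeasurable_fun_cvg en) => // t Dt.
  by apply: ereal_nondecreasing_is_cvgn; exact: nden.
have E0 t : DD t -> (0 <= E t)%E.
  move=> Dt; apply: lime_ge; first by apply: ereal_nondecreasing_is_cvgn; exact: nden.
  by apply: nearW => k; exact: en0.
have Efin : (\int[mu]_(t in DD) E t < +oo)%E.
  apply: (@le_lt_trans _ _ (A0 * ((2 * cp)^-1)%:E)%E); last first.
    by rewrite lte_mul_pinfty ?ltry// ge0_fin_numE.
  rewrite -(cvg_lim _ cv)//; apply: lime_le; first by apply/cvg_ex; eexists; exact: cv.
  by apply: nearW => k; rewrite lee_pdivlMr// muleC time_approx_energy_le.
have Eint : mu.-integrable DD E.
  apply/integrableP; split => //; rewrite (_ : (\int[mu]_(t in _) _)%E = (\int[mu]_(t in DD) E t)%E)//.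
  by apply: eq_integral => t /set_mem Dt; rewrite gee0_abs// E0.
suff <- : (\int[mu]_(t in DD) E t = 2^-1%:E * \int[mu]_(t in DD) jump_energy (v t))%E by [].
have mj : measurable_fun DD (fun t => jump_energy (v t)).
  by apply: measurable_funTS; exact: measurable_jump_energy.
have j0 t : (0 <= jump_energy (v t))%E.
  by apply: integral_ge0 => x _; apply: integral_ge0 => y _; rewrite lee_fin sqr_ge0.
rewrite -ge0_integralZl_EFin//.
apply: ae_eq_integral => //; first exact: measurable_funeM.
apply: filterS (integrable_ae mDD Eint) => t + Dt => /(_ Dt) Et.
have t0 := D0 _ Dt.
have [_ h] := H_form (measurable_pow_half t) (ev_fin t0).
apply/cvg_lim => //; apply: (h (fine (E t))) => k; rewrite -lee_fin fineK//.
by apply: (ereal_nondecreasing_le_cvg k (nden t Dt)); apply: ereal_nondecreasing_is_cvgn; exact: nden.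
Qed.

Lemma time_jump_energy_le :
  (cp%:E * \int[mu]_(t in `[0%R, +oo[) jump_energy (v t) <= A0)%E.
Proof.
have hp := p1; have c0 : 0 < 2 * cp by rewrite /cp; case: (leP 1 (p - 1)) => ?; lra.
have -> : (cp%:E = (2 * cp)%:E * 2^-1%:E)%E by rewrite -EFinM; congr EFin; field.
rewrite -muleA muleC -lee_pdivlMr//.
apply: (cvge_le _ time_jump_energy_lim) => //; apply: nearW => k.
by rewrite lee_pdivlMr// muleC time_approx_energy_le.
Qed.

(** By monotonicity the approximate energy of this very [k] lies below its limit. The mass is taken
    at time [dyad k], as in [time_differences_ge]. *)
Lemma pmass_le_jump_energy k (N : nat) : 2 <= p ->
  ((pmass (dyad k) - pmass N%:R)%:E <=
    (2 * p)%:E * \int[mu]_(t in `[0%R, +oo[) jump_energy (v t))%E.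
Proof.
move=> p2; have dk := dyad_gt0 k.
have h1 := time_differences_ge measurable_pmass pmass_ge0 pmass_ni dk (ler0n R N).
have ig := integrable_approx k (ler0n R N).
have h2 : \int[mu]_(t in `]0, N%:R]) (pmass t - pmass (t + dyad k)) <=
    \int[mu]_(t in `]0, N%:R]) (4 * p * dyad k * approx_energy k (v t)).
  apply: le_Rintegral => //.
  - exact: (integrable_differences measurable_pmass pmass_ge0 pmass_ni dk (ler0n R N)).
  - exact: integrableZR.
  - move=> t /=; rewrite in_itv/= => /andP[/ltW t0 _].
    apply: (le_trans (pmass_le_approx_energy k p2 t0)).
    by rewrite (_ : 2 * p * (2 * dyad k * _) = 4 * p * dyad k * approx_energy k (v t))//; ring.
have {h1 h2} := le_trans h1 h2; rewrite RintegralZl//.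
rewrite (_ : 4 * p * dyad k * _ = dyad k * (4 * p *
  Rintegral mu `]0, N%:R] (fun t => approx_energy k (v t)))); last by ring.
rewrite ler_pM2l// -lee_fin => h; apply: (le_trans h).
have -> : ((2 * p)%:E = (4 * p)%:E * 2^-1%:E)%E by rewrite -EFinM; congr EFin; field.
rewrite -muleA EFinM lee_pmul2l ?lte_fin//; last lra.
pose DD : set (measurableTypeR R) := [set` `[0%R, +oo[].
have mDD : measurable DD by exact: measurable_itv.
have D0 (t : R) : DD t -> 0 <= t by rewrite /DD/= in_itv/= andbT.
apply: (@le_trans _ _ (\int[mu]_(t in `[0%R, +oo[) (approx_energy k (v t))%:E)%E).
  rewrite /Rintegral fineK ?integrable_fin_num//.
  apply: ge0_subset_integral => //.
  - by apply: measurable_funTS; apply/measurable_EFinP; exact: measurable_approx_energy.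
  - by move=> t /D0 t0; rewrite lee_fin approx_energy_ge0.
  - by move=> t /=; rewrite !in_itv/= andbT => /andP[/ltW].
apply: (ereal_nondecreasing_le_cvg k _ time_jump_energy_lim).
move=> i j ij; apply: (@ge0_le_integral _ _ _ mu DD mDD).
- by move=> t /D0 t0; rewrite lee_fin approx_energy_ge0.
- by apply: measurable_funTS; apply/measurable_EFinP; exact: measurable_approx_energy.
- by apply: measurable_funTS; apply/measurable_EFinP; exact: measurable_approx_energy.
- by move=> t /D0 t0; rewrite lee_fin en_mono.
Qed.

End hardy_stein.

(** * The maximal function of the semigroup *)

Lemma maximal_const_ge0 (R : realType) (p : R) : 1 < p -> 0 <= maximal_const p.
Proof.
move=> p1; have hp := p1; rewrite /maximal_const !mulr_ge0 ?powR_ge0//.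
all: by rewrite ?invr_ge0; lra.
Qed.

Lemma le_limn_einf (R : realType) (u : nat -> \bar R) (c : \bar R) n0 :
  (forall k, (n0 <= k)%N -> (c <= u k)%E) -> (c <= limn_einf u)%E.
Proof.
move=> h; rewrite limn_einf_lim; apply: lime_ge; first exact: is_cvg_einfs.
exists n0 => // n /= n0n; apply/ereal_infP => _ [k /= nk <-].
by apply: h; exact: leq_trans nk.
Qed.

(** If [g <= c], the positive part of [h - c] is at most [|h - g|], so the integral of its square
    lies below every [e]. *)
Lemma ae_le_of_L2_limit d (T : measurableType d) (R : realType)
    (m : {measure set T -> \bar R}) (h c : T -> R) :
  measurable_fun setT h -> measurable_fun setT c ->
  (forall e : R, 0 < e -> exists g : T -> R, [/\ measurable_fun setT g,
     {ae m, forall x, g x <= c x} & (\int[m]_x ((g x - h x) ^+ 2)%:E <= e%:E)%E]) ->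
  {ae m, forall x, h x <= c x}.
Proof.
move=> mh mc H; pose w x := Num.max 0 (h x - c x).
have mw : measurable_fun setT w.
  by apply: measurable_maxr => //; exact: measurable_funB.
have w2 : (\int[m]_x ((w x) ^+ 2)%:E = 0)%E.
  apply/eqP; rewrite eq_le; apply/andP; split; last first.
    by apply: integral_ge0 => x _; rewrite lee_fin sqr_ge0.
  apply/lee_addgt0Pr => e e0; rewrite add0e; have [g [mg gc ge]] := H e e0.
  apply: le_trans ge; apply: ae_ge0_le_integral => //.
  - by move=> x _; rewrite lee_fin sqr_ge0.
  - by apply/measurable_EFinP; exact: measurable_funX.
  - by move=> x _; rewrite lee_fin sqr_ge0.
  - by apply/measurable_EFinP; apply: measurable_funX; exact: measurable_funB.
  apply: filterS gc => x gcx _; rewrite lee_fin -[leRHS]sqrrN opprB.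
  have wx : 0 <= w x <= Num.max 0 (h x - g x).
    rewrite le_max lexx/= /w; case: (leP 0 (h x - c x)) => hc; last by rewrite le_max lexx.
    by rewrite le_max; apply/orP; right; lra.
  rewrite -[leRHS]real_normK ?num_real//; rewrite !expr2.
  have [w0 w1] := andP wx; have hn : Num.max 0 (h x - g x) <= `|h x - g x|.
    by rewrite ge_max normr_ge0 ler_norm.
  by apply: ler_pM => //; exact: le_trans hn.
have mw2 : measurable_fun setT (fun x => ((w x) ^+ 2)%:E).
  by apply/measurable_EFinP; exact: measurable_funX.
have : ae_eq m setT (fun x => ((w x) ^+ 2)%:E) (cst 0%E).
  apply/ae_eq_integral_abs => //; rewrite -[RHS]w2; apply: eq_integral => x _.
  by rewrite gee0_abs// lee_fin sqr_ge0.
apply: filterS => x /(_ I) /= [/eqP]; rewrite sqrf_eq0 /w => /eqP wx.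
by rewrite -subr_le0 -wx le_max lexx orbT.
Qed.

Section maximal_function.
Context d (T : measurableType d) (R : realType).
Variables (m : {sigma_finite_measure set T -> \bar R}) (K : R.-sfker (R * T) ~> T).
Hypothesis K1 : forall z, (K z setT <= 1)%E.
Hypothesis K_semi : forall (s t : R) x (g : T -> \bar R), 0 <= s -> 0 <= t ->
  measurable_fun setT g -> (forall y, 0 <= g y)%E ->
  (\int[K ((s + t)%R, x)]_y g y = \int[K (s, x)]_y \int[K (t, y)]_z g z)%E.
Hypothesis K_sym : forall (t : R) (f g : T -> \bar R), 0 <= t ->
  measurable_fun setT f -> (forall y, 0 <= f y)%E ->
  measurable_fun setT g -> (forall y, 0 <= g y)%E ->
  (\int[m]_x (f x * \int[K (t, x)]_y g y) = \int[m]_x (g x * \int[K (t, x)]_y f y))%E.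
Hypothesis K_cont : forall g : T -> R, measurable_fun setT g ->
  (\int[m]_x ((g x) ^+ 2)%:E < +oo)%E -> forall e : R, 0 < e -> exists2 dl : R,
  0 < dl & forall t, 0 <= t -> t <= dl ->
    (\int[m]_x ((ksem K t g x - g x) ^+ 2)%:E <= e%:E)%E.

Variables (p : R) (f : T -> R).
Hypothesis p1 : 1 < p.
Hypothesis mf : measurable_fun setT f.
Hypothesis fp : (\int[m]_x (`|f x| `^ p)%:E < +oo)%E.

Variable B : nat -> set T.
Hypothesis mB : forall n, measurable (B n).
Hypothesis B_fin : forall n, (m (B n) < +oo)%E.
Hypothesis B_mono : forall n k, (n <= k)%N -> B n `<=` B k.
Hypothesis B_cover : \bigcup_n B n = setT.

(** Bounded and integrable, as [kernel_maximal] requires, and at each point equal to [|f|] from some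
    [n] on. *)
Definition trunc (n : nat) (x : T) : R := Num.min `|f x| n%:R * \1_(B n) x.

Let bmeas_indic n : bmeas (\1_(B n) : T -> R).
Proof.
split; [exact: measurable_indic|by []|exists 1 => x].
by rewrite indicE; case: (x \in B n).
Qed.

Let bmeas_min n : bmeas (fun x => Num.min `|f x| n%:R : R).
Proof.
split; last by exists n%:R => x; rewrite ge_min lexx orbT.
- by apply: measurable_minr => //; exact: measurableT_comp.
- by move=> x; rewrite le_min normr_ge0 ler0n.
Qed.

Let bmeas_lty u t x : bmeas u -> (\int[K (t, x)]_y (u y)%:E < +oo)%E.
Proof.
move=> bu; have [_ u0 _] := bu.
have /integrableP[_] := bmeas_integrable (Q := kslice K t) (fun y => K1 (t, y)) x bu.
by rewrite (eq_integral (fun y => (u y)%:E))// => y _; rewrite /= ger0_norm.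
Qed.

Lemma trunc_bmeas n : bmeas (trunc n).
Proof. exact: bmeasM. Qed.

Lemma trunc_le n x : trunc n x <= `|f x|.
Proof.
rewrite /trunc indicE; case: (x \in B n); rewrite ?mulr0// mulr1.
by rewrite ge_min lexx.
Qed.

Lemma trunc_mono n k x : (n <= k)%N -> trunc n x <= trunc k x.
Proof.
move=> nk; rewrite /trunc !indicE.
have [[_ h _] [_ h' _]] := (bmeas_min n, bmeas_min k).
have [xB|] := boolP (x \in B n).
  rewrite (mem_set (B_mono nk (set_mem xB))) !mulr1 le_min ge_min lexx/=.
  by rewrite ge_min ler_nat nk orbT.
by move=> _; rewrite mulr0 mulr_ge0.
Qed.

Lemma trunc_integrable n : (\int[m]_x (trunc n x)%:E < +oo)%E.
Proof.
apply: (@le_lt_trans _ _ (\int[m]_x (n%:R * \1_(B n) x)%:E)%E).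
  apply: ge0_le_integral => //.
  - by move=> x _; rewrite lee_fin; have [_ + _] := trunc_bmeas n; exact.
  - by apply/measurable_EFinP; have [] := trunc_bmeas n.
  - by apply/measurable_EFinP; apply: measurable_funM => //; exact: measurable_indic.
  - by move=> x _; rewrite lee_fin; apply: ler_wpM2r; [rewrite indicE ler0n|rewrite ge_min lexx orbT].
under eq_integral do rewrite EFinM.
rewrite ge0_integralZl_EFin//; last exact/measurable_EFinP/measurable_indic.
by rewrite integral_indic// setIT; apply: lte_mul_pinfty => //; exact: B_fin.
Qed.

Lemma trunc_sqr n : (\int[m]_x ((trunc n x) ^+ 2)%:E < +oo)%E.
Proof.
have [mt t0 _] := trunc_bmeas n.
apply: (@le_lt_trans _ _ (n%:R%:E * \int[m]_x (trunc n x)%:E)%E); last first.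
  rewrite lte_mul_pinfty ?lee_fin// ?trunc_integrable// ge0_fin_numE ?trunc_integrable//.
rewrite -ge0_integralZl_EFin//; last first.
- exact/measurable_EFinP.
- by move=> x _; rewrite lee_fin.
apply: ge0_le_integral => //.
- by move=> x _; rewrite lee_fin sqr_ge0.
- by apply/measurable_EFinP; exact: measurable_funX.
- by apply/measurable_EFinP; exact: measurable_funM.
move=> x _; rewrite lee_fin expr2 ler_wpM2r//.
rewrite /trunc indicE; case: (x \in B n); rewrite ?mulr0// mulr1.
by rewrite ge_min lexx orbT.
Qed.

Lemma trunc_cvg x : exists n, forall k, (n <= k)%N -> trunc k x = `|f x|.
Proof.
have [N _ xN] : (\bigcup_n B n) x by rewrite B_cover.
exists (maxn N (Num.truncn `|f x|).+1) => k; rewrite geq_max => /andP[Nk fk].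
rewrite /trunc indicE (mem_set (B_mono Nk xN)) mulr1 min_l//.
by rewrite ltW// (lt_le_trans (truncnS_gt _))// ler_nat.
Qed.

(** Iterating the step [dyad n] exactly [j + j] times reaches the time [j / 2^n]. With [j <= 4^n]
    these times have mesh [2^-n] and run up to [2^n], so each positive dyadic time is among them for
    all large [n]. *)
Definition dyadic_max (n : nat) (x : T) : R :=
  maxs (fun j => iter (j + j) (kop (kslice K (dyad R n))) (trunc n)) (4 ^ n).+1 x.

Lemma dyadic_max_bmeas n : bmeas (dyadic_max n).
Proof.
apply: bmeas_maxs => j; apply: iter_bmeas; last exact: trunc_bmeas.
by move=> g; apply: kop_bmeas => x; exact: K1.
Qed.

Lemma dyadic_max_ge n0 l i n x : (0 < i)%N -> (n0 <= n)%N -> (l <= n)%N -> (i <= 2 ^ n)%N ->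
  ksem K (i%:R / 2 ^+ l) (trunc n0) x <= dyadic_max n x.
Proof.
move=> i0 n0n ln i2.
(* With [j = i * 2^(n - l)] the time [j / 2^n] is [i / 2^l]. *)
have jn : (i * 2 ^ (n - l) < (4 ^ n).+1)%N.
  rewrite ltnS (_ : 4 ^ n = 2 ^ n * 2 ^ n)%N; last by rewrite -expnMn.
  by rewrite leq_mul// leq_pexp2l// leq_subr.
apply: le_trans (le_maxs _ _ jn).
have tt := trunc_bmeas.
rewrite (iter_ksem K1 K_semi) ?(ltW (dyad_gt0 _ _))//.
have -> : (i * 2 ^ (n - l) + i * 2 ^ (n - l))%N = (i * 2 ^ (n - l) * 2).-1.+1.
  by rewrite prednK ?muln2 ?addnn// double_gt0 muln_gt0 i0 expn_gt0.
rewrite prednK ?muln2; last by rewrite double_gt0 muln_gt0 i0 expn_gt0.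
have -> : dyad R n *+ (i * 2 ^ (n - l)).*2 = i%:R / 2 ^+ l.
  have [k ->] : exists k, n = (l + k)%N by exists (n - l)%N; rewrite subnKC.
  have e : (i * 2 ^ k).*2%:R = i%:R * 2 ^+ k * 2 :> R by rewrite -muln2 !natrM natrX.
  rewrite (addKn l k) -[LHS]mulr_natr e /dyad exprVn exprS exprD.
  by field; rewrite !expf_neq0.
by apply: (@kop_le _ _ _ (kslice K _)) => // [y|y]; [exact: K1|exact: trunc_mono].
Qed.

(** With a lower limit Fatou's lemma applies, and every quantity that is dominated for all large [n]
    stays dominated. *)
Let M (x : T) : \bar R := limn_einf (fun n => (dyadic_max n x `^ p)%:E).
(** Where the lower limit is infinite, [fine] yields [0]; this happens on an [m]-null set only. *)
Definition star (x : T) : R := fine (M x) `^ p^-1.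

Let p0 : 0 < p. Proof. by have hp := p1; lra. Qed.

Let mpow n : measurable_fun setT (fun x => (dyadic_max n x `^ p)%:E).
Proof.
have [mm m0 _] := dyadic_max_bmeas n.
by apply/measurable_EFinP; exact: (measurableT_comp (measurable_powR p) mm).
Qed.

Let mM : measurable_fun setT M.
Proof.
have -> : M = (fun x => - limn_esup (fun n => - (dyadic_max n x `^ p)%:E))%E.
  apply/funext => x; rewrite -limn_einfN /M; congr limn_einf.
  by apply/funext => n; rewrite /comp oppeK.
apply: measurableT_comp => //; apply: measurable_fun_limn_esup => n.
by apply: measurableT_comp.
Qed.

Let M0 x : (0 <= M x)%E.
Proof. by apply: (@le_limn_einf _ _ _ 0%N) => k _; rewrite lee_fin powR_ge0. Qed.

Let M_le : (\int[m]_x M x <= (maximal_const p)%:E * \int[m]_x (`|f x| `^ p)%:E)%E.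
Proof.
apply: le_trans (fatou _ _ _ _) _ => //; first by move=> n x _; rewrite lee_fin powR_ge0.
rewrite limn_einf_lim; apply: lime_le; first exact: is_cvg_einfs.
apply: nearW => n; apply: (@le_trans _ _ (\int[m]_x (dyadic_max n x `^ p)%:E)%E).
  by apply: ereal_inf_lbound; exists n => /=.
have Q1 x : (kslice K (dyad R n) x setT <= 1)%E by exact: K1.
apply: le_trans (@kernel_maximal _ _ _ _ m Q1 _ _ _ _ p1 (trunc_bmeas n) (trunc_integrable n)) _.
  move=> g h bg bh; have dk := ltW (dyad_gt0 R n).
  have [[mg g0 _] [mh h0 _]] := (bg, bh).
  have e u : bmeas u -> forall x, (kop (kslice K (dyad R n)) u x)%:E = (\int[K (dyad R n, x)]_y (u y)%:E)%E.
    by move=> bu x; have [_ u0 _] := bu; rewrite /kop fin_Rintegral//; exact: bmeas_lty.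
  under eq_integral do rewrite EFinM e//; rewrite K_sym//.
  - by apply: eq_integral => x _; rewrite EFinM e.
  - exact/measurable_EFinP.
  - exact/measurable_EFinP.
have [mt t0 _] := trunc_bmeas n.
apply: lee_wpmul2l; first by rewrite lee_fin maximal_const_ge0.
apply: ge0_le_integral => //.
- by move=> x _; rewrite lee_fin powR_ge0.
- by apply/measurable_EFinP; exact: (measurableT_comp (measurable_powR p) mt).
- by apply/measurable_EFinP/measurable_norm_powR.
- by move=> x _; rewrite lee_fin ge0_ler_powR ?nnegrE ?(ltW p0) ?trunc_le.
Qed.

Let M_fin : {ae m, forall x, M x \is a fin_num}.
Proof.
apply: (ge0_integral_ltyae mM M0); apply: le_lt_trans M_le _.
by rewrite lte_mul_pinfty// lee_fin maximal_const_ge0.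
Qed.

Lemma measurable_star : measurable_fun setT star.
Proof.
apply: (measurableT_comp (measurable_powR _)).
by apply: (measurableT_comp (@fine_measurable R setT measurableT)); exact: mM.
Qed.

Lemma star_ge0 x : 0 <= star x. Proof. exact: powR_ge0. Qed.

Lemma star_integral_le : (\int[m]_x (star x `^ p)%:E <=
  (maximal_const p)%:E * \int[m]_x (`|f x| `^ p)%:E)%E.
Proof.
apply: le_trans M_le; apply: ge0_le_integral; [by []| | |exact: mM|].
- by move=> x _; rewrite lee_fin powR_ge0.
- by apply/measurable_EFinP; exact: (measurableT_comp (measurable_powR p) measurable_star).
move=> x _; rewrite /star -powRrM mulVf ?gt_eqF// powRr1; last exact: fine_ge0.
by case: (M x) (M0 x) => [r|_|] //=; rewrite leey.
Qed.

Let dyadic_le_star : {ae m, forall x, forall n0 l i, (0 < i)%N ->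
  ksem K (i%:R / 2 ^+ l) (trunc n0) x <= star x}.
Proof.
apply: filterS M_fin => x Mx n0 l i i0.
have k0 : 0 <= ksem K (i%:R / 2 ^+ l) (trunc n0) x.
  by have [_ + _] := ksem_bmeas K1 (i%:R / 2 ^+ l) (trunc_bmeas n0); exact.
rewrite (_ : ksem _ _ _ _ = (ksem K (i%:R / 2 ^+ l) (trunc n0) x `^ p) `^ p^-1); last first.
  by rewrite -powRrM mulfV ?lt0r_neq0// powRr1.
apply: ge0_ler_powR; rewrite ?nnegrE ?invr_ge0 ?(ltW p0) ?powR_ge0//; first exact: fine_ge0.
rewrite -lee_fin fineK//; apply: (@le_limn_einf _ _ _ (maxn n0 (maxn l i))) => n.
rewrite !geq_max => /and3P[n0n ln i_n]; rewrite lee_fin.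
have i2 : (i <= 2 ^ n)%N by rewrite (leq_trans i_n)// ltnW// ltn_expl.
apply: ge0_ler_powR; rewrite ?nnegrE ?(ltW p0)//.
  by have [_ + _] := dyadic_max_bmeas n; exact.
exact: dyadic_max_ge.
Qed.

Lemma dyadic_above (t dl : R) : 0 <= t -> 0 < dl ->
  exists l i, (0 < i)%N /\ t <= i%:R / 2 ^+ l /\ i%:R / 2 ^+ l <= t + dl.
Proof.
move=> t0 dl0; pose l := (Num.truncn dl^-1).+1.
have h : (2 ^+ l)^-1 <= dl.
  rewrite -[dl]invrK lef_pV2 ?posrE ?exprn_gt0 ?invr_gt0//.
  rewrite ltW// (lt_le_trans (truncnS_gt _))// -natrX ler_nat ltnW// ltn_expl//.
exists l, (Num.truncn (t * 2 ^+ l)).+1; split => //.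
have t2 : 0 <= t * 2 ^+ l by rewrite mulr_ge0// exprn_ge0.
have /andP[h1 h2] := truncn_itv t2.
rewrite ler_pdivlMr ?exprn_gt0// ltW//; split => //.
rewrite ler_pdivrMr ?exprn_gt0// -natr1 mulrDl lerD//.
by rewrite -ler_pdivrMr ?exprn_gt0// mul1r.
Qed.

(** Approximation by dyadic times [s >= t]: the difference of the values at [s] and [t] is [P_t]
    applied to [P_(s-t) g - g], small in L^2 by contraction and strong continuity. The bound at [s]
    passes to [t] by [ae_le_of_L2_limit]. *)
Lemma ksem_trunc_le_star n0 (t : R) : 0 <= t ->
  {ae m, forall x, ksem K t (trunc n0) x <= star x}.
Proof.
move=> t0; have bt := trunc_bmeas n0; have [mt tr0 _] := bt.
apply: ae_le_of_L2_limit; [exact: measurable_ksem|exact: measurable_star|move=> e e0].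
have [dl dl0 h] := K_cont mt (trunc_sqr n0) e0.
have [l [i [i0 [ti it]]]] := dyadic_above t0 dl0; set s := _ / _ in ti it.
exists (ksem K s (trunc n0)); split; first exact: measurable_ksem.
  by apply: filterS dyadic_le_star => x; exact.
have st0 : 0 <= s - t by rewrite subr_ge0.
have std : s - t <= dl by rewrite lerBlDl.
apply: le_trans (h _ st0 std).
pose w y := ksem K (s - t) (trunc n0) y - trunc n0 y.
have mw : measurable_fun setT w by apply: measurable_funB => //; exact: measurable_ksem.
have := ksem_contraction K1 K_sym (ltr1n _ 2 : 1 < 2) t0 mw.
rewrite [X in _ -> (X <= _)%E](eq_integral (fun x => (`|ksem K t w x| `^ 2)%:E)); last first.
  move=> x _; rewrite powR_mulrn// real_normK ?num_real//; congr ((_ ^+ 2)%:E).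
  have -> : ksem K s (trunc n0) x = ksem K t (ksem K (s - t) (trunc n0)) x.
    by rewrite -(ksem_bmeas_semigroup K1 K_semi)// subrKC.
  rewrite /ksem RintegralB//.
  - apply: (bmeas_integrable (Q := kslice K t)); first by move=> y; exact: K1.
    exact: ksem_bmeas.
  - by apply: (bmeas_integrable (Q := kslice K t)) => // y; exact: K1.
move/le_trans; apply; rewrite le_eqVlt; apply/orP; left; apply/eqP.
by apply: eq_integral => x _; rewrite powR_mulrn// real_normK ?num_real.
Qed.

(** Monotone convergence in the truncation level. The exceptional null set still depends on [t]. *)
Lemma kernel_le_star (t : R) : 0 <= t ->
  {ae m, forall x, (\int[K (t, x)]_y (`|f y|)%:E <= (star x)%:E)%E}.
Proof.
move=> t0.
have : {ae m, forall x n0, ksem K t (trunc n0) x <= star x}.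
  by apply/ae_foralln => n0; exact: ksem_trunc_le_star.
apply: filterS => x h.
have cv := @cvg_monotone_convergence _ _ _ (K (t, x)) setT measurableT
  (fun n y => (trunc n y)%:E)
  (fun n => let: And3 mt _ _ := trunc_bmeas n in (iffRL (measurable_EFinP _ _) mt))
  (fun n y _ => let: And3 _ h _ := trunc_bmeas n in h y) _.
rewrite (eq_integral (fun y => limn (fun n => (trunc n y)%:E))); last first.
  move=> y _; apply/esym/cvg_lim => //; have [n hn] := trunc_cvg y.
  by apply: cvg_near_cst; exists n => // k /= nk; rewrite hn.
apply: (cvge_le _ (cv _)) => //; last by move=> y _ n k nk; rewrite lee_fin trunc_mono.
apply: nearW => n; have [_ tr0 _] := trunc_bmeas n.
by rewrite -fin_Rintegral ?lee_fin//; [exact: h|exact/bmeas_lty/trunc_bmeas].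
Qed.

End maximal_function.

Lemma maximal_function d (T : measurableType d) (R : realType)
    (m : {sigma_finite_measure set T -> \bar R}) (K : R.-sfker (R * T) ~> T) :
  (forall z, (K z setT <= 1)%E) ->
  (forall (s t : R) x (g : T -> \bar R), 0 <= s -> 0 <= t ->
    measurable_fun setT g -> (forall y, 0 <= g y)%E ->
    (\int[K ((s + t)%R, x)]_y g y = \int[K (s, x)]_y \int[K (t, y)]_z g z)%E) ->
  (forall (t : R) (f g : T -> \bar R), 0 <= t ->
    measurable_fun setT f -> (forall y, 0 <= f y)%E ->
    measurable_fun setT g -> (forall y, 0 <= g y)%E ->
    (\int[m]_x (f x * \int[K (t, x)]_y g y) = \int[m]_x (g x * \int[K (t, x)]_y f y))%E) ->
  (forall g : T -> R, measurable_fun setT g ->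
    (\int[m]_x ((g x) ^+ 2)%:E < +oo)%E -> forall e : R, 0 < e -> exists2 dl : R,
    0 < dl & forall t, 0 <= t -> t <= dl ->
      (\int[m]_x ((ksem K t g x - g x) ^+ 2)%:E <= e%:E)%E) ->
  forall (p : R) (f : T -> R), 1 < p -> measurable_fun setT f ->
  (\int[m]_x (`|f x| `^ p)%:E < +oo)%E ->
  exists fs : T -> R, [/\ measurable_fun setT fs, forall x, 0 <= fs x,
    (\int[m]_x (fs x `^ p)%:E <= (maximal_const p)%:E * \int[m]_x (`|f x| `^ p)%:E)%E &
    forall t, 0 <= t ->
      {ae m, forall x, (\int[K (t, x)]_y (`|f y|)%:E <= (fs x)%:E)%E}].
Proof.
move=> K1 Ks Ky Kc p f p1 mf fp.
have /sigma_finiteP [B [Bc Bm Bf]] := @sigma_finiteT _ _ _ m.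
have Bm' n k : (n <= k)%N -> B n `<=` B k by move=> nk; exact/subsetPset/Bm.
have mB n : measurable (B n) by case: (Bf n).
have mB' n : (m (B n) < +oo)%E by case: (Bf n).
exists (star K p f B); split.
- exact: (@measurable_star _ _ _ K K1 p f mf B mB).
- by move=> x; exact: star_ge0.
- exact: (star_integral_le K1 Ky p1 mf mB mB').
- exact: (@kernel_le_star _ _ _ m K K1 Ks Ky Kc p f p1 mf fp B mB mB' Bm' (esym Bc)).
Qed.

(** * Bounds for the square function *)

Lemma ge0_integral0_ae d (T : measurableType d) (R : realType)
    (mu : {measure set T -> \bar R}) (g : T -> \bar R) :
  measurable_fun setT g -> (forall x, 0 <= g x)%E -> (\int[mu]_x g x = 0)%E ->
  {ae mu, forall x, g x = 0%E}.
Proof.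
move=> mg g0 h; have : ae_eq mu setT g (cst 0%E).
  apply/ae_eq_integral_abs => //; rewrite -[RHS]h; apply: eq_integral => x _.
  by rewrite gee0_abs.
by apply: filterS => x; exact.
Qed.

(** Tonelli for null sets: exceptional points at each time become exceptional times at almost every
    point. Hence it suffices to have the maximal bound at each fixed time. *)
Lemma ae_swap d1 d2 (T1 : measurableType d1) (T2 : measurableType d2) (R : realType)
    (m1 : {sigma_finite_measure set T1 -> \bar R})
    (m2 : {sigma_finite_measure set T2 -> \bar R}) (S : set (T1 * T2)) :
  measurable S -> (forall t, {ae m2, forall x, ~ S (t, x)}) ->
  {ae m2, forall x, {ae m1, forall t, ~ S (t, x)}}.
Proof.
move=> mS h; pose F (z : T1 * T2) : \bar R := (\1_S z)%:E.
have mF : measurable_fun setT F by apply/measurable_EFinP; exact: measurable_indic.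
have F0 z : (0 <= F z)%E by rewrite lee_fin indicE ler0n.
have F0' z : F z = 0%E -> ~ S z.
  by move=> [] + Sz; rewrite indicE mem_set// => /eqP; rewrite oner_eq0.
have h0 : (\int[m2]_x \int[m1]_t F (t, x) = 0)%E.
  rewrite -fubini_tonelli//; apply: integral0_eq => t _.
  have mFt : measurable_fun setT (fun x => F (t, x)) by exact: measurableT_comp.
  transitivity (\int[m2]_x (cst 0%E x))%E; last by rewrite integral0.
  apply: ae_eq_integral => //; apply: filterS (h t) => x nS _.
  by rewrite /F indicE memNset.
have mG := @measurable_fun_fubini_tonelli_G _ _ _ _ _ m1 _ mF F0.
have G0 x : (0 <= \int[m1]_t F (t, x))%E by exact: integral_ge0.
apply: filterS (ge0_integral0_ae mG G0 h0) => x hx.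
have mFx : measurable_fun setT (fun t => F (t, x)) by exact: measurableT_comp.
by apply: filterS (ge0_integral0_ae mFx (fun t => F0 _) hx) => t; exact: F0'.
Qed.

Lemma half_line_tonelli d (T : measurableType d) (R : realType)
    (m : {sigma_finite_measure set T -> \bar R}) (F : R * T -> \bar R) :
  measurable_fun setT F -> (forall z, 0 <= F z)%E ->
  measurable_fun setT (fun x => \int[@lebesgue_measure R]_(t in `[0%R, +oo[) F (t, x))%E /\
  (\int[m]_x \int[@lebesgue_measure R]_(t in `[0%R, +oo[) F (t, x) =
   \int[@lebesgue_measure R]_(t in `[0%R, +oo[) \int[m]_x F (t, x))%E.
Proof.
move=> mF F0; pose D : set (measurableTypeR R) := [set` `[0%R, +oo[].
have mD : measurable D by exact: measurable_itv.
pose G (z : R * T) := (F z * (\1_D z.1)%:E)%E.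
have mG : measurable_fun setT G.
  apply: emeasurable_funM => //; apply/measurable_EFinP.
  by apply: (measurableT_comp _ measurable_fst); exact: measurable_indic.
have G0 z : (0 <= G z)%E by rewrite mule_ge0// lee_fin indicE ler0n.
have e x : (\int[@lebesgue_measure R]_(t in `[0%R, +oo[) F (t, x) =
    \int[@lebesgue_measure R]_t G (t, x))%E.
  by rewrite integral_mkcond epatch_indic.
under eq_fun do rewrite e.
split; first exact: (@measurable_fun_fubini_tonelli_G _ _ _ _ _ (@lebesgue_measure R) _ mG G0).
transitivity (\int[@lebesgue_measure R]_t \int[m]_x G (t, x))%E.
  exact: (esym (@fubini_tonelli _ _ _ _ _ (@lebesgue_measure R) m G mG G0)).
rewrite [RHS]integral_mkcond epatch_indic; apply: eq_integral => t _ /=.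
by rewrite -ge0_integralZr// ?lee_fin ?indicE ?ler0n//; exact: measurableT_comp.
Qed.

Lemma measurable_fun_chi d (T : measurableType d) (R : realType) (f g : T -> R) :
  measurable_fun setT f -> measurable_fun setT g ->
  measurable_fun setT (fun x => chi (f x) (g x)).
Proof.
move=> mf mg.
have mf' : measurable_fun setT (fun x => `|f x|) by exact: measurableT_comp.
have mg' : measurable_fun setT (fun x => `|g x|) by exact: measurableT_comp.
apply: measurable_fun_ifT => //; first exact: measurable_fun_ltr.
by apply: measurable_fun_ifT => //; exact: measurable_fun_eqr.
Qed.

Lemma chi_ge0 (R : realType) (a b : R) : 0 <= chi a b.
Proof. by rewrite /chi; case: ifP => // _; case: ifP => // _; rewrite invr_ge0. Qed.

Lemma sqr_sub_split (R : comNzRingType) (a b x y : R) : a + b = 1 ->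
  (y - x) ^+ 2 = a * (y - x) ^+ 2 + b * (x - y) ^+ 2.
Proof. by move=> ab; rewrite -[LHS]mul1r -ab; ring. Qed.

(** The value [2^-1] on ties is what makes the two halves add up. *)
Lemma chi_sym (R : realType) (a b : R) : chi a b + chi b a = 1.
Proof.
rewrite /chi; case: (ltgtP `|a| `|b|) => _; rewrite ?addr0 ?add0r//.
by field.
Qed.

(** The exponents [(2 - p)/2] and [p/2] add up to one, so the left side is a weighted geometric mean
    of [a^p] and [b] and lies below their maximum. *)
Lemma young_powR_max (R : realType) (p a b : R) : 0 < p -> p <= 2 -> 0 <= a -> 0 <= b ->
  (a `^ (2 - p) * b) `^ (p / 2) <= a `^ p + b.
Proof.
move=> p0 p2 a0 b0.
rewrite powRM ?powR_ge0// -powRrM.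
pose c := Num.max (a `^ p) b.
have c0 : 0 <= c by rewrite le_max powR_ge0.
have -> : a `^ ((2 - p) * (p / 2)) = (a `^ p) `^ ((2 - p) / 2).
  by rewrite -powRrM; congr (_ `^ _); ring.
apply: (@le_trans _ _ (c `^ ((2 - p) / 2) * c `^ (p / 2))).
  by apply: ler_pM; rewrite ?powR_ge0//; apply: ge0_ler_powR;
    rewrite ?nnegrE ?powR_ge0 ?le_max ?lexx ?orbT//; lra.
rewrite -powRD; last by apply/implyP => /eqP h; exfalso; lra.
rewrite (_ : _ + _ = 1); last by field.
by rewrite powRr1// /c ge_max lerDl b0 lerDr powR_ge0.
Qed.

(** Split at [y = e a^2]: below it the first term dominates; above it [a^2 < y / e] and the second
    one does. *)
Lemma young_powR_eps (R : realType) (p e a y : R) : 2 <= p -> 0 < e -> 0 <= a -> 0 <= y ->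
  a `^ (p - 2) * y <= e * a `^ p + e^-1 `^ ((p - 2) / 2) * y `^ (p / 2).
Proof.
move=> p2 e0 a0 y0; have [ye|ye] := leP y (e * a ^+ 2).
  apply: (@le_trans _ _ (e * a `^ p)); last by rewrite lerDl mulr_ge0// powR_ge0.
  apply: (@le_trans _ _ (a `^ (p - 2) * (e * a ^+ 2))); first by rewrite ler_wpM2l// powR_ge0.
  rewrite mulrCA -powR_mulrn// -powRD; first by rewrite subrK.
  by apply/implyP => /eqP h; exfalso; lra.
apply: (@le_trans _ _ (e^-1 `^ ((p - 2) / 2) * y `^ (p / 2))); last first.
  by rewrite lerDr mulr_ge0 ?powR_ge0// ltW.
have -> : a `^ (p - 2) = (a ^+ 2) `^ ((p - 2) / 2).
  by rewrite -powR_mulrn// -powRrM; congr (_ `^ _); field.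
have y1 : 0 < y by apply: le_lt_trans ye; rewrite mulr_ge0 ?sqr_ge0// ltW.
apply: (@le_trans _ _ ((e^-1 * y) `^ ((p - 2) / 2) * y)).
  have q0 : 0 <= (p - 2) / 2 by apply: divr_ge0; lra.
  have ey : 0 <= e^-1 * y by rewrite mulr_ge0// invr_ge0 ltW.
  rewrite ler_wpM2r//; apply: ge0_ler_powR; rewrite ?nnegrE ?sqr_ge0//.
  by rewrite ltW// mulrC ltr_pdivlMr// mulrC.
rewrite powRM ?invr_ge0 ?(ltW e0)// -mulrA ler_wpM2l ?powR_ge0//.
rewrite -[X in _ * X](powRr1 y0) -powRD; last by apply/implyP => _; rewrite gt_eqF.
by rewrite (_ : (p - 2) / 2 + 1 = p / 2)//; field.
Qed.

Section square_function_bounds.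
Context d (T : measurableType d) (R : realType).
Variables (m : {sigma_finite_measure set T -> \bar R}) (K : R.-sfker (R * T) ~> T)
  (Jk : R.-sfker T ~> T).
Hypothesis K1 : forall z, (K z setT <= 1)%E.
Hypothesis K_semi : forall (s t : R) x (g : T -> \bar R), 0 <= s -> 0 <= t ->
  measurable_fun setT g -> (forall y, 0 <= g y)%E ->
  (\int[K ((s + t)%R, x)]_y g y = \int[K (s, x)]_y \int[K (t, y)]_z g z)%E.
Hypothesis K_sym : forall (t : R) (f g : T -> \bar R), 0 <= t ->
  measurable_fun setT f -> (forall y, 0 <= f y)%E ->
  measurable_fun setT g -> (forall y, 0 <= g y)%E ->
  (\int[m]_x (f x * \int[K (t, x)]_y g y) = \int[m]_x (g x * \int[K (t, x)]_y f y))%E.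
Hypothesis K_cont : forall g : T -> R, measurable_fun setT g ->
  (\int[m]_x ((g x) ^+ 2)%:E < +oo)%E -> forall e : R, 0 < e -> exists2 dl : R,
  0 < dl & forall t, 0 <= t -> t <= dl ->
    (\int[m]_x ((ksem K t g x - g x) ^+ 2)%:E <= e%:E)%E.
Hypothesis Jk_sym : forall g : T * T -> \bar R, measurable_fun setT g ->
  (forall z, 0 <= g z)%E ->
  (\int[m]_x \int[Jk x]_y g (x, y) = \int[m]_x \int[Jk x]_y g (y, x))%E.
Hypothesis H_form : forall v : T -> R, measurable_fun setT v ->
  (\int[m]_x ((v x) ^+ 2)%:E < +oo)%E ->
  (forall k, approx_energy m K k v <= approx_energy m K k.+1 v) /\
  (forall C : R, (forall k, approx_energy m K k v <= C) ->
    (approx_energy m K k v)%:E @[k --> \oo] --> (2^-1%:E * jump_energy m Jk v)%E).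

Variables (p : R) (f : T -> R).
Hypothesis p1 : 1 < p.
Hypothesis mf : measurable_fun setT f.
Hypothesis fp : (\int[m]_x (`|f x| `^ p)%:E < +oo)%E.

Variable fs : T -> R.
Hypothesis mfs : measurable_fun setT fs.
Hypothesis fs0 : forall x, 0 <= fs x.
Hypothesis fsp : (\int[m]_x (fs x `^ p)%:E <=
  (maximal_const p)%:E * \int[m]_x (`|f x| `^ p)%:E)%E.
Hypothesis K_fs : forall t, 0 <= t ->
  {ae m, forall x, (\int[K (t, x)]_y (`|f y|)%:E <= (fs x)%:E)%E}.

Local Notation u := (fun t x => ksem K t f x).
Local Notation v := (pow_half K p f).
Local Notation A0 := (\int[m]_x (`|f x| `^ p)%:E)%E.
Local Notation mu := (@lebesgue_measure R).
Local Notation D := ([set` `[0%R, +oo[] : set (measurableTypeR R)).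

Let mD : measurable D. Proof. exact: measurable_itv. Qed.
Let D0 (t : R) : D t -> 0 <= t. Proof. by rewrite /= in_itv/= andbT. Qed.

Definition chi_energy (t : R) (x : T) : \bar R :=
  (\int[Jk x]_y ((u t y - u t x) ^+ 2 * chi (u t x) (u t y))%:E)%E.

Definition square_function (x : T) : \bar R :=
  (\int[mu]_(t in `[0%R, +oo[) chi_energy t x)%E.

Let carre (t : R) (x : T) : \bar R := (\int[Jk x]_y ((v t y - v t x) ^+ 2)%:E)%E.

Lemma measurable_jump_integral (F : (R * T) * T -> \bar R) :
  measurable_fun setT F -> (forall z, 0 <= F z)%E ->
  measurable_fun setT (fun z : R * T => \int[Jk z.2]_y F (z, y))%E.
Proof.
move=> mF F0; exact: (measurable_fun_integral_sfinite_kernel F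
  (kprecomp Jk (measurable_snd : measurable_fun setT (@snd R T)))).
Qed.

Let mpsi : measurable_fun setT (fun z : (R * T) * T => (z.1.1, z.2)).
Proof. by apply: measurable_fun_pair => //; exact: measurableT_comp. Qed.

Let mu1 : measurable_fun setT (fun z : (R * T) * T => u z.1.1 z.1.2).
Proof. exact: (measurableT_comp (measurable_ksem_joint K mf) measurable_fst). Qed.
Let mu2 : measurable_fun setT (fun z : (R * T) * T => u z.1.1 z.2).
Proof. exact: (measurableT_comp (measurable_ksem_joint K mf) mpsi). Qed.
Let mv1 : measurable_fun setT (fun z : (R * T) * T => v z.1.1 z.1.2).
Proof. exact: (measurableT_comp (measurable_pow_half_joint K p mf) measurable_fst). Qed.
Let mv2 : measurable_fun setT (fun z : (R * T) * T => v z.1.1 z.2).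
Proof. exact: (measurableT_comp (measurable_pow_half_joint K p mf) mpsi). Qed.

Let chi_int0 t x y : 0 <= (u t y - u t x) ^+ 2 * chi (u t x) (u t y).
Proof. by rewrite mulr_ge0 ?sqr_ge0 ?chi_ge0. Qed.

Let m_chi_int : measurable_fun setT (fun z : (R * T) * T =>
  (u z.1.1 z.2 - u z.1.1 z.1.2) ^+ 2 * chi (u z.1.1 z.1.2) (u z.1.1 z.2)).
Proof.
apply: measurable_funM; first by apply/measurable_funX; exact: measurable_funB.
exact: measurable_fun_chi mu1 mu2.
Qed.

Lemma measurable_chi_energy : measurable_fun setT (fun z : R * T => chi_energy z.1 z.2).
Proof.
apply: (measurable_jump_integral
  (F := fun z => ((u z.1.1 z.2 - u z.1.1 z.1.2) ^+ 2 * chi (u z.1.1 z.1.2) (u z.1.1 z.2))%:E)).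
  exact/measurable_EFinP.
by move=> z; rewrite lee_fin.
Qed.

Lemma chi_energy_ge0 t x : (0 <= chi_energy t x)%E.
Proof. by apply: integral_ge0 => y _; rewrite lee_fin. Qed.

Lemma square_function_ge0 x : (0 <= square_function x)%E.
Proof. by apply: integral_ge0 => t _; exact: chi_energy_ge0. Qed.

Lemma measurable_square_function : measurable_fun setT square_function.
Proof.
by have [] := half_line_tonelli m measurable_chi_energy (fun z => chi_energy_ge0 _ _).
Qed.

Let m_carre : measurable_fun setT (fun z : R * T => carre z.1 z.2).
Proof.
apply: (measurable_jump_integral
  (F := fun z => ((v z.1.1 z.2 - v z.1.1 z.1.2) ^+ 2)%:E)).
  by apply/measurable_EFinP/measurable_funX; exact: (measurable_funB mv2 mv1).
by move=> z; rewrite lee_fin sqr_ge0.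
Qed.

Let carre_ge0 t x : (0 <= carre t x)%E.
Proof. by apply: integral_ge0 => y _; rewrite lee_fin sqr_ge0. Qed.

Let sec (F : R * T -> \bar R) x : measurable_fun setT F ->
  measurable_fun setT (fun t => F (t, x)).
Proof. by move=> mF; exact: (measurableT_comp mF (measurable_pair2 x)). Qed.

Let sec1 (F : R * T -> \bar R) t : measurable_fun setT F ->
  measurable_fun setT (fun x => F (t, x)).
Proof. by move=> mF; exact: (measurableT_comp mF (measurable_pair1 t)). Qed.

Lemma ksem_le_star : {ae m, forall x, {ae mu, forall t, D t -> `|u t x| <= fs x}}.
Proof.
pose S := [set z : R * T | 0 <= z.1 /\ fs z.2 < `|u z.1 z.2|].
have mS : measurable S.
  have -> : S = (fun z : R * T => 0 <= z.1) @^-1` [set true] `&`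
    (fun z : R * T => fs z.2 < `|u z.1 z.2|) @^-1` [set true] by [].
  apply: measurableI; rewrite -[X in measurable X]setTI.
    by apply: measurable_fun_ler.
  apply: measurable_fun_ltr => //; first exact: measurableT_comp.
  by apply: measurableT_comp => //; exact: measurable_ksem_joint.
have := @ae_swap _ _ _ _ _ mu m S mS _.
case=> [t|A [mA A0 hA]].
  have [t0|t0] := leP 0 t; last first.
    by apply: aeW => x [] /=; rewrite leNgt t0.
  apply: filterS (K_fs t0) => x h [_] /=; apply/negP; rewrite -leNgt -lee_fin.
  apply: le_trans h.
  have mfk : measurable_fun setT (EFin \o f) by exact/measurable_EFinP.
  (* Where [f] is not integrable, [ksem] is only a default value, but the integral of [|f|] is then
     infinite and the bound is trivial. *)
  have [ifx|] := pselect ((K (t, x)).-integrable setT (EFin \o f)).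
    rewrite EFin_normr_Rintegral//; exact: le_abse_integral.
  move=> nif; rewrite (_ : (\int[_]_y _)%E = +oo%E) ?leey//.
  apply/eqP; rewrite -leye_eq leNgt; apply/negP => h; apply: nif.
  by apply/integrableP; split.
exists A; split => // x /= nx; apply: hA => /= hx; apply: nx.
apply: filterS hx => t nS Dt; rewrite leNgt; apply/negP => h; apply: nS.
by split => //; exact: D0.
Qed.

Lemma time_jump_energyE :
  (\int[mu]_(t in D) jump_energy m Jk (v t) = \int[m]_x \int[mu]_(t in D) carre t x)%E.
Proof. by have [_ ->] := half_line_tonelli m m_carre (fun z => carre_ge0 _ _). Qed.

Let cp : R := Num.min 1 (p - 1) / 2.
Let cp0 : 0 < cp.
Proof. by have hp := p1; rewrite /cp; case: (leP 1 (p - 1)) => ?; lra. Qed.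

Let jump_le : (\int[mu]_(t in D) jump_energy m Jk (v t) <= cp^-1%:E * A0)%E.
Proof.
have := time_jump_energy_le K1 K_semi K_sym H_form p1 mf fp.
rewrite -/cp => h; rewrite -[leLHS]mul1e -(divff (lt0r_neq0 cp0)) mulrC EFinM -muleA.
by rewrite lee_wpmul2l// lee_fin invr_ge0 ltW.
Qed.

(** At almost every [x] the square function is at most a constant times [fs^(2 - p)] times the time
    integral of [carre]. Raised to the power [p/2], the factors are separated by [young_powR_max];
    the maximal inequality and the Hardy-Stein bound give the two summands of the constant. *)
Lemma square_function_le : p <= 2 ->
  (\int[m]_x (square_function x `^ (p / 2)) <=
   (((2 / p) ^+ 2) `^ (p / 2) * (maximal_const p + cp^-1))%:E * A0)%E.
Proof.
move=> p2; have hp := p1; have pp0 : 0 < p by lra.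
pose c := (2 / p) ^+ 2; have c0 : 0 < c by rewrite exprn_gt0// divr_gt0.
pose I x : \bar R := (\int[mu]_(t in D) carre t x)%E.
have [mI _] := half_line_tonelli m m_carre (fun z => carre_ge0 _ _).
have I0 x : (0 <= I x)%E by apply: integral_ge0 => t _; exact: carre_ge0.
have mfsp : measurable_fun setT (fun x => (fs x `^ p)%:E).
  by apply/measurable_EFinP; exact: (measurableT_comp (measurable_powR p) mfs).
have -> : (((c `^ (p / 2)) * (maximal_const p + cp^-1))%:E * A0 =
   (c `^ (p / 2))%:E * ((maximal_const p)%:E * A0 + cp^-1%:E * A0))%E.
  by rewrite EFinM -muleA EFinD ge0_muleDl// lee_fin ?maximal_const_ge0// invr_ge0 ltW.
apply: (@le_trans _ _ ((c `^ (p / 2))%:E * \int[m]_x ((fs x `^ p)%:E + I x))%E); last first.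
  rewrite lee_wpmul2l ?lee_fin ?powR_ge0// ge0_integralD//; last by move=> x _; rewrite lee_fin powR_ge0.
  by apply: leeD => //; rewrite -time_jump_energyE.
rewrite -ge0_integralZl_EFin ?powR_ge0//; last 2 first.
- by move=> x _; rewrite adde_ge0// lee_fin powR_ge0.
- exact: emeasurable_funD.
apply: ae_ge0_le_integral; first exact: measurableT.
- by move=> x _; exact: poweR_ge0.
- by apply: (measurableT_comp (measurable_poweR _)); exact: measurable_square_function.
- by move=> x _; rewrite mule_ge0 ?lee_fin ?powR_ge0// adde_ge0// lee_fin powR_ge0.
- by apply: measurable_funeM; exact: emeasurable_funD.
apply: filterS ksem_le_star => x hx _.
have h1 : (square_function x <= (c * fs x `^ (2 - p))%:E * I x)%E.
  rewrite -ge0_integralZl_EFin//; last 2 first.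
  - by apply: measurable_funTS; exact: (sec (F := fun z => carre z.1 z.2) x m_carre).
  - by rewrite mulr_ge0 ?powR_ge0// ltW.
  apply: ae_ge0_le_integral; first exact: mD.
  - by move=> t _; exact: chi_energy_ge0.
  - by apply: measurable_funTS; exact: (sec (F := fun z => chi_energy z.1 z.2) x measurable_chi_energy).
  - by move=> t _; rewrite mule_ge0// lee_fin mulr_ge0 ?powR_ge0// ltW.
  - by apply: measurable_funTS; apply: measurable_funeM; exact: (sec (F := fun z => carre z.1 z.2) x m_carre).
  apply: filterS hx => t ht Dt; have utx := ht Dt.
  have mF1 : measurable_fun setT (fun y => ((v t y - v t x) ^+ 2)%:E).
    apply/measurable_EFinP/measurable_funX.
    by apply: measurable_funB; [exact: measurable_pow_half|exact: measurable_cst].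
  rewrite /carre -ge0_integralZl_EFin//; last 2 first.
  - by move=> y _; rewrite lee_fin sqr_ge0.
  - by rewrite mulr_ge0 ?powR_ge0// ltW.
  apply: ge0_le_integral => //.
  - by move=> y _; rewrite lee_fin.
  - apply/measurable_EFinP; exact: (measurableT_comp m_chi_int (measurable_pair1 (t, x))).
  - exact: measurable_funeM.
  move=> y _; rewrite -EFinM lee_fin.
  (* Where [|u t y| > |u t x|] the weight [chi] vanishes. Elsewhere it is at most one, and the
     larger value [|u t x|] is bounded by [fs x]. *)
  have [ba|ab] := leP `|u t y| `|u t x|; last first.
    by rewrite /chi ltNge (ltW ab)/= (lt_eqF ab) mulr0 mulr_ge0 ?sqr_ge0// mulr_ge0 ?powR_ge0// (ltW c0).
  apply: (@le_trans _ _ ((u t y - u t x) ^+ 2)).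
    by rewrite ler_piMr ?sqr_ge0// -(chi_sym (u t x) (u t y)) lerDl chi_ge0.
  apply: (le_trans (sqr_spowB_ge p1 p2 ba)).
  rewrite -[leRHS]mulrA; apply: ler_wpM2l; first exact: ltW.
  apply: ler_wpM2r; first exact: sqr_ge0.
  by apply: ge0_ler_powR; rewrite ?nnegrE// subr_ge0.
have h2 := gt0_ler_poweR (_ : 0 <= p / 2) _ _ h1.
apply: (le_trans (h2 _ _ _)).
- by rewrite divr_ge0// ltW.
- by rewrite in_itv/= square_function_ge0 leey.
- by rewrite in_itv/= leey andbT mule_ge0// lee_fin mulr_ge0 ?powR_ge0// ltW.
case: (I x) (I0 x) => [r|_|//].
- rewrite lee_fin => r0; rewrite -EFinM poweR_EFin -EFinD -EFinM lee_fin -mulrA.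
  rewrite powRM ?(ltW c0)//; last by rewrite mulr_ge0 ?powR_ge0.
  by rewrite ler_wpM2l ?powR_ge0// young_powR_max.
- by rewrite addeC addye// [leRHS]gt0_muley ?leey// lte_fin powR_gt0.
Qed.

(** The factor [2] comes from [chi_sym] together with the symmetry of the jump kernel, which maps
    one half of the energy onto the other; [(p / 2) ^+ 2] is the constant of [sqr_spowB_le]. *)
Lemma jump_energy_chi t : 2 <= p -> 0 <= t ->
  (jump_energy m Jk (v t) <=
   (2 * (p / 2) ^+ 2)%:E * \int[m]_x ((`|u t x| `^ (p - 2))%:E * chi_energy t x))%E.
Proof.
move=> p2 t0; have mvt := measurable_pow_half K p mf t; have mut := measurable_ksem K t mf.
pose g (z : T * T) : \bar R := (chi (u t z.1) (u t z.2) * (v t z.2 - v t z.1) ^+ 2)%:E.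
have g0 z : (0 <= g z)%E by rewrite lee_fin mulr_ge0 ?chi_ge0 ?sqr_ge0.
have mg : measurable_fun setT g.
  apply/measurable_EFinP/measurable_funM.
    by apply: measurable_fun_chi; exact: measurableT_comp.
  by apply: measurable_funX; apply: measurable_funB; exact: measurableT_comp.
have mgs : measurable_fun setT (fun z : T * T => g (z.2, z.1)).
  by apply: (measurableT_comp mg); exact: measurable_fun_pair.
have e : (jump_energy m Jk (v t) = 2%:E * \int[m]_x \int[Jk x]_y g (x, y))%E.
  rewrite (_ : 2%:E = 1 + 1)%E; last by rewrite -EFinD; congr EFin; ring.
  rewrite ge0_muleDl ?lee01// !mul1e.
  rewrite [X in (_ = _ + X)%E]Jk_sym// -ge0_integralD//; last 4 first.
  - by move=> x _; exact: integral_ge0.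
  - exact: (measurable_fun_integral_sfinite_kernel g Jk g0 mg).
  - by move=> x _; exact: integral_ge0.
  - exact: (measurable_fun_integral_sfinite_kernel (fun z => g (z.2, z.1)) Jk (fun _ => g0 _) mgs).
  apply: eq_integral => x _.
  transitivity (\int[Jk x]_y (g (x, y) + g (y, x)))%E; last first.
    apply: ge0_integralD; [exact: measurableT|by move=> y _; exact: g0| |by move=> y _; exact: g0|].
    - exact: (measurableT_comp mg (measurable_pair1 x)).
    - exact: (measurableT_comp mg (measurable_pair2 x)).
  apply: eq_integral => y _; rewrite /g/= -EFinD; congr EFin.
  exact: sqr_sub_split (chi_sym (u t x) (u t y)).
rewrite e EFinM -muleA lee_wpmul2l// -ge0_integralZl_EFin ?sqr_ge0//; last 2 first.
- by move=> x _; rewrite mule_ge0 ?lee_fin ?powR_ge0// chi_energy_ge0.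
- apply: emeasurable_funM; first by apply/measurable_EFinP/measurable_norm_powR.
  exact: (sec1 (F := fun z => chi_energy z.1 z.2) t measurable_chi_energy).
apply: ge0_le_integral; first exact: measurableT.
- by move=> x _; exact: integral_ge0.
- exact: (measurable_fun_integral_sfinite_kernel g Jk g0 mg).
- apply: measurable_funeM; apply: emeasurable_funM; first by apply/measurable_EFinP/measurable_norm_powR.
  exact: (sec1 (F := fun z => chi_energy z.1 z.2) t measurable_chi_energy).
move=> x _; have mc : measurable_fun setT (fun y => ((u t y - u t x) ^+ 2 * chi (u t x) (u t y))%:E).
  by apply/measurable_EFinP; exact: (measurableT_comp m_chi_int (measurable_pair1 (t, x))).
rewrite -ge0_integralZl_EFin ?powR_ge0//; last by move=> y _; rewrite lee_fin.
rewrite -ge0_integralZl_EFin ?sqr_ge0//; last 2 first.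
- by move=> y _; rewrite mule_ge0 ?lee_fin ?powR_ge0.
- exact: measurable_funeM.
apply: ge0_le_integral; [exact: measurableT|by move=> y _; exact: g0| | |].
- exact: (measurableT_comp mg (measurable_pair1 x)).
- by do 2 apply: measurable_funeM.
move=> y _; rewrite -!EFinM lee_fin/=.
have [ba|ab] := leP `|u t y| `|u t x|; last first.
  by rewrite /chi ltNge (ltW ab)/= (lt_eqF ab) mul0r !mulr0.
rewrite [leLHS]mulrC [X in _ <= _ * X]mulrA mulrA.
apply: ler_wpM2r; first exact: chi_ge0.
exact: (sqr_spowB_le p2 ba).
Qed.

Lemma time_jump_energy_chi : 2 <= p ->
  (\int[mu]_(t in D) jump_energy m Jk (v t) <=
   (2 * (p / 2) ^+ 2)%:E * \int[m]_x ((fs x `^ (p - 2))%:E * square_function x))%E.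
Proof.
move=> p2; pose F (z : R * T) : \bar R := ((`|u z.1 z.2| `^ (p - 2))%:E * chi_energy z.1 z.2)%E.
have F0 z : (0 <= F z)%E by rewrite mule_ge0 ?lee_fin ?powR_ge0// chi_energy_ge0.
have mF : measurable_fun setT F.
  apply: emeasurable_funM; last exact: measurable_chi_energy.
  by apply/measurable_EFinP/measurable_norm_powR; exact: measurable_ksem_joint.
have [mI e] := half_line_tonelli m mF F0.
have c0 : 0 <= 2 * (p / 2) ^+ 2 by rewrite mulr_ge0// sqr_ge0.
have mFm : measurable_fun setT (fun t => \int[m]_x F (t, x))%E.
  exact: (@measurable_fun_fubini_tonelli_F _ _ _ _ _ m F mF F0).
apply: (@le_trans _ _ ((2 * (p / 2) ^+ 2)%:E * \int[mu]_(t in D) \int[m]_x F (t, x))%E).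
  rewrite -ge0_integralZl_EFin//; last 2 first.
  - by move=> t _; exact: integral_ge0.
  - exact: measurable_funTS.
  apply: ge0_le_integral => //.
  - by move=> t _; apply: integral_ge0 => x _; exact: carre_ge0.
  - by apply: measurable_funTS; exact: measurable_jump_energy.
  - by apply: measurable_funTS; exact: measurable_funeM.
  - by move=> t /D0 t0; exact: jump_energy_chi.
rewrite -e lee_wpmul2l//; apply: ae_ge0_le_integral => //.
- by move=> x _; exact: integral_ge0.
- by move=> x _; rewrite mule_ge0 ?lee_fin ?powR_ge0// square_function_ge0.
- apply: emeasurable_funM; last exact: measurable_square_function.
  by apply/measurable_EFinP; exact: (measurableT_comp (measurable_powR _) mfs).
apply: filterS ksem_le_star => x hx _.
have -> : ((fs x `^ (p - 2))%:E * square_function x =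
    \int[mu]_(t in D) ((fs x `^ (p - 2))%:E * chi_energy t x))%E.
  apply/esym; apply: ge0_integralZl_EFin; [exact: mD|by move=> t _; exact: chi_energy_ge0| |exact: powR_ge0].
  by apply: measurable_funTS; exact: (sec (F := fun z => chi_energy z.1 z.2) x measurable_chi_energy).
apply: (@ae_ge0_le_integral _ _ _ mu D mD); first by move=> t _; exact: F0.
- by apply: measurable_funTS; exact: (sec x mF).
- by move=> t _; rewrite mule_ge0 ?lee_fin ?powR_ge0// chi_energy_ge0.
- by apply: measurable_funTS; apply: measurable_funeM; exact: (sec (F := fun z => chi_energy z.1 z.2) x measurable_chi_energy).
apply: filterS hx => t ht Dt; rewrite lee_wpmul2r ?chi_energy_ge0// lee_fin.
by apply: ge0_ler_powR; rewrite ?nnegrE ?subr_ge0// ht.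
Qed.

Lemma time_jump_energy_young (e : R) : 2 <= p -> 0 < e ->
  (\int[mu]_(t in D) jump_energy m Jk (v t) <=
   (2 * (p / 2) ^+ 2)%:E * ((e * maximal_const p)%:E * A0 +
     (e^-1 `^ ((p - 2) / 2))%:E * \int[m]_x (square_function x `^ (p / 2))))%E.
Proof.
move=> p2 e0; apply: (le_trans (time_jump_energy_chi p2)).
have c0 : 0 <= 2 * (p / 2) ^+ 2 by rewrite mulr_ge0// sqr_ge0.
have mG := measurable_square_function.
have mGp : measurable_fun setT (fun x => square_function x `^ (p / 2))%E.
  exact: (measurableT_comp (measurable_poweR _) mG).
have mfsp : measurable_fun setT (fun x => (fs x `^ p)%:E).
  by apply/measurable_EFinP; exact: (measurableT_comp (measurable_powR p) mfs).
rewrite lee_wpmul2l//.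
apply: (@le_trans _ _ (e%:E * \int[m]_x (fs x `^ p)%:E +
   (e^-1 `^ ((p - 2) / 2))%:E * \int[m]_x (square_function x `^ (p / 2)))%E); last first.
  by apply: leeD2r; rewrite EFinM -muleA; apply: lee_wpmul2l => //; rewrite lee_fin ltW.
rewrite -!ge0_integralZl_EFin ?powR_ge0 ?(ltW e0)//; last 2 first.
- by move=> x _; exact: poweR_ge0.
- by move=> x _; rewrite lee_fin powR_ge0.
rewrite -ge0_integralD//; last 4 first.
- by move=> x _; rewrite mule_ge0 ?lee_fin ?powR_ge0// ltW.
- exact: measurable_funeM.
- by move=> x _; rewrite mule_ge0 ?lee_fin ?powR_ge0// poweR_ge0.
- exact: measurable_funeM.
apply: ge0_le_integral; first exact: measurableT.
- by move=> x _; rewrite mule_ge0 ?lee_fin ?powR_ge0// square_function_ge0.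
- apply: emeasurable_funM => //.
  by apply/measurable_EFinP; exact: (measurableT_comp (measurable_powR _) mfs).
- by apply: emeasurable_funD; exact: measurable_funeM.
move=> x _; case: (square_function x) (square_function_ge0 x) => [r|_|//].
- by rewrite lee_fin => r0; rewrite poweR_EFin -!EFinM -EFinD lee_fin young_powR_eps.
- rewrite poweRyr; last by rewrite mulf_neq0//; have hp := p1; rewrite gt_eqF//; lra.
  rewrite [X in (_ <= _ + X)%E]gt0_muley ?lte_fin ?powR_gt0 ?invr_gt0//.
  by rewrite addeC addye// leey.
Qed.

End square_function_bounds.

Lemma powR_sum3_le (R : realType) (p a b c : R) : 0 <= p -> 0 <= a -> 0 <= b -> 0 <= c ->
  (a + b + c) `^ p <= 3 `^ p * (a `^ p + b `^ p + c `^ p).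
Proof.
move=> p0 a0 b0 c0; pose M := Num.max a (Num.max b c).
have M0 : 0 <= M by rewrite le_max a0.
apply: (@le_trans _ _ ((3 * M) `^ p)).
  apply: ge0_ler_powR; rewrite ?nnegrE ?addr_ge0 ?mulr_ge0//.
  rewrite (_ : 3 * M = M + M + M); last by ring.
  by rewrite !lerD// /M !le_max lexx ?orbT.
rewrite powRM// ler_wpM2l ?powR_ge0//.
have [ha hb hc] := And3 (powR_ge0 a p) (powR_ge0 b p) (powR_ge0 c p).
have [->|[->|->]] : M = a \/ M = b \/ M = c.
  by rewrite /M; case: (leP b c) => _; case: leP => _; auto.
all: lra.
Qed.

Lemma dyad_small (R : realType) (dl : R) : 0 < dl -> exists k, dyad R k <= dl.
Proof.
move=> dl0; exists (Num.truncn dl^-1); rewrite /dyad exprVn.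
rewrite -[dl]invrK lef_pV2 ?posrE ?exprn_gt0 ?invr_gt0//.
by rewrite ltW// (lt_le_trans (truncnS_gt _))// -natrX ler_nat invrK ltnW// ltn_expl.
Qed.

(** * Continuity in L^p at time zero *)

Section Lp_continuity.
Context d (T : measurableType d) (R : realType).
Variables (m : {sigma_finite_measure set T -> \bar R}) (K : R.-sfker (R * T) ~> T).
Hypothesis K1 : forall z, (K z setT <= 1)%E.
Hypothesis K_sym : forall (t : R) (f g : T -> \bar R), 0 <= t ->
  measurable_fun setT f -> (forall y, 0 <= f y)%E ->
  measurable_fun setT g -> (forall y, 0 <= g y)%E ->
  (\int[m]_x (f x * \int[K (t, x)]_y g y) = \int[m]_x (g x * \int[K (t, x)]_y f y))%E.
Hypothesis K_cont : forall g : T -> R, measurable_fun setT g ->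
  (\int[m]_x ((g x) ^+ 2)%:E < +oo)%E -> forall e : R, 0 < e -> exists2 dl : R,
  0 < dl & forall t, 0 <= t -> t <= dl ->
    (\int[m]_x ((ksem K t g x - g x) ^+ 2)%:E <= e%:E)%E.

Lemma ksem_bounded (g : T -> R) (n t : R) x : measurable_fun setT g ->
  (forall y, `|g y| <= n) -> `|ksem K t g x| <= n /\ (K (t, x)).-integrable setT (EFin \o g).
Proof.
move=> mg gn; have n0 : 0 <= n by exact: le_trans (normr_ge0 _) (gn x).
have mgE : measurable_fun setT (EFin \o g) by exact/measurable_EFinP.
have bd : (\int[K (t, x)]_y `|(EFin \o g) y| <= n%:E)%E.
  apply: (@le_trans _ _ (\int[K (t, x)]_y (cst n%:E y))%E).
    apply: ge0_le_integral => //; first exact: measurableT_comp.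
    by move=> y _; rewrite lee_fin.
  by rewrite integral_cst// -[leRHS]mule1 lee_wpmul2l.
have ig : (K (t, x)).-integrable setT (EFin \o g).
  by apply/integrableP; split => //; exact: le_lt_trans bd (ltry _).
split=> //; rewrite -lee_fin EFin_normr_Rintegral//.
by apply: le_trans bd; exact: le_abse_integral.
Qed.

Variables (p : R) (f : T -> R).
Hypothesis p2 : 2 <= p.
Hypothesis mf : measurable_fun setT f.
Hypothesis fp : (\int[m]_x (`|f x| `^ p)%:E < +oo)%E.
Hypothesis K_fin : forall t, 0 <= t ->
  {ae m, forall x, (\int[K (t, x)]_y (`|f y|)%:E < +oo)%E}.

Let p0 : 0 < p. Proof. by have hp := p2; lra. Qed.
Let p1 : 1 < p. Proof. by have hp := p2; lra. Qed.

(** [f] is cut down to the part of a set of finite measure where [|f| <= n]; dominated convergence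
    with the majorant [|f|^p] does the rest. *)
Lemma bounded_approximation (e : R) : 0 < e -> exists (n : nat) (g : T -> R),
  [/\ measurable_fun setT g, forall x, `|g x| <= n%:R,
      (\int[m]_x ((g x) ^+ 2)%:E < +oo)%E &
      (\int[m]_x (`|f x - g x| `^ p)%:E <= e%:E)%E].
Proof.
move=> e0; have /sigma_finiteP [B [Bc Bm Bf]] := @sigma_finiteT _ _ _ m.
pose C n := B n `&` [set x | `|f x| <= n%:R].
have mC n : measurable (C n).
  apply: measurableI; first by case: (Bf n).
  rewrite -[X in measurable X]setTI (_ : [set x | _] = (fun x => `|f x| <= n%:R) @^-1` [set true])//.
  by apply: measurable_fun_ler => //; exact: measurableT_comp.
pose g n x : R := f x * \1_(C n) x.
have mg n : measurable_fun setT (g n).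
  by apply: measurable_funM => //; exact: measurable_indic.
have gn n x : `|g n x| <= n%:R * \1_(B n) x.
  rewrite /g !indicE; case: (boolP (x \in C n)) => [|_].
    by move=> /set_mem [Bx /= fx]; rewrite (mem_set Bx) !mulr1.
  by rewrite mulr0 normr0 mulr_ge0.
have fg n x : `|f x - g n x| <= `|f x|.
  rewrite /g indicE; case: (x \in C n); first by rewrite mulr1 subrr normr0.
  by rewrite mulr0 subr0.
have mfp : measurable_fun setT (fun x => (`|f x| `^ p)%:E).
  by apply/measurable_EFinP/measurable_norm_powR.
have cv : (\int[m]_x (`|f x - g n x| `^ p)%:E)%E @[n --> \oo] --> (\int[m]_x (cst 0%E x))%E.
  apply: (@dominated_cvg _ _ _ m setT measurableT
    (fun n x => (`|f x - g n x| `^ p)%:E) (cst 0%E) (fun x => (`|f x| `^ p)%:E)).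
  - by move=> n; apply/measurable_EFinP/measurable_norm_powR; exact: measurable_funB.
  - move=> x _; have [N _ xN] : (\bigcup_i B i) x by rewrite -Bc.
    apply: cvg_near_cst; exists (maxn N (Num.truncn `|f x|).+1) => // k /=.
    rewrite geq_max => /andP[Nk fk]; rewrite /g indicE mem_set ?mulr1 ?subrr ?normr0 ?powR0 ?gt_eqF//.
    split; first by have /subsetPset := Bm _ _ Nk; exact.
    by rewrite /= ltW// (lt_le_trans (truncnS_gt _))// ler_nat.
  - by [].
  - apply/integrableP; split => //; under eq_integral do rewrite gee0_abs ?lee_fin ?powR_ge0//.
    exact: fp.
  - move=> n x _; rewrite gee0_abs ?lee_fin ?powR_ge0//.
    by apply: ge0_ler_powR; rewrite ?nnegrE ?(ltW p0).
rewrite integral0 in cv.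
have [N _ hN] : \forall n \near \oo, (\int[m]_x (`|f x - g n x| `^ p)%:E < e%:E)%E.
  apply: (cv [set x | (x < e%:E)%E]); apply: open_nbhs_nbhs; split; first exact: open_ereal_lt_ereal.
  by rewrite /= lte_fin.
exists N, (g N); split => //.
- move=> x; apply: (le_trans (gn N x)); rewrite indicE.
  by case: (_ \in _); rewrite ?mulr1 ?mulr0.
- apply: (@le_lt_trans _ _ (\int[m]_x ((N%:R ^+ 2)%:E * (\1_(B N) x)%:E))%E).
    apply: ge0_le_integral => //.
    + by move=> x _; rewrite lee_fin sqr_ge0.
    + by apply/measurable_EFinP/measurable_funX.
    + apply: measurable_funeM; apply/measurable_EFinP; apply: measurable_indic.
      by case: (Bf N).
    move=> x _; rewrite -EFinM lee_fin -[leLHS]real_normK ?num_real//.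
    have := gn N x; rewrite indicE; case: (_ \in _); rewrite ?mulr1 ?mulr0 => h.
      by rewrite !expr2 ler_pM.
    have -> : `|g N x| = 0 by apply/le_anti; rewrite h normr_ge0.
    by rewrite expr0n.
  rewrite ge0_integralZl_EFin ?sqr_ge0//; last first.
  - by apply/measurable_EFinP; apply: measurable_indic; case: (Bf N).
  rewrite integral_indic ?setIT//; last by case: (Bf N).
  by apply: lte_mul_pinfty => //; case: (Bf N).
- by rewrite ltW//; apply: hN => /=.
Qed.

(** Deduced from continuity in L^2: if [g] is bounded by [n], the [p]-th power of [|g - P_h g|] is
    at most [(2 n)^(p - 2)] times its square. The remaining errors [f - g] and [P_h (g - f)] are
    small by the choice of [g] and by contraction. *)
Lemma Lp_continuity (e : R) : 0 < e ->
  exists k, (\int[m]_x (`|f x - ksem K (dyad R k) f x| `^ p)%:E <= e%:E)%E.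
Proof.
move=> e0; have c3 : 0 < 3 `^ p :> R by rewrite powR_gt0.
(* Three pieces of size [dd], and the factor [3^p] of [powR_sum3_le]. *)
pose dd := e / (3 * 3 `^ p); have dd0 : 0 < dd by rewrite divr_gt0// mulr_gt0.
have [n [g [mg gn g2 fg]]] := bounded_approximation dd0.
(* The summand [1] keeps [c] positive, since [n] may be [0]. *)
pose c := (2 * n%:R) `^ (p - 2) + 1 : R; have c0 : 0 < c by rewrite ltr_wpDl ?powR_ge0.
have [dl dl0 h] := K_cont mg g2 (divr_gt0 dd0 c0).
have [k kd] := dyad_small dl0; exists k.
have hk0 := ltW (dyad_gt0 R k); set hk := dyad R k in kd hk0 *.
have mUf := measurable_ksem K hk mf; have mUg := measurable_ksem K hk mg.
have mgf : measurable_fun setT (fun x => g x - f x) by exact: measurable_funB.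
have mUgf := measurable_ksem K hk mgf.
have mp (w : T -> R) : measurable_fun setT w -> measurable_fun setT (fun x => (`|w x| `^ p)%:E).
  by move=> mw; apply/measurable_EFinP/measurable_norm_powR.
have pw0 (w : T -> R) x : (0 <= (`|w x| `^ p)%:E)%E by rewrite lee_fin powR_ge0.
pose a1 x := f x - g x; pose a2 x := g x - ksem K hk g x; pose a3 := ksem K hk (fun x => g x - f x).
have ma1 : measurable_fun setT a1 by exact: measurable_funB.
have ma2 : measurable_fun setT a2 by exact: measurable_funB.
have b1 : (\int[m]_x (`|a1 x| `^ p)%:E <= dd%:E)%E by exact: fg.
have b3 : (\int[m]_x (`|a3 x| `^ p)%:E <= dd%:E)%E.
  apply: (le_trans (ksem_contraction K1 K_sym p1 hk0 mgf)).
  by under eq_integral do rewrite distrC.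
have b2 : (\int[m]_x (`|a2 x| `^ p)%:E <= dd%:E)%E.
  apply: (@le_trans _ _ (c%:E * \int[m]_x ((ksem K hk g x - g x) ^+ 2)%:E)%E); last first.
    have := h _ hk0 kd; rewrite -(@lee_pmul2l _ c%:E) ?lte_fin// => /le_trans; apply.
    by rewrite -EFinM mulrC divfK// gt_eqF.
  rewrite -ge0_integralZl_EFin ?(ltW c0)//; last 2 first.
  - by move=> x _; rewrite lee_fin sqr_ge0.
  - by apply/measurable_EFinP/measurable_funX/measurable_funB.
  apply: ge0_le_integral => //; first exact: mp.
    by apply: measurable_funeM; apply/measurable_EFinP/measurable_funX/measurable_funB.
  move=> x _; rewrite -EFinM lee_fin -[X in _ <= _ * X]sqrrN opprB -/(a2 x).
  have a2n : `|a2 x| <= 2 * n%:R.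
    apply: (le_trans (ler_normB _ _)); rewrite mulr_natl mulr2n lerD//.
    by have [] := ksem_bounded hk x mg gn.
  have -> : `|a2 x| `^ p = `|a2 x| `^ (p - 2) * a2 x ^+ 2.
    rewrite -[in RHS](real_normK (num_real (a2 x))) -powR_mulrn// -powRD ?subrK//.
    by apply/implyP => /eqP pe; have := p0; rewrite pe ltxx.
  rewrite ler_wpM2r ?sqr_ge0// /c (@le_trans _ _ ((2 * n%:R) `^ (p - 2)))// ?lerDl//.
  by apply: ge0_ler_powR; rewrite ?nnegrE ?subr_ge0// mulr_ge0.
apply: (@le_trans _ _ ((3 `^ p)%:E * \int[m]_x ((`|a1 x| `^ p)%:E + (`|a2 x| `^ p)%:E + (`|a3 x| `^ p)%:E))%E).
  rewrite -ge0_integralZl_EFin ?powR_ge0//; last 2 first.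
  - by move=> x _; rewrite !adde_ge0.
  - by apply: emeasurable_funD; [apply: emeasurable_funD|]; exact: mp.
  apply: ae_ge0_le_integral => //.
  - by apply: mp; exact: measurable_funB.
  - by move=> x _; rewrite mule_ge0 ?lee_fin ?powR_ge0// !addr_ge0// powR_ge0.
  - by apply: measurable_funeM; apply: emeasurable_funD; [apply: emeasurable_funD|]; exact: mp.
  apply: filterS (K_fin hk0) => x fx _.
  have if' : (K (hk, x)).-integrable setT (EFin \o f).
    by apply/integrableP; split => //; exact/measurable_EFinP.
  have [_ ig] := ksem_bounded hk x mg gn.
  rewrite -!EFinD -EFinM lee_fin (_ : f x - ksem K hk f x = a1 x + a2 x + a3 x); last first.
    by rewrite /a1 /a2 /a3 /ksem RintegralB//; ring.
  apply: (@le_trans _ _ ((`|a1 x| + `|a2 x| + `|a3 x|) `^ p)).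
    apply: ge0_ler_powR; rewrite ?nnegrE ?(ltW p0) ?addr_ge0//.
    by apply: (le_trans (ler_normD _ _)); rewrite lerD2r ler_normD.
  by apply: powR_sum3_le; rewrite ?(ltW p0).
rewrite ge0_integralD//; last 3 first.
- by move=> x _; rewrite adde_ge0.
- by apply: emeasurable_funD; exact: mp.
- exact: mp.
rewrite ge0_integralD//; [|exact: mp|exact: mp].
apply: (@le_trans _ _ ((3 `^ p)%:E * (dd%:E + dd%:E + dd%:E))%E).
  apply: lee_wpmul2l; first by rewrite lee_fin ltW.
  exact: (leeD (leeD b1 b2) b3).
rewrite -!EFinD -EFinM lee_fin /dd le_eqVlt; apply/orP; left; apply/eqP.
by field; rewrite gt_eqF.
Qed.

End Lp_continuity.

(** The factor [3^p] is lost in recovering [f] from [P_h f] for a small [h], [2 * p] is the constant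
    of [bregman_le], and the last factor is that of [jump_energy_chi]. *)
Definition jump_const {R : realType} (p : R) : R := 3 `^ p * (2 * p) * (2 * (p / 2) ^+ 2).

(** The inner inverse is the Young parameter [e] for which the maximal term takes up at most half of
    the left side; the leading [2] comes from absorbing that half. The [+ 1] keeps the denominator
    positive. *)
Definition lower_const {R : realType} (p : R) : R :=
  2 * jump_const p *
  (((2 * jump_const p * (maximal_const p + 1))^-1)^-1 `^ ((p - 2) / 2)).

Lemma jump_const_gt0 (R : realType) (p : R) : 2 <= p -> 0 < jump_const p.
Proof.
move=> p2; rewrite /jump_const !mulr_gt0 ?powR_gt0 ?exprn_gt0 ?divr_gt0//; lra.
Qed.

Lemma lower_const_gt0 (R : realType) (p : R) : 2 <= p -> 0 < lower_const p.
Proof.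
move=> p2; have j0 := jump_const_gt0 p2; have p1 : 1 < p by lra.
have M0 := maximal_const_ge0 p1.
by rewrite /lower_const invrK !mulr_gt0 ?powR_gt0 ?mulr_gt0//; lra.
Qed.

(** * The two bounds for abstract kernels *)

Section lower_bound.
Context d (T : measurableType d) (R : realType).
Variables (m : {sigma_finite_measure set T -> \bar R}) (K : R.-sfker (R * T) ~> T)
  (Jk : R.-sfker T ~> T).
Hypothesis K1 : forall z, (K z setT <= 1)%E.
Hypothesis K_semi : forall (s t : R) x (g : T -> \bar R), 0 <= s -> 0 <= t ->
  measurable_fun setT g -> (forall y, 0 <= g y)%E ->
  (\int[K ((s + t)%R, x)]_y g y = \int[K (s, x)]_y \int[K (t, y)]_z g z)%E.
Hypothesis K_sym : forall (t : R) (f g : T -> \bar R), 0 <= t ->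
  measurable_fun setT f -> (forall y, 0 <= f y)%E ->
  measurable_fun setT g -> (forall y, 0 <= g y)%E ->
  (\int[m]_x (f x * \int[K (t, x)]_y g y) = \int[m]_x (g x * \int[K (t, x)]_y f y))%E.
Hypothesis K_cont : forall g : T -> R, measurable_fun setT g ->
  (\int[m]_x ((g x) ^+ 2)%:E < +oo)%E -> forall e : R, 0 < e -> exists2 dl : R,
  0 < dl & forall t, 0 <= t -> t <= dl ->
    (\int[m]_x ((ksem K t g x - g x) ^+ 2)%:E <= e%:E)%E.
Hypothesis Jk_sym : forall g : T * T -> \bar R, measurable_fun setT g ->
  (forall z, 0 <= g z)%E ->
  (\int[m]_x \int[Jk x]_y g (x, y) = \int[m]_x \int[Jk x]_y g (y, x))%E.
Hypothesis H_form : forall v : T -> R, measurable_fun setT v ->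
  (\int[m]_x ((v x) ^+ 2)%:E < +oo)%E ->
  (forall k, approx_energy m K k v <= approx_energy m K k.+1 v) /\
  (forall C : R, (forall k, approx_energy m K k v <= C) ->
    (approx_energy m K k v)%:E @[k --> \oo] --> (2^-1%:E * jump_energy m Jk v)%E).
Variables (p : R) (f : T -> R).
Hypothesis mf : measurable_fun setT f.
Hypothesis fp : (\int[m]_x (`|f x| `^ p)%:E < +oo)%E.

Lemma square_function_upper : 1 < p -> p <= 2 ->
  (\int[m]_x (square_function K Jk f x `^ (p / 2)) <=
   (((2 / p) ^+ 2) `^ (p / 2) * (maximal_const p + (Num.min 1 (p - 1) / 2)^-1))%:E *
   \int[m]_x (`|f x| `^ p)%:E)%E.
Proof.
move=> p1 p2; have [fs [mfs fs0 fsp Kfs]] := maximal_function K1 K_semi K_sym K_cont p1 mf fp.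
exact: (square_function_le K1 K_semi K_sym H_form p1 mf fp mfs fs0 fsp Kfs p2).
Qed.

Lemma square_function_lower : 2 <= p -> pmass m K p f N%:R @[N --> \oo] --> (0 : R) ->
  (\int[m]_x (`|f x| `^ p)%:E <=
   (lower_const p)%:E * \int[m]_x (square_function K Jk f x `^ (p / 2)))%E.
Proof.
move=> p2 stab; have p1 : 1 < p by lra.
have [fs [mfs fs0 fsp Kfs]] := maximal_function K1 K_semi K_sym K_cont p1 mf fp.
have Kfin t : 0 <= t -> {ae m, forall x, (\int[K (t, x)]_y (`|f y|)%:E < +oo)%E}.
  by move=> t0; apply: filterS (Kfs t t0) => x /le_lt_trans; apply; rewrite ltry.
have young := fun e => time_jump_energy_young (e := e) Jk_sym p1 mf mfs fs0 fsp Kfs p2.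
have jle := time_jump_energy_le K1 K_semi K_sym H_form p1 mf fp.
have ple := fun k N => pmass_le_jump_energy K1 K_semi K_sym H_form p1 mf fp k N p2.
have pE := fun t t0 => pmassE K1 K_sym p1 mf fp (t := t) t0.
have cont := Lp_continuity K1 K_sym K_cont p2 mf fp Kfin.
move: young jle ple; set Jt := (\int[_]_(t in _) _)%E.
set Bq := (\int[m]_x (_ `^ (p / 2)))%E => young jle ple.
have Bq0 : (0 <= Bq)%E by apply: integral_ge0 => x _; exact: poweR_ge0.
have Jt0 : (0 <= Jt)%E.
  by apply: integral_ge0 => t _; apply: integral_ge0 => x _; apply: integral_ge0 => y _;
    rewrite lee_fin sqr_ge0.
have A00 : (0 <= \int[m]_x (`|f x| `^ p)%:E)%E by apply: integral_ge0 => x _; rewrite lee_fin powR_ge0.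
have pp0 : 0 < p by lra.
have j0 := jump_const_gt0 p2; have M0 := maximal_const_ge0 p1.
have L0 := lower_const_gt0 p2.
(* An infinite right side leaves nothing to prove; otherwise all quantities are finite and the
   estimates become real ones, which allows the absorption. *)
have [Boo|Bfin] := eqVneq Bq +oo%E.
  by rewrite Boo gt0_muley ?leey// lte_fin.
have BqE : Bq = (fine Bq)%:E.
  by rewrite fineK// ge0_fin_numE// lt_neqAle Bfin leey.
have A0E : (\int[m]_x (`|f x| `^ p)%:E)%E = (fine (\int[m]_x (`|f x| `^ p)%:E)%E)%:E.
  by rewrite fineK// ge0_fin_numE.
set a := fine (\int[m]_x _)%E in A0E.
have a0 : 0 <= a by rewrite fine_ge0.
pose e := (2 * jump_const p * (maximal_const p + 1))^-1.
have e0 : 0 < e by rewrite invr_gt0 mulr_gt0 ?(mulr_gt0 _ j0) ?(ltr_wpDl M0).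
have Jle : (Jt <= (2 * (p / 2) ^+ 2 * (e * maximal_const p * a +
    e^-1 `^ ((p - 2) / 2) * fine Bq))%:E)%E.
  by have := young e e0; rewrite A0E BqE.
have JtE : Jt = (fine Jt)%:E.
  by rewrite fineK// ge0_fin_numE//; exact: le_lt_trans Jle (ltry _).
move: Jle; rewrite JtE lee_fin; set j := fine Jt; set b := fine Bq => Jle.
(* Strong stability removes the mass at time [N] as [N] tends to infinity. *)
have pj k : pmass m K p f (dyad R k) <= 2 * p * j.
  have h N : pmass m K p f (dyad R k) - pmass m K p f N%:R <= 2 * p * j.
    by have := ple k N; rewrite JtE -EFinM lee_fin.
  have cv : pmass m K p f (dyad R k) - pmass m K p f N%:R @[N --> \oo] -->
      pmass m K p f (dyad R k) - 0 by apply: cvgB => //; exact: cvg_cst.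
  rewrite subr0 in cv; rewrite -(cvg_lim (@Rhausdorff R) cv); apply: limr_le; last exact: nearW.
  by apply/cvg_ex; eexists; exact: cv.
(* From time [dyad k] back to time [0]: [f] is the sum of [P_h f] and [f - P_h f], with [0] as third
   term in [powR_sum3_le], and [Lp_continuity] provides [k]. *)
have aj : a <= 3 `^ p * (2 * p * j).
  apply/ler_addgt0Pr => e1 e10.
  have c3 : 0 < 3 `^ p :> R by rewrite powR_gt0.
  have [k hk] := cont (e1 / 3 `^ p) (divr_gt0 e10 c3).
  rewrite -lee_fin -A0E.
  have mp (w : T -> R) : measurable_fun setT w -> measurable_fun setT (fun x => (`|w x| `^ p)%:E).
    by move=> mw; apply/measurable_EFinP/measurable_norm_powR.
  have mU := measurable_ksem K (dyad R k) mf.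
  have mD : measurable_fun setT (fun x => f x - ksem K (dyad R k) f x) by exact: measurable_funB.
  apply: (@le_trans _ _ ((3 `^ p)%:E * \int[m]_x ((`|ksem K (dyad R k) f x| `^ p)%:E +
      (`|f x - ksem K (dyad R k) f x| `^ p)%:E))%E).
    rewrite -ge0_integralZl_EFin ?(ltW c3)//; last 2 first.
    - by move=> x _; rewrite adde_ge0// lee_fin powR_ge0.
    - by apply: emeasurable_funD; exact: mp.
    apply: ge0_le_integral => //.
    - exact: mp.
    - by apply: measurable_funeM; apply: emeasurable_funD; exact: mp.
    move=> x _; rewrite -EFinD -EFinM lee_fin; set w := ksem _ _ _ _.
    have := powR_sum3_le (ltW pp0) (normr_ge0 w) (normr_ge0 (f x - w)) (lexx 0).
    rewrite addr0 (powR0 (lt0r_neq0 pp0)) addr0.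
    apply: le_trans; apply: ge0_ler_powR; rewrite ?nnegrE ?addr_ge0 ?(ltW pp0)//.
    by rewrite (le_trans _ (ler_normD _ _))// subrKC.
  rewrite ge0_integralD//; [|exact: mp|exact: mp].
  rewrite -(pE _ (ltW (dyad_gt0 R k))).
  apply: (@le_trans _ _ ((3 `^ p)%:E * ((2 * p * j)%:E + (e1 / 3 `^ p)%:E))%E).
    by rewrite lee_wpmul2l ?lee_fin ?(ltW c3)// leeD// lee_fin.
  rewrite -EFinD -EFinM lee_fin le_eqVlt; apply/orP; left; apply/eqP.
  by field; rewrite gt_eqF.
rewrite A0E BqE -/b -EFinM lee_fin.
pose ce := e^-1 `^ ((p - 2) / 2).
have h1 : a <= jump_const p * (e * maximal_const p * a + ce * b).
  apply: (le_trans aj).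
  set X := _ + _; rewrite (_ : jump_const p * X = 3 `^ p * (2 * p * (2 * (p / 2) ^+ 2 * X))); last first.
    by rewrite /jump_const; ring.
  apply: ler_wpM2l; first exact: powR_ge0.
  by apply: ler_wpM2l; [rewrite mulr_ge0// ltW|exact: Jle].
have h2 : jump_const p * (e * maximal_const p * a) <= a / 2.
  have [J0 M1] : jump_const p != 0 /\ maximal_const p + 1 != 0.
    by split; rewrite gt_eqF// (ltr_wpDl M0).
  rewrite (_ : jump_const p * _ = a / 2 * (maximal_const p / (maximal_const p + 1))); last first.
    by rewrite /e; move: (jump_const p) (maximal_const p) J0 M1 => J M J0 M1; field; rewrite M1 J0.
  rewrite -[leRHS]mulr1; apply: ler_wpM2l; first by rewrite divr_ge0.
  by rewrite ler_pdivrMr ?mul1r ?lerDl ?(ltr_wpDl M0).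
have h3 : lower_const p * b = 2 * (jump_const p * (ce * b)) by rewrite /lower_const -/e -/ce; ring.
by rewrite h3; rewrite mulrDr in h1; lra.
Qed.

End lower_bound.

(** * The transition kernel of a Hunt process *)

Definition precompact_base (E : topologicalType) (U : nat -> set E) :=
  [/\ forall n, open (U n), forall n, compact (closure (U n)) &
      forall x (V : set E), nbhs x V -> exists n, U n x /\ closure (U n) `<=` V].

Lemma ball_halves (R : realType) (E : pseudoMetricType R) (x y : E) (r : R) :
  0 < r -> ball x (r / 4) y -> closure (ball y (r / 4)) `<=` ball x r.
Proof.
move=> r0 xy z cz; have r4 : 0 < r / 4 by lra.
have [w [yw zw]] := cz _ (nbhsx_ballx z _ r4).
have := ball_triangle (ball_triangle xy yw) (ball_sym zw).
by apply: le_ball; lra.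
Qed.

(** Interiors of balls of radius [1/(k+1)] about a countable dense set, replaced by the empty set
    when the closure is not compact. Local compactness makes small balls qualify, and [r / 4] leaves
    room for the closure inside [ball x r]. *)
Lemma exists_precompact_base (R : realType) (E : pmetricType R) :
  locally_compact [set: E] -> (exists S : set E, countable S /\ dense S) ->
  exists U : nat -> set E, precompact_base U.
Proof.
move=> lc [S [/countable_injP [phi phi_inj] dS]].
pose g n : E := xget point [set s | S s /\ phi s = n].
have gphi s : S s -> g (phi s) = s.
  move=> Ss; rewrite /g; case: xgetP => [z _ [Sz zs]|/(_ s)]; last by case.
  by apply: phi_inj; rewrite ?inE.
pose B (nk : nat * nat) := ball (g nk.1) (nk.2.+1%:R^-1 : R).
pose U n : set E := if unpickle n is Some nk then
  (if pselect (compact (closure (B nk))) then interior (B nk) else set0) else set0.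
exists U; split.
- move=> n; rewrite /U; case: (unpickle n) => [nk|]; last exact: open0.
  by case: pselect => h /=; [exact: open_interior|exact: open0].
- move=> n; rewrite /U; case: (unpickle n) => [nk|]; last by rewrite closure0; exact: compact0.
  case: pselect => h /=; last by rewrite closure0; exact: compact0.
  apply: (subclosed_compact _ h); first exact: closed_closure.
  by apply: closureS; exact: interior_subset.
- move=> x V xV; have := lc x I; rewrite /= withinET => -[W xW [cW clW]].
  have : nbhs x (V `&` W) by exact: filterI.
  move=> xVW; have [r /= r0 rVW] := (nbhs_ballP x (V `&` W)).1 xVW.
  have r4 : 0 < r / 4 by lra.
  pose k := Num.truncn (r / 4)^-1; pose e : R := k.+1%:R^-1.
  have e0 : 0 < e by rewrite invr_gt0.
  have er : e <= r / 4.
    rewrite /e -[r / 4]invrK lef_pV2 ?posrE ?invr_gt0//.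
    by rewrite ltW// truncnS_gt.
  have e2 : 0 < e / 2 by lra.
  have [s [xs Ss]] : (interior (ball x (e / 2)) `&` S) !=set0.
    apply: dS; last exact: open_interior.
    by exists x; apply: nbhs_singleton; apply: nbhs_interior; exact: nbhsx_ballx.
  have {}xs := interior_subset xs.
  have cB : closure (ball s e) `<=` ball x r.
    have xs4 : ball x (r / 4) s by apply: le_ball xs; lra.
    apply: subset_trans (ball_halves r0 xs4); apply: closureS; exact: le_ball.
  have cpt : compact (closure (ball s e)).
    apply: subclosed_compact cW _; first exact: closed_closure.
    by apply: subset_trans cB _ => z /rVW [].
  exists (pickle (phi s, k)); rewrite /U pickleK.
  have BE : B (phi s, k) = ball s e by rewrite /B /= gphi.
  rewrite BE; case: pselect => h; last by case: (h cpt).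
  split => /=.
    apply: filterS (nbhsx_ballx x _ e2) => z xz.
    rewrite (splitr e); apply: ball_triangle xz; exact: ball_sym.
  apply: subset_trans (closureS (@interior_subset _ _)) _.
  by apply: subset_trans cB _ => z /rVW [].
Qed.

Lemma borel_open (E : ptopologicalType) (V : set E) :
  open V -> measurable (V : set (borel E)).
Proof. by move=> oV; exact: sub_sigma_algebra. Qed.

Lemma borel_closed (E : ptopologicalType) (V : set E) :
  closed V -> measurable (V : set (borel E)).
Proof.
move=> cV; rewrite -(setCK V); apply: measurableC.
by apply: borel_open; exact: closed_openC.
Qed.

Lemma measurable_fun_borel d (T : measurableType d) (E : ptopologicalType) (h : T -> borel E) :
  (forall V : set E, open V -> measurable (h @^-1` V)) -> measurable_fun setT h.
Proof.
move=> H; apply: (@measurability _ _ _ (borel E) setT h open erefl).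
by move=> _ [V oV <-]; rewrite setTI; exact: H.
Qed.

Lemma closed_some (E : topologicalType) (C : set E) : compact C -> closed C ->
  closed (Some @` C : set (with_cemetery E)).
Proof.
move=> cC clC; rewrite -openC openE => -[x|] nx /=; last first.
  exists C => //; move=> z [[y nCy <-]|->]; last by case.
  by move=> [w Cw] [] wy; apply: nCy; rewrite -wy.
rewrite /interior /=; have nCx : (~` C) x by move=> Cx; apply: nx; exists x.
have := open_nbhs_nbhs (conj (closed_openC clC) nCx).
move=> /one_point_compactification_some_nbhs; apply: filterS => _ [y nCy <-] [w Cw] [] wy.
by apply: nCy; rewrite -wy.
Qed.

Lemma measurable_some_image (E : ptopologicalType) (B : set (borel E)) :
  measurable B -> measurable (Some @` B : set (borel (with_cemetery E))).
Proof.
pose G : set (set (borel E)) := [set B | measurable (Some @` B : set (borel (with_cemetery E)))].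
have mS : measurable (Some @` setT : set (borel (with_cemetery E))).
  by apply: borel_open; apply: one_point_compactification_open_some; exact: openT.
have sG : sigma_algebra setT G.
  split; rewrite /G/=.
  - by rewrite image_set0.
  - move=> A mA; rewrite (_ : Some @` _ = (Some @` setT) `\` (Some @` A)); first exact: measurableD.
    apply/seteqP; split => [_ [x [_ nAx] <-]|_ [[x _ <-] nAx]].
      by split; [exists x|move=> [y Ay [yx]]; apply: nAx; rewrite -yx].
    by exists x => //; split => // Ax; apply: nAx; exists x.
  - by move=> F mF; rewrite image_bigcup; exact: bigcup_measurable.
move=> mB; apply: (smallest_sub sG _ mB) => V oV.
by apply: borel_open; exact: one_point_compactification_open_some.
Qed.

Section partial_dirac.
Context d d' (X : measurableType d) (Y : measurableType d') (R : realType).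
Variables (A : set X) (h : X -> Y).

(** Composing a kernel with this one restricts it to [A] and takes the image under [h]. It will
    discard the paths that have reached the cemetery. *)
Definition partial_dirac of measurable A & measurable_fun setT h :
    X -> {measure set Y -> \bar R} :=
  fun x => if x \in A then (dirac (h x) : {measure set Y -> \bar R}) else mzero.

Hypothesis mA : measurable A.
Hypothesis mh : measurable_fun setT h.

Lemma partial_diracE x (B : set Y) :
  partial_dirac mA mh x B = (\1_(A `&` h @^-1` B) x)%:E.
Proof.
by rewrite /partial_dirac indicE in_setI; case: (x \in A).
Qed.

Let measurable_partial_dirac B : measurable B ->
  measurable_fun setT (partial_dirac mA mh ^~ B).
Proof.
move=> mB; rewrite (_ : (fun x => partial_dirac mA mh x B) = (fun x => (\1_(A `&` h @^-1` B) x)%:E)); last first.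
  by apply/funext => x; rewrite partial_diracE.
apply/measurable_EFinP; apply: measurable_indic; apply: measurableI => //.
by rewrite -[X in measurable X]setTI; exact: mh.
Qed.

HB.instance Definition _ :=
  isKernel.Build _ _ X Y R (partial_dirac mA mh) measurable_partial_dirac.

Let partial_dirac_uub : measure_fam_uub (partial_dirac mA mh).
Proof.
exists 2 => x; rewrite partial_diracE lte_fin indicE.
by case: (_ \in _) => /=; rewrite ?ltr0n// ltr1n.
Qed.

HB.instance Definition _ :=
  Kernel_isFinite.Build _ _ X Y R (partial_dirac mA mh) partial_dirac_uub.

Lemma integral_partial_dirac x (g : Y -> \bar R) : measurable_fun setT g ->
  (forall y, 0 <= g y)%E ->
  (\int[partial_dirac mA mh x]_y g y = (\1_A x)%:E * g (h x))%E.
Proof.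
move=> mg g0; rewrite /partial_dirac indicE; case: (x \in A).
  by rewrite integral_dirac// diracT mul1e.
by rewrite integral_measure_zero mul0e.
Qed.

End partial_dirac.

Lemma partial_image_kernel d1 d2 d3 (X : measurableType d1) (Y : measurableType d2)
    (Z : measurableType d3) (R : realType) (l : R.-sfker X ~> Y)
    (A : set (X * Y)) (h : X * Y -> Z) : measurable A -> measurable_fun setT h ->
  exists K : R.-sfker X ~> Z,
   (forall x B, measurable B -> K x B = l x [set y | A (x, y) /\ B (h (x, y))]) /\
   (forall x (g : Z -> \bar R), measurable_fun setT g -> (forall z, 0 <= g z)%E ->
     (\int[K x]_z g z = \int[l x]_y ((\1_A (x, y))%:E * g (h (x, y))))%E).
Proof.
move=> mA mh; exists (l \; partial_dirac R mA mh)%E; split => [x B mB|x g mg g0].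
  rewrite /= /kcomp; under eq_integral do rewrite partial_diracE.
  have mS : measurable (A `&` h @^-1` B).
    by apply: measurableI => //; rewrite -[X in measurable X]setTI; exact: mh.
  have mSx : measurable (xsection (A `&` h @^-1` B) x) by exact: measurable_xsection.
  rewrite (eq_integral (fun y => (\1_(xsection (A `&` h @^-1` B) x) y)%:E)); last first.
    move=> y _; rewrite !indicE; congr ((nat_of_bool _)%:R%:E).
    by rewrite mem_xsection.
  rewrite integral_indic// setIT; congr (l x _).
  by apply/seteqP; split => y; rewrite /xsection /= inE.
rewrite [LHS](integral_kcomp l (partial_dirac R mA mh) x g0 mg).
by apply: eq_integral => y _; rewrite integral_partial_dirac.
Qed.

Lemma sigma_finite_borel (R : realType) (E : pmetricType R)
    (m : {measure set (borel E) -> \bar R}) (U : nat -> set E) :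
  precompact_base U -> (forall K : set E, compact K -> (m K < +oo)%E) ->
  sigma_finite setT m.
Proof.
move=> [oU cU bU] mK; exists U.
  apply/seteqP; split => // x _; have [n [Ux _]] := bU x setT filterT.
  by exists n.
move=> n; split; first exact: borel_open.
apply: le_lt_trans (mK _ (cU n)); apply: le_measure; rewrite ?inE.
- exact: borel_open.
- by apply: borel_closed; exact: closed_closure.
- exact: subset_closure.
Qed.

Section joint_measurability.
Context (R : realType) (E : pmetricType R) (X : process E).
Hypothesis hX : hunt X.
Variable U : nat -> set E.
Hypothesis baseU : precompact_base U.

(** The successor makes the grid time strictly later than [t], so that right-continuity along [t^'+]
    applies. *)
Definition grid_time (n : nat) (t : R) : R := (Num.truncn (t * 2 ^+ n)).+1%:R / 2 ^+ n.

Lemma grid_time_cvg (t : R) : 0 <= t -> grid_time n t @[n --> \oo] --> t^'+.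
Proof.
move=> t0 V /= [e /= e0 eV]; have [k hk] := dyad_small e0.
have g2 n : 0 < 2 ^+ n :> R by rewrite exprn_gt0.
exists k.+2 => // n /= kn; apply: eV.
- have t2 : 0 <= t * 2 ^+ n by rewrite mulr_ge0// ltW.
  have /andP[h1 _] := truncn_itv t2.
  rewrite /= ltr0_norm; last by rewrite subr_lt0 ltr_pdivlMr// truncnS_gt.
  rewrite opprB ltrBlDl ltr_pdivrMr// -natr1 mulrDl.
  apply: (@lt_le_trans _ _ (t * 2 ^+ n + dyad R k * 2 ^+ n)); last first.
    by rewrite lerD2l ler_pM2r.
  apply: ler_ltD => //; rewrite /dyad exprVn mulrC ltr_pdivlMr// mul1r.
  by rewrite ltr_eXn2l// ltr1n.
- by rewrite /= ltr_pdivlMr// truncnS_gt.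
Qed.

(** Negative times are sent to [0], since the paths are only controlled from time [0] on. *)
Let path_joint (z : R * omega X) : with_cemetery E := sample_path X (Num.max 0 z.1) z.2.

Lemma measurable_path (t : R) (B : set (borel (with_cemetery E))) : 0 <= t ->
  measurable B -> measurable (sample_path X t @^-1` B).
Proof. by move=> t0 mB; apply: (hunt_sub hX t0); exact: hunt_adapted. Qed.

(** The path is in [V] at [t] exactly when, for some basic set with closure in [V], it lies in that
    closure at all late grid times: openness gives one direction by right-continuity, closedness the
    other. Each grid time takes countably many values, so these events are measurable. *)
Lemma measurable_path_joint (V : set E) : open V ->
  measurable [set z : R * omega X | (Some @` V : set (with_cemetery E)) (path_joint z)].
Proof.
move=> oV; have [oU cU bU] := baseU.
pose P n k : set (R * omega X) :=
  [set z | (Some @` (closure (U n)) : set (with_cemetery E))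
    (sample_path X (grid_time k (Num.max 0 z.1)) z.2)].
have mP n k : measurable (P n k).
  have -> : P n k = \bigcup_j ([set t : R | Num.truncn (Num.max 0 t * 2 ^+ k) = j] `*`
      (sample_path X (j.+1%:R / 2 ^+ k) @^-1` (Some @` (closure (U n))))).
    apply/seteqP; split => [[t w] /= Pt|[t w] [j _ [/= <-]]//].
    by exists (Num.truncn (Num.max 0 t * 2 ^+ k)).
  apply: bigcup_measurable => j _; apply: measurableX.
    have mt : measurable_fun setT (fun t : R => Num.max 0 t * 2 ^+ k).
      by apply: measurable_funM => //; exact: measurable_maxr.
    have -> : [set t : R | Num.truncn (Num.max 0 t * 2 ^+ k) = j] =
        (fun t : R => Num.max 0 t * 2 ^+ k) @^-1` `[j%:R, j.+1%:R[%classic.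
      apply/seteqP; split => t /=; rewrite in_itv/=; set a := _ * _.
        have a0 : 0 <= a by rewrite mulr_ge0 ?exprn_ge0// le_max lexx.
        by move=> <-; exact: truncn_itv.
      by move=> h; apply: truncn_def.
    by rewrite -[X in measurable X]setTI; exact: mt.
  apply: measurable_path; first by rewrite divr_ge0// exprn_ge0.
  by apply: borel_closed; apply: closed_some => //; exact: closed_closure.
rewrite (_ : [set z | _] = \bigcup_(n in [set n | closure (U n) `<=` V])
    \bigcup_N \bigcap_(k in [set k | (N <= k)%N]) P n k).
  apply: bigcup_measurable => n _; apply: bigcup_measurable => N _.
  by apply: bigcap_measurable => //; exists N => /=.
apply/seteqP; split => [[t w]|[t w] [n /= UV [N _ hP]]].
- move=> /= -[x Vx px]; have t0 : 0 <= Num.max 0 t by rewrite le_max lexx.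
  have [n [Ux UV]] := bU x V (open_nbhs_nbhs (conj oV Vx)).
  exists n => //; have cv := @hunt_right_continuous _ _ _ hX _ w t0.
  have cvg : sample_path X (grid_time k (Num.max 0 t)) w @[k --> \oo] --> path_joint (t, w).
    exact: (cvg_comp _ _ (grid_time_cvg t0) cv).
  have Vn : nbhs (path_joint (t, w)) (Some @` U n : set (with_cemetery E)).
    rewrite -px; apply: one_point_compactification_some_nbhs.
    by apply: open_nbhs_nbhs; split.
  have [N _ hN] := cvg _ Vn.
  exists N => // k /= Nk; have [y Uy e] := hN k Nk.
  by exists y; [exact: subset_closure|exact: e].
- have t0 : 0 <= Num.max 0 t by rewrite le_max lexx.
  have cv := @hunt_right_continuous _ _ _ hX _ w t0.
  have cvg : sample_path X (grid_time k (Num.max 0 t)) w @[k --> \oo] --> path_joint (t, w).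
    exact: (cvg_comp _ _ (grid_time_cvg t0) cv).
  have cl : closed (Some @` closure (U n) : set (with_cemetery E)).
    by apply: closed_some => //; exact: closed_closure.
  have : (Some @` closure (U n) : set (with_cemetery E)) (path_joint (t, w)).
    apply: cl => V' nV'; have [N' _ hN'] := cvg V' nV'.
    exists (sample_path X (grid_time (maxn N N') (Num.max 0 t)) w); split.
      by apply: hP => /=; exact: leq_maxl.
    by apply: hN' => /=; exact: leq_maxr.
  by move=> [x cx <-]; exists x => //; exact: UV.
Qed.

Definition alive : set (R * omega X) := [set z | path_joint z <> None].

Lemma measurable_alive : measurable alive.
Proof.
rewrite (_ : alive = [set z | (Some @` setT : set (with_cemetery E)) (path_joint z)]).
  by apply: measurable_path_joint; exact: openT.
apply/seteqP; split => z; rewrite /alive /=; last by move=> [x _ <-].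
by case: (path_joint z) => [x _|//]; exists x.
Qed.

(** The value at the cemetery is arbitrary; it is only used together with [alive]. *)
Definition position (z : R * omega X) : borel E := odflt point (path_joint z).

Lemma measurable_position : measurable_fun setT position.
Proof.
apply: measurable_fun_borel => V oV.
rewrite (_ : _ @^-1` _ = [set z | (Some @` V : set (with_cemetery E)) (path_joint z)] `|`
    (if pselect (V point) then ~` alive else set0)).
  apply: measurableU; first exact: measurable_path_joint.
  by case: pselect => h /=; [apply: measurableC; exact: measurable_alive|].
apply/seteqP; split => z; rewrite /position /=.
- case e : (path_joint z) => [x|] /= Vx; first by left; exists x.
  by right; case: pselect => h //=; rewrite /alive /= => h'; apply: h'.
- move=> [[x Vx <-]//|]; case: pselect => Vp //=; rewrite /alive /=.
  by case: (path_joint z) => [x|//]; case.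
Qed.

(** The gain over [Pt] is joint measurability in time and starting point, which makes Tonelli in [t]
    available. The kernel is the image under [position] of the law restricted to [alive], hence
    s-finite and of mass at most one. *)
Lemma transition_kernel : exists K : R.-sfker (R * borel E)%type ~> borel E,
  (forall z, K z setT <= 1)%E /\
  (forall t x B, measurable B -> 0 <= t ->
     K (t, x) B = law X (Some x) (sample_path X t @^-1` (Some @` B))) /\
  (forall (t : R) x (g : borel E -> \bar R), 0 <= t -> measurable_fun setT g ->
     (forall y, 0 <= g y)%E ->
     (\int[K (t, x)]_y g y =
      \int[law X (Some x)]_w oapp g 0 (sample_path X t w))%E).
Proof.
have msome : measurable_fun setT (fun z : R * borel E => (Some z.2 : borel (with_cemetery E))).
  apply: (measurableT_comp _ measurable_snd).
  apply: measurable_fun_borel => V oV; apply: borel_open.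
  apply: open_comp oV => x _; exact: one_point_compactification_some_continuous.
pose l : R.-sfker (R * borel E)%type ~> omega X := kprecomp (law X) msome.
pose phi (z : (R * borel E) * omega X) : R * omega X := (z.1.1, z.2).
have mphi : measurable_fun setT phi.
  by apply: measurable_fun_pair => //; exact: measurableT_comp.
have mA : measurable (phi @^-1` alive).
  by rewrite -[X in measurable X]setTI; apply: mphi => //; exact: measurable_alive.
have mh : measurable_fun setT (position \o phi).
  exact: (measurableT_comp measurable_position mphi).
have [K [KE KI]] := partial_image_kernel l mA mh.
exists K; split; last split => [t x B mB t0|t x g t0 mg g0].
- move=> z; rewrite KE//.
  rewrite (_ : [set y | _] = xsection (phi @^-1` alive) z); last first.
    by apply/seteqP; split => w; rewrite /xsection /= inE => // -[].
  apply: (@le_trans _ _ (l z setT)); last by rewrite /l /kprecomp prob_kernel.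
  by apply: le_measure; rewrite ?inE//; exact: measurable_xsection.
-
rewrite KE//; congr (law X _ _); apply/seteqP; split => w /=;
    rewrite /alive /position /path_joint /= max_r//.
    by case: (sample_path X t w) => [y [_ By]|[]//]; exists y.
  by move=> [y By <-].
- rewrite KI//; apply: eq_integral => w _.
rewrite indicE /position /path_joint /= max_r//.
case e : (sample_path X t w) => [y|] /=.
  by rewrite mem_set ?mul1e// /alive /path_joint /= max_r// e.
by rewrite memNset ?mul0e// /alive /path_joint /= max_r// e; exact.
Qed.

End joint_measurability.

Lemma Lfun_finP d (T : measurableType d) (R : realType) (m : {measure set T -> \bar R})
    (p : R) (f : T -> R) : 0 < p ->
  f \in Lfun m p%:E <->
  measurable_fun setT f /\ (\int[m]_x (`|f x| `^ p)%:E < +oo)%E.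
Proof.
move=> p0; have e : ('N[m]_p%:E[EFin \o f] `^ p = \int[m]_x (`|f x| `^ p)%:E)%E.
  by rewrite poweR_Lnorm ?gt_eqF.
split.
  move=> /andP[mf ff]; split; first by move: mf; rewrite inE.
  by move: ff; rewrite inE /= /finite_norm -e => /poweR_lty.
move=> [mf ff]; apply/andP; split; first by rewrite inE.
rewrite inE /= /finite_norm; apply: (@lty_poweRy _ _ p); first by rewrite gt_eqF.
by rewrite e.
Qed.

Lemma L2P (R : realType) (E : pmetricType R) (m : {measure set (borel E) -> \bar R})
    (f : E -> R) : L2 m f <->
  measurable_fun setT (f : borel E -> R) /\ (\int[m]_x ((f x) ^+ 2)%:E < +oo)%E.
Proof.
rewrite /L2 /= Lfun_finP//.
rewrite (eq_integral (fun x : borel E => ((f x) ^+ 2)%:E))// => x _.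
by rewrite powR_mulrn// real_normK// num_real.
Qed.

(** * Semigroup law, continuity and symmetry of the transition kernel *)

Section transition_properties.
Context (R : realType) (E : pmetricType R) (X : process E).
Hypothesis hX : hunt X.
Variable K : R.-sfker (R * borel E)%type ~> borel E.
Hypothesis KE : forall t x B, measurable B -> 0 <= t ->
  K (t, x) B = law X (Some x) (sample_path X t @^-1` (Some @` B)).
Hypothesis KI : forall (t : R) x (g : borel E -> \bar R), 0 <= t -> measurable_fun setT g ->
  (forall y, 0 <= g y)%E ->
  (\int[K (t, x)]_y g y = \int[law X (Some x)]_w oapp g 0 (sample_path X t w))%E.

Lemma Pt_ksem (t : R) (f : borel E -> R) x : 0 <= t -> measurable_fun setT f ->
  Pt X t f x = ksem K t f x.
Proof.
move=> t0 mf; rewrite /Pt /ksem /Rintegral; congr fine.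
have mfE : measurable_fun setT (EFin \o f) by exact/measurable_EFinP.
rewrite integralE [RHS]integralE; congr (_ - _)%E.
- rewrite KI//; last exact: measurable_funepos.
  apply: eq_integral => w _; rewrite funeposE.
  by case: (sample_path X t w) => [y|] //=; rewrite ?funeposE// maxxx.
- rewrite KI//; last exact: measurable_funeneg.
  apply: eq_integral => w _; rewrite funenegE.
  case: (sample_path X t w) => [y|] /=; first by rewrite funenegE.
  by rewrite oppr0 maxxx.
Qed.

Lemma law_cemetery (t : R) (B : set E) : 0 <= t -> measurable (B : set (borel E)) ->
  law X None (sample_path X t @^-1` (Some @` B)) = 0%E.
Proof.
move=> t0 mB; have ms := measurable_some_image mB.
have mN : measurable [set w | sample_path X 0 w = None].
  apply: (hunt_sub hX (lexx 0)); apply: (hunt_adapted hX (B := [set None])) => //.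
  rewrite (_ : [set None] = ~` (Some @` [set: E])).
    by apply: measurableC; exact: (@measurable_some_image E setT measurableT).
  by apply/seteqP; split => [_ -> [] //|[x|//]] /(_ _)/= h; exfalso; apply: h; exists x.
have e : law X None (~` [set w | sample_path X 0 w = None]) = 0%E.
  have h := measureU (law X None) mN (measurableC mN) (setICr _).
  have lT : law X None setT = 1%E by exact: prob_kernel.
  rewrite setUCr in h.
  have : (1 = 1 + law X None (~` [set w | sample_path X 0 w = None]))%E.
    exact: (etrans (esym lT) (etrans h (congr1 (fun z => z + _)%E (hunt_start hX (None : with_cemetery E))))).
  by case: (law X None (~` _)) => [r [h1]|//|//]; congr EFin; lra.
apply/eqP; rewrite eq_le measure_ge0 andbT -e; apply: le_measure; rewrite ?inE.
- exact: measurable_path.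
- exact: measurableC.
- by move=> w [y _ yw] /(hunt_cemetery hX (lexx 0) t0); rewrite -yw.
Qed.

Lemma filtration_setT t : 0 <= t -> filtration X t setT.
Proof.
move=> t0; have [h0 hC _] := hunt_sigma hX t0.
by have := hC _ h0; rewrite setD0.
Qed.

Lemma stopping_time_cst (s : R) : 0 <= s -> stopping_time (fun _ : omega X => s%:E).
Proof.
move=> s0; split => [w|t t0]; first by rewrite lee_fin.
have [st|st] := boolP (s <= t).
  rewrite (_ : [set w | _] = setT); first exact: filtration_setT.
  by apply/seteqP; split => w //= _; rewrite lee_fin.
rewrite (_ : [set w | _] = set0); first by have [] := hunt_sigma hX t0.
by apply/seteqP; split => w //=; rewrite lee_fin (negbTE st).
Qed.

Lemma hunt_markov_cst (s t : R) x (B : set (borel E)) : 0 <= s -> 0 <= t -> measurable B ->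
  K (s + t, x) B = (\int[K (s, x)]_y K (t, y) B)%E.
Proof.
move=> s0 t0 mB; have ms := measurable_some_image mB.
have st0 : 0 <= s + t by exact: addr_ge0.
have sA : stopped_sigma_algebra (fun _ : omega X => s%:E) setT.
  by split => // u u0; rewrite setTI; have [_] := stopping_time_cst s0; exact.
have := hunt_markov hX (stopping_time_cst s0) sA (Some x) t0 ms.
rewrite /= (_ : setT `&` _ = sample_path X (s + t) @^-1` (Some @` B)); last first.
  by rewrite setTI; apply/seteqP; split => w /= [] // y By yw; split; [exact: ltry|exists y].
rewrite KE// => ->; rewrite (_ : setT `&` _ = setT); last first.
  by rewrite setTI; apply/seteqP; split => w //= _; rewrite ltry.
have mK : measurable_fun setT (fun y => K (t, y) B).
  exact: (measurableT_comp (measurable_kernel K _ mB) (measurable_pair1 t)).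
rewrite KI//; apply: eq_integral => w _.
by case: (sample_path X s w) => [y|] /=; [rewrite KE|exact: law_cemetery].
Qed.

Lemma transition_semigroup (s t : R) x (g : borel E -> \bar R) : 0 <= s -> 0 <= t ->
  measurable_fun setT g -> (forall y, 0 <= g y)%E ->
  (\int[K ((s + t)%R, x)]_y g y = \int[K (s, x)]_y \int[K (t, y)]_z g z)%E.
Proof.
move=> s0 t0 mg g0.
have mphi : measurable_fun setT (fun z : borel E * borel E => (t, z.2)).
  by apply: measurable_fun_pair.
pose K2 : R.-sfker (borel E * borel E)%type ~> borel E := kprecomp K mphi.
pose K3 : R.-sfker borel E ~> borel E := (kslice K s \; K2)%E.
have -> : (\int[K (s, x)]_y \int[K (t, y)]_z g z = \int[K3 x]_z g z)%E.
  by rewrite [RHS](integral_kcomp (kslice K s) K2 x g0 mg).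
apply: eq_measure_integral => B mB _.
by rewrite hunt_markov_cst.
Qed.

Variable m : {sigma_finite_measure set (borel E) -> \bar R}.
Hypothesis hP : L2_semigroup m (Pt X).

Lemma transition_continuous (g : borel E -> R) : measurable_fun setT g ->
  (\int[m]_x ((g x) ^+ 2)%:E < +oo)%E -> forall e : R, 0 < e -> exists2 dl : R,
  0 < dl & forall t, 0 <= t -> t <= dl ->
    (\int[m]_x ((ksem K t g x - g x) ^+ 2)%:E <= e%:E)%E.
Proof.
move=> mg g2 e e0; have Lg : L2 m g by apply/L2P.
have /= cv := sg_continuous hP Lg.
have s0 : 0 < Num.sqrt e by rewrite sqrtr_gt0.
have oS : nbhs 0%E [set x : \bar R | (x < (Num.sqrt e)%:E)%E].
  by apply: open_nbhs_nbhs; split; [exact: open_ereal_lt_ereal|rewrite /= lte_fin].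
have [dl /= dl0 hdl] := cv _ oS.
exists (dl / 2); first by rewrite divr_gt0.
(* Strong continuity is a limit along [0^'+], so the time [0] itself is handled by [sg_0]. *)
move=> t; rewrite le_eqVlt => /predU1P[<-|t0] tdl.
  rewrite (ae_eq_integral (cst 0%E)) ?integral0 ?lee_fin ?(ltW e0)//.
    apply/measurable_EFinP/measurable_funX/measurable_funB => //.
    exact: measurable_ksem.
  by apply: filterS (sg_0 hP Lg) => x /(_ I) h _; rewrite -Pt_ksem// h subrr expr0n.
have : ('N[m]_2%:E[(fun x => (Pt X t g x - g x)%:E)] < (Num.sqrt e)%:E)%E.
  by apply: hdl => //=; rewrite sub0r normrN gtr0_norm//; lra.
move=> h; rewrite (eq_integral (fun x : borel E => `|(Pt X t g x - g x)%:E| `^ 2)%E); last first.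
  move=> x _; rewrite /= Pt_ksem ?(ltW t0)//.
  by rewrite powR_mulrn// real_normK ?num_real.
rewrite -poweR_Lnorm//.
apply: (@le_trans _ _ ((Num.sqrt e)%:E `^ 2)%E); last first.
  by rewrite poweR_EFin lee_fin powR_mulrn ?sqrtr_ge0// sqr_sqrtr// ltW.
apply: gt0_ler_poweR => //; last exact: ltW.
- by rewrite in_itv/= Lnorm_ge0 leey.
- by rewrite in_itv/= lee_fin sqrtr_ge0 leey.
Qed.

Hypothesis K1 : forall z, (K z setT <= 1)%E.

Let bmeas_kint t f x : bmeas f ->
  ((ksem K t f x)%:E = \int[K (t, x)]_y (f y)%:E)%E.
Proof.
move=> bf; have [_ f0 _] := bf; rewrite /ksem fin_Rintegral//.
have /integrableP[_] := bmeas_integrable (Q := kslice K t) (fun y => K1 (t, y)) x bf.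
by rewrite (eq_integral (fun y => (f y)%:E))// => y _; rewrite /= ger0_norm.
Qed.

Lemma bmeas_L2 (f : borel E -> R) : bmeas f -> (\int[m]_x (f x)%:E < +oo)%E -> L2 m f.
Proof.
move=> [mf f0 [C fC]] ff; apply/L2P; split => //.
have C0 : 0 <= C by exact: le_trans (f0 point) (fC point).
apply: (@le_lt_trans _ _ (C%:E * \int[m]_x (f x)%:E)%E); last by apply: lte_mul_pinfty.
rewrite -ge0_integralZl_EFin//; [|by move=> x _; rewrite lee_fin|exact/measurable_EFinP].
apply: ge0_le_integral => //.
- by move=> x _; rewrite lee_fin sqr_ge0.
- exact/measurable_EFinP/measurable_funX.
- by apply: measurable_funeM; exact/measurable_EFinP.
- by move=> x _; rewrite -EFinM lee_fin expr2 ler_wpM2r.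
Qed.

Definition duality (t : R) (f g : borel E -> \bar R) : \bar R :=
  (\int[m]_x (f x * \int[K (t, x)]_y g y))%E.

Lemma duality_bmeas (t : R) (f g : borel E -> R) : 0 <= t ->
  bmeas f -> bmeas g -> (\int[m]_x (f x)%:E < +oo)%E -> (\int[m]_x (g x)%:E < +oo)%E ->
  duality t (EFin \o f) (EFin \o g) = duality t (EFin \o g) (EFin \o f).
Proof.
move=> t0 bf bg ff gf.
have h u w : bmeas u -> bmeas w -> (\int[m]_x (u x)%:E < +oo)%E ->
    duality t (EFin \o u) (EFin \o w) = (dot m u (Pt X t w))%:E.
  move=> bu bw uf; have [mw w0 [C wC]] := bw; have [mu u0 _] := bu.
  rewrite /duality; under eq_integral do rewrite /= -bmeas_kint// -EFinM.
  rewrite /dot -fin_Rintegral.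
  - by congr EFin; apply: eq_Rintegral => x _; rewrite Pt_ksem.
  - by move=> x; rewrite mulr_ge0//; have [_ h _] := ksem_bmeas K1 t bw; exact: h.
  - have [mk k0 [D kD]] := ksem_bmeas K1 t bw.
    have D0 : 0 <= D by exact: le_trans (k0 point) (kD point).
    apply: (@le_lt_trans _ _ (D%:E * \int[m]_x (u x)%:E)%E); last by apply: lte_mul_pinfty.
    rewrite -ge0_integralZl_EFin//; [|by move=> x _; rewrite lee_fin|exact/measurable_EFinP].
    apply: ge0_le_integral => //.
    + by move=> x _; rewrite lee_fin mulr_ge0.
    + by apply/measurable_EFinP; exact: measurable_funM.
    + by apply: measurable_funeM; exact/measurable_EFinP.
    + by move=> x _; rewrite -EFinM lee_fin mulrC ler_wpM2r.
apply: (etrans (h _ _ bf bg ff)); apply: (etrans _ (esym (h _ _ bg bf gf))).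
apply: (congr1 EFin).
rewrite -(sg_sym hP t0 (bmeas_L2 bf ff) (bmeas_L2 bg gf)) /dot.
by apply: eq_Rintegral => x _; rewrite mulrC.
Qed.

End transition_properties.

(** The point is [b = +oo]: either [l = 0] and all [a n] vanish, or [a n] is positive from some [n]
    on and the products are infinite. *)
Lemma cvge_mul_nondecreasing (R : realType) (a : nat -> \bar R) (l b : \bar R) :
  (forall n, 0 <= a n)%E -> {homo a : n k / (n <= k)%N >-> (n <= k)%E} ->
  (0 <= b)%E -> a n @[n --> \oo] --> l -> (b * a n)%E @[n --> \oo] --> (b * l)%E.
Proof.
move=> a0 nda b0 al; have al' n := ereal_nondecreasing_le_cvg n nda al.
case: b b0 => [b| |//] b0; first exact: cvgeZl.
have [l0|l0] := eqVneq l 0%E.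
  have a00 n : a n = 0%E by apply/eqP; rewrite eq_le a0 andbT -l0 al'.
  rewrite l0 mule0; under eq_fun do rewrite a00 mule0; exact: cvg_cst.
have lp : (0 < l)%E by rewrite lt_def l0 (le_trans (a0 0%N) (al' 0%N)).
have [N _ hN] : \forall n \near \oo, (0 < a n)%E.
  by apply: (al [set x | (0 < x)%E]); apply: open_nbhs_nbhs; split => //; exact: open_ereal_gt_ereal.
rewrite gt0_mulye//; apply: cvg_near_cst; exists N => // n /= Nn.
by rewrite gt0_mulye// hN.
Qed.

(** * Extension of the duality to all nonnegative functions *)

Section kernel_duality.
Context d (T : measurableType d) (R : realType).
Variables (m : {sigma_finite_measure set T -> \bar R}) (Q : R.-sfker T ~> T).
Hypothesis Q_sym : forall f g : T -> R, bmeas f -> bmeas g ->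
  (\int[m]_x (f x)%:E < +oo)%E -> (\int[m]_x (g x)%:E < +oo)%E ->
  (\int[m]_x ((f x)%:E * \int[Q x]_y (g y)%:E) = \int[m]_x ((g x)%:E * \int[Q x]_y (f y)%:E))%E.

Let S (f g : T -> \bar R) : \bar R := (\int[m]_x (f x * \int[Q x]_y g y))%E.

Let kint (g : T -> \bar R) : measurable_fun setT g -> (forall x, 0 <= g x)%E ->
  measurable_fun setT (fun x => \int[Q x]_y g y)%E.
Proof.
by move=> mg g0; apply: measurable_fun_integral_kernel => // U mU; exact: measurable_kernel.
Qed.

Lemma kernel_duality_cvgr (f g : T -> \bar R) (g_ : nat -> T -> \bar R) :
  measurable_fun setT f -> (forall x, 0 <= f x)%E ->
  (forall n, measurable_fun setT (g_ n)) -> (forall n x, 0 <= g_ n x)%E ->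
  (forall x, {homo g_ ^~ x : n k / (n <= k)%N >-> (n <= k)%E}) ->
  (forall x, g_ n x @[n --> \oo] --> g x) -> S f (g_ n) @[n --> \oo] --> S f g.
Proof.
move=> mf f0 mg g0 ndg gc.
have Qc x : (\int[Q x]_y g_ n y)%E @[n --> \oo] --> (\int[Q x]_y g y)%E.
  rewrite (eq_integral (fun y => limn (g_ ^~ y))); last by move=> y _; apply/esym/cvg_lim.
  by apply: cvg_monotone_convergence => //.
have Qnd x : {homo (fun n => \int[Q x]_y g_ n y)%E : n k / (n <= k)%N >-> (n <= k)%E}.
  by move=> n k nk; apply: ge0_le_integral => // y _; exact: ndg.
rewrite /S (eq_integral (fun x => limn (fun n => f x * \int[Q x]_y g_ n y)%E)); last first.
  move=> x _; apply/esym/cvg_lim => //; apply: cvge_mul_nondecreasing => // n.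
  exact: integral_ge0.
apply: cvg_monotone_convergence => //.
- by move=> n; apply: emeasurable_funM => //; exact: kint.
- by move=> n x _; rewrite mule_ge0// integral_ge0.
- by move=> x _ n k nk; rewrite lee_wpmul2l//; exact: Qnd.
Qed.

Lemma kernel_duality_cvgl (f g : T -> \bar R) (f_ : nat -> T -> \bar R) :
  measurable_fun setT g -> (forall x, 0 <= g x)%E ->
  (forall n, measurable_fun setT (f_ n)) -> (forall n x, 0 <= f_ n x)%E ->
  (forall x, {homo f_ ^~ x : n k / (n <= k)%N >-> (n <= k)%E}) ->
  (forall x, f_ n x @[n --> \oo] --> f x) -> S (f_ n) g @[n --> \oo] --> S f g.
Proof.
move=> mg g0 mf f0 ndf fc.
have Qg0 x : (0 <= \int[Q x]_y g y)%E by exact: integral_ge0.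
rewrite /S (eq_integral (fun x => limn (fun n => f_ n x * \int[Q x]_y g y)%E)); last first.
  move=> x _; apply/esym/cvg_lim => //; rewrite muleC; under eq_fun do rewrite muleC.
  exact: cvge_mul_nondecreasing.
apply: cvg_monotone_convergence => //.
- by move=> n; apply: emeasurable_funM => //; exact: kint.
- by move=> n x _; rewrite mule_ge0.
- by move=> x _ n k nk; rewrite lee_wpmul2r//; exact: ndf.
Qed.

Lemma bounded_exhaustion (f : T -> \bar R) : measurable_fun setT f ->
  (forall x, 0 <= f x)%E -> exists f_ : nat -> T -> R,
  [/\ forall n, bmeas (f_ n), forall n, (\int[m]_x (f_ n x)%:E < +oo)%E,
      forall x, {homo f_ ^~ x : n k / (n <= k)%N >-> n <= k} &
      forall x, (f_ n x)%:E @[n --> \oo] --> f x].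
Proof.
move=> mf f0; have /sigma_finiteP [B [Bc Bm Bf]] := @sigma_finiteT _ _ _ m.
have mB n : measurable (B n) by case: (Bf n).
have Bm' n k : (n <= k)%N -> B n `<=` B k by move=> nk; exact/subsetPset/Bm.
pose h n x : R := fine (mine (f x) n%:R%:E).
have hE n x : ((h n x)%:E = mine (f x) n%:R%:E)%E.
  rewrite fineK// fin_numE; apply/andP; split.
    by rewrite gt_eqF// (lt_le_trans (ltNyr 0))// le_min f0 lee_fin ler0n.
  by rewrite lt_eqF// (le_lt_trans _ (ltry n%:R))// ge_min lexx orbT.
have h0 n x : 0 <= h n x by rewrite -lee_fin hE le_min f0 lee_fin ler0n.
have hn n x : h n x <= n%:R by rewrite -lee_fin hE ge_min lexx orbT.
have hnd n k x : (n <= k)%N -> h n x <= h k x.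
  by move=> nk; rewrite -lee_fin !hE le_min ge_min lexx/= ge_min lee_fin ler_nat nk orbT.
have mh n : measurable_fun setT (h n).
  apply: (measurableT_comp (@fine_measurable R setT measurableT)).
  exact: measurable_mine.
exists (fun n x => h n x * \1_(B n) x); split.
- move=> n; apply: bmeasM; first by split => //; exists n%:R => x.
  split; first exact: measurable_indic.
    by move=> x; rewrite indicE ler0n.
  by exists 1 => x; rewrite indicE; case: (_ \in _).
- move=> n; apply: (@le_lt_trans _ _ (n%:R%:E * \int[m]_x (\1_(B n) x)%:E)%E); last first.
    rewrite integral_indic// setIT; apply: lte_mul_pinfty => //.
    by case: (Bf n).
  rewrite -ge0_integralZl_EFin//; last exact/measurable_EFinP/measurable_indic.
  apply: ge0_le_integral => //.
  + by move=> x _; rewrite lee_fin mulr_ge0// indicE ler0n.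
  + by apply/measurable_EFinP/measurable_funM => //; exact: measurable_indic.
  + by apply: measurable_funeM; exact/measurable_EFinP/measurable_indic.
  + by move=> x _; rewrite -EFinM lee_fin ler_wpM2r// indicE ler0n.
- move=> x n k nk; rewrite !indicE.
  have [xB|_] := boolP (x \in B n); last by rewrite mulr0 mulr_ge0.
  by rewrite (mem_set (Bm' _ _ nk _ (set_mem xB))) !mulr1 hnd.
- move=> x; have [N _ xN] : (\bigcup_i B i) x by rewrite -Bc.
  apply: (@cvg_trans _ (mine (f x) n%:R%:E @[n --> \oo])%E).
    apply: near_eq_cvg; exists N => // n /= Nn.
    by rewrite indicE mem_set ?mulr1 ?hE//; exact: (Bm' N).
  case: (f x) (f0 x) => [r r0| _|//].
    apply: cvg_near_cst; exists (Num.truncn r).+1 => // n /= rn.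
    by apply/min_idPl; rewrite lee_fin ltW// (lt_le_trans (truncnS_gt _))// ler_nat.
  have h1 : (n%:R%:E : \bar R) @[n --> \oo] --> +oo%E.
    by apply/cvgeyPge => A; exists (Num.truncn A).+1 => // n /= An;
      rewrite lee_fin ltW// (lt_le_trans (truncnS_gt _))// ler_nat.
  by under eq_fun => n do rewrite (_ : mine +oo n%:R%:E = n%:R%:E)%E ?min_r ?leey//.
Qed.

(** Monotone limits are taken in one argument at a time, starting from bounded integrable
    functions. *)
Lemma kernel_duality (f g : T -> \bar R) :
  measurable_fun setT f -> (forall x, 0 <= f x)%E ->
  measurable_fun setT g -> (forall x, 0 <= g x)%E -> S f g = S g f.
Proof.
move=> mf f0 mg g0.
have [f_ [bf ff ndf fc]] := bounded_exhaustion mf f0.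
have [g_ [bg gg ndg gc]] := bounded_exhaustion mg g0.
have mE (u : T -> R) : bmeas u -> measurable_fun setT (fun x : T => (u x)%:E) by move=> [mu _ _]; exact/measurable_EFinP.
have E0 (u : T -> R) : bmeas u -> forall x : T, (0 <= (u x)%:E)%E by move=> [_ u0 _] x; rewrite lee_fin.
have ndf' x : {homo (fun n => (f_ n x)%:E) : n k / (n <= k)%N >-> (n <= k)%E}.
  by move=> n k nk; rewrite lee_fin ndf.
have ndg' x : {homo (fun n => (g_ n x)%:E) : n k / (n <= k)%N >-> (n <= k)%E}.
  by move=> n k nk; rewrite lee_fin ndg.
have h n : S f (EFin \o g_ n) = S (EFin \o g_ n) f.
  have c1 := kernel_duality_cvgl (mE _ (bg n)) (E0 _ (bg n)) (fun k => mE _ (bf k))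
    (fun k => E0 _ (bf k)) ndf' fc.
  have c2 := kernel_duality_cvgr (mE _ (bg n)) (E0 _ (bg n)) (fun k => mE _ (bf k))
    (fun k => E0 _ (bf k)) ndf' fc.
  apply: (cvg_unique (@ereal_hausdorff R) c1).
  rewrite (_ : (fun k => _) = (fun k => S (EFin \o g_ n) (fun x => (f_ k x)%:E))); first exact: c2.
  by apply/funext => k; exact: Q_sym.
have c1 := kernel_duality_cvgr mf f0 (fun k => mE _ (bg k)) (fun k => E0 _ (bg k)) ndg' gc.
have c2 := kernel_duality_cvgl mf f0 (fun k => mE _ (bg k)) (fun k => E0 _ (bg k)) ndg' gc.
apply: (cvg_unique (@ereal_hausdorff R) c1).
rewrite (_ : (fun k => _) = (fun k => S (fun x => (g_ k x)%:E) f)); first exact: c2.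
by apply/funext => k; exact: h.
Qed.

End kernel_duality.

(** * The jump kernel *)

Section nonnegative_functions.
Import HBNNSimple.

(** The integral is a supremum over simple functions, and cutting a simple function off on a null
    set does not change its integral. Measurability of [f] and [g] does not enter, which matters for
    expressions in a kernel not known to be s-finite. *)
Lemma ge0_le_integral_off_null d (T : measurableType d) (R : realType)
    (mu : {measure set T -> \bar R}) (f g : T -> \bar R) (N : set T) :
  (forall x, 0 <= f x)%E -> (forall x, 0 <= g x)%E ->
  measurable N -> mu N = 0%E -> (forall x, ~ N x -> (f x <= g x)%E) ->
  (\int[mu]_x f x <= \int[mu]_x g x)%E.
Proof.
move=> f0 g0 mN N0 fg; rewrite [leLHS]ge0_integralTE//.
apply: ge_ereal_sup => _ [h /= hf <-].
have mNC : measurable (~` N) by exact: measurableC.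
have -> : sintegral mu h = sintegral mu (proj_nnsfun h mNC).
  have <- : h \_ setT = h by apply/funext => x; rewrite patchT ?inE.
  have e1 := integral_nnsfun mu measurableT h.
  have e2 := integral_nnsfun mu measurableT (proj_nnsfun h mNC).
  rewrite -e1 (_ : (proj_nnsfun h mNC : T -> R) = proj_nnsfun h mNC \_ setT); last first.
    by apply/funext => x; rewrite patchT ?inE.
  rewrite -e2; apply: ae_eq_integral => //; [exact/measurable_EFinP|exact/measurable_EFinP|].
  exists N; split => // x /=; apply: contra_notP => Nx _ /=.
  by rewrite mindicE mem_set// mulr1.
rewrite [leRHS]ge0_integralTE//; apply: ereal_sup_ubound.
exists (proj_nnsfun h mNC) => // x /=; rewrite mindicE.
have [Nx|Nx] := pselect (N x).
  by rewrite memNset ?mulr0//; exact.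
by rewrite mem_set ?mulr1//; apply: (le_trans (hf x)); exact: fg.
Qed.

Lemma ge0_ae_eq_integral_nonmeasurable d (T : measurableType d) (R : realType)
    (mu : {measure set T -> \bar R}) (f g : T -> \bar R) :
  (forall x, 0 <= f x)%E -> (forall x, 0 <= g x)%E ->
  {ae mu, forall x, f x = g x} -> (\int[mu]_x f x = \int[mu]_x g x)%E.
Proof.
move=> f0 g0 [N [mN N0 hN]].
have fg x : ~ N x -> f x = g x by move=> nN; apply: contrapT => h; apply: nN; exact: hN.
apply/eqP; rewrite eq_le; apply/andP; split;
  by apply: (ge0_le_integral_off_null (N := N)) => // x /fg ->.
Qed.

(** Monotone class induction. Scaling and addition form one clause because a simple function is
    built by adding one weighted indicator at a time. *)
Lemma nonneg_measurable_ind d (T : measurableType d) (R : realType)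
    (P : (T -> \bar R) -> Prop) :
  (forall A, measurable A -> P (fun x => (\1_A x)%:E)) ->
  (forall (c : R) f g, 0 <= c -> measurable_fun setT f -> measurable_fun setT g ->
    (forall x, 0 <= f x)%E -> (forall x, 0 <= g x)%E -> P f -> P g ->
    P (fun x => c%:E * f x + g x)%E) ->
  (forall (f_ : nat -> T -> \bar R) f, (forall n, measurable_fun setT (f_ n)) ->
    (forall n x, 0 <= f_ n x)%E -> (forall x, {homo f_ ^~ x : n k / (n <= k)%N >-> (n <= k)%E}) ->
    (forall x, f_ n x @[n --> \oo] --> f x) -> (forall n, P (f_ n)) -> P f) ->
  forall f, measurable_fun setT f -> (forall x, 0 <= f x)%E -> P f.
Proof.
move=> Pi Pl Pm f mf f0.
have P0 : P (cst 0%E).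
  by have := Pi set0 measurable0; rewrite (_ : (fun x => _) = cst 0%E)//; apply/funext => x; rewrite indic0.
apply: (Pm (fun n x => (nnsfun_approx measurableT mf n x)%:E)).
- by move=> n; exact/measurable_EFinP.
- by move=> n x; rewrite lee_fin.
- by move=> x n k nk; rewrite lee_fin; have /lefP := nd_nnsfun_approx measurableT mf nk; exact.
- by move=> x; exact: cvg_nnsfun_approx.
move=> n; set h := nnsfun_approx _ _ _.
have -> : (fun x => (h x)%:E) = (fun x => (\sum_(y <- finmap.enum_fset (fset_set (range h)))
    y * \1_(h @^-1` [set y]) x)%:E).
  by apply/funext => x; rewrite fimfunE fsbig_finite.
have hr y : y \in finmap.enum_fset (fset_set (range h)) -> 0 <= y.
  move=> yh; have yr : y \in range h := etrans (esym (in_fset_set (fimfunP h) y)) yh.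
  by have [x _ <-] := set_mem yr.
elim: (finmap.enum_fset _) hr => [|y s IH] hr.
  by under eq_fun do rewrite big_nil.
under eq_fun do rewrite big_cons EFinD EFinM.
have mi (z : R) : measurable_fun setT (fun x => \1_(h @^-1` [set z]) x : R) by exact: measurable_indic.
have hr' z : z \in s -> 0 <= z by move=> zs; apply: hr; rewrite inE zs orbT.
apply: Pl.
- by apply: hr; rewrite inE eqxx.
- exact/measurable_EFinP.
- by apply/measurable_EFinP; apply: measurable_sum => z; exact: measurable_funM.
- by move=> x; rewrite lee_fin indicE ler0n.
- move=> x; rewrite lee_fin big_seq; apply: sumr_ge0 => z zs.
  by apply: mulr_ge0; [exact: hr'|rewrite indicE ler0n].
- by apply: Pi; rewrite -[X in measurable X]setTI; exact: measurable_funP.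
- exact: IH.
Qed.

End nonnegative_functions.

Section restricted_kernel.
Context d d' (X : measurableType d) (Y : measurableType d') (R : realType).
Variables (k : R.-ker X ~> Y) (L : set X) (B : set Y) (r : R).

Definition restricted_kernel (mL : measurable L) (mB : measurable B)
    (kr : forall x, L x -> (k x B < r%:E)%E) : X -> {measure set Y -> \bar R} :=
  fun x => if x \in L then (mrestr (k x) mB : {measure set Y -> \bar R}) else mzero.

Hypotheses (mL : measurable L) (mB : measurable B)
  (kr : forall x, L x -> (k x B < r%:E)%E).

Lemma restricted_kernelE x (C : set Y) :
  restricted_kernel mL mB kr x C = ((\1_L x)%:E * k x (C `&` B))%E.
Proof.
rewrite /restricted_kernel indicE; case: (x \in L); first by rewrite mul1e.
by rewrite mul0e.
Qed.

Let measurable_restricted_kernel C : measurable C ->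
  measurable_fun setT (restricted_kernel mL mB kr ^~ C).
Proof.
move=> mC; under eq_fun do rewrite restricted_kernelE.
apply: emeasurable_funM; first exact/measurable_EFinP/measurable_indic.
by apply: measurable_kernel; exact: measurableI.
Qed.

HB.instance Definition _ := isKernel.Build _ _ X Y R (restricted_kernel mL mB kr)
  measurable_restricted_kernel.

Let restricted_kernel_uub : measure_fam_uub (restricted_kernel mL mB kr).
Proof.
exists (Num.max r 1) => x; rewrite restricted_kernelE setTI indicE.
have [xL|_] := boolP (x \in L).
  by rewrite mul1e (lt_le_trans (kr (set_mem xL)))// lee_fin le_max lexx.
by rewrite mul0e lte_fin lt_max ltr01 orbT.
Qed.

HB.instance Definition _ := Kernel_isFinite.Build _ _ X Y R (restricted_kernel mL mB kr)
  restricted_kernel_uub.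

End restricted_kernel.

Lemma nneseries_single (R : realType) (a : nat -> \bar R) n0 :
  (forall n, n != n0 -> a n = 0%E) -> (\sum_(0 <= n <oo) a n = a n0)%E.
Proof.
move=> h; apply/cvg_lim => //; apply: cvg_near_cst; exists n0.+1 => // n /= n0n.
rewrite (bigD1_seq n0) ?mem_index_iota ?iota_uniq//=.
by rewrite big1 ?adde0// => i; exact: h.
Qed.

(* The rectangle is cut along the level sets of the total mass. *)
Lemma sfinite_rectangle d d' (X : measurableType d) (Y : measurableType d') (R : realType)
    (k : R.-ker X ~> Y) (A : set X) (B : set Y) : measurable A -> measurable B ->
  (forall x, A x -> (k x B < +oo)%E) ->
  exists l : R.-sfker X ~> Y, forall x C, measurable C ->
    l x C = ((\1_A x)%:E * k x (C `&` B))%E.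
Proof.
move=> mA mB kfin.
pose L n := A `&` [set x | n%:R%:E <= k x B]%E `&` [set x | k x B < n.+1%:R%:E]%E.
have mk := measurable_kernel k B mB.
have mL n : measurable (L n).
  apply: measurableI; first apply: measurableI => //.
    rewrite -[X in measurable X]setTI; exact: emeasurable_fun_c_infty.
  rewrite -[X in measurable X]setTI; exact: emeasurable_fun_infty_o.
have kr n x : L n x -> (k x B < n.+1%:R%:E)%E by move=> [].
pose l (n : nat) : R.-sfker X ~> Y := restricted_kernel (mL n) mB (kr n).
exists (kseries l) => x C mC; transitivity (\sum_(0 <= n <oo) l n x C)%E; first by [].
have lE n : l n x C = ((\1_(L n) x)%:E * k x (C `&` B))%E by exact: restricted_kernelE.
under eq_eseriesr do rewrite lE.
have [xA|xA] := boolP (x \in A); last first.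
  rewrite eseries0; first by rewrite indicE (negbTE xA) mul0e.
  move=> n _ _; rewrite indicE memNset ?mul0e// => -[[Ax _] _].
  by move/negP: xA; apply; rewrite inE.
have Ax := set_mem xA; have kx := kfin x Ax.
pose n0 := Num.truncn (fine (k x B)).
have kE : (k x B = (fine (k x B))%:E)%E by rewrite fineK// ge0_fin_numE.
have Ln n : L n x <-> n = n0.
  split => [[[_ /= h1] h2]|->].
    by apply/esym; apply: truncn_def; move: h1 h2; rewrite kE lee_fin lte_fin => -> ->.
  have /andP[h1 h2] := truncn_itv (fine_ge0 (measure_ge0 (k x) B)).
  by split; [split => //=|]; rewrite /= kE ?lee_fin ?lte_fin.
rewrite (nneseries_single (n0 := n0)).
  by rewrite !indicE xA mem_set//; exact/Ln.
move=> n nn0; rewrite indicE memNset ?mul0e// => /Ln nE.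
by rewrite nE eqxx in nn0.
Qed.

Section jump_measure.
Context (R : realType) (E : pmetricType R).
Variable m : {sigma_finite_measure set (borel E) -> \bar R}.
Variables (J : {measure set (borel E * borel E) -> \bar R}) (Jk : R.-ker borel E ~> borel E).
Hypothesis J_radon : @radon_on R (E * E)%type (@offdiag E)
  (measurable : set (set (borel E * borel E))) J.
Hypothesis J_sym : forall C : set (borel E * borel E), measurable C ->
  C `<=` @offdiag E -> J [set z | C (z.2, z.1)] = J C.
Hypothesis J_kernel : forall C : set (borel E * borel E), measurable C ->
  C `<=` @offdiag E -> J C = (\int[m]_x Jk x (xsection C x))%E.
Variable U : nat -> set E.
Hypothesis baseU : precompact_base U.

(** Disjointness of the closures makes their product a compact set off the diagonal, where [J] is
    finite. Indices of other pairs give the empty rectangle. *)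
Definition rectangle (n : nat) : set E * set E :=
  if unpickle n is Some (i, j) then
    if pselect (closure (U i) `&` closure (U j) = set0) then (U i, U j) else (set0, set0)
  else (set0, set0).
Local Notation A_ n := (rectangle n).1.
Local Notation B_ n := (rectangle n).2.

Let rectangleP n : rectangle n = (set0, set0) \/ exists i j,
  closure (U i) `&` closure (U j) = set0 /\ rectangle n = (U i, U j).
Proof.
rewrite /rectangle; case: (unpickle n) => [[i j]|]; last by left.
by case: pselect => h /=; [right; exists i, j|left].
Qed.

Lemma measurable_rectangle n : measurable (A_ n : set (borel E)) /\ measurable (B_ n : set (borel E)).
Proof.
have [oU _ _] := baseU.
case: (rectangleP n) => [->|[i [j [_ ->]]]] /=; first by split; exact: measurable0.
by split; exact: borel_open.
Qed.

Lemma rectangle_offdiag n : (A_ n `*` B_ n : set (borel E * borel E)) `<=` @offdiag E.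
Proof.
case: (rectangleP n) => [->|[i [j [h ->]]]] /= -[x y] /= [] //= Ux Uy xy.
have : (closure (U i) `&` closure (U j)) x.
  by split; apply: subset_closure => //; rewrite [x]xy.
by rewrite h.
Qed.

Lemma rectangle_finite n : (J (A_ n `*` B_ n) < +oo)%E.
Proof.
have [oU cU bU] := baseU; have [mA mB] := measurable_rectangle n.
case: (rectangleP n) => [e|[i [j [h e]]]]; rewrite e /=.
  by rewrite set0X measure0.
have [JK _] := J_radon.
apply: (@le_lt_trans _ _ (J (closure (U i) `*` closure (U j)))); last first.
  apply: JK; first exact: compact_setX.
  move=> [x y] /= [cx cy] xy; have : (closure (U i) `&` closure (U j)) x.
    by split => //; rewrite [x]xy.
  by rewrite h.
apply: le_measure; rewrite ?inE.
- by apply: measurableX; exact: borel_open.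
- by apply: measurableX; apply: borel_closed; exact: closed_closure.
- by move=> [x y] /= [Ux Uy]; split; exact: subset_closure.
Qed.

Lemma rectangle_cover (x y : E) : x <> y -> exists n, A_ n x /\ B_ n y.
Proof.
move=> /eqP xy; have [oU cU bU] := baseU.
have := @metric_hausdorff R E; rewrite open_hausdorff => /(_ x y xy).
move=> [[V W] /= [xV yW] [oV oW /eqP VW]].
have [i [Ux UV]] := bU x V (open_nbhs_nbhs (conj oV (set_mem xV))).
have [j [Uy UW]] := bU y W (open_nbhs_nbhs (conj oW (set_mem yW))).
exists (pickle (i, j)); rewrite /rectangle pickleK.
case: pselect => // h; exfalso; apply: h.
by apply/seteqP; split => // z [/UV Vz /UW Wz]; rewrite -VW.
Qed.

Lemma offdiag_bigcup : @offdiag E = \bigcup_n (A_ n `*` B_ n).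
Proof.
apply/seteqP; split => [[x y] /= xy|z [n _]]; last exact: rectangle_offdiag.
by have [n [Ax By]] := rectangle_cover xy; exists n.
Qed.

Lemma measurable_offdiag : measurable (@offdiag E : set (borel E * borel E)).
Proof.
rewrite offdiag_bigcup; apply: bigcup_measurable => n _.
by have [mA mB] := measurable_rectangle n; exact: measurableX.
Qed.

(** An [m]-null set because [J] is finite on each rectangle; off it, [Jk] restricted to a rectangle
    is finite. *)
Let bad : set (borel E) := \bigcup_n (A_ n `&` [set x | Jk x (B_ n) = +oo%E]).

Let measurable_bad : measurable bad.
Proof.
apply: bigcup_measurable => n _; have [mA mB] := measurable_rectangle n.
apply: measurableI => //; rewrite -[X in measurable X]setTI.
rewrite (_ : [set x | _] = (fun x => Jk x (B_ n)) @^-1` [set +oo%E])//.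
exact: measurable_kernel.
Qed.

Let bad_ae : {ae m, forall x, ~ bad x}.
Proof.
have H n : {ae m, forall x, ~ (A_ n x /\ Jk x (B_ n) = +oo%E)}.
  have [mA mB] := measurable_rectangle n.
  have e : J (A_ n `*` B_ n) = (\int[m]_x ((\1_(A_ n) x)%:E * Jk x (B_ n)))%E.
  rewrite J_kernel; [|exact: measurableX|exact: rectangle_offdiag].
  apply: eq_integral => x _; rewrite indicE.
  have [xA|xA] := boolP (x \in A_ n); first by rewrite in_xsectionX// mul1e.
  by rewrite notin_xsectionX// measure0 mul0e.
have mf : measurable_fun setT (fun x : borel E => (\1_(A_ n) x)%:E * Jk x (B_ n))%E.
  apply: emeasurable_funM; last exact: measurable_kernel.
  exact/measurable_EFinP/measurable_indic.
have f0 (x : borel E) : (0 <= (\1_(A_ n) x)%:E * Jk x (B_ n))%E.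
  by rewrite mule_ge0// lee_fin indicE.
  apply: filterS (ge0_integral_ltyae mf f0 _); last by rewrite -e; exact: rectangle_finite.
  by move=> x + [Ax Jx]; rewrite indicE mem_set// mul1e Jx.
by apply: filterS (ae_foralln H) => x h [n _ hn]; exact: (h n).
Qed.

(** [Jk] need not be s-finite, but off [bad] it is finite on each rectangle, and [sfinite_rectangle]
    applies. Disjoint pieces of the rectangles exhaust the complement of the diagonal, so the sum of
    the restrictions is [Jk] without the diagonal; nothing is claimed on [bad]. *)
Lemma sfinite_jump_kernel : exists Jk' : R.-sfker borel E ~> borel E,
  {ae m, forall x, forall C, measurable C -> Jk' x C = Jk x (C `&` [set~ x])}.
Proof.
pose W n : set (borel E * borel E) := seqDU (fun n => A_ n `*` B_ n) n.
have mW n : measurable (W n).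
  rewrite /W /seqDU; apply: measurableD.
    by have [mA mB] := measurable_rectangle n; exact: measurableX.
  apply: bigsetU_measurable => i _.
  by have [mA mB] := measurable_rectangle i; exact: measurableX.
have msnd : measurable_fun setT (snd : borel E * borel E -> borel E) by exact: measurable_snd.
have H n : exists Kn : R.-sfker borel E ~> borel E, forall x C, measurable C -> ~ bad x ->
    Kn x C = Jk x (C `&` xsection (W n) x).
  have [mA mB] := measurable_rectangle n.
  have mAb : measurable (A_ n `\` bad : set (borel E)) by exact: measurableD.
  have fin x : (A_ n `\` bad) x -> (Jk x (B_ n) < +oo)%E.
    move=> [Ax nb]; rewrite ltey; apply/eqP => h; apply: nb.
    by exists n.
  have [l lE] := sfinite_rectangle mAb mB fin.
  have [Kn [KnE _]] := partial_image_kernel l (mW n) msnd.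
  exists Kn => x C mC nb; rewrite KnE//.
  have -> : [set y | W n (x, y) /\ C (x, y).2] = C `&` xsection (W n) x.
    by apply/seteqP; split => y; rewrite /xsection /= inE => -[].
  have mx : measurable (xsection (W n) x) by exact: measurable_xsection.
  rewrite lE; last exact: measurableI.
  have WAB y : W n (x, y) -> A_ n x /\ B_ n y by move=> [].
  have [Ax|nA] := pselect (A_ n x).
    rewrite indicE mem_set// mul1e; congr (Jk x _).
    apply/seteqP; split => y; first by move=> [].
    by rewrite /xsection /= inE => -[Cy Wy]; split => //; have [] := WAB y Wy.
  rewrite indicE memNset ?mul0e; last by move=> [].
  rewrite (_ : _ `&` _ = set0) ?measure0//; apply/seteqP; split => // y.
  by rewrite /xsection /= inE => -[_ /WAB []].
have [Kn hKn] := choice H.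
exists (kseries Kn); apply: filterS bad_ae => x nb C mC.
transitivity (\sum_(0 <= n <oo) Kn n x C)%E; first by [].
rewrite (eq_eseriesr (fun n _ => hKn n x C mC nb)).
rewrite -(@measure_semi_bigcup _ _ _ (Jk x) (fun n => C `&` xsection (W n) x)).
- congr (Jk x _); rewrite -setI_bigcupr; congr (_ `&` _).
  rewrite -xsection_bigcup /W -seqDU_bigcup_eq -offdiag_bigcup.
  by apply/seteqP; split => y; rewrite /xsection /= inE /offdiag /= => h e; apply: h.
- by move=> n; apply: measurableI => //; exact: measurable_xsection.
- apply/trivIsetP => i j _ _ ij; apply/seteqP; split => // y.
  rewrite /xsection /= => -[[_ +] [_ +]]; rewrite !inE => Wi Wj.
  have /trivIsetP /(_ i j I I ij) := trivIset_seqDU (fun n => A_ n `*` B_ n : set (borel E * borel E)).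
  by move=> /seteqP [/(_ (x, y)) h _]; apply: h.
- apply: bigcup_measurable => n _; apply: measurableI => //; exact: measurable_xsection.
Qed.

Variable Jk' : R.-sfker borel E ~> borel E.
Hypothesis Jk'E : {ae m, forall x, forall C, measurable C -> Jk' x C = Jk x (C `&` [set~ x])}.

Let setC1_measurable (x : borel E) : measurable ([set~ x] : set (borel E)).
Proof.
apply: measurableC; apply: (borel_closed (V := [set (x : E)])).
by apply: accessible_closed_set1; apply: hausdorff_accessible; exact: metric_hausdorff.
Qed.

Lemma jump_integral (g : borel E * borel E -> \bar R) : measurable_fun setT g ->
  (forall z, 0 <= g z)%E ->
  (\int[J]_(z in @offdiag E) g z = \int[m]_x \int[Jk' x]_y g (x, y))%E.
Proof.
move=> mg g0; have mO := measurable_offdiag.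
have mI h : measurable_fun setT h -> (forall z, 0 <= h z)%E ->
    measurable_fun setT (fun x => \int[Jk' x]_y h (x, y))%E.
  by move=> mh h0; exact: (measurable_fun_integral_sfinite_kernel h Jk' h0 mh).
have msec (h : borel E * borel E -> \bar R) x : measurable_fun setT h ->
    measurable_fun setT (fun y => h (x, y)).
  by move=> mh; exact: (measurableT_comp mh (measurable_pair1 x)).
apply: (nonneg_measurable_ind
  (P := fun g => \int[J]_(z in @offdiag E) g z = \int[m]_x \int[Jk' x]_y g (x, y))%E) mg g0.
- move=> C mC; rewrite integral_indic//.
  rewrite J_kernel; [|exact: measurableI|by move=> z []].
  apply: ge0_ae_eq_integral_nonmeasurable => //.
    by move=> x; apply: integral_ge0 => y _; rewrite lee_fin indicE.
  apply: filterS Jk'E => x hx.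
  rewrite (eq_integral (fun y => (\1_(xsection C x) y)%:E)); last first.
    by move=> y _; rewrite !indicE mem_xsection.
  have mCx : measurable (xsection C x) by exact: measurable_xsection.
  rewrite integral_indic// setIT hx//; congr (Jk x _).
  apply/seteqP; split => y; rewrite /xsection /= !inE.
    by move=> [Cy xy]; split => // e; apply: xy.
  by move=> [Cy xy]; split => // e; apply: xy.
- move=> c f h c0 mf mh f0 h0 Pf Ph.
  have mfD : measurable_fun (@offdiag E : set (borel E * borel E)) f by exact: measurable_funTS.
  have mhD : measurable_fun (@offdiag E : set (borel E * borel E)) h by exact: measurable_funTS.
  have If0 x : (0 <= \int[Jk' x]_y f (x, y))%E by exact: integral_ge0.
  have Ih0 x : (0 <= \int[Jk' x]_y h (x, y))%E by exact: integral_ge0.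
  have cf0 z : (0 <= c%:E * f z)%E by rewrite mule_ge0.
  have cI0 x : (0 <= c%:E * \int[Jk' x]_y f (x, y))%E by rewrite mule_ge0.
  rewrite (ge0_integralD J mO (fun z _ => cf0 z) (measurable_funeM _ mfD) (fun z _ => h0 z) mhD).
  rewrite (ge0_integralZl_EFin J mO (fun z _ => f0 z) mfD c0) Pf Ph.
  rewrite -(ge0_integralZl_EFin m measurableT (fun x _ => If0 x) (mI f mf f0) c0).
  rewrite -(ge0_integralD m measurableT (fun x _ => cI0 x) (measurable_funeM _ (mI f mf f0))
    (fun x _ => Ih0 x) (mI h mh h0)).
  apply: eq_integral => x _; rewrite ge0_integralD//; last 2 first.
  + by apply: measurable_funeM; exact: msec.
  + exact: msec.
  by rewrite ge0_integralZl_EFin//; exact: msec.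
- move=> f_ f mf_ f0_ nd fc Pf.
  have lhs : (\int[J]_(z in @offdiag E) f_ n z)%E @[n --> \oo] --> (\int[J]_(z in @offdiag E) f z)%E.
    rewrite (eq_integral (fun z => limn (f_ ^~ z))); last by move=> z _; apply/esym/cvg_lim.
    by apply: cvg_monotone_convergence => // n; exact: measurable_funTS.
  have rhs : (\int[m]_x \int[Jk' x]_y f_ n (x, y))%E @[n --> \oo] -->
      (\int[m]_x \int[Jk' x]_y f (x, y))%E.
    have inner x : (\int[Jk' x]_y f_ n (x, y))%E @[n --> \oo] --> (\int[Jk' x]_y f (x, y))%E.
      rewrite (eq_integral (fun y => limn (fun n => f_ n (x, y)))); last by move=> y _; apply/esym/cvg_lim.
      by apply: cvg_monotone_convergence => // n; exact: msec.
    rewrite (eq_integral (fun x => limn (fun n => \int[Jk' x]_y f_ n (x, y))%E)); last first.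
      by move=> x _; apply/esym/cvg_lim.
    apply: cvg_monotone_convergence => //.
    + by move=> n; exact: mI.
    + by move=> n x _; exact: integral_ge0.
    + by move=> x _ n k nk; apply: ge0_le_integral => // [|| y _]; [exact: msec|exact: msec|exact: nd].
  move: lhs; rewrite (_ : (fun n => _) = (fun n => \int[m]_x \int[Jk' x]_y f_ n (x, y))%E); last first.
    by apply/funext => n; exact: Pf.
  by move=> lhs; exact: (cvg_unique (@ereal_hausdorff R) lhs rhs).
Qed.

Lemma jump_integral_swap (g : borel E * borel E -> \bar R) : measurable_fun setT g ->
  (forall z, 0 <= g z)%E ->
  (\int[J]_(z in @offdiag E) g z = \int[J]_(z in @offdiag E) g (z.2, z.1))%E.
Proof.
move=> mg g0; have mO := measurable_offdiag.
have msw : measurable_fun setT (fun z : borel E * borel E => (z.2, z.1)) by exact: measurable_fun_pair.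
have mS (h : borel E * borel E -> \bar R) : measurable_fun setT h ->
    measurable_fun setT (fun z => h (z.2, z.1)).
  by move=> mh; exact: (measurableT_comp mh msw).
apply: (nonneg_measurable_ind
  (P := fun g => \int[J]_(z in @offdiag E) g z = \int[J]_(z in @offdiag E) g (z.2, z.1))%E) mg g0.
- move=> C mC; rewrite integral_indic// -J_sym; [|exact: measurableI|by move=> z []].
  rewrite (eq_integral (fun z => (\1_[set z | C (z.2, z.1)] z)%:E)); last first.
    by move=> z _; rewrite !indicE; congr (_%:R%:E); apply/idP/idP; rewrite !inE.
  rewrite integral_indic//; last by rewrite -[X in measurable X]setTI; exact: msw.
  congr (J _); apply/seteqP; split => -[x y] /= [Cxy xy]; split => //.
    by move=> e; apply: xy; exact: esym.
  by move=> e; apply: xy; exact: esym.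
- move=> c f h c0 mf mh f0 h0 Pf Ph.
  have mT (w : borel E * borel E -> \bar R) : measurable_fun setT w ->
    measurable_fun (@offdiag E : set (borel E * borel E)) w by exact: measurable_funTS.
  rewrite ge0_integralD//; [|by move=> z _; rewrite mule_ge0|apply: measurable_funeM; exact: mT|exact: mT].
  rewrite [RHS]ge0_integralD//; [|by move=> z _; rewrite mule_ge0| |by apply: mT; exact: mS]; last first.
    by apply: measurable_funeM; apply: mT; exact: mS.
  rewrite ge0_integralZl_EFin//; last exact: mT.
  rewrite Pf Ph ge0_integralZl_EFin//.
  by apply: mT; exact: mS.
- move=> f_ f mf_ f0_ nd fc Pf.
  have lhs : (\int[J]_(z in @offdiag E) f_ n z)%E @[n --> \oo] --> (\int[J]_(z in @offdiag E) f z)%E.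
    rewrite (eq_integral (fun z => limn (f_ ^~ z))); last by move=> z _; apply/esym/cvg_lim.
    by apply: cvg_monotone_convergence => // n; exact: measurable_funTS.
  have rhs : (\int[J]_(z in @offdiag E) f_ n (z.2, z.1))%E @[n --> \oo] -->
      (\int[J]_(z in @offdiag E) f (z.2, z.1))%E.
    rewrite (eq_integral (fun z => limn (fun n => f_ n (z.2, z.1)))); last by move=> z _; apply/esym/cvg_lim.
    by apply: cvg_monotone_convergence => // n; apply: measurable_funTS; exact: mS.
  move: lhs; rewrite (_ : (fun n => _) = (fun n => \int[J]_(z in @offdiag E) f_ n (z.2, z.1))%E); last first.
    by apply/funext => n; exact: Pf.
  by move=> lhs; exact: (cvg_unique (@ereal_hausdorff R) lhs rhs).
Qed.

Lemma jump_kernel_sym (g : borel E * borel E -> \bar R) : measurable_fun setT g ->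
  (forall z, 0 <= g z)%E ->
  (\int[m]_x \int[Jk' x]_y g (x, y) = \int[m]_x \int[Jk' x]_y g (y, x))%E.
Proof.
move=> mg g0; rewrite -jump_integral// jump_integral_swap//.
rewrite (jump_integral (g := fun z => g (z.2, z.1)))//.
by apply: (measurableT_comp mg); exact: measurable_fun_pair.
Qed.

(** In the first coordinate because [J] has a kernel with respect to [m], in the second by symmetry.
    Hence a function may replace its quasi-continuous version in an integral against [J]. *)
Lemma jump_null (N : set (borel E)) : measurable N -> m N = 0%E ->
  {ae J, forall z, @offdiag E z -> ~ N z.1 /\ ~ N z.2}.
Proof.
move=> mN N0; have mO := measurable_offdiag.
have m1 : measurable (fst @^-1` N : set (borel E * borel E)).
  by rewrite -[X in measurable X]setTI; exact: measurable_fst.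
have m2 : measurable (snd @^-1` N : set (borel E * borel E)).
  by rewrite -[X in measurable X]setTI; exact: measurable_snd.
have g0 (i : borel E * borel E -> borel E) z : (0 <= (\1_N (i z))%:E :> \bar R)%E by rewrite lee_fin indicE.
have mg (i : borel E * borel E -> borel E) : measurable_fun setT i ->
    measurable_fun setT (fun z => (\1_N (i z))%:E : \bar R).
  by move=> mi; apply/measurable_EFinP; apply: (measurableT_comp _ mi); exact: measurable_indic.
have h1 : (\int[J]_(z in @offdiag E) (\1_N z.1)%:E = 0)%E.
  rewrite (jump_integral (mg fst measurable_fst) (g0 fst)).
  transitivity (\int[m]_x (cst 0%E x))%E; last by rewrite integral0.
  apply: ge0_ae_eq_integral_nonmeasurable => //.
    by move=> x; apply: integral_ge0 => y _; exact: g0.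
  exists N; split => // x /=; apply: contra_notP => Nx.
  by apply: integral0_eq => y _; rewrite indicE memNset.
have h2 : (\int[J]_(z in @offdiag E) (\1_N z.2)%:E = 0)%E.
  by rewrite -h1 (jump_integral_swap (mg snd measurable_snd) (g0 snd)).
have J1 : J (fst @^-1` N `&` @offdiag E) = 0%E by rewrite -h1 -(integral_indic J mO m1).
have J2 : J (snd @^-1` N `&` @offdiag E) = 0%E by rewrite -h2 -(integral_indic J mO m2).
have n1 : J.-negligible (fst @^-1` N `&` @offdiag E) by exists (fst @^-1` N `&` @offdiag E); split => //; exact: measurableI.
have n2 : J.-negligible (snd @^-1` N `&` @offdiag E) by exists (snd @^-1` N `&` @offdiag E); split => //; exact: measurableI.
apply: negligibleS (negligibleU n1 n2) => z /= nz.
have [zO|zO] := pselect (@offdiag E z); last by exfalso; apply: nz.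
have [N1|N1] := pselect (N z.1); first by left.
have [N2|N2] := pselect (N z.2); first by right.
by exfalso; apply: nz.
Qed.

End jump_measure.

(** * The form as a limit of slopes *)

Section slope_at_zero.
Context (R : realType) (psi : R -> R).
Hypothesis psi0 : forall t, 0 <= t -> 0 <= psi t.
Hypothesis psi_nd : forall s t, 0 <= s -> s <= t -> psi s <= psi t.
Hypothesis psi_mul : forall n t, 0 <= t -> psi (n%:R * t) <= n%:R * psi t.

Let multiple_le (t h : R) : 0 <= t -> 0 < h -> exists n : nat,
  t <= n%:R * h /\ n%:R * h <= t + h.
Proof.
move=> t0 h0; exists (Num.truncn (t / h)).+1; split.
  by rewrite -ler_pdivrMr// ltW// truncnS_gt.
have /andP[h1 _] := truncn_itv (divr_ge0 t0 (ltW h0)).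
by rewrite -natr1 mulrDl mul1r lerD2r -ler_pdivlMr.
Qed.

(** A multiple of [dyad k] just above [t] overshoots by at most [dyad k], which can be made
    small. *)
Lemma slope_bounded (C t : R) : (forall k, psi (dyad R k) <= C * dyad R k) -> 0 <= t ->
  psi t <= C * t.
Proof.
move=> hC t0; have C0 : 0 <= C.
  have := le_trans (psi0 (ltW (dyad_gt0 R 0))) (hC 0%N).
  by rewrite pmulr_lge0// dyad_gt0.
have C1 : 0 < C + 1 by lra.
apply/ler_addgt0Pr => e e0.
have [k hk] := dyad_small (divr_gt0 e0 C1); have dk := dyad_gt0 R k.
have [n [h1 h2]] := multiple_le t0 dk.
apply: le_trans (psi_nd t0 h1) _; apply: le_trans (psi_mul n (ltW dk)) _.
apply: (@le_trans _ _ (C * (n%:R * dyad R k))).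
  by rewrite mulrCA ler_wpM2l.
apply: le_trans (ler_wpM2l C0 h2) _; rewrite mulrDr lerD2l.
apply: (@le_trans _ _ ((C + 1) * dyad R k)); first by rewrite ler_wpM2r ?(ltW dk)//; lra.
by rewrite mulrC -ler_pdivlMr.
Qed.

(** The limit is the supremum of all slopes. A nearly optimal [h] is covered by [n] steps of a small
    [t], so [psi h <= n psi t], and only the overshoot, at most [t], has to be made negligible. *)
Lemma slope_cvg (C : R) : (forall k, psi (dyad R k) <= C * dyad R k) ->
  exists L : R, psi t / t @[t --> 0^'+] --> L.
Proof.
move=> hC; pose A := [set psi t / t | t in [set t : R | 0 < t]].
have hA : has_sup A.
  split; first by exists (psi 1 / 1), 1 => //=; exact: ltr01.
  exists C => _ [t /= t0 <-]; rewrite ler_pdivrMr//.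
  by apply: slope_bounded => //; exact: ltW.
exists (sup A); apply/cvgrPdist_le => e e0.
have [_ [h /= h0 <-] hh] := sup_adherent e0 hA.
have {}hh : (sup A - e) * h < psi h by rewrite -ltr_pdivlMr.
(* For [t <= d] the overshoot costs at most the gap in the numerator; the [+ 1] keeps the
   denominator positive. *)
pose d := (psi h - (sup A - e) * h) / (`|sup A - e| + 1).
have d0 : 0 < d.
  by rewrite divr_gt0 ?subr_gt0// ltr_wpDl.
have S0 : 0 <= sup A.
  have h1 : 0 <= psi 1 / 1 by rewrite divr1 psi0.
  by apply: le_trans h1 _; apply: sup_upper_bound => //; exists 1 => //=; exact: ltr01.
near=> t; have t0 : 0 < t by near: t; exact: nbhs_right_gt.
have td : t <= d by near: t; exact: nbhs_right_le.
have up : psi t / t <= sup A by apply: sup_upper_bound => //; exists t.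
rewrite ger0_norm ?subr_ge0// lerBlDr -lerBlDl ler_pdivlMr//.
have [n [h1 h2]] := multiple_le (ltW h0) t0.
have n0 : 0 < n%:R * t by apply: lt_le_trans h1.
have [Sneg|Spos] := leP (sup A - e) 0.
  by apply: (@le_trans _ _ 0); [apply: mulr_le0_ge0 => //; exact: ltW|exact: psi0 (ltW t0)].
have hn : psi h <= n%:R * psi t := le_trans (psi_nd (ltW h0) h1) (psi_mul n (ltW t0)).
have n1 : 0 < n%:R :> R by rewrite -(pmulr_lgt0 _ t0).
rewrite -(ler_pM2l n1); apply: le_trans hn.
apply: (@le_trans _ _ ((sup A - e) * (h + t))); first by rewrite mulrCA ler_wpM2l ?(ltW Spos).
rewrite mulrDr -lerBrDl; apply: (@le_trans _ _ ((sup A - e) * d)); first by rewrite ler_wpM2l ?(ltW Spos).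
rewrite /d mulrCA -[leRHS]mulr1 ler_wpM2l ?subr_ge0 ?(ltW hh)//.
rewrite gtr0_norm// ler_pdivrMr; [rewrite mul1r lerDl|]; lra.
Unshelve. all: by end_near. Qed.

End slope_at_zero.

Section L2_products.
Context (R : realType) (E : pmetricType R) (m : {measure set (borel E) -> \bar R}).
Implicit Types u v w : E -> R.

Lemma L2_measurable u : L2 m u -> measurable_fun setT (u : borel E -> R).
Proof. by move=> /L2P []. Qed.

Lemma L2_integrable_mul u v : L2 m u -> L2 m v ->
  m.-integrable setT (EFin \o (fun x : borel E => u x * v x)).
Proof.
move=> /L2P[mu u2] /L2P[mv v2].
have ms (w : borel E -> R) : measurable_fun setT w -> measurable_fun setT (fun x => ((w x) ^+ 2)%:E).
  by move=> mw; apply/measurable_EFinP/measurable_funX.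
have s0 (w : borel E -> R) x : (0 <= ((w x) ^+ 2)%:E)%E by rewrite lee_fin sqr_ge0.
apply/integrableP; split; first by apply/measurable_EFinP; exact: measurable_funM.
apply: (@le_lt_trans _ _ (\int[m]_x (((u x) ^+ 2)%:E + ((v x) ^+ 2)%:E))%E).
  apply: ge0_le_integral => //.
  - by apply: measurableT_comp => //; apply/measurable_EFinP; exact: measurable_funM.
  - by apply: emeasurable_funD; exact: ms.
  move=> x _; rewrite /= -EFinD lee_fin normrM.
  have := sqr_ge0 (`|u x| - `|v x|).
  rewrite sqrrB !real_normK ?num_real// => h.
  have := normr_ge0 (u x); have := normr_ge0 (v x); nra.
rewrite ge0_integralD//; [|exact: ms|exact: ms].
by rewrite lte_add_pinfty.
Qed.

Lemma L2_sub u v : L2 m u -> L2 m v -> L2 m (fun x => u x - v x).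
Proof.
move=> Lu Lv; have iuv := L2_integrable_mul.
have [mu mv] := (L2_measurable Lu, L2_measurable Lv).
apply/L2P; split; first exact: measurable_funB.
have h : m.-integrable setT (EFin \o (fun x : borel E =>
    u x * u x + (u x * v x * (-2) + v x * v x))).
  apply: integrableDR => //; first exact: iuv.
  apply: integrableDR => //; last exact: iuv.
  rewrite (_ : EFin \o _ = EFin \o (fun x => (-2) * (u x * v x))); last first.
    by apply/funext => x /=; rewrite mulrC.
  by apply: integrableZR => //; exact: iuv.
have /integrableP [_] := h; apply: le_lt_trans.
apply: ge0_le_integral => //.
- by move=> x _; rewrite lee_fin sqr_ge0.
- by apply/measurable_EFinP/measurable_funX; exact: measurable_funB.
- by apply: measurableT_comp => //; exact: measurable_int h.
move=> x _; rewrite /= lee_fin; apply: le_trans (ler_norm _).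
by rewrite le_eqVlt; apply/orP; left; apply/eqP; ring.
Qed.

Lemma dot_subl u v w : L2 m u -> L2 m v -> L2 m w ->
  dot m (fun x => u x - v x) w = dot m u w - dot m v w.
Proof.
move=> Lu Lv Lw; rewrite /dot -RintegralB//; [|exact: L2_integrable_mul..].
by apply: eq_Rintegral => x _; rewrite mulrBl.
Qed.

Lemma dotC u v : dot m u v = dot m v u.
Proof. by apply: eq_Rintegral => x _; rewrite mulrC. Qed.

Lemma dot_subr u v w : L2 m u -> L2 m v -> L2 m w ->
  dot m w (fun x => u x - v x) = dot m w u - dot m w v.
Proof. by move=> Lu Lv Lw; rewrite dotC dot_subl// !(dotC _ w). Qed.

Lemma dot_ge0 u : 0 <= dot m u u.
Proof. by apply: Rintegral_ge0 => x _; rewrite -expr2 sqr_ge0. Qed.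

Lemma dot_ae u v w : L2 m u -> L2 m v -> L2 m w -> ae_eq m setT u v ->
  dot m u w = dot m v w.
Proof.
move=> Lu Lv Lw uv; rewrite /dot /Rintegral; congr fine; apply: ae_eq_integral => //.
- by apply/measurable_EFinP; apply: measurable_funM; exact: L2_measurable.
- by apply/measurable_EFinP; apply: measurable_funM; exact: L2_measurable.
by apply: filterS uv => x /(_ I) -> _.
Qed.

Lemma dot_sqr u : dot m u u = fine (\int[m]_x ((u x) ^+ 2)%:E)%E.
Proof. by rewrite /dot /Rintegral; congr fine; apply: eq_integral => x _; rewrite expr2. Qed.

End L2_products.

Section semigroup_slope.
Context (R : realType) (E : pmetricType R) (m : {measure set (borel E) -> \bar R}).
Variable P : R -> (E -> R) -> E -> R.
Hypothesis hP : L2_semigroup m P.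
Variable v : E -> R.
Hypothesis Lv : L2 m v.

Let q (t : R) : R := dot m (P t v) v.
Let LP t : 0 <= t -> L2 m (P t v). Proof. by move=> t0; exact: (sg_L2 hP). Qed.

Let qD s t : 0 <= s -> 0 <= t -> q (s + t) = dot m (P s v) (P t v).
Proof.
move=> s0 t0; have st0 : 0 <= s + t by exact: addr_ge0.
rewrite /q (dot_ae (LP st0) (sg_L2 hP s0 (LP t0)) Lv (sg_add hP s0 t0 Lv)).
by rewrite (sg_sym hP s0 (LP t0) Lv) dotC.
Qed.

Let q0 : q 0 = dot m v v.
Proof. by rewrite /q (dot_ae (LP (lexx 0)) Lv Lv (sg_0 hP Lv)). Qed.

Let contraction t w : 0 <= t -> L2 m w -> dot m (P t w) (P t w) <= dot m w w.
Proof.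
move=> t0 Lw; have LPw := sg_L2 hP t0 Lw.
have e u : L2 m u -> ((dot m u u)%:E = 'N[m]_2%:E[EFin \o u] `^ 2)%E.
  move=> Lu; have /L2P[mu u2] := Lu.
  rewrite poweR_Lnorm// dot_sqr fineK.
    by apply: eq_integral => x _; rewrite /= powR_mulrn// real_normK ?num_real.
  by rewrite ge0_fin_numE// integral_ge0// => x _; rewrite lee_fin sqr_ge0.
rewrite -lee_fin !e//; apply: gt0_ler_poweR => //.
- by rewrite in_itv/= Lnorm_ge0 leey.
- by rewrite in_itv/= Lnorm_ge0 leey.
- exact: (sg_contraction hP).
Qed.

Let q_ni s t : 0 <= s -> s <= t -> q t <= q s.
Proof.
move=> s0 st; have a0 : 0 <= s / 2 by lra.
have b0 : 0 <= (t - s) / 2 by lra.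
have ba0 := addr_ge0 b0 a0.
rewrite (_ : t = ((t - s) / 2 + s / 2) + ((t - s) / 2 + s / 2)); last by field.
rewrite [in leRHS](_ : s = s / 2 + s / 2); last by field.
rewrite qD// [leRHS]qD//.
have Lb := sg_L2 hP b0 (LP a0); have ae := sg_add hP b0 a0 Lv.
rewrite (dot_ae (LP ba0) Lb (LP ba0) ae) dotC (dot_ae (LP ba0) Lb Lb ae).
exact: (contraction b0 (LP a0)).
Qed.

(** By symmetry [q (a + b)] is the scalar product of [P_a v] and [P_b v], so this is nonnegativity
    of the squared norm of their difference. Convexity of [q] takes the place of the spectral
    theorem. *)
Let q_convex a b : 0 <= a -> 0 <= b -> 2 * q (a + b) <= q (a + a) + q (b + b).
Proof.
move=> a0 b0; have [La Lb] := (LP a0, LP b0).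
have := dot_ge0 m (fun x => P a v x - P b v x).
rewrite dot_subl//; last exact: L2_sub.
rewrite !dot_subr// -!qD// (addrC b a); lra.
Qed.

Definition slope_energy (t : R) : R := dot m v v - q t.

Lemma slope_energyE t : 0 <= t -> dot m (fun x => v x - P t v x) v = slope_energy t.
Proof. by move=> t0; rewrite dot_subl//; exact: LP. Qed.

Lemma slope_energy_double t : 0 <= t ->
  slope_energy (t + t) = dot m v v - dot m (P t v) (P t v).
Proof. by move=> t0; rewrite /slope_energy qD. Qed.

Lemma slope_energy_nd s t : 0 <= s -> s <= t -> slope_energy s <= slope_energy t.
Proof. by move=> s0 st; rewrite lerB// q_ni. Qed.

Lemma slope_energy_ge0 t : 0 <= t -> 0 <= slope_energy t.
Proof. by move=> t0; rewrite subr_ge0 -q0 q_ni. Qed.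

Lemma slope_energy_mul n t : 0 <= t -> slope_energy (n%:R * t) <= n%:R * slope_energy t.
Proof.
move=> t0; have kt k : 0 <= k%:R * t / 2 by rewrite divr_ge0// mulr_ge0.
have step k : q (k%:R * t) - q (k.+1%:R * t) <= slope_energy t.
  rewrite /slope_energy -q0; elim: k => [|k IH]; first by rewrite mul0r mul1r.
  apply: le_trans IH.
  (* Convexity at the half-times [k t / 2] and [(k + 2) t / 2]: the decrease of [q] over successive
     steps of length [t] becomes smaller, so the first step is the largest. *)
  have := q_convex (kt k) (kt k.+2).
  rewrite (_ : _ + k.+2%:R * t / 2 = k.+1%:R * t); last by rewrite -[k.+2%:R]natr1 -[k.+1%:R]natr1; field.
  rewrite (_ : _ + k%:R * t / 2 = k%:R * t); last by field.
  rewrite (_ : _ + k.+2%:R * t / 2 = k.+2%:R * t); last by field.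
  lra.
elim: n => [|n IH]; first by rewrite !mul0r /slope_energy q0 subrr.
have := step n; rewrite -!natr1 !mulrDl !mul1r; move: IH; rewrite /slope_energy; lra.
Qed.

Variables (D : set (E -> R)) (Ef : (E -> R) -> (E -> R) -> R).
Hypothesis hF : form_of_semigroup m D Ef P.

(** Bounded slopes along the dyadic times force convergence along all times, and that is membership
    in the domain by [form_of_semigroup]. *)
Lemma form_of_bounded_slope (C : R) :
  (forall k, slope_energy (dyad R k) <= C * dyad R k) ->
  D v /\ slope_energy t / t @[t --> 0^'+] --> Ef v v.
Proof.
move=> hC; have [hD hE] := hF.
have near_eq l : slope_energy t / t @[t --> 0^'+] --> l <->
    dot m (fun x => v x - P t v x) v / t @[t --> 0^'+] --> l.
  have e : {near 0^'+, (fun t => slope_energy t / t) =1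
      (fun t => dot m (fun x => v x - P t v x) v / t)}.
    near=> t; rewrite slope_energyE//; apply: ltW; near: t; exact: nbhs_right_gt.
  by split => h; apply: cvg_trans h; apply: near_eq_cvg; [|apply: filterS e => t].
have [L hL] := slope_cvg slope_energy_ge0 slope_energy_nd slope_energy_mul hC.
have Dv : D v by apply/hD; split => //; exists L; exact/near_eq.
by split => //; apply/near_eq; exact: hE.
Unshelve. all: by end_near. Qed.

Lemma slope_energy_dyad_nd k :
  slope_energy (dyad R k) / dyad R k <= slope_energy (dyad R k.+1) / dyad R k.+1.
Proof.
have d1 := dyad_gt0 R k.+1.
have e : dyad R k = 2%:R * dyad R k.+1 by rewrite /dyad [in RHS]exprS mulrA mulfV// mul1r.
have d2 : 0 < 2%:R * dyad R k.+1 by rewrite mulr_gt0.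
rewrite e ler_pdivrMr// (_ : _ * (2%:R * _) = 2%:R * slope_energy (dyad R k.+1)).
  by apply: slope_energy_mul; exact: ltW.
by field; rewrite gt_eqF.
Qed.

End semigroup_slope.

Lemma dyad_cvg (R : realType) : dyad R k @[k --> \oo] --> (0 : R)^'+.
Proof.
move=> V /= [e /= e0 eV]; have e2 : 0 < e / 2 by lra.
have [k hk] := dyad_small e2.
exists k => // n /= kn; apply: eV; last exact: dyad_gt0.
have dn := dyad_gt0 R n.
rewrite /= sub0r normrN gtr0_norm//; apply: (@le_lt_trans _ _ (dyad R k)); last by lra.
by rewrite /dyad ler_wiXn2l// ?invr_ge0// invf_le1// ler1n.
Qed.

Lemma sigma_finite_package d (T : measurableType d) (R : realType)
    (m : {measure set T -> \bar R}) : sigma_finite setT m ->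
  exists m' : {sigma_finite_measure set T -> \bar R}, (m' : {measure set T -> \bar R}) = m.
Proof.
case: m => mf mc /= sf.
pose mm : {measure set T -> \bar R} := Measure.Pack mc.
pose M := @Measure_isSigmaFinite.Build _ _ _ mm sf.
by exists (HB.pack_for {sigma_finite_measure set T -> \bar R} (mf : set T -> \bar R) mm M).
Qed.

Lemma integral_restricted d (T : measurableType d) (R : realType)
    (mu nu : {measure set T -> \bar R}) (D : set T) (g : T -> \bar R) : measurable D ->
  (forall C, measurable C -> nu C = mu (C `&` D)) ->
  measurable_fun setT g -> (forall x, 0 <= g x)%E ->
  (\int[nu]_x g x = \int[mu]_(x in D) g x)%E.
Proof.
move=> mD h mg g0.
apply: (nonneg_measurable_ind (P := fun g => \int[nu]_x g x = \int[mu]_(x in D) g x)%E) mg g0.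
- by move=> A mA; rewrite !integral_indic// setIT h.
- move=> c f1 f2 c0 m1 m2 f10 f20 P1 P2.
  have mT (w : T -> \bar R) : measurable_fun setT w -> measurable_fun D w by exact: measurable_funTS.
  have cf0 x : (0 <= c%:E * f1 x)%E by rewrite mule_ge0.
  rewrite (ge0_integralD nu measurableT (fun x _ => cf0 x) (measurable_funeM _ m1) (fun x _ => f20 x) m2).
  rewrite (ge0_integralD mu mD (fun x _ => cf0 x) (measurable_funeM _ (mT _ m1)) (fun x _ => f20 x) (mT _ m2)).
  by rewrite ge0_integralZl_EFin// P1 P2 ge0_integralZl_EFin//; exact: mT.
- move=> f_ f1 mf_ f0_ nd fc Pf.
  have lhs : (\int[nu]_x f_ n x)%E @[n --> \oo] --> (\int[nu]_x f1 x)%E.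
    rewrite (eq_integral (fun z => limn (f_ ^~ z))); last by move=> z _; apply/esym/cvg_lim.
    exact: cvg_monotone_convergence.
  have rhs : (\int[mu]_(x in D) f_ n x)%E @[n --> \oo] --> (\int[mu]_(x in D) f1 x)%E.
    rewrite (eq_integral (fun z => limn (f_ ^~ z))); last by move=> z _; apply/esym/cvg_lim.
    by apply: cvg_monotone_convergence => // n; exact: measurable_funTS.
  move: lhs; rewrite (_ : (fun n => _) = (fun n => \int[mu]_(x in D) f_ n x)%E); last first.
    by apply/funext => n; exact: Pf.
  by move=> lhs; exact: (cvg_unique (@ereal_hausdorff R) lhs rhs).
Qed.

(** * Transfer of the bounds to the pure-jump setting *)

Section setting.
Context (R : realType) (E : pmetricType R).
Variable m : {sigma_finite_measure set (borel E) -> \bar R}.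
Variables (D : set (E -> R)) (Ef : (E -> R) -> (E -> R) -> R).
Variables (J : {measure set (borel E * borel E) -> \bar R}) (Jk : R.-ker borel E ~> borel E).
Variable X : process E.
Hypothesis S : pure_jump_setting m D Ef J Jk X.
Variable U : nat -> set E.
Hypothesis baseU : precompact_base U.

Variable K : R.-sfker (R * borel E)%type ~> borel E.
Hypothesis K1 : forall z, (K z setT <= 1)%E.
Hypothesis KE : forall t x B, measurable B -> 0 <= t ->
  K (t, x) B = law X (Some x) (sample_path X t @^-1` (Some @` B)).
Hypothesis KI : forall (t : R) x (g : borel E -> \bar R), 0 <= t -> measurable_fun setT g ->
  (forall y, 0 <= g y)%E ->
  (\int[K (t, x)]_y g y = \int[law X (Some x)]_w oapp g 0 (sample_path X t w))%E.

Variable Jk' : R.-sfker borel E ~> borel E.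
Hypothesis Jk'E : {ae m, forall x, forall C, measurable C -> Jk' x C = Jk x (C `&` [set~ x])}.

Let hX := set_hunt S.
Let hP := set_semigroup S.
Let hJ := set_jump S.

Lemma transition_duality (t : R) (f g : borel E -> \bar R) : 0 <= t ->
  measurable_fun setT f -> (forall y, 0 <= f y)%E ->
  measurable_fun setT g -> (forall y, 0 <= g y)%E ->
  (\int[m]_x (f x * \int[K (t, x)]_y g y) = \int[m]_x (g x * \int[K (t, x)]_y f y))%E.
Proof.
move=> t0 mf f0 mg g0.
exact: (kernel_duality (Q := kslice K t)
  (fun u w bu bw uf wf => duality_bmeas KI hP K1 t0 bu bw uf wf) mf f0 mg g0).
Qed.

Lemma approx_energy_slope k (v : borel E -> R) : L2 m v ->
  approx_energy m K k v = slope_energy m (Pt X) v (2 * dyad R k) / (2 * dyad R k).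
Proof.
move=> Lv; have mv := L2_measurable Lv; have dk := ltW (dyad_gt0 R k).
rewrite /approx_energy mulr_natl mulr2n slope_energy_double// !dot_sqr.
congr ((_ - fine _) / _); apply: eq_integral => x _.
by rewrite (Pt_ksem KI x dk mv).
Qed.

Lemma dyadS k : 2 * dyad R k.+1 = dyad R k.
Proof. by rewrite /dyad [in LHS]exprS mulrA mulfV// mul1r. Qed.

Lemma dyad_double_cvg : 2 * dyad R k @[k --> \oo] --> (0 : R)^'+.
Proof.
have h := @dyad_cvg R; move=> V /h [k _ hk].
by exists k.+1 => // -[//|n] /= kn; rewrite dyadS; exact: hk.
Qed.

(** This is [H_form] for the process. Bounded energies put [v] in the domain; its form value is then
    an integral against [J] of quasi-continuous versions, which agree with [v] off a [J]-null set by
    [jump_null]. *)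
Lemma form_limit (v : borel E -> R) : measurable_fun setT v ->
  (\int[m]_x ((v x) ^+ 2)%:E < +oo)%E ->
  (forall k, approx_energy m K k v <= approx_energy m K k.+1 v) /\
  (forall C : R, (forall k, approx_energy m K k v <= C) ->
    (approx_energy m K k v)%:E @[k --> \oo] --> (2^-1%:E * jump_energy m Jk' v)%E).
Proof.
move=> mv v2; have Lv : L2 m v by apply/L2P.
split => [k|C hC].
  rewrite !approx_energy_slope// dyadS.
  (* The slope is taken over [2 * dyad k], which is [1] for [k = 0] and [dyad (k - 1)] otherwise;
     the time [1] is not of the form [dyad] and is treated directly. *)
  case: k => [|k]; last by rewrite dyadS; exact: slope_energy_dyad_nd.
  have d1 := dyad_gt0 R 0%N.
  have d2 : 0 < 2 * dyad R 0 by rewrite mulr_gt0.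
  rewrite ler_pdivrMr// (_ : _ * (2 * _) = 2%:R * slope_energy m (Pt X) v (dyad R 0)).
    by apply: slope_energy_mul => //; exact: ltW.
  by field; rewrite gt_eqF.
have hC' k : slope_energy m (Pt X) v (dyad R k) <= C * dyad R k.
  by have := hC k.+1; rewrite approx_energy_slope// dyadS ler_pdivrMr// dyad_gt0.
have [Dv cv] := form_of_bounded_slope hP Lv (set_associated S) hC'.
have [u' [v' [[mu' uv _] [mv' vv _] fE]]] := pj_form hJ Dv Dv.
have JE : (\int[J]_(z in @offdiag E) ((u' z.2 - u' z.1) * (v' z.2 - v' z.1))%:E =
    jump_energy m Jk' v)%E.
  have [N1 [mN1 N10 hN1]] := uv; have [N2 [mN2 N20 hN2]] := vv.
  have d1 := measurable_offdiag baseU.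
  have jn N : measurable N -> m N = 0%E -> _ :=
    jump_null (pj_sym hJ) (pj_kernel hJ) baseU Jk'E (N := N).
  have md (w : borel E -> R) : measurable_fun setT w ->
      measurable_fun setT (fun z : borel E * borel E => w z.2 - w z.1).
    by move=> mw; apply: measurable_funB; exact: measurableT_comp.
  have := jump_integral (g := fun z : borel E * borel E => ((v z.2 - v z.1) ^+ 2)%:E)
    (pj_kernel hJ) baseU Jk'E.
  rewrite /jump_energy /= => <-; last 2 first.
  - by apply/measurable_EFinP; apply: measurable_funX; exact: md.
  - by move=> z; rewrite lee_fin sqr_ge0.
  apply: ae_eq_integral => //.
  - by apply: measurable_funTS; apply/measurable_EFinP; apply: measurable_funM; exact: md.
  - by apply: measurable_funTS; apply/measurable_EFinP; apply: measurable_funX; exact: md.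
  have mN : measurable (N1 `|` N2) by exact: measurableU.
  have N0 : m (N1 `|` N2) = 0%E by rewrite measureU0.
  have [B [mB B0 hB]] := jn _ mN N0.
  exists B; split => // z /= nz; apply: hB => /= h12; apply: nz => zO.
  have eq1 (x : E) : ~ N1 x -> u' x = v x.
    by move=> nN; apply/esym; apply: contrapT => h; apply: nN; apply: hN1 => /= /(_ I).
  have eq2 (x : E) : ~ N2 x -> v' x = v x.
    by move=> nN; apply/esym; apply: contrapT => h; apply: nN; apply: hN2 => /= /(_ I).
  have [na nb] := h12 zO.
  have [a1 b1] : ~ N1 z.1 /\ ~ N2 z.1 by split=> h; apply: na; [left|right].
  have [a2 b2] : ~ N1 z.2 /\ ~ N2 z.2 by split=> h; apply: nb; [left|right].
  by rewrite !eq1// !eq2// -expr2.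
rewrite -JE -fE; apply: cvg_EFin; first by near=> k.
rewrite /comp /=; under eq_fun do rewrite approx_energy_slope//.
exact: (cvg_comp _ _ dyad_double_cvg cv).
Unshelve. all: by end_near. Qed.

Lemma Gtilde_square_function (f : borel E -> R) : measurable_fun setT f ->
  {ae m, forall x, (Gtilde Jk X f x = (square_function K Jk' f x) `^ 2^-1)%E}.
Proof.
move=> mf; apply: filterS Jk'E => x hx; rewrite /Gtilde /square_function.
apply: (congr1 (fun z => z `^ 2^-1)%E); apply: eq_integral => t; rewrite inE /= in_itv/= andbT => t0.
have mx : measurable ([set~ x] : set (borel E)).
  apply: measurableC; apply: (borel_closed (V := [set (x : E)])).
  by apply: accessible_closed_set1; apply: hausdorff_accessible; exact: metric_hausdorff.
have mu := measurable_ksem K t mf.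
rewrite /chi_energy (integral_restricted mx hx).
- by apply: eq_integral => y _; rewrite !(Pt_ksem KI _ t0 mf).
- apply/measurable_EFinP/measurable_funM; last exact: measurable_fun_chi.
  by apply/measurable_funX/measurable_funB.
- by move=> y; rewrite lee_fin mulr_ge0 ?sqr_ge0 ?chi_ge0.
Qed.

Variables (p : R) (f : borel E -> R).
Hypothesis p1 : 1 < p.
Hypothesis Lf : f \in Lfun m p%:E.

Let p0 : 0 < p. Proof. by have hp := p1; lra. Qed.

Lemma Lnorm_Gtilde : ('N[m]_p%:E[Gtilde Jk X f] =
  (\int[m]_x (square_function K Jk' f x `^ (p / 2))) `^ p^-1)%E.
Proof.
have [mf ff] := (Lfun_finP m f p0).1 Lf.
rewrite Lnorm.unlock /=; congr (_ `^ _)%E; apply: ge0_ae_eq_integral_nonmeasurable.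
- by move=> x; exact: poweR_ge0.
- by move=> x; exact: poweR_ge0.
apply: filterS (Gtilde_square_function mf) => x ->.
by rewrite gee0_abs ?poweR_ge0// -poweRrM mulrC.
Qed.

Lemma Lnorm_f : ('N[m]_p%:E[EFin \o f] = (\int[m]_x (`|f x| `^ p)%:E) `^ p^-1)%E.
Proof. by rewrite Lnorm.unlock. Qed.

Lemma setting_upper : p <= 2 ->
  (\int[m]_x (square_function K Jk' f x `^ (p / 2)) <=
   (((2 / p) ^+ 2) `^ (p / 2) * (maximal_const p + (Num.min 1 (p - 1) / 2)^-1))%:E *
   \int[m]_x (`|f x| `^ p)%:E)%E.
Proof.
move=> p2; have [mf ff] := (Lfun_finP m f p0).1 Lf.
apply: (square_function_upper K1 (transition_semigroup hX KE KI)
  transition_duality (transition_continuous KI hP) form_limit mf ff p1 p2).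
Qed.

Lemma setting_lower : 2 <= p -> strongly_stable m X p ->
  (\int[m]_x (`|f x| `^ p)%:E <=
   (lower_const p)%:E * \int[m]_x (square_function K Jk' f x `^ (p / 2)))%E.
Proof.
move=> p2 stab; have [mf ff] := (Lfun_finP m f p0).1 Lf.
apply: (square_function_lower K1 (transition_semigroup hX KE KI)
  transition_duality (transition_continuous KI hP)
  (jump_kernel_sym (pj_sym hJ) (pj_kernel hJ) baseU Jk'E) form_limit mf ff p2).
have cv := stab f Lf.
apply/cvgrPdist_le => e e0.
have e1 : 0 < e `^ p^-1 by rewrite powR_gt0.
have oS : nbhs 0%E [set x : \bar R | (x < (e `^ p^-1)%:E)%E].
  by apply: open_nbhs_nbhs; split; [exact: open_ereal_lt_ereal|rewrite /= lte_fin].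
have [A [_ hA]] := cv _ oS.
exists (Num.truncn A).+1 => // N /= AN.
have {}hA : ('N[m]_p%:E[EFin \o Pt X N%:R f] < (e `^ p^-1)%:E)%E.
  by apply: hA; rewrite (lt_le_trans (truncnS_gt _))// ler_nat.
rewrite sub0r normrN ger0_norm; last by rewrite fine_ge0// integral_ge0// => x _; rewrite lee_fin powR_ge0.
have I0 : (0 <= \int[m]_x (`|ksem K N%:R f x| `^ p)%:E)%E.
  by apply: integral_ge0 => x _; rewrite lee_fin powR_ge0.
have h : (\int[m]_x (`|ksem K N%:R f x| `^ p)%:E <= e%:E)%E.
  have -> : (\int[m]_x (`|ksem K N%:R f x| `^ p)%:E = 'N[m]_p%:E[EFin \o Pt X N%:R f] `^ p)%E.
    rewrite (poweR_Lnorm m (EFin \o Pt X N%:R f) (lt0r_neq0 p0)).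
    apply: eq_integral => x _.
    by rewrite -(Pt_ksem KI x (ler0n R N) mf).
  rewrite (_ : e%:E = (e `^ p^-1)%:E `^ p)%E; last first.
    by rewrite poweR_EFin -powRrM mulVf ?gt_eqF// powRr1// ltW.
  apply: gt0_ler_poweR; [exact: ltW| | |exact: ltW].
  - by rewrite in_itv/= Lnorm_ge0 leey.
  - by rewrite in_itv/= lee_fin (ltW e1) leey.
by rewrite -lee_fin fineK// (ge0_fin_numE I0) (le_lt_trans h (ltry _)).
Qed.

End setting.

Definition upper_const {R : realType} (p : R) : R :=
  ((2 / p) ^+ 2) `^ (p / 2) * (maximal_const p + (Num.min 1 (p - 1) / 2)^-1).

(** The integrals are hidden behind [A] and [G], so that the auxiliary kernels and the sigma-finite
    structure put on [m] do not appear in the conclusion. *)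
Lemma setting_bounds (R : realType) (E : pmetricType R)
    (m : {measure set (borel E) -> \bar R})
    (D : set (E -> R)) (Ef : (E -> R) -> (E -> R) -> R)
    (J : {measure set (borel E * borel E) -> \bar R})
    (Jk : R.-ker borel E ~> borel E) (X : process E) (p : R) (f : borel E -> R) :
  pure_jump_setting m D Ef J Jk X -> 1 < p -> f \in Lfun m p%:E ->
  exists A G : \bar R, [/\ (0 <= A)%E, (0 <= G)%E,
    ('N[m]_p%:E[EFin \o f] = A `^ p^-1)%E & ('N[m]_p%:E[Gtilde Jk X f] = G `^ p^-1)%E] /\
    (p <= 2 -> (G <= (upper_const p)%:E * A)%E) /\
    (2 <= p -> strongly_stable m X p -> (A <= (lower_const p)%:E * G)%E).
Proof.
move=> S p1 Lf.
have [U baseU] := exists_precompact_base (set_locally_compact S) (set_separable S).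
have mK (C : set E) : compact C -> (m C < +oo)%E.
  by move=> cC; have [h _] := set_radon S; exact: h.
have [m' mE] := sigma_finite_package (sigma_finite_borel baseU mK).
subst m.
have [K [K1 [KE KI]]] := transition_kernel (set_hunt S) baseU.
have [Jk' Jk'E] := sfinite_jump_kernel (pj_radon (set_jump S)) (pj_kernel (set_jump S)) baseU.
exists (\int[m']_x (`|f x| `^ p)%:E)%E, (\int[m']_x (square_function K Jk' f x `^ (p / 2)))%E.
split; last split.
- split.
  + by apply: integral_ge0 => x _; rewrite lee_fin powR_ge0.
  + by apply: integral_ge0 => x _; exact: poweR_ge0.
  + exact: Lnorm_f.
  + exact: (Lnorm_Gtilde KI Jk'E p1 Lf).
- exact: (setting_upper S baseU K1 KE KI Jk'E p1 Lf).
- exact: (setting_lower S baseU K1 KE KI Jk'E p1 Lf).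
Qed.

Lemma upper_const_gt0 (R : realType) (p : R) : 1 < p -> 0 < upper_const p.
Proof.
move=> p1; have M0 := maximal_const_ge0 p1.
have c0 : 0 < Num.min 1 (p - 1) / 2 by case: (leP 1 (p - 1)) => ?; lra.
rewrite /upper_const mulr_gt0 ?powR_gt0 ?exprn_gt0 ?divr_gt0//; first by lra.
by rewrite ltr_wpDl// invr_gt0.
Qed.

Lemma poweR_inv_le (R : realType) (p c : R) (a b : \bar R) : 0 < p -> 0 < c ->
  (0 <= a)%E -> (0 <= b)%E -> (a <= c%:E * b)%E ->
  (a `^ p^-1 <= (c `^ p^-1)%:E * b `^ p^-1)%E.
Proof.
move=> p0 c0 a0 b0 h; rewrite -poweR_EFin -poweRM//; last by rewrite lee_fin ltW.
apply: gt0_ler_poweR => //; first by rewrite invr_ge0 ltW.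
- by rewrite in_itv/= a0 leey.
- by rewrite in_itv/= leey andbT mule_ge0// lee_fin ltW.
Qed.

(** * Fair coins *)

Definition cylinder (n : nat) (w : nat -> bool) : set (nat -> bool) :=
  [set s | forall k, (k < n)%N -> s k = w k].

Definition cylinders : set (set (nat -> bool)) :=
  [set C | C = set0 \/ exists n w, C = cylinder n w].

Definition coins := g_sigma_algebraType cylinders.

Lemma measurable_cylinder n w : measurable (cylinder n w : set coins).
Proof. by apply: sub_sigma_algebra; right; exists n, w. Qed.

Lemma setI_closed_cylinders : setI_closed cylinders.
Proof.
move=> A B [->|[n [w ->]]]; first by rewrite set0I; left.
move=> [->|[k [v ->]]]; first by rewrite setI0; left.
wlog nk : n k w v / (n <= k)%N.
  by move=> h; case/orP: (leq_total n k) => [/h//|/h hk]; rewrite setIC; exact: hk.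
case: (pselect (exists s, (cylinder n w `&` cylinder k v) s)) => [[s [sw sv]]|h]; last first.
  by left; apply/seteqP; split => // s hs; apply: h; exists s.
right; exists k, v; apply/seteqP; split => [x []//|x xv]; split => // j jn.
by rewrite xv ?(leq_trans jn)// -sv ?(leq_trans jn)// sw.
Qed.

Lemma measurable_bit k b : measurable ([set s | s k = b] : set coins).
Proof.
rewrite (_ : [set s | _] = \bigcup_(l in [set l : seq bool | nth false l k = b])
   cylinder k.+1 (nth false l)); last first.
  apply/seteqP; split => [s <-|s [l <- h]]; last exact: h.
  exists (mkseq s k.+1) => [|j jk] /=; first by rewrite nth_mkseq.
  by rewrite nth_mkseq.
rewrite bigcup_mkcond; apply: countable_bigcupT_measurable => [|l].
  exact: countableP.
by case: ifP => // _; exact: measurable_cylinder.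
Qed.

Lemma measurable_to_coins d (T : measurableType d) (f : T -> coins) :
  (forall k b, measurable [set x | f x k = b]) -> measurable_fun setT f.
Proof.
move=> h; apply: (@measurability _ _ T coins setT f cylinders erefl) => _ [_ [->|[n [w ->]]] <-].
  by rewrite preimage_set0 setI0.
rewrite setTI (_ : _ @^-1` _ = \bigcap_(k < n) [set x | f x k = w k]); last first.
  by apply/seteqP; split => [x h1 k|x h1 k]; exact: h1.
by apply: bigcap_measurableType => // k _.
Qed.

(** A pair of independent coin sequences is coded as one, with the halves at even and odd positions.
    Decoding repeatedly draws a fresh clock for every jump from a single sequence. *)
Definition interleave (z : coins * coins) : coins :=
  fun k => if odd k then z.2 k./2 else z.1 k./2.
Definition evens (s : coins) : coins := fun k => s k.*2.
Definition odds (s : coins) : coins := fun k => s k.*2.+1.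

Lemma evens_interleave z : evens (interleave z) = z.1.
Proof. by apply/funext => k; rewrite /evens /interleave odd_double doubleK. Qed.

Lemma odds_interleave z : odds (interleave z) = z.2.
Proof. by apply/funext => k; rewrite /odds /interleave /= odd_double/= uphalf_double. Qed.

Lemma measurable_interleave : measurable_fun setT interleave.
Proof.
apply: measurable_to_coins => k b; rewrite /interleave; case: (odd k).
- by rewrite -[X in measurable X]setTI; exact: (@measurable_snd _ _ coins coins measurableT _ (measurable_bit _ b)).
- by rewrite -[X in measurable X]setTI; exact: (@measurable_fst _ _ coins coins measurableT _ (measurable_bit _ b)).
Qed.

Lemma measurable_evens : measurable_fun setT evens.
Proof. by apply: measurable_to_coins => k b; exact: measurable_bit. Qed.

Lemma measurable_odds : measurable_fun setT odds.
Proof. by apply: measurable_to_coins => k b; exact: measurable_bit. Qed.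

Section fair_coins.
Variable R : realType.

Definition doubling (x : R) : R := if 2^-1 <= x then 2 * x - 1 else 2 * x.

Definition bits (x : R) : coins := fun k => 2^-1 <= iter k doubling x.

Lemma measurable_doubling : measurable_fun setT doubling.
Proof.
apply: measurable_fun_ifT.
- by apply: measurable_fun_ler.
- by apply: measurable_funB => //; apply: measurable_funM.
- by apply: measurable_funM.
Qed.

Lemma measurable_bits : measurable_fun setT bits.
Proof.
have mi k : measurable_fun setT (fun x : R => iter k doubling x).
  by elim: k => [|k ih] /=; [exact: measurable_id|apply: measurableT_comp ih => //; exact: measurable_doubling].
apply: measurable_to_coins => k b.
have := measurable_fun_ler (measurable_cst (2^-1 : R)) (mi k).
by move=> /(_ measurableT [set b] I); rewrite setTI.
Qed.

Definition unit_interval : set R := `[0, 1[%classic.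

Lemma measurable_unit_interval : measurable unit_interval.
Proof. exact: measurable_itv. Qed.

Lemma doubling_unit (x : R) : unit_interval x -> unit_interval (doubling x).
Proof.
rewrite /unit_interval /= !in_itv /= => /andP[x0 x1]; rewrite /doubling.
by have [h|h] := leP 2^-1 x; lra.
Qed.

Fixpoint dyadic_value n (w : nat -> bool) : R :=
  if n is n'.+1 then ((w 0%N)%:R + dyadic_value n' (fun k => w k.+1)) / 2 else 0.

Lemma dyadic_value_ge0 n w : 0 <= dyadic_value n w.
Proof. by elim: n w => //= n ih w; rewrite divr_ge0// addr_ge0. Qed.

Lemma dyadic_value_le1 n w : dyadic_value n w + 2^-1 ^+ n <= 1.
Proof.
elim: n w => [|n ih] w /=; first by rewrite expr0 add0r.
by have := ih (fun k => w k.+1); rewrite exprS; case: (w 0%N) => /=; lra.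
Qed.

Lemma bits_cylinder n w x : unit_interval x ->
  cylinder n w (bits x) <-> (dyadic_value n w <= x < dyadic_value n w + 2^-1 ^+ n).
Proof.
elim: n w x => [|n ih] w x xu.
  by split => // _; move: xu; rewrite /unit_interval /= in_itv /= expr0 add0r.
have xu2 := doubling_unit xu.
have -> : cylinder n.+1 w (bits x) <->
    bits x 0%N = w 0%N /\ cylinder n (fun k => w k.+1) (bits (doubling x)).
  split=> [h|[h0 h] [//|k]].
    by split=> [|k kn]; [exact: h|rewrite -(h k.+1)// /bits iterSr].
  by rewrite ltnS => /h; rewrite /bits iterSr.
rewrite (ih _ _ xu2) /= exprS.
have := dyadic_value_ge0 n (fun k => w k.+1).
have := dyadic_value_le1 n (fun k => w k.+1).
have : (0 : R) < 2^-1 ^+ n by rewrite exprn_gt0.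
move: (2^-1 ^+ n) (dyadic_value n _) => e v e0 ve v0.
move: xu; rewrite /unit_interval /= in_itv /= => /andP[x0 x1].
rewrite /bits /= /doubling.
case: (w 0%N) => /=; case: (leP 2^-1 x) => xh; split => [[]//|] //; lra.
Qed.

(** The binary digits of a uniform point of the unit interval are independent fair coins. *)
Definition fair_coins : set coins -> \bar R :=
  image_measure (mrestr (@lebesgue_measure R) measurable_unit_interval) measurable_bits.

HB.instance Definition _ := Measure.copy fair_coins
  (image_measure (mrestr (@lebesgue_measure R) measurable_unit_interval) measurable_bits).

Lemma fair_coins_setT : fair_coins setT = 1%E.
Proof.
rewrite /fair_coins /= /pushforward /mrestr preimage_setT setTI /unit_interval.
by rewrite lebesgue_measure_itv /= lte_fin ltr01 oppr0 adde0.
Qed.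

HB.instance Definition _ :=
  Measure_isProbability.Build _ _ _ fair_coins fair_coins_setT.

Lemma fair_coins_cylinder n w : fair_coins (cylinder n w) = (2^-1 ^+ n)%:E.
Proof.
rewrite /fair_coins /= /pushforward /mrestr.
rewrite (_ : _ `&` _ = `[dyadic_value n w, (dyadic_value n w + 2^-1 ^+ n)[%classic).
  have e0 : (0 : R) < 2^-1 ^+ n by rewrite exprn_gt0.
  by rewrite lebesgue_measure_itv /= lte_fin ltrDl e0 -EFinB addrC addKr.
apply/seteqP; split => [x [xw xu]|x] /=.
  by rewrite in_itv /=; apply/(bits_cylinder n w xu).
rewrite in_itv /= => xd.
have xu : unit_interval x.
  have := dyadic_value_ge0 n w; have := dyadic_value_le1 n w.
  by rewrite /unit_interval /= in_itv /=; case/andP: xd => *; lra.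
by split => //; apply/(bits_cylinder n w xu).
Qed.

Lemma interleave_cylinder n w : interleave @^-1` cylinder n w =
  cylinder (uphalf n) (evens w) `*` cylinder n./2 (odds w).
Proof.
apply/seteqP; split => [[a b] /= h|[a b] [/= ha hb] k kn].
  split => k kn /=.
    have := h k.*2; rewrite /interleave odd_double doubleK /= => -> //.
    by lia.
  have := h k.*2.+1; rewrite /interleave /= odd_double /= uphalf_double => -> //.
  by lia.
rewrite /interleave; case: ifPn => ok.
  rewrite /= hb /odds; last by lia.
  by congr w; lia.
by rewrite /= ha /evens; [congr w; lia|lia].
Qed.

(** On a cylinder of length [n] both sides are [2^-n], with [uphalf n] coins at even positions and
    [n./2] at odd ones. Cylinders are stable under intersection, so the two measures coincide. *)
Lemma fair_coins_interleave (A : set coins) : measurable A ->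
  fair_coins A = (fair_coins \x fair_coins)%E (interleave @^-1` A).
Proof.
move=> mA.
pose mu2 := image_measure (fair_coins \x fair_coins)%E measurable_interleave.
apply: (@measure_unique _ R coins cylinders (fun=> setT) erefl setI_closed_cylinders
  _ _ fair_coins mu2 _ _ A mA).
- by right; exists 0%N, (fun=> false); apply/seteqP; split.
- by rewrite bigcup_const.
- move=> C [->|[n [w ->]]]; first by rewrite !measure0.
  rewrite [RHS](_ : _ = (fair_coins \x fair_coins)%E (interleave @^-1` cylinder n w))//.
  rewrite interleave_cylinder product_measure1E; [|exact: measurable_cylinder..].
  transitivity (fair_coins (cylinder (uphalf n) (evens w)) *
      fair_coins (cylinder n./2 (odds w)))%E; last by [].
  rewrite !fair_coins_cylinder -EFinM -exprD uphalf_half -addnA addnn odd_double_half.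
  exact: fair_coins_cylinder.
- by move=> n; have := @fair_coins_setT; rewrite -[X in (X < _)%E]/(fair_coins setT) => ->; exact: ltry.
Qed.

Definition coin_value (s : coins) : R :=
  fine (\sum_(k <oo) (if s k then 2^-1 ^+ k.+1 else 0)%:E)%E.

Lemma measurable_coin_value : measurable_fun setT coin_value.
Proof.
apply: measurableT_comp => //; apply: ge0_emeasurable_sum => [k s _ _|k _].
  by rewrite lee_fin; case: ifP => // _; rewrite exprn_ge0.
apply/measurable_EFinP; apply: measurable_fun_ifT => //.
apply: (measurable_fun_bool true); rewrite setTI; exact: measurable_bit.
Qed.

Lemma bits_expansion (x : R) n : unit_interval x ->
  x = \sum_(0 <= k < n) (if bits x k then 2^-1 ^+ k.+1 else 0) +
      2^-1 ^+ n * iter n doubling x.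
Proof.
move=> xu; elim: n => [|n ih]; first by rewrite big_geq// expr0 mul1r add0r.
rewrite big_nat_recr//= {1}ih -addrA; congr (_ + _).
by rewrite /bits /= /doubling exprS; case: (2^-1 <= _); field.
Qed.

Lemma coin_value_bits (x : R) : unit_interval x -> coin_value (bits x) = x.
Proof.
move=> xu; rewrite /coin_value (_ : (\sum_(k <oo) _)%E = x%:E)//.
apply: cvg_lim => //.
rewrite (_ : (fun n => _) = EFin \o (fun n => x - 2^-1 ^+ n * iter n doubling x)); last first.
  apply/funext => n /=; rewrite sumEFin; congr EFin.
  by rewrite {2}(bits_expansion n xu) addrK.
apply: cvg_EFin; first by near=> n.
rewrite -[X in _ --> X]subr0; apply: cvgB; first exact: cvg_cst.
have un n : unit_interval (iter n doubling x) by elim: n => //= n; exact: doubling_unit.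
apply: (@squeeze_cvgr _ _ _ _ (cst 0) (fun n => 2^-1 ^+ n)).
- near=> n; have := un n; rewrite /unit_interval /= in_itv /= => /andP[i0 i1].
  by rewrite mulr_ge0 ?exprn_ge0//= ler_piMr ?exprn_ge0// ltW.
- exact: cvg_cst.
- by apply: cvg_expr; rewrite ger0_norm//; lra.
Unshelve. all: by end_near. Qed.

(** The first binary digit is kept for [mark]; [doubling] removes it and leaves an independent
    uniform value, which the logarithm turns into an exponential time. The maximum with [0] secures
    nonnegativity on every sequence. *)
Definition clock (s : coins) : R := Num.max 0 (- ln (1 - doubling (coin_value s))).
Definition mark (s : coins) : bool := 2^-1 <= coin_value s.

Lemma measurable_clock : measurable_fun setT clock.
Proof.
apply: measurable_maxr => //; apply: measurableT_comp => //.
apply: measurableT_comp; first exact: measurable_ln.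
apply: measurable_funB => //; apply: measurableT_comp; first exact: measurable_doubling.
exact: measurable_coin_value.
Qed.

Lemma measurable_mark : measurable_fun setT mark.
Proof. by apply: measurable_fun_ler => //; exact: measurable_coin_value. Qed.

Lemma clock_ge0 s : 0 <= clock s.
Proof. by rewrite /clock le_max lexx. Qed.

Lemma fair_coins_clock (t : R) b : 0 <= t ->
  fair_coins [set s | t < clock s /\ mark s = b] = (expR (- t) / 2)%:E.
Proof.
move=> t0; rewrite /fair_coins /= /pushforward /mrestr.
have q0 := expR_gt0 (- t); have q1 : expR (- t) <= 1 by rewrite -expR0 ler_expR oppr_le0.
(* With the first digit fixed, [doubling x > 1 - expR (- t)] describes an interval of length
   [expR (- t) / 2]. *)
set i := if b then `]1 - expR (- t) / 2, 1[ else `](1 - expR (- t)) / 2, 2^-1[.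
rewrite (_ : _ `&` _ = [set` i]).
  rewrite lebesgue_measure_itv /i; case: (b) => /=; rewrite lte_fin.
    by rewrite ifT; [congr EFin; lra|lra].
  by rewrite ifT; [congr EFin; lra|lra].
apply/seteqP; split => x.
  move=> [[xt xb] xu]; move: xt xb (doubling_unit xu); rewrite /clock /mark coin_value_bits//.
  move: xu; rewrite /unit_interval /= !in_itv /= => /andP[x0 x1].
  rewrite lt_max ltNge t0 /= => tx xb /andP[d0 d1].
  have : 1 - doubling x < expR (- t).
    by rewrite -ltr_ln ?posrE ?subr_gt0// expRK; lra.
  by move: xb; rewrite /i /doubling; case: (b); have [h|h] := leP 2^-1 x => //= _ ?; lra.
move=> xi; have xu : unit_interval x.
  by move: xi; rewrite /i /unit_interval /= in_itv /=; case: (b); rewrite in_itv /=; lra.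
split => //; rewrite /= /clock /mark coin_value_bits//.
have := doubling_unit xu; rewrite /unit_interval /= in_itv /= => /andP[d0 d1].
have e : (2^-1 <= x) = b.
  by move: xi; rewrite /i; case: (b); have [h|h] := leP 2^-1 x => //=; rewrite in_itv /=; lra.
split => //; rewrite lt_max ltNge t0 /= ltrNr -[ltRHS]expRK ltr_ln ?posrE ?subr_gt0//.
by move: xi; rewrite /i /doubling e; case: (b); rewrite /= in_itv /=; lra.
Qed.

End fair_coins.

(** * Jump chains with exponential clocks *)

Section jump_chain.
Context d (N : measurableType d) (R : realType) (V : choiceType).
Variables (hd tl : N -> N) (tau : N -> R) (mrk : N -> bool).
Variables (lam : V -> R) (nxt : V -> bool -> V).

Definition hold v s := tau (hd s) / lam v.
Definition jump_to v s := nxt v (mrk (hd s)).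

Fixpoint steps n v s t : V :=
  if n is n'.+1 then
    if t < hold v s then v else steps n' (jump_to v s) (tl s) (t - hold v s)
  else v.

Definition clk k s := tau (hd (iter k tl s)).

Lemma clkS k s : clk k.+1 s = clk k (tl s).
Proof. by rewrite /clk iterSr. Qed.

Definition good s := forall M : nat, exists k, M%:R < clk k s.

(* The exceptional noises outside good, which may make the clocks accumulate,
   give constant paths. *)
Definition chain v s t : V :=
  if `[< good s >] then
    xget v [set y | exists k, forall n, (k <= n)%N -> steps n v s t = y]
  else v.

Variable Lam : R.
Hypothesis tau_ge0 : forall s, 0 <= tau s.
Hypothesis lam_gt0 : forall v, 0 < lam v.
Hypothesis lam_le : forall v, lam v <= Lam.

Lemma hold_ge0 v s : 0 <= hold v s.
Proof. by rewrite divr_ge0// ltW. Qed.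

Lemma Lam_ge0 (v : V) : 0 <= Lam.
Proof. exact: le_trans (ltW (lam_gt0 v)) (lam_le v). Qed.

Lemma clk0_hold v s t : Lam * t < clk 0 s -> t < hold v s.
Proof.
move=> h; rewrite /hold ltr_pdivlMr//; have [t0|t0] := leP 0 t.
  by rewrite (le_lt_trans _ h)// mulrC ler_wpM2r.
by rewrite (lt_le_trans _ (tau_ge0 _))// nmulr_rlt0.
Qed.

Lemma clk_tl k v s t : Lam * t < clk k.+1 s -> Lam * (t - hold v s) < clk k (tl s).
Proof.
rewrite clkS => h; rewrite (le_lt_trans _ h)// ler_wpM2l ?(Lam_ge0 v)//.
by rewrite gerBl hold_ge0.
Qed.

(** All rates are at most [Lam], so a clock of index [k] above [Lam * t] outlasts the remaining time
    in whatever state it starts: at most [k] jumps occur up to [t]. *)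
Lemma steps_stable k n v s t : Lam * t < clk k s -> (k < n)%N ->
  steps n v s t = steps k.+1 v s t.
Proof.
elim: k n v s t => [|k ih] [//|n] v s t h kn.
  by rewrite /= (clk0_hold v h).
rewrite [LHS]/= [RHS]/=; case: ifP => // _.
by rewrite (ih n) //; exact: clk_tl.
Qed.

Lemma good_clk s t : good s -> exists k, Lam * t < clk k s.
Proof.
move=> /(_ (Num.truncn (Lam * t)).+1) [k hk]; exists k.
by rewrite (lt_trans _ hk)// truncnS_gt.
Qed.

Lemma chain_steps k n v s t : good s -> Lam * t < clk k s -> (k < n)%N ->
  chain v s t = steps n v s t.
Proof.
move=> gs h kn; rewrite /chain asboolT//; case: xgetP => [y _ [j hj]|].
  by rewrite -(hj (maxn j n)) ?leq_maxl// !(steps_stable v h)// leq_max kn orbT.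
move=> /(_ (steps n v s t)) []; exists k.+1 => j kj.
by rewrite !(steps_stable v h).
Qed.

Lemma good_tl s : good (tl s) <-> good s.
Proof.
split => [h M|h M].
  by have [k hk] := h M; exists k.+1; rewrite clkS.
have [[|k] hk] := h (maxn M (Num.truncn (clk 0 s)).+1).
  move: hk; rewrite ltNge (le_trans (ltW (truncnS_gt (clk 0 s))))//.
  by rewrite ler_nat leq_maxr.
exists k; move: hk; rewrite clkS; apply: le_lt_trans.
by rewrite ler_nat leq_maxl.
Qed.

Lemma chain_lt v s t : t < hold v s -> chain v s t = v.
Proof.
move=> h; have [gs|gs] := pselect (good s); last by rewrite /chain asboolF.
have [k hk] := good_clk t gs.
by rewrite (chain_steps v gs hk (ltnSn _)) /= h.
Qed.

Lemma chain_ge v s t : good s -> hold v s <= t ->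
  chain v s t = chain (jump_to v s) (tl s) (t - hold v s).
Proof.
move=> gs h; have gt : good (tl s) by apply/good_tl.
have [k hk] := good_clk (t - hold v s) gt.
have [j hj] := good_clk t gs.
rewrite (@chain_steps j (maxn j k).+2 v s t)//; last by rewrite ltnS leqW// leq_maxl.
rewrite (@chain_steps k (maxn j k).+1 _ (tl s))//; last by rewrite ltnS leq_maxr.
by rewrite [LHS]/= ltNge h.
Qed.

Lemma chain_right v s t : exists2 e : R, 0 < e &
  forall u, t <= u -> u < t + e -> chain v s u = chain v s t.
Proof.
have [gs|gs] := pselect (good s); last first.
  by exists 1 => // u _ _; rewrite /chain asboolF.
have [k hk] := good_clk t gs.
elim: k v s t gs hk => [|k ih] v s t gs hk; have [th|th] := ltP t (hold v s).
- exists (hold v s - t) => [|u _ uh]; first by rewrite subr_gt0.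
  by rewrite !chain_lt//; lra.
- by have := clk0_hold v hk; rewrite ltNge th.
- exists (hold v s - t) => [|u _ uh]; first by rewrite subr_gt0.
  by rewrite !chain_lt//; lra.
have [||e e0 he] := ih (jump_to v s) (tl s) (t - hold v s); first by apply/good_tl.
  exact: clk_tl.
exists e => // u tu ut; rewrite (chain_ge gs th) (chain_ge gs (le_trans th tu)).
by apply: he; lra.
Qed.

Lemma chain_left v s t : exists2 e : R, 0 < e & exists y,
  forall u, t - e <= u -> u < t -> chain v s u = y.
Proof.
have [gs|gs] := pselect (good s); last first.
  by exists 1 => //; exists v => u _ _; rewrite /chain asboolF.
have [k hk] := good_clk t gs.
elim: k v s t gs hk => [|k ih] v s t gs hk; have [th|th] := leP t (hold v s).
- by exists 1 => //; exists v => u _ ut; rewrite chain_lt// (lt_le_trans ut).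
- by have := clk0_hold v hk; rewrite ltNge ltW.
- by exists 1 => //; exists v => u _ ut; rewrite chain_lt// (lt_le_trans ut).
have [||e e0 [y he]] := ih (jump_to v s) (tl s) (t - hold v s); first by apply/good_tl.
  exact: clk_tl.
exists (Num.min e (t - hold v s)); first by rewrite lt_min e0 subr_gt0.
have m1 : Num.min e (t - hold v s) <= e by rewrite ge_min lexx.
have m2 : Num.min e (t - hold v s) <= t - hold v s by rewrite ge_min lexx orbT.
by exists y => u tu ut; rewrite (chain_ge gs); [apply: he; lra|lra].
Qed.

Hypothesis mhd : measurable_fun setT hd.
Hypothesis mtl : measurable_fun setT tl.
Hypothesis mtau : measurable_fun setT tau.
Hypothesis mmrk : measurable_fun setT mrk.

Lemma measurable_clk k : measurable_fun setT (clk k).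
Proof.
apply: measurableT_comp => //; apply: measurableT_comp => //.
elim: k => [|k ih]; first exact: measurable_id.
exact: (measurableT_comp mtl ih).
Qed.

Lemma measurable_hold v : measurable_fun setT (hold v).
Proof. by apply: measurable_funM => //; apply: measurableT_comp. Qed.

Lemma measurable_good : measurable [set s | good s].
Proof.
rewrite (_ : [set s | _] = \bigcap_(M : nat) \bigcup_k [set s | M%:R < clk k s]).
  apply: bigcapT_measurable => M; apply: bigcupT_measurable => k.
  rewrite -[X in measurable X]setTI.
  exact: (measurable_fun_ltr (measurable_cst _) (measurable_clk k) measurableT (Y := [set true])).
apply/seteqP; split => [s gs M _|s gs M].
  by have [k hk] := gs M; exists k.
by have [k _ hk] := gs M I; exists k.
Qed.

Section joint.
Context d' (T : measurableType d').

Lemma measurable_steps n v (S : T -> N) (g : T -> R) (C : set V) :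
  measurable_fun setT S -> measurable_fun setT g ->
  measurable [set z | C (steps n v (S z) (g z))].
Proof.
elim: n v S g => [|n ih] v S g mS mg /=.
  have [c|c] := pselect (C v).
    by rewrite (_ : [set _ | _] = setT)//; apply/seteqP; split.
  by rewrite (_ : [set _ | _] = set0)//; apply/seteqP; split.
have mh : measurable_fun setT (fun z => hold v (S z)).
  exact: measurableT_comp (measurable_hold v) mS.
have m1 : measurable [set z | g z < hold v (S z)].
  rewrite -[X in measurable X]setTI.
  exact: (measurable_fun_ltr mg mh measurableT (Y := [set true])).
have mb b : measurable [set z | mrk (hd (S z)) = b].
  rewrite -[X in measurable X]setTI.
  exact: (measurableT_comp mmrk (measurableT_comp mhd mS) measurableT (Y := [set b])).
have mn b : measurable [set z | C (steps n (nxt v b) (tl (S z)) (g z - hold v (S z)))].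
  by apply: ih; [exact: measurableT_comp mtl mS|exact: measurable_funB].
rewrite (_ : [set _ | _] = ([set z | g z < hold v (S z)] `&` [set z | C v]) `|`
  (~` [set z | g z < hold v (S z)] `&` \bigcup_(b : bool) ([set z | mrk (hd (S z)) = b] `&`
    [set z | C (steps n (nxt v b) (tl (S z)) (g z - hold v (S z)))]))); last first.
  apply/seteqP; split => [z /=|z /=].
    case: ifP => h c; first by left.
    by right; split => //; exists (mrk (hd (S z))).
  case=> [[-> //]|[/negP/negbTE -> [b _ /= [<-]]]] //.
apply: measurableU.
  apply: measurableI => //; have [c|c] := pselect (C v).
    by rewrite (_ : [set _ | _] = setT)//; apply/seteqP; split.
  by rewrite (_ : [set _ | _] = set0)//; apply/seteqP; split.
apply: measurableI; first exact: measurableC.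
apply: countable_bigcupT_measurable => [|b]; first exact: countableP.
exact: measurableI.
Qed.

Lemma measurable_chain v (S : T -> N) (g : T -> R) (C : set V) :
  measurable_fun setT S -> measurable_fun setT g ->
  measurable [set z | C (chain v (S z) (g z))].
Proof.
move=> mS mg; have mG : measurable [set z | good (S z)].
  by rewrite -[X in measurable X]setTI; exact: mS measurableT _ measurable_good.
rewrite (_ : [set _ | _] = ([set z | good (S z)] `&`
    \bigcup_k \bigcap_(n in [set n | (k <= n)%N]) [set z | C (steps n v (S z) (g z))]) `|`
    (~` [set z | good (S z)] `&` [set z | C v])); last first.
  apply/seteqP; split => [z /= c|z /=].
    have [gs|gs] := pselect (good (S z)); last first.
      by right; split => //; move: c; rewrite /chain asboolF.
    have [k hk] := good_clk (g z) gs.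
    by left; split => //; exists k.+1 => // n /= kn; rewrite -(chain_steps v gs hk kn).
  case=> [[gs [k _ hk]]|[gs c]]; last by rewrite /chain asboolF.
  have [j hj] := good_clk (g z) gs.
  rewrite (@chain_steps j (maxn j k).+1 _ (S z))// ?ltnS ?leq_maxl//.
  by apply: hk => /=; rewrite leqW// leq_maxr.
apply: measurableU; apply: measurableI => //.
- apply: bigcupT_measurable => k; apply: bigcap_measurableType => // n _.
  exact: measurable_steps.
- exact: measurableC.
- have [c|c] := pselect (C v).
    by rewrite (_ : [set _ | _] = setT)//; apply/seteqP; split.
  by rewrite (_ : [set _ | _] = set0)//; apply/seteqP; split.
Qed.

End joint.
End jump_chain.

Section chain_markov.
Context d (N : measurableType d) (R : realType) (V : choiceType).
Variables (mu : probability N R) (cons : N * N -> N).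
Variables (hd tl : N -> N) (tau : N -> R) (mrk : N -> bool).
Variables (lam : V -> R) (nxt : V -> bool -> V).
Variable Lam : R.
Hypothesis tau_ge0 : forall s, 0 <= tau s.
Hypothesis lam_gt0 : forall v, 0 < lam v.
Hypothesis lam_le : forall v, lam v <= Lam.
Hypothesis mhd : measurable_fun setT hd.
Hypothesis mtl : measurable_fun setT tl.
Hypothesis mtau : measurable_fun setT tau.
Hypothesis mmrk : measurable_fun setT mrk.
Hypothesis mcons : measurable_fun setT cons.
Hypothesis hdK : forall z, hd (cons z) = z.1.
Hypothesis tlK : forall z, tl (cons z) = z.2.
Hypothesis consP : forall A, measurable A -> mu A = (mu \x mu)%E (cons @^-1` A).
Hypothesis tauP : forall t b, 0 <= t ->
  mu [set s | t < tau s /\ mrk s = b] = (expR (- t) / 2)%:E.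

Local Notation chain := (chain hd tl tau mrk lam nxt).
Local Notation good := (good hd tl tau).
Local Notation clk := (clk hd tl tau).

Let mchain d' (T : measurableType d') v (S : T -> N) (g : T -> R) (C : set V) :
    measurable_fun setT S -> measurable_fun setT g ->
    measurable [set z | C (chain v (S z) (g z))].
Proof. exact: (measurable_chain nxt tau_ge0 lam_gt0 lam_le mhd mtl mtau mmrk). Qed.

Lemma cons_integral (f : N -> \bar R) : measurable_fun setT f -> (forall s, 0 <= f s)%E ->
  (\int[mu]_s f s = \int[mu]_a \int[mu]_b f (cons (a, b)))%E /\
  (\int[mu]_s f s = \int[mu]_b \int[mu]_a f (cons (a, b)))%E.
Proof.
move=> mf f0.
have mg : measurable_fun setT (f \o cons) by exact: measurableT_comp.
have -> : (\int[mu]_s f s = \int[mu \x mu]_z (f \o cons) z)%E.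
  rewrite -(ge0_integral_image (mu \x mu)%E mcons mf f0).
  by apply: eq_measure_integral => A mA _; exact: (consP mA).
have g0 z : (0 <= (f \o cons) z)%E by exact: f0.
by split; [rewrite fubini_tonelli1|rewrite fubini_tonelli2].
Qed.

Lemma mu_integral A : measurable A -> (mu A = \int[mu]_s (\1_A s)%:E)%E.
Proof. by move=> mA; rewrite integral_indic// setIT. Qed.

Lemma mtau_gt t : measurable [set s | t < tau s].
Proof.
rewrite -[X in measurable X]setTI.
exact: (measurable_fun_ltr (measurable_cst _) mtau measurableT (Y := [set true])).
Qed.

Lemma mmrk_eq b : measurable [set s | mrk s = b].
Proof. by rewrite -[X in measurable X]setTI; exact: (mmrk measurableT (Y := [set b])). Qed.

Lemma tau_tail t : 0 <= t -> mu [set s | t < tau s] = (expR (- t))%:E.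
Proof.
move=> t0; pose B b := [set s | t < tau s /\ mrk s = b].
have mB b : measurable (B b) by apply: measurableI; [exact: mtau_gt|exact: mmrk_eq].
have -> : [set s | t < tau s] = B true `|` B false.
  apply/seteqP; split => [s /= h|s /= [[]|[]]//].
  by case e : (mrk s); [left|right].
have -> : mu (B true `|` B false) = (mu (B true) + mu (B false))%E.
  apply: measureU => //.
  by apply/seteqP; split => // s [[_ e1] [_ e2]]; move: e1; rewrite e2.
by rewrite /B !tauP// -EFinD; congr EFin; lra.
Qed.

Lemma tau_le t : 0 <= t -> mu [set s | ~ t < tau s] = (1 - expR (- t))%:E.
Proof.
by move=> t0; rewrite [LHS](probability_setC mu (mtau_gt t)) EFinB -(tau_tail t0).
Qed.

Lemma clk0K z : clk 0 (cons z) = tau z.1.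
Proof. by rewrite -[clk 0 _]/(tau (hd _)) hdK. Qed.

(** For the event [Q M] that no clock exceeds [M], independence of the first clock from the others
    gives [mu (Q M) = (1 - expR (- M)) mu (Q M)], hence measure zero. *)
Lemma good_ae : mu [set s | ~ good s] = 0%E.
Proof.
pose Q (M : nat) := [set s | forall k, ~ M%:R < clk k s].
have mQ M : measurable (Q M).
  rewrite (_ : Q M = \bigcap_k ~` [set s | M%:R < clk k s]); last first.
    by apply/seteqP; split => [s h k _|s h k]; exact: h.
  apply: bigcapT_measurable => k; apply: measurableC; rewrite -[X in measurable X]setTI.
  exact: (measurable_fun_ltr (measurable_cst _) (measurable_clk mhd mtl mtau k)
    measurableT (Y := [set true])).
have Q0 M : mu (Q M) = 0%E.
  have h : mu (Q M) = ((1 - expR (- M%:R))%:E * mu (Q M))%E.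
    rewrite {1}(consP (mQ M)) -tau_le//.
    rewrite (_ : _ @^-1` _ = [set s | ~ M%:R < tau s] `*` Q M).
      by rewrite product_measure1E//; apply: measurableC; exact: mtau_gt.
    apply/seteqP; split => [[a b] h|[a b] [/= ha hb] [|k]].
    - split => /= [|k]; first by have := h 0%N; rewrite clk0K.
      by have := h k.+1; rewrite clkS tlK.
    - by rewrite clk0K.
    - by rewrite clkS tlK; exact: hb.
  move: h; have : mu (Q M) \is a fin_num by exact: fin_num_measure.
  case/fineK => <-; move: (fine _) => r; rewrite -EFinM => -[h].
  have e0 := expR_gt0 (- M%:R : R); congr EFin; nra.
have QN : mu.-negligible (\bigcup_M Q M).
  apply: negligible_bigcup => M; exists (Q M); split => //; exact: Q0.
apply: measure_negligible; first by apply: measurableC; exact: measurable_good.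
apply: negligibleS QN => s gs; apply: contrapT => h; apply: gs => M; apply: contrapT => hM.
by apply: h; exists M => // k hk; apply: hM; exists k.
Qed.

(** The law of the residual clock and the scaled law of a new clock agree on the half-lines to the
    right, which generate. The mark is carried along because the path after the jump depends on
    it. *)
Lemma clock_memoryless (t : R) b (A : set R) : 0 <= t -> measurable A ->
  mu [set s | t < tau s /\ A (tau s - t) /\ mrk s = b] =
  ((expR (- t))%:E * mu [set s | (0 < tau s)%R /\ A (tau s) /\ mrk s = b])%E.
Proof.
move=> t0 mA.
have mg : measurable_fun setT (fun s => tau s - t) by exact: measurable_funB.
pose D1 := [set s | t < tau s /\ mrk s = b].
pose D2 := [set s | 0 < tau s /\ mrk s = b].
have mD1 : measurable D1 by apply: measurableI; [exact: mtau_gt|exact: mmrk_eq].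
have mD2 : measurable D2 by apply: measurableI; [exact: mtau_gt|exact: mmrk_eq].
pose m1 := image_measure (mrestr mu mD1) mg.
have e0 : 0 <= expR (- t) by exact: expR_ge0.
pose m2 := mscale (NngNum e0) (image_measure (mrestr mu mD2) mtau).
have h : forall x, m1 `]x, +oo[%classic = m2 `]x, +oo[%classic.
  move=> x; rewrite /m1 /m2 /mscale /image_measure /= /pushforward /mrestr.
  (* Both clocks are positive on the events considered, so a threshold below [0] acts like [0]. *)
  pose y := Num.max 0 x; have y0 : 0 <= y by rewrite le_max lexx.
  rewrite (_ : _ `&` D1 = [set s | t + y < tau s /\ mrk s = b]); last first.
    apply/seteqP; split => s; rewrite /D1 /= in_itv /= andbT.
      by move=> [h1 [h2 ->]]; split => //; rewrite addrC -ltrBrDr gt_max h1 subr_gt0 h2.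
    move=> [h1 ->]; have h2 : y < tau s - t by lra.
    by move: h2; rewrite gt_max => /andP[h2 ->]; split => //; split => //; lra.
  rewrite (_ : _ `&` D2 = [set s | y < tau s /\ mrk s = b]); last first.
    apply/seteqP; split => s; rewrite /D2 /= in_itv /= andbT.
      by move=> [h1 [h2 ->]]; split => //; rewrite gt_max h1 h2.
    by move=> [h1 ->]; move: h1; rewrite gt_max => /andP[-> ->].
  rewrite !tauP ?addr_ge0// -EFinM; congr EFin.
  by rewrite opprD expRD mulrA.
have mE : m1 A = m2 A; last first.
  transitivity (m1 A); last (rewrite mE /m2 /mscale /=; congr (_ * mu _)%E).
    by congr (mu _); apply/seteqP; split => [s [h1 [h2 h3]]|s [h1 [h2 h3]]]; split.
  by apply/seteqP; split => [s [h1 [h2 h3]]|s [h1 [h2 h3]]]; split.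
apply: (@measure_unique _ _ _ (@RGenOInfty.G R)
  (fun k => `](- k%:R), +oo[%classic) (RGenOInfty.measurableE R) _ _ _ m1 m2 _ _ A mA).
- move=> _ _ [x ->] [y ->]; exists (Num.max x y).
  by apply/seteqP; split => z; rewrite /= !in_itv/= !andbT gt_max; [case=> -> ->|case/andP].
- by move=> k; exists (- k%:R).
- apply/seteqP; split => // x _; exists (Num.truncn (- x)).+1 => //=.
  by rewrite in_itv /= andbT ltrNl truncnS_gt.
- by move=> _ [x ->]; exact: h.
- move=> k; rewrite /m1 /image_measure /= /pushforward /mrestr.
  have mI : measurable ((fun s => tau s - t) @^-1` `](- k%:R), +oo[ `&` D1).
    apply: measurableI => //; rewrite -[X in measurable X]setTI.
    exact: (mg measurableT _ (measurable_itv _)).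
  by rewrite -ge0_fin_numE// fin_num_measure.
Qed.

Lemma measurable_cons1 b : measurable_fun setT (fun a => cons (a, b)).
Proof. by apply: (measurableT_comp mcons); exact: measurable_fun_pair. Qed.

Lemma measurable_cons2 a : measurable_fun setT (fun b => cons (a, b)).
Proof. by apply: (measurableT_comp mcons); exact: measurable_fun_pair. Qed.

Lemma measurable_section1 P b : measurable P -> measurable [set a | P (cons (a, b))].
Proof.
by move=> mP; rewrite -[X in measurable X]setTI; exact: measurable_cons1 measurableT _ mP.
Qed.

Lemma measurable_section2 P a : measurable P -> measurable [set b | P (cons (a, b))].
Proof.
by move=> mP; rewrite -[X in measurable X]setTI; exact: measurable_cons2 measurableT _ mP.
Qed.

Lemma indic_cons_integral P b : measurable P ->
  (\int[mu]_a (\1_P (cons (a, b)))%:E = mu [set a | P (cons (a, b))])%E.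
Proof.
by move=> mP; rewrite (mu_integral (measurable_section1 b mP)); apply: eq_integral.
Qed.

Lemma measurable_section_measure P : measurable P ->
  measurable_fun setT (fun b => mu [set a | P (cons (a, b))]).
Proof.
move=> mP; under eq_fun do rewrite -indic_cons_integral//.
apply: (measurable_fun_fubini_tonelli_G (m1 := mu) (fun z => (\1_P (cons z))%:E)) => [|z].
  by apply/measurable_EFinP; apply: (measurableT_comp _ mcons); exact: measurable_indic.
by rewrite lee_fin.
Qed.

Lemma cons_measure P : measurable P ->
  (mu P = \int[mu]_b mu [set a | P (cons (a, b))])%E.
Proof.
move=> mP; rewrite (mu_integral mP).
have [||_ ->] := @cons_integral (fun s => (\1_P s)%:E).
- by apply/measurable_EFinP; exact: measurable_indic.
- by move=> s; rewrite lee_fin.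
by apply: eq_integral => b _; rewrite indic_cons_integral.
Qed.

Lemma measure_mark_split A : measurable A ->
  mu A = (mu [set s | A s /\ mrk s = true] + mu [set s | A s /\ mrk s = false])%E.
Proof.
move=> mA; rewrite -[in RHS]measureU.
- congr (mu _); apply/seteqP; split => [s /= h|s /= [[]|[]]//].
  by case e : (mrk s); [left|right].
- by apply: measurableI => //; exact: mmrk_eq.
- by apply: measurableI => //; exact: mmrk_eq.
- by apply/seteqP; split => // s [[_ e1] [_ e2]]; move: e1; rewrite e2.
Qed.

Lemma measure_tau_gt0 A : measurable A -> mu A = mu [set s | 0 < tau s /\ A s].
Proof.
move=> mA; have mD := mtau_gt 0.
rewrite [LHS](measureDI mu mA mD) [X in (X + _)%E](_ : _ = 0%E).
  by rewrite add0e setIC.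
apply/eqP; rewrite eq_le measure_ge0 andbT.
have <- : mu [set s | ~ 0 < tau s] = 0%E by rewrite tau_le// oppr0 expR0 subrr.
apply: le_measure; rewrite ?inE; [exact: measurableD|exact: measurableC|].
by move=> s [].
Qed.

Lemma chain_cons v a b t : good b ->
  chain v (cons (a, b)) t =
  if t < tau a / lam v then v else chain (nxt v (mrk a)) b (t - tau a / lam v).
Proof.
move=> gb; have hE : hold hd tau lam v (cons (a, b)) = tau a / lam v by rewrite /hold hdK.
have gs : good (cons (a, b)) by apply/good_tl => //; rewrite tlK.
have [h|h] := ltP; first by rewrite (chain_lt _ _ _ tau_ge0 lam_gt0 lam_le)// hE.
by rewrite (chain_ge _ _ tau_ge0 lam_gt0 lam_le gs) ?hE// /jump_to hdK tlK.
Qed.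

(** With the later noise [b] fixed, the event depends on the first clock only through its residual
    [tau a - lam v * t] and its mark, so [clock_memoryless] applies; then one integrates over
    [b]. *)
Lemma chain_survival v (t u : R) (C : set V) : 0 <= t -> 0 <= u ->
  mu [set s | lam v * t < tau (hd s) /\ C (chain v s (t + u))] =
  ((expR (- (lam v * t)))%:E * mu [set s | C (chain v s u)])%E.
Proof.
move=> t0 u0; have lv := lam_gt0 v; have lt0 : 0 <= lam v * t by rewrite mulr_ge0// ltW.
have mC x : measurable [set s | C (chain v s x)].
  by apply: (@mchain _ _ _ id (fun=> x)).
have mP : measurable [set s | lam v * t < tau (hd s) /\ C (chain v s (t + u))].
  apply: measurableI; last exact: mC.
  by rewrite -[X in measurable X]setTI; exact: (mhd measurableT (mtau_gt _)).
rewrite (cons_measure mP) (cons_measure (mC u)) -ge0_integralZl//; last first.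
- exact: measurable_section_measure.
apply: ge0_ae_eq_integral_nonmeasurable => [b|b|]; first exact: measure_ge0.
  by rewrite mule_ge0// lee_fin expR_ge0.
exists [set b | ~ good b]; split.
- by apply: measurableC; exact: measurable_good.
- exact: good_ae.
apply: subsetCl => b /= /contrapT gb.
pose Psi r be := C (if u < r / lam v then v else chain (nxt v be) b (u - r / lam v)).
have mPsi be : measurable [set r | Psi r be].
  have mr : measurable_fun setT (fun r : R => r / lam v) by exact: measurable_funM.
  have m1 : measurable [set r : R | u < r / lam v].
    rewrite -[X in measurable X]setTI.
    exact: (measurable_fun_ltr (measurable_cst _) mr measurableT (Y := [set true])).
  rewrite (_ : [set r | _] = ([set r | u < r / lam v] `&` [set r | C v]) `|`
     (~` [set r | u < r / lam v] `&` [set r | C (chain (nxt v be) b (u - r / lam v))])).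
    apply: measurableU; apply: measurableI => //; last 2 first.
    - exact: measurableC.
    - by apply: (@mchain _ _ _ (fun=> b)) => //; exact: measurable_funB.
    have [c|c] := pselect (C v).
      by rewrite (_ : [set _ | _] = setT)//; apply/seteqP; split.
    by rewrite (_ : [set _ | _] = set0)//; apply/seteqP; split.
  apply/seteqP; split => r /=; rewrite /Psi.
    by case: ifP => h c; [left|right].
  by case=> [[-> //]|[/negP/negbTE ->]].
have lE a : (tau a - lam v * t) / lam v = tau a / lam v - t.
  by rewrite mulrBl mulrAC mulfV ?mul1r// gt_eqF.
have mS : measurable [set a | 0 < tau a /\ C (chain v (cons (a, b)) u)].
  by apply: measurableI; [exact: mtau_gt|exact: (measurable_section1 b (mC u))].
rewrite (measure_mark_split (measurable_section1 b mP)).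
rewrite (measure_tau_gt0 (measurable_section1 b (mC u))) (measure_mark_split mS).
have key be : mu [set s | (lam v * t < tau (hd (cons (s, b))) /\
    C (chain v (cons (s, b)) (t + u))) /\ mrk s = be] =
    ((expR (- (lam v * t)))%:E *
     mu [set s | ((0 < tau s)%R /\ C (chain v (cons (s, b)) u)) /\ mrk s = be])%E.
  transitivity (mu [set a | lam v * t < tau a /\
      [set r | Psi r be] (tau a - lam v * t) /\ mrk a = be]).
    have e a : (t + u < tau a / lam v) = (u < tau a / lam v - t) by rewrite ltrBrDl.
    have e' a : t + u - tau a / lam v = u - (tau a / lam v - t) by lra.
    congr (mu _); apply/seteqP; split => a; rewrite /Psi /= lE hdK.
      by move=> [[h1 h2] h3]; split => //; split => //; move: h2; rewrite chain_cons// h3 e e'.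
    by move=> [h1 [h2 h3]]; split => //; split => //; rewrite chain_cons// h3 e e'.
  rewrite clock_memoryless//; congr (_ * mu _)%E; apply/seteqP; split => a.
    by move=> [h1 [h2 h3]]; split => //; split => //; rewrite chain_cons// h3.
  by move=> [[h1 h2] h3]; split => //; split => //; move: h2; rewrite chain_cons// h3.
by rewrite ge0_muleDr//; congr (_ + _)%E; exact: key.
Qed.

(** The past is expressed by invariance among noises with the same path up to [t] rather than by a
    generated sigma-algebra. Only [good] noises are compared, the others being null. *)
Definition admissible v t (B : set N) := measurable B /\
  forall s s', good s -> good s' ->
    (forall x, 0 <= x -> x <= t -> chain v s x = chain v s' x) -> B s -> B s'.

Lemma good_cons a b : good b -> good (cons (a, b)).
Proof. by move=> gb; apply/good_tl => //; rewrite tlK. Qed.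

Lemma admissible_section v t B a : admissible v t B -> tau a / lam v <= t ->
  admissible (nxt v (mrk a)) (t - tau a / lam v) [set b | B (cons (a, b))].
Proof.
move=> [mB hB] h; split; first exact: measurable_section2.
move=> b b' gb gb' hbb' /=; apply: hB; [exact: good_cons|exact: good_cons|].
move=> x x0 xt; rewrite !chain_cons//; case: ltP => // hx.
by apply: hbb'; lra.
Qed.

Lemma eq_integral_good (A A' : set N) (F : N -> \bar R) : (forall s, 0 <= F s)%E ->
  (forall s, good s -> A s <-> A' s) -> (\int[mu]_(s in A) F s = \int[mu]_(s in A') F s)%E.
Proof.
move=> F0 h; rewrite integral_mkcond [RHS]integral_mkcond.
apply: ge0_ae_eq_integral_nonmeasurable => [s|s|]; rewrite ?patchE.
- by case: ifP.
- by case: ifP.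
exists [set s | ~ good s]; split.
- by apply: measurableC; exact: measurable_good.
- exact: good_ae.
apply: subsetCl => s /= /contrapT gs; rewrite !patchE.
by rewrite (_ : (s \in A) = (s \in A'))//; apply/idP/idP => /set_mem/(h _ gs)/mem_set.
Qed.

(* The hypotheses say that F v t, a function of the path started at v, only
   looks at the path after time t. *)
Record future_functional (F : V -> R -> N -> \bar R) : Prop := {
  ff_measurable : forall v t, measurable_fun setT (F v t) ;
  ff_ge0 : forall v t s, (0 <= F v t s)%E ;
  ff_le1 : forall v t s, (F v t s <= 1)%E ;
  ff_shift : forall v t a b, good b -> tau a / lam v <= t ->
    F v t (cons (a, b)) = F (nxt v (mrk a)) (t - tau a / lam v) b }.

Definition late v t : set N := [set s | lam v * t < tau (hd s)].

Lemma measurable_late v t : measurable (late v t).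
Proof. by rewrite -[X in measurable X]setTI; exact: (mhd measurableT (mtau_gt _)). Qed.

Definition early (F : V -> R -> N -> \bar R) v t (B : set N) a : \bar R :=
  if (lam v * t < tau a)%R then 0%E
  else (\int[mu]_(b in [set b | B (cons (a, b))])
    F (nxt v (mrk a)) (t - tau a / lam v)%R b)%E.

Lemma early_integral F v t B : future_functional F -> measurable B ->
  (\int[mu]_(s in B `\` late v t) F v t s =
   \int[mu]_a early F v t B a)%E /\ measurable_fun setT (early F v t B).
Proof.
move=> ffF mB; pose G := F v t \_ (B `\` late v t).
have mBL : measurable (B `\` late v t) by apply: measurableD => //; exact: measurable_late.
have mG : measurable_fun setT G.
  apply/(measurable_restrictT _ _).1 => //.
  exact: (measurable_funTS (ff_measurable ffF v t)).
have G0 s : (0 <= G s)%E by rewrite /G patchE; case: ifP => // _; exact: ff_ge0 ffF _ _ _.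
have inner a : (\int[mu]_b G (cons (a, b)) = early F v t B a)%E.
  rewrite /early; case: ifPn => h.
    apply: integral0_eq => b _; rewrite /G patchE ifF//; apply/negbTE; rewrite notin_setE.
    by move=> [_]; apply; rewrite /late /= hdK.
  rewrite [RHS]integral_mkcond; apply: ge0_ae_eq_integral_nonmeasurable => [b|b|].
  - exact: G0.
  - by rewrite patchE; case: ifP => // _; exact: ff_ge0 ffF _ _ _.
  exists [set s | ~ good s]; split.
  - by apply: measurableC; exact: measurable_good.
  - exact: good_ae.
  apply: subsetCl => b /= /contrapT gb; rewrite /G !patchE.
  have hl : tau a / lam v <= t by rewrite ler_pdivrMr// mulrC leNgt.
  rewrite (ff_shift ffF gb hl).
  rewrite (_ : (cons (a, b) \in _) = (b \in [set b | B (cons (a, b))]))//.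
  apply/idP/idP => /set_mem; first by case=> *; exact/mem_set.
  by move=> hB; apply/mem_set; split => //; rewrite /late /= hdK; apply/negP.
split.
  rewrite integral_mkcond (cons_integral mG G0).1.
  by apply: eq_integral => a _; exact: inner.
rewrite (_ : early F v t B = (fun a => \int[mu]_b G (cons (a, b)))%E); last first.
  by apply/funext => a; rewrite inner.
apply: (measurable_fun_fubini_tonelli_F (m2 := mu) (fun z => G (cons z))) => [|z].
  exact: measurableT_comp mG mcons.
exact: G0.
Qed.

Section compare.
Variables F1 F2 : V -> R -> N -> \bar R.
Hypothesis ff1 : future_functional F1.
Hypothesis ff2 : future_functional F2.
Hypothesis late_eq : forall v t, 0 <= t ->
  (\int[mu]_(s in late v t) F1 v t s = \int[mu]_(s in late v t) F2 v t s)%E.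

(** Induction on the first jump: if it comes after [t], the integrals agree by [late_eq]; if it
    comes before, the induction hypothesis applies from the new state. Each round costs a factor at
    most [1 - expR (- (Lam * T))], where [T] stays fixed while the remaining time shrinks. *)
Lemma compare_contraction (T : R) n v t B : 0 <= t -> t <= T -> admissible v t B ->
  (\int[mu]_(s in B) F1 v t s <=
   \int[mu]_(s in B) F2 v t s + ((1 - expR (- (Lam * T))) ^+ n)%:E)%E.
Proof.
elim: n v t B => [|n ih] v t B t0 tT [mB hB].
  rewrite expr0; apply: (@le_trans _ _ 1%E); last first.
    by rewrite leeDr// integral_ge0// => s _; exact: ff_ge0 ff2 _ _ _.
  apply: (@le_trans _ _ (\int[mu]_(s in B) 1)%E).
    apply: ge0_le_integral => //.
    - by move=> s _; exact: ff_ge0 ff1 _ _ _.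
    - exact: (measurable_funTS (ff_measurable ff1 v t)).
    - by move=> s _; exact: ff_le1 ff1 _ _ _.
  by rewrite integral_cst// mul1e probability_le1.
set k := 1 - expR (- (Lam * T)).
have L0 : 0 <= Lam by exact: (Lam_ge0 lam_gt0 lam_le v).
have k0 : 0 <= k.
  by rewrite subr_ge0 -[leRHS]expR0 ler_expR oppr_le0 mulr_ge0// (le_trans t0).
have mL := measurable_late v t.
have split_late F : future_functional F -> (\int[mu]_(s in B) F v t s =
    \int[mu]_(s in B `&` late v t) F v t s + \int[mu]_(s in B `\` late v t) F v t s)%E.
  move=> ffF; rewrite -ge0_integral_setU//.
  - by rewrite setUIDK.
  - exact: measurableI.
  - exact: measurableD.
  - exact: (measurable_funTS (ff_measurable ffF v t)).
  - by move=> s _; exact: ff_ge0 ffF _ _ _.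
  - by apply/disj_setPS => s [[_ h] [_]].
rewrite (split_late _ ff1) (split_late _ ff2) -addeA; apply: leeD.
  rewrite le_eqVlt; apply/orP; left; apply/eqP.
  (* The good noises in [late v t] all have the constant path [v] up to [t], so an admissible [B]
     contains all of them or none. *)
  have [[s0 [Bs Ls gs]]|h] := pselect (exists s, [/\ B s, late v t s & good s]).
    have e s : good s -> (B `&` late v t) s <-> late v t s.
      move=> gs'; split=> [[]//|Ls']; split => //; apply: hB Bs => // x x0 xt.
      have hx s' : late v t s' -> chain v s' x = v.
        move=> Ls2; apply: (chain_lt _ _ _ tau_ge0 lam_gt0 lam_le).
        by rewrite /hold (le_lt_trans xt)// ltr_pdivlMr// mulrC.
      by rewrite !hx.
    rewrite (eq_integral_good (ff_ge0 ff1 v t) e) (eq_integral_good (ff_ge0 ff2 v t) e).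
    exact: late_eq.
  have e s : good s -> (B `&` late v t) s <-> set0 s.
    by move=> gs; split => // -[Bs Ls]; apply: h; exists s.
  rewrite (eq_integral_good (ff_ge0 ff1 v t) e) (eq_integral_good (ff_ge0 ff2 v t) e).
  by rewrite !integral_set0.
have [-> m1] := early_integral v t ff1 mB; have [-> m2] := early_integral v t ff2 mB.
have early_ge0 F a : future_functional F -> (0 <= early F v t B a)%E.
  move=> ffF; rewrite /early; case: ifP => // _.
  by apply: integral_ge0 => b _; exact: ff_ge0 ffF _ _ _.
have lt0 : 0 <= lam v * t by rewrite mulr_ge0// ltW.
pose D := [set a | ~ lam v * t < tau a].
have mD : measurable D by apply: measurableC; exact: mtau_gt.
have kn0 : (0 <= (k ^+ n)%:E :> \bar R)%E by rewrite lee_fin exprn_ge0.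
have mk : measurable_fun setT (fun a => ((k ^+ n)%:E * (\1_D a)%:E)%E).
  by apply: measurable_funeM; apply/measurable_EFinP; exact: measurable_indic.
apply: (@le_trans _ _ (\int[mu]_a (early F2 v t B a + (k ^+ n)%:E * (\1_D a)%:E))%E).
  apply: ge0_le_integral => //.
  - by move=> a _; exact: early_ge0.
  - exact: emeasurable_funD.
  move=> a _; rewrite /early; case: ifPn => h.
    by rewrite add0e mule_ge0// lee_fin.
  rewrite indicE mem_set ?mule1; last by apply/negP.
  have hl : tau a / lam v <= t by rewrite ler_pdivrMr// mulrC leNgt.
  have h0 : 0 <= tau a / lam v by rewrite divr_ge0// ltW.
  apply: ih; first by rewrite subr_ge0.
    by rewrite (le_trans _ tT)// gerBl.
  exact: admissible_section.
rewrite ge0_integralD//; last 2 first.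
- by move=> a _; exact: early_ge0.
- by move=> a _; rewrite mule_ge0// lee_fin.
rewrite leeD2l// ge0_integralZl//; last first.
  by apply/measurable_EFinP; exact: measurable_indic.
rewrite -mu_integral// (tau_le lt0) -EFinM lee_fin exprSr ler_wpM2l ?exprn_ge0//.
rewrite /k lerB// ler_expR lerN2.
by rewrite (le_trans (ler_wpM2r t0 (lam_le v)))// ler_wpM2l.
Qed.

Lemma compare_future v t B : 0 <= t -> admissible v t B ->
  (\int[mu]_(s in B) F1 v t s <= \int[mu]_(s in B) F2 v t s)%E.
Proof.
move=> t0 aB; apply/lee_addgt0Pr => e e0.
set k := 1 - expR (- (Lam * t)).
have L0 : 0 <= Lam by exact: (Lam_ge0 lam_gt0 lam_le v).
have k0 : 0 <= k by rewrite subr_ge0 -[leRHS]expR0 ler_expR oppr_le0 mulr_ge0.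
have k1 : `|k| < 1 by rewrite ger0_norm// ltrBlDr ltrDl expR_gt0.
have := cvg_expr k1 => /cvgrPdist_lt /(_ e e0) [n _ /(_ n (leqnn _))] /=.
rewrite sub0r normrN ger0_norm ?exprn_ge0// => /ltW kn.
apply: le_trans (compare_contraction n t0 (lexx t) aB) _.
by rewrite leeD2l// lee_fin.
Qed.

End compare.

Lemma measure_late v t : 0 <= t -> mu (late v t) = (expR (- (lam v * t)))%:E.
Proof.
move=> t0; have := @chain_survival v t 0 setT t0 (lexx _).
rewrite (_ : [set s | setT (chain v s 0)] = setT); last by apply/seteqP; split.
rewrite probability_setT mule1 => <-; congr (mu _).
by apply/seteqP; split => [s h|s []].
Qed.

(** [F1] is the indicator of the future event, [F2] its probability from the state at time [t].
    Their integrals agree before the first jump by [chain_survival], and [compare_future] is used in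
    both directions. *)
Lemma chain_markov v t u B (C : set V) : 0 <= t -> 0 <= u -> admissible v t B ->
  mu [set s | B s /\ C (chain v s (t + u))] =
  (\int[mu]_(s in B) mu [set s' | C (chain (chain v s t) s' u)])%E.
Proof.
move=> t0 u0 aB; have [mB _] := aB.
pose q w := mu [set s | C (chain w s u)].
have mC w x : measurable [set s | C (chain w s x)] by apply: (@mchain _ _ _ id (fun=> x)).
pose F1 v t s : \bar R := (\1_[set s | C (chain v s (t + u))] s)%:E.
pose F2 v t s : \bar R := q (chain v s t).
have ff1 : future_functional F1.
  split=> [w x|w x s|w x s|w x a b gb h]; rewrite /F1.
  - by apply/measurable_EFinP; exact: measurable_indic.
  - by rewrite lee_fin.
  - by rewrite lee_fin indicE; case: (_ \in _).
  - have e : chain w (cons (a, b)) (x + u) = chain (nxt w (mrk a)) b (x - tau a / lam w + u).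
      rewrite chain_cons// ltNge (le_trans h) ?lerDl//=.
      by rewrite (_ : x + u - _ = x - tau a / lam w + u)//; lra.
    rewrite !indicE; congr ((nat_of_bool _)%:R%:E).
    by apply/idP/idP => /set_mem h1; apply/mem_set; move: h1; rewrite /= e.
have ff2 : future_functional F2.
  split=> [w x|w x s|w x s|w x a b gb h]; rewrite /F2.
  - move=> _ Y mY; rewrite setTI.
    exact: (@mchain _ _ w id (fun=> x) [set y | Y (q y)]).
  - exact: measure_ge0.
  - exact: probability_le1.
  - by rewrite chain_cons// ltNge h.
have late_eq w x : 0 <= x ->
    (\int[mu]_(s in late w x) F1 w x s = \int[mu]_(s in late w x) F2 w x s)%E.
  move=> x0; have mL := measurable_late w x.
  rewrite /F1 integral_indic// setIC.
  rewrite [LHS](chain_survival w C x0 u0) -measure_late// muleC -integral_cst//.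
  apply: eq_integral => s; rewrite inE => Ls; rewrite /F2 /= (chain_lt _ _ _ tau_ge0 lam_gt0 lam_le)//.
  by rewrite /hold ltr_pdivlMr// mulrC.
have -> : mu [set s | B s /\ C (chain v s (t + u))] = (\int[mu]_(s in B) F1 v t s)%E.
  by rewrite /F1 integral_indic// setIC.
apply/eqP; rewrite eq_le; apply/andP; split.
- exact: (compare_future ff1 ff2 late_eq t0 aB).
- by apply: (compare_future ff2 ff1 _ t0 aB) => w x x0; rewrite late_eq.
Qed.

Let muDI A B : measurable A -> measurable B ->
  mu A = (mu (A `\` B) + mu (A `&` B))%E.
Proof. by move=> mA mB; exact: measureDI. Qed.

Lemma measure_mark b : mu [set s | mrk s = b] = (2^-1)%:E.
Proof.
by rewrite (measure_tau_gt0 (mmrk_eq b)) tauP// oppr0 expR0 mul1r.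
Qed.

Lemma measure_early_mark t b : 0 <= t ->
  mu [set s | ~ t < tau s /\ mrk s = b] = ((1 - expR (- t)) / 2)%:E.
Proof.
move=> t0; have := muDI (mmrk_eq b) (mtau_gt t).
rewrite measure_mark (_ : _ `&` _ = [set s | t < tau s /\ mrk s = b]); last first.
  by apply/seteqP; split => s [].
rewrite (_ : _ `\` _ = [set s | ~ t < tau s /\ mrk s = b]); last first.
  by apply/seteqP; split => s [].
have fm A : measurable A -> mu A \is a fin_num by move=> mA; exact: fin_num_measure.
have mA : measurable [set s | ~ t < tau s /\ mrk s = b].
  by apply: measurableI; [apply: measurableC; exact: mtau_gt|exact: mmrk_eq].
by rewrite tauP// -(fineK (fm _ mA)) -EFinD => -[e]; congr EFin; lra.
Qed.

(** Comparing the second clock with the largest rate rules out a second jump whatever the new state,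
    and it makes the event a product. *)
Definition one_jump v t b : set N := [set s | (~ lam v * t < tau (hd s) /\
  mrk (hd s) = b) /\ Lam * t < tau (hd (tl s))].

Lemma measurable_one_jump v t b : measurable (one_jump v t b).
Proof.
apply: measurableI; last first.
  rewrite -[X in measurable X]setTI.
  exact: (measurableT_comp mhd mtl measurableT (mtau_gt _)).
apply: measurableI; first exact: measurableC (measurable_late v t).
by rewrite -[X in measurable X]setTI; exact: (mhd measurableT (mmrk_eq b)).
Qed.

Lemma measure_one_jump v t b : 0 <= t ->
  mu (one_jump v t b) = ((1 - expR (- (lam v * t))) / 2 * expR (- (Lam * t)))%:E.
Proof.
move=> t0; have lt0 : 0 <= lam v * t by rewrite mulr_ge0// ltW.
have Lt0 : 0 <= Lam * t by rewrite mulr_ge0// (Lam_ge0 lam_gt0 lam_le v).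
rewrite (consP (measurable_one_jump v t b)).
rewrite (_ : _ @^-1` _ = [set s | ~ lam v * t < tau s /\ mrk s = b] `*`
    [set s | Lam * t < tau (hd s)]); last first.
  by apply/seteqP; split => -[x y]; rewrite /one_jump /= !hdK tlK.
rewrite product_measure1E; last 2 first.
- by apply: measurableI; [apply: measurableC; exact: mtau_gt|exact: mmrk_eq].
- by rewrite -[X in measurable X]setTI; exact: (mhd measurableT (mtau_gt _)).
transitivity (mu [set s | ~ (lam v * t < tau s)%R /\ mrk s = b] *
  mu [set s | (Lam * t < tau (hd s))%R])%E; first by [].
rewrite EFinM -(measure_early_mark b lt0); congr (_ * _)%E.
rewrite -(tau_tail Lt0).
have mh : measurable [set s | Lam * t < tau (hd s)].
  by rewrite -[X in measurable X]setTI; exact: (mhd measurableT (mtau_gt _)).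
rewrite (consP mh) (_ : _ @^-1` _ = [set s | Lam * t < tau s] `*` setT); last first.
  by apply/seteqP; split => -[x y]; rewrite /= hdK; [split|case].
rewrite product_measure1E//; last exact: mtau_gt.
transitivity (mu [set s | (Lam * t < tau s)%R] * mu setT)%E; first by [].
by rewrite probability_setT mule1.
Qed.

Lemma chain_one_jump v t b s : good s -> 0 <= t -> one_jump v t b s ->
  chain v s t = nxt v b.
Proof.
move=> gs t0 [[h1 h2] h3].
have hl : hold hd tau lam v s <= t by rewrite /hold ler_pdivrMr// mulrC leNgt; apply/negP.
rewrite (chain_ge _ _ tau_ge0 lam_gt0 lam_le gs hl) /jump_to h2.
apply: (chain_lt _ _ _ tau_ge0 lam_gt0 lam_le); rewrite /hold ltr_pdivlMr//.
apply: le_lt_trans h3; have [h0 L0] : 0 <= hold hd tau lam v s /\ 0 <= Lam.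
  by split; [rewrite divr_ge0// ltW|rewrite (Lam_ge0 lam_gt0 lam_le v)].
rewrite mulrC; apply: (@le_trans _ _ (lam (nxt v b) * t)); last by rewrite ler_wpM2r.
by rewrite ler_wpM2l ?(ltW (lam_gt0 _))// gerBl.
Qed.

(** No jump, and exactly one jump with either mark, are disjoint events of known probability. Lower
    bounds suffice because their sum over [y] is nearly one for small [t]. *)
Lemma chain_prob_ge v y t : 0 <= t ->
  (((v == y)%:R * expR (- (lam v * t)) +
    ((nxt v true == y)%:R + (nxt v false == y)%:R) *
    ((1 - expR (- (lam v * t))) / 2 * expR (- (Lam * t))))%:E <=
   mu [set s | chain v s t = y])%E.
Proof.
move=> t0; have mG := measurable_good mhd mtl mtau.
have mC : measurable [set s | chain v s t = y] by apply: (@mchain _ _ _ id (fun=> t) (set1 y)).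
pose D1 := if v == y then late v t else set0.
pose D b := if nxt v b == y then one_jump v t b `&` [set s | good s] else set0.
have mD1 : measurable D1 by rewrite /D1; case: ifP => // _; exact: measurable_late.
have mD b : measurable (D b).
  by rewrite /D; case: ifP => // _; apply: measurableI => //; exact: measurable_one_jump.
have E1 : mu D1 = ((v == y)%:R * expR (- (lam v * t)))%:E.
  by rewrite /D1; case: ifP => _; rewrite ?measure0 ?mul0r// mul1r measure_late.
have E b : mu (D b) = ((nxt v b == y)%:R * ((1 - expR (- (lam v * t))) / 2 * expR (- (Lam * t))))%:E.
  rewrite /D; case: ifP => _; rewrite ?measure0 ?mul0r// mul1r -(measure_one_jump v b t0).
  apply/esym; rewrite [LHS](muDI (measurable_one_jump v t b) mG).
  rewrite [X in (X + _)%E](_ : _ = 0%E) ?add0e//.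
  apply/eqP; rewrite eq_le measure_ge0 andbT -good_ae.
  apply: le_measure; rewrite ?inE; [|exact: measurableC|by move=> s []].
  by apply: measurableD => //; exact: measurable_one_jump.
have sub1 s : D1 s -> late v t s /\ v = y by rewrite /D1; case: ifP => // /eqP.
have sub b s : D b s -> [/\ one_jump v t b s, good s & nxt v b = y].
  by rewrite /D; case: ifP => // /eqP ? [].
apply: (@le_trans _ _ (mu (D1 `|` (D true `|` D false)))); last first.
  apply: le_measure; rewrite ?inE//; first by apply: measurableU => //; exact: measurableU.
  move=> s [/sub1[h <-]|[]/sub[h gs <-]] /=.
  - apply: (chain_lt _ _ _ tau_ge0 lam_gt0 lam_le).
    by rewrite /hold ltr_pdivlMr// mulrC.
  - exact: chain_one_jump h.
  - exact: chain_one_jump h.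
have -> : mu (D1 `|` (D true `|` D false)) = (mu D1 + (mu (D true) + mu (D false)))%E.
  have -> : mu (D1 `|` (D true `|` D false)) = (mu D1 + mu (D true `|` D false))%E.
    apply: measureU => //; first exact: measurableU.
    by apply/seteqP; split => // s [/sub1[h _] []/sub[[[]]]].
  congr (_ + _)%E; apply: measureU => //.
  apply/seteqP; split => // s [/sub[[[_ e1]] _ _ _] /sub[[[_ e2]] _ _ _]].
  by move: e1; rewrite e2.
by rewrite E1 !E -!EFinD mulrDl.
Qed.

End chain_markov.

(** * The chain on three points *)

Lemma one_sub_expRN (R : realType) (x : R) : 0 <= x ->
  0 <= x - (1 - expR (- x)) /\ x - (1 - expR (- x)) <= x ^+ 2.
Proof.
move=> x0; have h1 := expR_ge1Dx (- x); split; first lra.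
have h2 := expR_ge1Dx x; have e0 := expR_gt0 x.
have : expR (- x) <= (1 + x)^-1.
  by rewrite expRN lef_pV2 ?posrE//; lra.
have : (1 + x)^-1 <= 1 - x + x ^+ 2.
  rewrite -[leLHS]mul1r ler_pdivrMr; last lra.
  rewrite (_ : _ * _ = 1 + x ^+ 3); last by ring.
  by rewrite lerDl exprn_ge0.
lra.
Qed.

Section three_point_chain.
Variables (R : realType) (eps : R).
Hypothesis eps0 : 0 < eps.
Hypothesis eps1 : eps <= 1.

Local Notation mu := (@fair_coins R).

(** [None] is the centre, [Some b] are the two ends. A rate is the total conductance over the mass,
    hence [2 / eps] at the centre. *)
Definition tri_rate (v : option bool) : R := if v is Some _ then 1 else 2 / eps.
Definition tri_next (v : option bool) (b : bool) : option bool :=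
  if v is Some _ then None else Some b.

Local Notation Lam := (2 / eps).

Lemma Lam_ge2 : 2 <= Lam.
Proof. by rewrite ler_pdivlMr//; have := eps1; lra. Qed.

Lemma tri_rate_gt0 v : 0 < tri_rate v.
Proof. by case: v => [b|] //=; have := Lam_ge2; lra. Qed.

Lemma tri_rate_le v : tri_rate v <= Lam.
Proof. by case: v => [b|] //=; have := Lam_ge2; lra. Qed.

Definition walk (v : option bool) (s : coins) (t : R) : option bool :=
  chain evens odds (@clock R) (@mark R) tri_rate tri_next v s t.

Definition good_noise (s : coins) : Prop := good evens odds (@clock R) s.

Definition past_event (v : option bool) (t : R) (B : set coins) : Prop :=
  measurable B /\ forall s s', good_noise s -> good_noise s' ->
    (forall x, 0 <= x -> x <= t -> walk v s x = walk v s' x) -> B s -> B s'.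

Let ge0 := @clock_ge0 R.

Lemma walk_right v s t : exists2 e : R, 0 < e &
  forall u, t <= u -> u < t + e -> walk v s u = walk v s t.
Proof. exact: (chain_right _ _ _ _ ge0 tri_rate_gt0 tri_rate_le). Qed.

Lemma walk_left v s t : exists2 e : R, 0 < e & exists y,
  forall u, t - e <= u -> u < t -> walk v s u = y.
Proof. exact: (chain_left _ _ _ _ ge0 tri_rate_gt0 tri_rate_le). Qed.

Lemma measurable_walk d (T : measurableType d) v (S : T -> coins) (g : T -> R)
    (C : set (option bool)) : measurable_fun setT S -> measurable_fun setT g ->
  measurable [set z | C (walk v (S z) (g z))].
Proof.
exact: (measurable_chain tri_next ge0 tri_rate_gt0 tri_rate_le measurable_evens
  measurable_odds (@measurable_clock R) (@measurable_mark R)).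
Qed.

Lemma measurable_walk_at v t C : measurable [set s | C (walk v s t)].
Proof. by apply: (@measurable_walk _ _ _ id (fun=> t)). Qed.

Lemma walk_markov v t u B (C : set (option bool)) : 0 <= t -> 0 <= u ->
  past_event v t B ->
  mu [set s | B s /\ C (walk v s (t + u))] =
  (\int[mu]_(s in B) mu [set s' | C (walk (walk v s t) s' u)])%E.
Proof.
exact: (chain_markov ge0 tri_rate_gt0 tri_rate_le measurable_evens measurable_odds
  (@measurable_clock R) (@measurable_mark R)
  measurable_interleave evens_interleave odds_interleave (@fair_coins_interleave R)
  (@fair_coins_clock R)).
Qed.

Lemma walk_prob_ge v y t : 0 <= t ->
  (((v == y)%:R * expR (- (tri_rate v * t)) +
    ((tri_next v true == y)%:R + (tri_next v false == y)%:R) *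
    ((1 - expR (- (tri_rate v * t))) / 2 * expR (- (Lam * t))))%:E <=
   mu [set s | walk v s t = y])%E.
Proof.
exact: (chain_prob_ge tri_next ge0 tri_rate_gt0 tri_rate_le measurable_evens measurable_odds
  (@measurable_clock R) (@measurable_mark R)
  measurable_interleave evens_interleave odds_interleave (@fair_coins_interleave R)
  (@fair_coins_clock R)).
Qed.

Definition tri_sum {M : nmodType} (g : option bool -> M) : M :=
  g None + g (Some true) + g (Some false).

Lemma walk_integral v t (B : set coins) (F : option bool -> \bar R) :
  measurable B -> (forall w, 0 <= F w)%E ->
  (\int[mu]_(s in B) F (walk v s t) =
   tri_sum (fun w => F w * mu (B `&` [set s | walk v s t = w])))%E.
Proof.
move=> mB F0.
have m1 w : measurable [set s | walk v s t = w].
  exact: (measurable_walk_at v t (set1 w)).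
have mi w : measurable_fun B (fun s => (F w * (\1_[set s | walk v s t = w] s)%:E)%E).
  apply: emeasurable_funM => //; apply/measurable_EFinP; exact: measurable_indic.
have i0 w s : (0 <= F w * (\1_[set s | walk v s t = w] s)%:E)%E.
  by rewrite mule_ge0// lee_fin.
have ii w : (\int[mu]_(s in B) (F w * (\1_[set s | walk v s t = w] s)%:E) =
    F w * mu (B `&` [set s | walk v s t = w]))%E.
  rewrite ge0_integralZl//.
  - by rewrite integral_indic// setIC.
  - by apply/measurable_EFinP; exact: measurable_indic.
pose A w s : \bar R := (F w * (\1_[set s | walk v s t = w] s)%:E)%E.
rewrite (eq_integral (fun s => A None s + A (Some true) s + A (Some false) s)%E).
  transitivity (\int[mu]_(s in B) (A None s) + \int[mu]_(s in B) (A (Some true) s) +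
      \int[mu]_(s in B) (A (Some false) s))%E; last by rewrite !ii.
  have mA w : measurable_fun B (A w) by exact: mi.
  have A0 w s : B s -> (0 <= A w s)%E by move=> _; exact: i0.
  have <- : (\int[mu]_(s in B) (A None s + A (Some true) s) =
      \int[mu]_(s in B) A None s + \int[mu]_(s in B) A (Some true) s)%E.
    by apply: ge0_integralD => // s; exact: A0.
  apply: ge0_integralD => //.
  - by move=> s Bs; rewrite adde_ge0// A0.
  - exact: emeasurable_funD.
  - by move=> s; exact: A0.
move=> s _; rewrite /A; have iE w : \1_[set s | walk v s t = w] s = (walk v s t == w)%:R :> R.
  by rewrite indicE; congr (nat_of_bool _)%:R; apply/idP/eqP => [/set_mem|h]//; exact/mem_set.
rewrite !iE; case: (walk v s t) => [[]|] /=;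
  by rewrite ?mule0 ?mule1 ?add0e ?adde0.
Qed.

Definition prob t v y : R := fine (mu [set s | walk v s t = y]).

Lemma probE t v y : mu [set s | walk v s t = y] = (prob t v y)%:E.
Proof.
by rewrite /prob fineK// fin_num_measure//; exact: (measurable_walk_at v t (set1 y)).
Qed.

Lemma prob_ge0 t v y : 0 <= prob t v y.
Proof. by rewrite fine_ge0. Qed.

Lemma prob_sum t v : tri_sum (prob t v) = 1.
Proof.
have := @walk_integral v t setT (fun=> 1%E) measurableT (fun=> lee01).
rewrite integral_cst//= mul1e fair_coins_setT /tri_sum !setTI !mul1e !probE -!EFinD.
by move=> -[].
Qed.

Lemma prob_add t u v y : 0 <= t -> 0 <= u ->
  prob (t + u) v y = tri_sum (fun w => prob u w y * prob t v w).
Proof.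
move=> t0 u0.
have := @walk_markov v t u setT (set1 y) t0 u0 (conj measurableT (fun _ _ _ _ _ _ => I)).
rewrite (@walk_integral v t setT (fun w => mu [set s | walk w s u = y])) //.
rewrite (_ : [set s | _] = [set s | walk v s (t + u) = y]); last by apply/seteqP; split => // s [].
by rewrite /tri_sum !setTI !probE -!EFinM -!EFinD => -[].
Qed.

Definition expect t (f : option bool -> R) v : R := tri_sum (fun y => f y * prob t v y).

Lemma expect_add t u f v : 0 <= t -> 0 <= u ->
  expect (t + u) f v = expect t (expect u f) v.
Proof. by move=> t0 u0; rewrite /expect /tri_sum !prob_add// /tri_sum; ring. Qed.

Lemma expect_lin t (a b : R) f g v :
  expect t (fun y => a * f y + b * g y) v = a * expect t f v + b * expect t g v.
Proof. by rewrite /expect /tri_sum; ring. Qed.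

Lemma expect_cst t v (c : R) : expect t (fun=> c) v = c.
Proof. by rewrite -[RHS]mulr1 -(prob_sum t v) /expect /tri_sum; ring. Qed.

Lemma expect_bound t f v (M : R) : (forall y, `|f y| <= M) -> `|expect t f v| <= M.
Proof.
move=> fM; have M0 y := le_trans (normr_ge0 _) (fM y).
have h y : `|f y * prob t v y| <= M * prob t v y.
  by rewrite normrM [`|prob _ _ _|]ger0_norm ?prob_ge0// ler_wpM2r ?prob_ge0.
rewrite -[leRHS]mulr1 -(prob_sum t v) /expect /tri_sum !mulrDr.
apply: le_trans (ler_normD _ _) _; apply: lerD => //.
by apply: le_trans (ler_normD _ _) _; apply: lerD.
Qed.

(** The lower bounds of [walk_prob_ge] add up to [1 - (1 - q) (1 - r)], so their total defect is at
    most [(Lam h)^2]. This makes them two-sided; a second error of that size comes from replacing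
    [r] by [1]. *)
Lemma expect_short h f v (M : R) : 0 <= h -> (forall y, `|f y| <= M) ->
  `|expect h f v - (f v + (1 - expR (- (tri_rate v * h))) *
     ((f (tri_next v true) + f (tri_next v false)) / 2 - f v))| <= 2 * M * (Lam * h) ^+ 2.
Proof.
move=> h0 fM; have M0 := le_trans (normr_ge0 _) (fM None).
have pge y := walk_prob_ge v y h0; move: pge.
set x := tri_rate v * h; set L := Lam * h.
have x0 : 0 <= x by rewrite mulr_ge0// ltW// tri_rate_gt0.
have xL : x <= L by rewrite ler_wpM2r// tri_rate_le.
have L0 : 0 <= L by exact: le_trans xL.
set q := expR (- x); set r := expR (- L).
have [_ _] := one_sub_expRN x0; have q0 : 0 < q by exact: expR_gt0.
have q1 : 1 - q <= L by have [] := one_sub_expRN x0; rewrite -/q; lra.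
have q2 : q <= 1 by rewrite /q -expR0 ler_expR oppr_le0.
have r1 : 1 - r <= L by have [] := one_sub_expRN L0; rewrite -/r; lra.
have r2 : r <= 1 by rewrite /r -expR0 ler_expR oppr_le0.
move=> pge.
pose a y := (v == y)%:R * q + ((tri_next v true == y)%:R + (tri_next v false == y)%:R) * ((1 - q) / 2 * r).
have pa y : 0 <= prob h v y - a y by rewrite subr_ge0 -lee_fin -probE; exact: pge.
have sum_a : tri_sum a = 1 - (1 - q) * (1 - r).
  by rewrite /tri_sum /a; case: (v) => [[]|] /=; lra.
have sum_d : tri_sum (fun y => prob h v y - a y) = (1 - q) * (1 - r).
  by have := prob_sum h v; move: sum_a; rewrite /tri_sum => *; lra.
have qr : (1 - q) * (1 - r) <= L ^+ 2 by rewrite expr2 ler_pM//; lra.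
have fa : tri_sum (fun y => f y * a y) =
    q * f v + (1 - q) / 2 * r * (f (tri_next v true) + f (tri_next v false)).
  by rewrite /tri_sum /a; case: (v) => [[]|] /=; lra.
set S := f (tri_next v true) + f (tri_next v false) in fa *.
have SM : `|S / 2| <= M.
  rewrite normrM [`|2^-1|]ger0_norm// ler_pdivrMr//.
  by apply: le_trans (ler_normD _ _) _; rewrite mulr_natr mulr2n lerD.
have -> : expect h f v - (f v + (1 - q) * (S / 2 - f v)) =
    tri_sum (fun y => f y * (prob h v y - a y)) - (1 - q) * (1 - r) * (S / 2).
  rewrite (_ : tri_sum _ = expect h f v - tri_sum (fun y => f y * a y)).
    by rewrite fa; field.
  by rewrite /expect /tri_sum; ring.
have b1 : `|tri_sum (fun y => f y * (prob h v y - a y))| <= M * ((1 - q) * (1 - r)).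
  rewrite -sum_d /tri_sum.
  have -> (k l m : R) : M * (k + l + m) = M * k + M * l + M * m by ring.
  have hh y : `|f y * (prob h v y - a y)| <= M * (prob h v y - a y).
    by rewrite normrM [`|prob _ _ _ - _|]ger0_norm ?pa// ler_wpM2r ?pa.
  apply: le_trans (ler_normD _ _) _; apply: lerD => //.
  by apply: le_trans (ler_normD _ _) _; apply: lerD.
have b2 : `|(1 - q) * (1 - r) * (S / 2)| <= (1 - q) * (1 - r) * M.
  by rewrite normrM [`|(1 - q) * _|]ger0_norm ?mulr_ge0 ?ler_wpM2l ?mulr_ge0 ?subr_ge0.
apply: le_trans (ler_normB _ _) _.
have : M * ((1 - q) * (1 - r)) <= M * L ^+ 2 by rewrite ler_wpM2l.
by move: b1 b2; nra.
Qed.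

Definition tri_gen (f : option bool -> R) v : R :=
  tri_rate v * ((f (tri_next v true) + f (tri_next v false)) / 2 - f v).

Lemma expect0 f v : expect 0 f v = f v.
Proof.
have fM y : `|f y| <= tri_sum (fun y => `|f y|).
  have n0 z := normr_ge0 (f z).
  by case: y => [[]|]; rewrite /tri_sum; have := n0 None; have := n0 (Some true); have := n0 (Some false); lra.
have := expect_short v (lexx 0) fM; rewrite !mulr0 oppr0 expR0 subrr mul0r addr0 expr0n /= mulr0.
by rewrite normr_le0 subr_eq0 => /eqP.
Qed.

Section eigenfunction.
Variables (phi : option bool -> R) (g : R).
Hypothesis g0 : 0 <= g.
Hypothesis phi_eigen : forall v, tri_gen phi v = - g * phi v.

Let M := tri_sum (fun y => `|phi y|).
Let C := M * (2 * Lam ^+ 2 + g * Lam + g ^+ 2).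

Let phiM y : `|phi y| <= M.
Proof.
have n0 z := normr_ge0 (phi z).
by case: y => [[]|]; rewrite /M /tri_sum; have := n0 None; have := n0 (Some true); have := n0 (Some false); lra.
Qed.

Let M0 : 0 <= M. Proof. exact: le_trans (normr_ge0 _) (phiM None). Qed.

Let C0 : 0 <= C.
Proof. by rewrite mulr_ge0 ?addr_ge0 ?mulr_ge0 ?sqr_ge0//; have := Lam_ge2; lra. Qed.

(** The three summands of [C] bound the error of [expect_short], that of replacing
    [(1 - q) / tri_rate v] by [h], and the second-order term of [expR (- (g * h))]. *)
Lemma eigen_short h v : 0 <= h -> `|expect h phi v - expR (- (g * h)) * phi v| <= C * h ^+ 2.
Proof.
move=> h0; have := expect_short v h0 phiM.
have l0 := tri_rate_gt0 v; have lL := tri_rate_le v.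
have x0 : 0 <= tri_rate v * h by rewrite mulr_ge0// ltW.
have y0 : 0 <= g * h by rewrite mulr_ge0.
have [a1 a2] := one_sub_expRN x0; have [b1 b2] := one_sub_expRN y0.
move: a1 a2 b1 b2; set q := expR _; set w := expR _ => a1 a2 b1 b2.
have e : (phi (tri_next v true) + phi (tri_next v false)) / 2 - phi v = - g * phi v / tri_rate v.
  by rewrite -phi_eigen /tri_gen; field; rewrite gt_eqF.
rewrite e => hs.
pose th := h - (1 - q) / tri_rate v.
have th0 : 0 <= th.
  by rewrite subr_ge0 ler_pdivrMr// mulrC -subr_ge0.
have thL : th <= Lam * h ^+ 2.
  apply: (@le_trans _ _ (tri_rate v * h ^+ 2)); last by rewrite ler_wpM2r// sqr_ge0.
  rewrite /th -(ler_pM2l l0) mulrBr mulrCA mulfV ?gt_eqF// mulr1.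
  rewrite (_ : tri_rate v * (tri_rate v * h ^+ 2) = (tri_rate v * h) ^+ 2)//.
  by ring.
have -> : expect h phi v - w * phi v =
    (expect h phi v - (phi v + (1 - q) * (- g * phi v / tri_rate v))) +
    (phi v * (g * th) - phi v * (w - 1 + g * h)).
  by rewrite /th; field; rewrite gt_eqF.
apply: le_trans (ler_normD _ _) _.
have -> : C * h ^+ 2 = 2 * M * (Lam * h) ^+ 2 + (M * (g * (Lam * h ^+ 2)) + M * (g * h) ^+ 2).
  by rewrite /C; ring.
apply: lerD => //; apply: le_trans (ler_normB _ _) _; apply: lerD.
  rewrite normrM ler_pM//; rewrite ger0_norm ?mulr_ge0//.
  by rewrite ler_wpM2l.
by rewrite normrM ler_pM//; rewrite ger0_norm; lra.
Qed.

Lemma eigen_telescope h v n : 0 <= h ->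
  `|expect (n%:R * h) phi v - expR (- (g * (n%:R * h))) * phi v| <= n%:R * (C * h ^+ 2).
Proof.
move=> h0; elim: n v => [|n ih] v.
  by rewrite !mul0r mulr0 oppr0 expR0 mul1r expect0 subrr normr0.
have nh : 0 <= n%:R * h by rewrite mulr_ge0.
rewrite mulrSr !mulrDl !mul1r addrC expect_add// addrC mulrDr opprD expRD.
set w := expR (- (g * (n%:R * h))); set w' := expR (- (g * h)).
have w1 : w' <= 1 by rewrite /w' -[leRHS]expR0 ler_expR oppr_le0 mulr_ge0.
have w0 : 0 < w' by exact: expR_gt0.
have -> : expect (n%:R * h) (expect h phi) v - w * w' * phi v =
    w' * (expect (n%:R * h) phi v - w * phi v) +
    expect (n%:R * h) (fun y => 1 * expect h phi y + (- w') * phi y) v.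
  by rewrite expect_lin; ring.
apply: le_trans (ler_normD _ _) _; apply: lerD.
  rewrite normrM (ger0_norm (ltW w0)); apply: le_trans (ih v).
  by rewrite ler_piMl.
by apply: expect_bound => y; rewrite mul1r mulNr; exact: eigen_short.
Qed.

(** The local error has order [h^2], so [n] steps of length [t / n] err by at most [C t^2 / n].
    Expectations of eigenfunctions are thus computed without differentiating in [t]. *)
Lemma expect_eigen t v : 0 <= t -> expect t phi v = expR (- (g * t)) * phi v.
Proof.
move=> t0; apply/eqP; rewrite -subr_eq0 -normr_le0; apply/ler_addgt0Pr => e e0.
rewrite add0r; pose n := (Num.truncn (C * t ^+ 2 / e)).+1.
have n0 : (0 : R) < n%:R by rewrite ltr0n.
have := eigen_telescope v n (divr_ge0 t0 (ltW n0)).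
rewrite mulrCA mulfV ?gt_eqF// mulr1 => /le_trans; apply.
rewrite (_ : n%:R * _ = C * t ^+ 2 / n%:R); last by field; rewrite gt_eqF.
by rewrite ler_pdivrMr// [e * _]mulrC -ler_pdivrMr//; apply/ltW; exact: truncnS_gt.
Qed.

End eigenfunction.

(** An eigenfunction of [tri_gen] for [- 1], while [even_mode] belongs to [- (1 + 2 / eps)];
    together with the constants they span all functions. *)
Definition odd_mode (v : option bool) : R :=
  if v is Some b then (if b then 1 else - 1) else 0.
Definition even_mode (v : option bool) : R := if v is Some _ then 1 else - Lam.

Definition odd_coef (f : option bool -> R) : R := (f (Some true) - f (Some false)) / 2.
Definition even_coef (f : option bool -> R) : R :=
  ((f (Some true) + f (Some false)) / 2 - f None) / (1 + Lam).
Definition const_coef (f : option bool -> R) : R :=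
  (f (Some true) + f (Some false)) / 2 - even_coef f.

Lemma mode_decomposition f v :
  f v = const_coef f + odd_coef f * odd_mode v + even_coef f * even_mode v.
Proof.
have L0 : 1 + Lam != 0 by have := Lam_ge2 => ?; rewrite gt_eqF//; lra.
rewrite /const_coef /even_coef /odd_coef /odd_mode /even_mode.
move: Lam L0 => L L0.
by case: v => [[]|]; field.
Qed.

Lemma expect_modes t f v : 0 <= t ->
  expect t f v = const_coef f + odd_coef f * expR (- t) * odd_mode v +
    even_coef f * expR (- ((1 + Lam) * t)) * even_mode v.
Proof.
move=> t0; have L2 := Lam_ge2.
have {1}-> : f = (fun y => 1 * const_coef f +
    1 * (odd_coef f * odd_mode y + even_coef f * even_mode y)).
  by apply/funext => y; rewrite {1}(mode_decomposition f y); ring.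
rewrite expect_lin expect_cst expect_lin.
rewrite (expect_eigen (g := 1)) ?(expect_eigen (g := 1 + Lam))//.
- by rewrite !mul1r; ring.
- by lra.
- by case=> [b|]; rewrite /tri_gen /=; move: Lam => L; field.
- by case=> [[]|]; rewrite /tri_gen /=; ring.
Qed.

End three_point_chain.

(** * The Hunt process on three points *)

(** The parameter is a phantom that fixes the field in which the distance takes its values. *)
Definition tri (R : realType) : Type := option bool.

HB.instance Definition _ (R : realType) := Choice.copy (tri R) (option bool).
HB.instance Definition _ (R : realType) := isPointed.Build (tri R) None.

Section tri_metric.
Variable R : realType.

Definition tri_dist (x y : tri R) : R := (x != y)%:R.

Let distxx x : tri_dist x x = 0. Proof. by rewrite /tri_dist eqxx. Qed.

Let dist0 x y : tri_dist x y = 0 -> x = y.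
Proof. by rewrite /tri_dist; case: eqP => //= _ /eqP; rewrite oner_eq0. Qed.

Let distC x y : tri_dist x y = tri_dist y x.
Proof. by rewrite /tri_dist eq_sym. Qed.

Let dist_triangle y x z : tri_dist x z <= tri_dist x y + tri_dist y z.
Proof.
rewrite /tri_dist; case: (eqVneq x y) => [->|xy]; first by rewrite add0r.
by case: (x != z); case: (y != z) => /=; lra.
Qed.

HB.instance Definition _ := isMetric.Build R (tri R) distxx dist0 distC dist_triangle.

Lemma tri_nbhs (x : tri R) : nbhs x [set x].
Proof.
have := nbhsx_ballx x (1 : R) ltr01; apply: filterS => y.
rewrite ballEmdist /= => h; apply/eqP; apply: contraTT h => yx.
by rewrite /mdist /= /tri_dist eq_sym yx ltxx.
Qed.

Lemma tri_open (A : set (tri R)) : open A.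
Proof.
by rewrite openE => x Ax; apply: filterS (tri_nbhs x) => y ->.
Qed.

Lemma tri_closed (A : set (tri R)) : closed A.
Proof. by rewrite -[A]setCK; apply: open_closedC; exact: tri_open. Qed.

Lemma tri_finite (A : set (tri R)) : finite_set A.
Proof.
apply: (@sub_finite_set _ _ [set None; Some true; Some false]).
  by move=> [[]|] _ /=; tauto.
by rewrite !finite_setU.
Qed.

Lemma tri_compact (A : set (tri R)) : compact A.
Proof. exact: finite_compact (tri_finite A). Qed.

Lemma tri_cemetery_open (A : set (with_cemetery (tri R))) : open A.
Proof.
rewrite openE => -[x|] Ax.
  by apply: filterS (tri_nbhs x) => y ->.
exists setT => /=; first by split; [exact: tri_compact|exact: tri_closed].
by move=> y [[z]|->] //; rewrite setCT.
Qed.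

Lemma measurable_tri (A : set (borel (tri R))) : measurable A.
Proof. by apply: sub_sigma_algebra; exact: tri_open. Qed.

Lemma measurable_tri_cemetery (A : set (borel (with_cemetery (tri R)))) : measurable A.
Proof. by apply: sub_sigma_algebra; exact: tri_cemetery_open. Qed.

Lemma measurable_fun_tri d (T : measurableType d) (f : borel (tri R) -> T) :
  measurable_fun setT f.
Proof. by move=> _ Y _; exact: measurable_tri. Qed.

Lemma measurable_fun_tri_cemetery d (T : measurableType d)
  (f : borel (with_cemetery (tri R)) -> T) : measurable_fun setT f.
Proof. by move=> _ Y _; exact: measurable_tri_cemetery. Qed.

End tri_metric.

Section tri_process.
Variables (R : realType) (eps : R).
Hypothesis eps0 : 0 < eps.
Hypothesis eps1 : eps <= 1.

Local Notation state := (with_cemetery (tri R)).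
Local Notation Omega := (borel state * (R * coins))%type.
Local Notation mu := (@fair_coins R).

(* The middle coordinate is a time shift: it vanishes under every law, and
   only serves to make the shifts of a path available. *)
Definition tri_path (t : R) (w : Omega) : state :=
  if w.1 is Some v then Some (walk eps v w.2.2 (w.2.1 + t)) else None.

Lemma measurable_start (x : borel state) : measurable_fun setT (fun s : coins => (x, (0 : R, s)) : Omega).
Proof. by apply: measurable_fun_pair => //; exact: measurable_fun_pair. Qed.

Definition tri_law (x : borel state) : {measure set Omega -> \bar R} :=
  image_measure mu (measurable_start x).

Lemma tri_lawE x U : tri_law x U = mu [set s | U (x, (0, s))].
Proof. by []. Qed.

Lemma measurable_tri_law U : measurable U -> measurable_fun setT (tri_law ^~ U).
Proof. by move=> _; exact: measurable_fun_tri_cemetery. Qed.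

HB.instance Definition _ := isKernel.Build _ _ _ _ R tri_law measurable_tri_law.

Lemma tri_law_setT x : tri_law x setT = 1%E.
Proof. exact: fair_coins_setT. Qed.

HB.instance Definition _ := Kernel_isProbability.Build _ _ _ _ R tri_law tri_law_setT.

(** The filtration is encoded by invariance under paths that agree up to [t]. This matches
    [past_event] and makes its right-continuity elementary. *)
Definition tri_past (t : R) : set (set Omega) :=
  [set A | measurable A /\ forall w w',
    (forall u, 0 <= u -> u <= t -> tri_path u w = tri_path u w') -> A w -> A w'].

Definition tri_process : process (tri R) :=
  @Process R (tri R) _ Omega tri_law tri_path tri_past.

Lemma measurable_tri_path (g : Omega -> R) (B : set state) : measurable_fun setT g ->
  measurable [set w | B (tri_path (g w) w)].
Proof.
move=> mg.
have mfst (C : set state) : measurable [set w : Omega | C w.1].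
  rewrite -[X in measurable X]setTI.
  exact: (@measurable_fst _ _ (borel state) _ measurableT _ (measurable_tri_cemetery C)).
have mS : measurable_fun setT (fun w : Omega => w.2.2).
  exact: (measurableT_comp measurable_snd measurable_snd).
have mr : measurable_fun setT (fun w : Omega => w.2.1 + g w).
  by apply: measurable_funD => //; exact: (measurableT_comp measurable_fst measurable_snd).
rewrite (_ : [set _ | _] = [set w | w.1 = None /\ B None] `|`
    \bigcup_(v : option bool) ([set w : Omega | w.1 = Some v] `&`
      [set w | B (Some (walk eps v w.2.2 (w.2.1 + g w)))])); last first.
  apply/seteqP; split => -[[v|] [r s]] /=; rewrite /tri_path /=.
  - by move=> h; right; exists v.
  - by left.
  - by case=> [[]//|[v' _ /= [[->]]]].
  - by case=> [[]//|[v' _ /= []]].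
apply: measurableU.
  by apply: measurableI; [exact: (mfst (set1 None))|exact: (mfst (fun=> B None))].
apply: countable_bigcupT_measurable => [|v]; first exact: countableP.
apply: measurableI; first exact: (mfst (set1 (Some v))).
exact: (measurable_walk eps0 eps1 v (fun y => B (Some y)) mS mr).
Qed.

Lemma tri_path_right t w : exists2 e : R, 0 < e &
  forall u, t <= u -> u < t + e -> tri_path u w = tri_path t w.
Proof.
rewrite /tri_path; case: w => -[v|] [r s] /=; last by exists 1.
have [e e0 he] := walk_right eps0 eps1 v s (r + t).
by exists e => // u tu ut; rewrite he//; lra.
Qed.

Lemma tri_path_left t w : exists2 e : R, 0 < e & exists y,
  forall u, t - e <= u -> u < t -> tri_path u w = y.
Proof.
rewrite /tri_path; case: w => -[v|] [r s] /=; last by exists 1 => //; exists None.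
have [e e0 [y he]] := walk_left eps0 eps1 v s (r + t).
by exists e => //; exists (Some y) => u tu ut; rewrite he//; lra.
Qed.

Lemma tri_past_iff t A w w' : tri_past t A ->
  (forall u, 0 <= u -> u <= t -> tri_path u w = tri_path u w') -> A w <-> A w'.
Proof.
by move=> [_ hA] h; split; apply: hA => // u u0 ut; rewrite h.
Qed.

Lemma tri_past_sigma t : sigma_algebra setT (tri_past t).
Proof.
split.
- by split.
- move=> A hA; split; first by apply: measurableD => //; case: hA.
  by move=> w w' h [_ nA]; split => // hA'; apply: nA; apply/(tri_past_iff hA h).
- move=> F hF; split; first by apply: bigcupT_measurable => n; case: (hF n).
  by move=> w w' h [n _ Fn]; exists n => //; case: (hF n) => _; apply; [exact: h|].
Qed.

Lemma tri_past_mono s t : s <= t -> tri_past s `<=` tri_past t.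
Proof.
move=> st A [mA hA]; split => // w w' h; apply: hA => u u0 us.
by apply: h => //; exact: le_trans us st.
Qed.

(** Paths are constant for a short while after [t], so two that agree up to [t] agree up to some
    [t + d]. *)
Lemma tri_past_right t : 0 <= t ->
  \bigcap_(s in [set s | t < s]) tri_past s `<=` tri_past t.
Proof.
move=> t0 A hA; split; first by have [|] := hA (t + 1); first by rewrite /= ltrDl.
move=> w w' h.
have [e e0 he] := tri_path_right t w; have [e' e'0 he'] := tri_path_right t w'.
pose d := Num.min e e' / 2.
have m0 : 0 < Num.min e e' by rewrite lt_min e0 e'0.
have m1 : Num.min e e' <= e by rewrite ge_min lexx.
have m2 : Num.min e e' <= e' by rewrite ge_min lexx orbT.
have [|_] := hA (t + d); first by rewrite /= ltrDl divr_gt0.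
apply => u u0 ut; have [tu|tu] := leP t u; last by apply: h => //; exact: ltW.
rewrite he//; last by rewrite /d in ut; lra.
by rewrite he' ?h//; rewrite /d in ut; lra.
Qed.

Lemma tri_markov x t u A (B : set state) : 0 <= t -> 0 <= u -> tri_past t A ->
  tri_law x (A `&` [set w | B (tri_path (t + u) w)]) =
  (\int[tri_law x]_(w in A) tri_law (tri_path t w) [set w' | B (tri_path u w')])%E.
Proof.
move=> t0 u0 [mA hA].
rewrite integral_mkcond ge0_integral_image; last 2 first.
- apply/(measurable_restrictT _ _).1 => //; apply: measurable_funTS.
  move=> _ Y mY; rewrite setTI.
  exact: (@measurable_tri_path (fun=> t) [set y | Y (tri_law y [set w' | B (tri_path u w')])]).
- by move=> w; rewrite patchE; case: ifP => // _; exact: measure_ge0.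
rewrite -(integral_mkcond [set s | A (x, (0, s))]
  (fun s => tri_law (tri_path t (x, (0, s))) [set w' | B (tri_path u w')])).
have mS : measurable [set s | A (x, (0, s))].
  by rewrite -[X in measurable X]setTI; exact: (measurable_start x measurableT mA).
case: x mS => [v|] mS; rewrite [LHS]tri_lawE.
  have := @walk_markov _ _ eps0 eps1 v t u [set s | A (Some v, (0, s))] (fun y => B (Some y)) t0 u0.
  rewrite (_ : [set s | _ /\ _] = [set s | (A `&` [set w | B (tri_path (t + u) w)]) (Some v, (0, s))]).
    move=> ->.
      apply: eq_integral => s _; rewrite tri_lawE; congr (mu _).
      by apply/seteqP; split => s'; rewrite /tri_path /= !add0r.
    split => // s s' _ _ h; apply: hA => y y0 yt.
    by rewrite /tri_path /= add0r h.
  by apply/seteqP; split => s; rewrite /tri_path /= !add0r.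
have E : (fun s : coins => tri_law (tri_path t (None, (0, s))) [set w' | B (tri_path u w')]) =
    cst (\1_B (None : state))%:E.
  apply/funext => s; rewrite /cst tri_lawE /tri_path /=.
  have [b|b] := pselect (B None).
    rewrite (_ : [set _ | _] = setT); last by apply/seteqP; split.
    by rewrite fair_coins_setT indicE mem_set.
  rewrite (_ : [set _ | _] = set0); last by apply/seteqP; split.
  by rewrite measure0 indicE memNset.
rewrite E integral_cst// /tri_path /=.
have [b|b] := pselect (B None).
  rewrite indicE mem_set// mul1e; congr (mu _).
  by apply/seteqP; split => s // [].
rewrite indicE memNset// mul0e (_ : [set _ | _] = set0) ?measure0//.
by apply/seteqP; split => s // [].
Qed.

Lemma integral_mul_indic x (A D : set Omega) (F : Omega -> \bar R) :
  (\int[tri_law x]_(w in A) ((\1_D w)%:E * F w) = \int[tri_law x]_(w in A `&` D) F w)%E.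
Proof.
rewrite integral_mkcondr; apply: eq_integral => w _.
by rewrite patchE indicE; case: (w \in D); rewrite ?mul1e ?mul0e.
Qed.

(** * The strong Markov property by discretized stopping times *)

Section stopping.
Variable s : Omega -> \bar R.
Hypothesis s0 : forall w, (0 <= s w)%E.
Hypothesis s_past : forall t : R, 0 <= t -> tri_past t [set w | (s w <= t%:E)%E].

Definition grid n k : R := k%:R * 2^-1 ^+ n.

Lemma grid_ge0 n k : 0 <= grid n k.
Proof. by rewrite mulr_ge0// exprn_ge0. Qed.

Lemma le_grid n j k : (j <= k)%N -> grid n j <= grid n k.
Proof. by move=> jk; rewrite ler_wpM2r ?exprn_ge0// ler_nat. Qed.

(** On this cell [grid n k] is the value of the discretized stopping time, which approximates [s]
    from above. *)
Definition grid_cell n k : set Omega := [set w | (s w <= (grid n k)%:E)%E /\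
  forall j, (j < k)%N -> ~ (s w <= (grid n j)%:E)%E].

Lemma measurable_stop t : 0 <= t -> measurable [set w | (s w <= t%:E)%E].
Proof. by move=> t0; have [] := s_past t0. Qed.

Lemma measurable_grid_cell n k : measurable (grid_cell n k).
Proof.
apply: measurableI; first by apply: measurable_stop; exact: grid_ge0.
rewrite (_ : (fun w => _) = \bigcap_(j < k) ~` [set w | (s w <= (grid n j)%:E)%E]).
  apply: bigcap_measurableType => // j _; apply: measurableC.
  by apply: measurable_stop; exact: grid_ge0.
by apply/seteqP; split => w h j; exact: h.
Qed.

Lemma past_grid_cell A n k : measurable A ->
  (forall t : R, 0 <= t -> tri_past t (A `&` [set w | (s w <= t%:E)%E])) ->
  tri_past (grid n k) (A `&` grid_cell n k).
Proof.
move=> mA hA; split; first by apply: measurableI => //; exact: measurable_grid_cell.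
move=> w w' h [Aw [sw nw]].
have [Aw' sw'] : (A `&` [set w | (s w <= (grid n k)%:E)%E]) w'.
  by apply/(tri_past_iff (hA _ (grid_ge0 n k)) h).
split => //; split => // j jk sj; apply: (nw j jk).
apply/(tri_past_iff (s_past (grid_ge0 n j)) (w' := w')) => // u u0 uj.
by apply: h => //; apply: le_trans uj (le_grid n (ltnW jk)).
Qed.

Lemma grid_cell_index n w : (s w < +oo)%E -> exists k,
  [/\ grid_cell n k w, fine (s w) <= grid n k & grid n k < fine (s w) + 2^-1 ^+ n].
Proof.
move=> sw; have fs : s w \is a fin_num by rewrite ge0_fin_numE.
set r := fine (s w); have r0 : 0 <= r by rewrite fine_ge0.
have e0 : (0 : R) < 2^-1 ^+ n by rewrite exprn_gt0.
have ex : exists k, r <= grid n k.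
  exists (Num.truncn (r / 2^-1 ^+ n)).+1.
  by rewrite /grid -ler_pdivrMr// ltW// truncnS_gt.
have sE k : (s w <= (grid n k)%:E)%E = (r <= grid n k) by rewrite -lee_fin fineK.
have := ex_minnP ex; case=> k rk mk; exists k; split => //.
  by split => [|j jk]; rewrite sE// => /mk; rewrite leqNgt jk.
case: k rk mk => [|k] rk mk.
  by rewrite /grid mul0r ltr_wpDl.
have : grid n k < r by rewrite ltNge; apply/negP => /mk; rewrite ltnn.
by rewrite /grid -[k.+1]addn1 natrD mulrDl mul1r; lra.
Qed.

Lemma grid_cell_unique n j k w : grid_cell n j w -> grid_cell n k w -> j = k.
Proof.
wlog jk : j k / (j < k)%N.
  move=> h hj hk; case: (ltngtP j k) => // jk; [exact: h|exact/esym/h].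
by move=> [hj _] [_ /(_ _ jk)].
Qed.

Lemma grid_cell_finite n k w : grid_cell n k w -> (s w < +oo)%E.
Proof. by case=> /= h _; exact: le_lt_trans h (ltry _). Qed.

Definition grid_sum (F : R -> Omega -> \bar R) n w : \bar R :=
  (\sum_(0 <= k <oo) ((\1_(grid_cell n k) w)%:E * F (grid n k) w))%E.

(** Since [F] is constant just after each time, its value at the next grid time equals the one at
    [s] as soon as the mesh is small: the sequence becomes stationary. *)
Lemma grid_sum_cvg (F : R -> Omega -> \bar R) w :
  (forall r, 0 <= r -> exists2 e : R, 0 < e & forall u, r <= u -> u < r + e -> F u w = F r w) ->
  grid_sum F n w @[n --> \oo] -->
    ((\1_[set w | (s w < +oo)%E] w)%:E * F (fine (s w)) w)%E.
Proof.
move=> hF; have [sw|sw] := pselect (s w < +oo)%E; last first.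
  rewrite indicE memNset// mul0e.
  rewrite (_ : grid_sum F ^~ w = fun=> 0%E); first exact: cvg_cst.
  apply/funext => n; rewrite /grid_sum eseries0// => k _ _.
  by rewrite indicE memNset ?mul0e// => /grid_cell_finite.
have r0 : 0 <= fine (s w) by rewrite fine_ge0.
rewrite indicE mem_set// mul1e; have [e e0 he] := hF _ r0.
apply: cvg_near_cst.
have : `|2^-1 : R| < 1 by rewrite ger0_norm//; lra.
move=> /cvg_expr /cvgrPdist_lt /(_ e e0) [N _ hN].
exists N => // n /= /hN /=; rewrite sub0r normrN ger0_norm ?exprn_ge0// => ne.
have [k [ck k1 k2]] := grid_cell_index n sw.
rewrite /grid_sum (@nneseries_single _ _ k) => [|j jk].
  by rewrite indicE mem_set// mul1e he//; apply: lt_trans k2 _; rewrite ltrD2l.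
rewrite indicE memNset ?mul0e// => cj; move: jk.
by rewrite (grid_cell_unique cj ck) eqxx.
Qed.

Lemma measurable_grid_sum (F : R -> Omega -> \bar R) n : (forall u, measurable_fun setT (F u)) ->
  (forall u w, (0 <= F u w)%E) -> measurable_fun setT (grid_sum F n).
Proof.
move=> mF F0; apply: ge0_emeasurable_sum => [k w _ _|k _].
  by rewrite mule_ge0// lee_fin.
apply: emeasurable_funM => //; apply/measurable_EFinP; apply: measurable_indic.
exact: measurable_grid_cell.
Qed.

Lemma measurable_at_stop (F : R -> Omega -> \bar R) : (forall u, measurable_fun setT (F u)) ->
  (forall u w, (0 <= F u w)%E) ->
  (forall w r, 0 <= r -> exists2 e : R, 0 < e & forall u, r <= u -> u < r + e -> F u w = F r w) ->
  measurable_fun setT (fun w => ((\1_[set w | (s w < +oo)%E] w)%:E * F (fine (s w)) w)%E).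
Proof.
move=> mF F0 hF; apply: (emeasurable_fun_cvg (grid_sum F)) => [n|w _].
  exact: measurable_grid_sum.
by apply: grid_sum_cvg => r; exact: hF.
Qed.

Lemma grid_sum_le1 (F : R -> Omega -> \bar R) n w : (forall u w, 0 <= F u w)%E -> (forall u w, F u w <= 1)%E ->
  (0 <= grid_sum F n w <= 1)%E.
Proof.
move=> F0 F1; apply/andP; split.
  by apply: nneseries_ge0 => k _ _; rewrite mule_ge0// lee_fin.
have [sw|sw] := pselect (s w < +oo)%E; last first.
  rewrite /grid_sum eseries0// => k _ _.
  by rewrite indicE memNset ?mul0e// => /grid_cell_finite.
have [k [ck k1 k2]] := grid_cell_index n sw.
rewrite /grid_sum (@nneseries_single _ _ k) => [|j jk].
  by rewrite indicE mem_set// mul1e.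
rewrite indicE memNset ?mul0e// => cj; move: jk.
by rewrite (grid_cell_unique cj ck) eqxx.
Qed.

Lemma grid_integral_cvg (F : R -> Omega -> \bar R) x A : measurable A -> (forall u, measurable_fun setT (F u)) ->
  (forall u w, 0 <= F u w)%E -> (forall u w, F u w <= 1)%E ->
  (forall w r, 0 <= r -> exists2 e : R, 0 < e & forall u, r <= u -> u < r + e -> F u w = F r w) ->
  (\int[tri_law x]_(w in A) grid_sum F n w)%E @[n --> \oo] -->
  (\int[tri_law x]_(w in A) ((\1_[set w | (s w < +oo)%E] w)%:E * F (fine (s w)) w))%E.
Proof.
move=> mA mF F0 F1 hF.
have [|||||] := @dominated_convergence _ _ _ (tri_law x) A mA (grid_sum F)
  (fun w => ((\1_[set w | (s w < +oo)%E] w)%:E * F (fine (s w)) w)%E) (fun=> 1%E).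
- by move=> n; apply: measurable_funTS; exact: measurable_grid_sum.
- by apply: measurable_funTS; exact: measurable_at_stop.
- by apply: aeW => w _; apply: grid_sum_cvg => r; exact: hF.
- apply/integrableP; split; first exact: measurable_cst.
  rewrite (eq_integral (fun=> 1%E)) => [|w _]; last by rewrite gee0_abs.
  rewrite integral_cst// mul1e (@le_lt_trans _ _ 1%E)// ?ltry//.
  rewrite -(tri_law_setT x); apply: le_measure; rewrite ?inE//.
- apply: aeW => w n _; have /andP[g0 g1] := grid_sum_le1 n w F0 F1.
  by rewrite gee0_abs.
by move=> _ _.
Qed.

(** On each grid cell this is [tri_markov] at a fixed time; both sides converge as the mesh tends to
    [0]. Measurability of the event is returned as well, for use in [tri_leave_stop]. *)
Lemma tri_strong_markov x t A (B : set state) : 0 <= t -> measurable A ->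
  (forall u : R, 0 <= u -> tri_past u (A `&` [set w | (s w <= u%:E)%E])) ->
  measurable [set w | (s w < +oo)%E /\ B (tri_path (fine (s w) + t) w)] /\
  tri_law x (A `&` [set w | (s w < +oo)%E /\ B (tri_path (fine (s w) + t) w)]) =
  (\int[tri_law x]_(w in A `&` [set w | (s w < +oo)%E])
     tri_law (tri_path (fine (s w)) w) [set w' | B (tri_path t w')])%E.
Proof.
move=> t0 mA hA.
pose G y := tri_law y [set w' | B (tri_path t w')].
have mB r : measurable [set w | B (tri_path r w)].
  exact: (@measurable_tri_path (fun=> r)).
pose FL u w : \bar R := (\1_[set w | B (tri_path (u + t) w)] w)%:E.
pose FR u w : \bar R := G (tri_path u w).
have mL u : measurable_fun setT (FL u) by apply/measurable_EFinP; exact: measurable_indic.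
have mR u : measurable_fun setT (FR u).
  by move=> _ Y mY; rewrite setTI; exact: (@measurable_tri_path (fun=> u) [set y | Y (G y)]).
have L0 u w : (0 <= FL u w)%E by rewrite lee_fin.
have R0 u w : (0 <= FR u w)%E by exact: measure_ge0.
have L1 u w : (FL u w <= 1)%E by rewrite lee_fin indicE; case: (_ \in _).
have R1 u w : (FR u w <= 1)%E.
  by rewrite -(tri_law_setT (tri_path u w)); apply: le_measure; rewrite ?inE.
have hL w r : 0 <= r -> exists2 e : R, 0 < e & forall u, r <= u -> u < r + e -> FL u w = FL r w.
  move=> _; have [e e0 he] := tri_path_right (r + t) w; exists e => // u ru ur.
  rewrite /FL !indicE; congr ((nat_of_bool _)%:R%:E).
  have {}he : tri_path (u + t) w = tri_path (r + t) w by apply: he; lra.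
  by apply/idP/idP => /set_mem h1; apply/mem_set; move: h1; rewrite /= he.
have hR w r : 0 <= r -> exists2 e : R, 0 < e & forall u, r <= u -> u < r + e -> FR u w = FR r w.
  move=> _; have [e e0 he] := tri_path_right r w; exists e => // u ru ur.
  by rewrite /FR he.
have mC n k := measurable_grid_cell n k.
have step n : (\int[tri_law x]_(w in A) grid_sum FL n w = \int[tri_law x]_(w in A) grid_sum FR n w)%E.
  have mI k (F : R -> Omega -> \bar R) : (forall u, measurable_fun setT (F u)) ->
      measurable_fun A (fun w => ((\1_(grid_cell n k) w)%:E * F (grid n k) w)%E).
    move=> mF; apply: measurable_funTS; apply: emeasurable_funM => //.
    by apply/measurable_EFinP; exact: measurable_indic.
  rewrite /grid_sum integral_nneseries//; last 2 first.
  - by move=> k; exact: (mI k FL mL).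
  - by move=> k w _; rewrite mule_ge0// lee_fin.
  rewrite integral_nneseries//; last 2 first.
  - by move=> k; exact: (mI k FR mR).
  - by move=> k w _; rewrite mule_ge0// lee_fin.
  apply: eq_eseriesr => k _.
  have cut (F : R -> Omega -> \bar R) : (\int[tri_law x]_(w in A) ((\1_(grid_cell n k) w)%:E * F (grid n k) w) =
      \int[tri_law x]_(w in A `&` grid_cell n k) F (grid n k) w)%E.
    exact: integral_mul_indic.
  rewrite !cut /FL integral_indic//; last exact: measurableI.
  rewrite setIC.
  exact: (tri_markov x B (grid_ge0 n k) t0 (past_grid_cell n k mA hA)).
have cL := @grid_integral_cvg FL x A mA mL L0 L1 hL.
have cR := @grid_integral_cvg FR x A mA mR R0 R1 hR.
have mS : measurable [set w | (s w < +oo)%E /\ B (tri_path (fine (s w) + t) w)].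
  have := measurable_at_stop mL L0 hL => /(_ measurableT [set 1%E]).
  rewrite setTI => /(_ (emeasurable_set1 _)).
  congr (measurable _); apply/seteqP; split => w /=.
    rewrite !indicE -EFinM => -[] /eqP; rewrite -natrM pnatr_eq1 muln_eq1 !eqb1.
    by move=> /andP[/set_mem ? /set_mem].
  by move=> [h1 h2]; rewrite /FL !indicE !mem_set// mule1.
split => //.
have mf : measurable [set w | (s w < +oo)%E].
  have := measurable_at_stop (F := fun _ _ => 1%E) (fun=> measurable_cst _) (fun _ _ => lee01)
    (fun _ r _ => ex_intro2 _ _ 1 ltr01 (fun _ _ _ => erefl)).
  move=> /(_ measurableT [set 1%E]).
  rewrite setTI => /(_ (emeasurable_set1 _)).
  congr (measurable _); apply/seteqP; split => w /=.
    by rewrite mule1 indicE => -[] /eqP; rewrite pnatr_eq1 eqb1 => /set_mem.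
  by move=> h; rewrite mule1 indicE mem_set.
transitivity (\int[tri_law x]_(w in A) ((\1_[set w | (s w < +oo)%E] w)%:E * FL (fine (s w)) w))%E.
  rewrite (eq_integral (fun w => (\1_[set w | (s w < +oo)%E /\ B (tri_path (fine (s w) + t) w)] w)%:E)).
    by rewrite integral_indic// setIC.
  move=> w _; rewrite /FL !indicE -EFinM -natrM mulnb; congr ((nat_of_bool _)%:R%:E).
  by apply/andP/idP => [[/set_mem h1 /set_mem h2]|/set_mem[h1 h2]]; [exact/mem_set|split; exact/mem_set].
transitivity (\int[tri_law x]_(w in A) ((\1_[set w | (s w < +oo)%E] w)%:E * FR (fine (s w)) w))%E.
  move: cL; rewrite (_ : (fun n => _) = (fun n => \int[tri_law x]_(w in A) grid_sum FR n w)%E).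
    by move=> cL; exact: (cvg_unique _ cL cR).
  by apply/funext => n; exact: step.
exact: integral_mul_indic.
Qed.

End stopping.

Lemma tri_leave y h : 0 <= h ->
  (tri_law y [set w | tri_path h w <> y] <= (1 - expR (- (2 / eps * h)))%:E)%E.
Proof.
move=> h0; have L2 := Lam_ge2 eps0 eps1.
have Lh0 : 0 <= 2 / eps * h by rewrite mulr_ge0//; lra.
have k0 : 0 <= 1 - expR (- (2 / eps * h)).
  by rewrite subr_ge0 -[leRHS]expR0 ler_expR oppr_le0.
case: y => [v|]; rewrite tri_lawE /tri_path /=; last first.
  by rewrite (_ : [set _ | _] = set0) ?measure0 ?lee_fin//; apply/seteqP; split => w //=; apply.
have mW : measurable [set s | walk eps v s h = v].
  exact: (measurable_walk_at eps0 eps1 v h (set1 v)).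
have -> : [set s | Some (walk eps v s (0 + h)) <> Some v :> state] = ~` [set s | walk eps v s h = v].
  by apply/seteqP; split => s; rewrite /= add0r => hs hE; apply: hs; [rewrite hE|case: hE].
have -> : mu (~` [set s | walk eps v s h = v]) = (1 - mu [set s | walk eps v s h = v])%E.
  exact: probability_setC.
have := walk_prob_ge eps0 eps1 v v h0; rewrite probE// eqxx mul1r lee_fin => hp.
rewrite -EFinB lee_fin lerB//; apply: le_trans hp.
have rL : tri_rate eps v * h <= 2 / eps * h by rewrite ler_wpM2r// tri_rate_le.
have r0 : 0 <= tri_rate eps v * h by rewrite mulr_ge0// ltW// tri_rate_gt0.
rewrite (le_trans (_ : _ <= expR (- (tri_rate eps v * h))))//; first by rewrite ler_expR lerN2.
rewrite lerDl mulr_ge0// mulr_ge0// ?expR_ge0// divr_ge0//.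
by rewrite subr_ge0 -[leRHS]expR0 ler_expR oppr_le0.
Qed.

Lemma tri_law_le1 x A : measurable A -> (tri_law x A <= 1)%E.
Proof.
by move=> mA; rewrite -(tri_law_setT x); apply: le_measure; rewrite ?inE.
Qed.

(** The state at the stopping time takes finitely many values, so the event splits along the sets
    [Q y]; on each of them the strong Markov property reduces to [tri_leave]. The bound does not
    depend on [s], which quasi-left-continuity requires. *)
Lemma tri_leave_stop (s : Omega -> \bar R) x h : (forall w, (0 <= s w)%E) ->
  (forall t : R, 0 <= t -> tri_past t [set w | (s w <= t%:E)%E]) -> 0 <= h ->
  measurable [set w | (s w < +oo)%E /\ tri_path (fine (s w) + h) w <> tri_path (fine (s w)) w] /\
  (tri_law x [set w | (s w < +oo)%E /\
     tri_path (fine (s w) + h) w <> tri_path (fine (s w)) w] <=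
   (1 - expR (- (2 / eps * h)))%:E)%E.
Proof.
move=> s0 s_past h0.
have stopped t : 0 <= t -> tri_past t (setT `&` [set w | (s w <= t%:E)%E]).
  by move=> t0; rewrite setTI; exact: s_past.
pose Q y : set Omega := [set w | (s w < +oo)%E /\ tri_path (fine (s w)) w = y].
have mQ y : measurable (Q y).
  have [+ _] := tri_strong_markov s0 s_past x (set1 y) (lexx 0) measurableT stopped.
  by congr (measurable _); apply/seteqP; split => w; rewrite /Q /= addr0.
(* Two paths that agree up to [t], one of which stops by then, have the same stopping time, hence
   the same state there. *)
have pQ y t : 0 <= t -> tri_past t (Q y `&` [set w | (s w <= t%:E)%E]).
  move=> t0; split; first by apply: measurableI => //; exact: (s_past t t0).1.
  move=> w w' ww' [[sw sy] st].
  have st' : (s w' <= t%:E)%E by apply/(tri_past_iff (s_past t t0) ww').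
  have sw' : (s w' < +oo)%E by exact: le_lt_trans st' (ltry _).
  have f1 : s w \is a fin_num by rewrite ge0_fin_numE.
  have f2 : s w' \is a fin_num by rewrite ge0_fin_numE.
  have u1 : fine (s w) <= t by rewrite -lee_fin fineK.
  have u2 : fine (s w') <= t by rewrite -lee_fin fineK.
  have e : s w = s w'.
    apply/eqP; rewrite eq_le; apply/andP; split.
      rewrite -(fineK f2).
      apply/(tri_past_iff (s_past _ (fine_ge0 (s0 w'))) (w' := w')).
        by move=> u u0 uu; apply: ww' => //; exact: le_trans uu u2.
      by rewrite /= fineK.
    rewrite -(fineK f1).
    apply/(tri_past_iff (s_past _ (fine_ge0 (s0 w))) (w := w)).
      by move=> u u0 uu; apply: ww' => //; exact: le_trans uu u1.
    by rewrite /= fineK.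
  by split => //; split => //; rewrite -e -sy -ww' ?fine_ge0.
pose C y : set Omega := Q y `&` [set w | (s w < +oo)%E /\ (~` [set y]) (tri_path (fine (s w) + h) w)].
have sm y := tri_strong_markov s0 s_past x (~` [set y]) h0 (mQ y) (pQ y).
have mC y : measurable (C y) by apply: measurableI => //; exact: (sm y).1.
have CQ y : (tri_law x (C y) <= (1 - expR (- (2 / eps * h)))%:E * tri_law x (Q y))%E.
  rewrite (sm y).2 (_ : Q y `&` [set w | (s w < +oo)%E] = Q y); last first.
    by apply/seteqP; split => [w []//|w []].
  rewrite (eq_integral (fun=> tri_law y [set w' | tri_path h w' <> y])) => [|w]; last first.
    by rewrite inE => -[_ ->].
  by rewrite integral_cst// lee_wpmul2r//; exact: tri_leave.
have fin_state : finite_set [set: state].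
  apply: (@sub_finite_set _ _ [set None; Some None; Some (Some true); Some (Some false)]).
    by move=> [[[]|]|] _ /=; tauto.
  by rewrite !finite_setU.
have triv (P : state -> set Omega) : (forall y, P y `<=` Q y) -> trivIset setT P.
  move=> PQ; apply/trivIsetP => y z _ _ yz; apply/seteqP; split => // w [/PQ[_ wy] /PQ[_ wz]].
  by move/eqP: yz; apply; rewrite -wy -wz.
have BE : [set w | (s w < +oo)%E /\ tri_path (fine (s w) + h) w <> tri_path (fine (s w)) w] =
    \bigcup_(y in [set: state]) C y.
  apply/seteqP; split => w.
    by move=> [sw hw]; exists (tri_path (fine (s w)) w).
  by move=> [y _ [[sw sy] [_ hy]]]; split => //; rewrite sy.
have mB : measurable (\bigcup_(y in [set: state]) C y).
  exact: fin_bigcup_measurable.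
rewrite BE; split => //.
rewrite measure_fin_bigcup//; last by apply: triv => y w [].
apply: (@le_trans _ _ (\sum_(y \in [set: state]) ((1 - expR (- (2 / eps * h)))%:E * tri_law x (Q y)))%E).
  by apply: lee_fsum => // y _; exact: CQ.
rewrite -ge0_mule_fsumr//.
have QE : (tri_law x (\bigcup_(y in [set: state]) Q y) = \sum_(y \in [set: state]) tri_law x (Q y))%E.
  by apply: measure_fin_bigcup => //; exact: (triv Q (fun _ _ h => h)).
rewrite -QE -[leRHS]mule1 lee_wpmul2l ?tri_law_le1//; last exact: fin_bigcup_measurable.
have L2 := Lam_ge2 eps0 eps1; rewrite lee_fin subr_ge0 -[leRHS]expR0 ler_expR oppr_le0 mulr_ge0//.
by lra.
Qed.

Lemma tri_path_cvg_right t w : tri_path u w @[u --> t^'+] --> tri_path t w.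
Proof.
have [e e0 he] := tri_path_right t w.
apply: cvg_near_cst; near=> u.
by apply: he; near: u; [exact: nbhs_right_ge|apply: nbhs_right_lt; rewrite ltrDl].
Unshelve. all: by end_near. Qed.

Lemma tri_path_cvg_left t w : exists y : state, tri_path u w @[u --> t^'-] --> y.
Proof.
have [e e0 [y he]] := tri_path_left t w; exists y.
apply: cvg_near_cst; near=> u.
by apply: he; near: u; [apply: nbhs_left_ge; rewrite ltrBlDr ltrDl|exact: nbhs_left_lt].
Unshelve. all: by end_near. Qed.

(** If convergence fails, all [s_ n w] lie strictly below their supremum and the path jumps exactly
    there. So, for every small [h], the path changes between [s_ n w] and [s_ n w + h] for all large
    [n], which has probability at most [1 - expR (- (2 / eps * h))]. *)
Lemma tri_quasi_left (s_ : nat -> Omega -> \bar R) x :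
  (forall n w, (0 <= s_ n w)%E) ->
  (forall n (t : R), 0 <= t -> tri_past t [set w | (s_ n w <= t%:E)%E]) ->
  (forall w, {homo s_ ^~ w : n k / (n <= k)%N >-> (n <= k)%E}) ->
  {ae tri_law x, forall w,
    (ereal_sup [set s_ n w | n in [set: nat]] < +oo)%E ->
    tri_path (fine (s_ n w)) w @[n --> \oo] -->
    tri_path (fine (ereal_sup [set s_ n w | n in [set: nat]])) w}.
Proof.
move=> s0 s_past s_nd; have L2 := Lam_ge2 eps0 eps1.
pose h i : R := i.+1%:R^-1.
have h0 i : 0 < h i by rewrite invr_gt0.
pose C n i : set Omega := [set w | (s_ n w < +oo)%E /\
  tri_path (fine (s_ n w) + h i) w <> tri_path (fine (s_ n w)) w].
have leave n i := tri_leave_stop x (s0 n) (s_past n) (ltW (h0 i)).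
have mC n i : measurable (C n i) by exact: (leave n i).1.
pose T N i := \bigcap_(n in [set n | (N <= n)%N]) C n i.
have mT N i : measurable (T N i) by apply: bigcap_measurableType.
pose W i := \bigcup_N T N i.
have mW i : measurable (W i) by exact: bigcupT_measurable.
have W_le i : (tri_law x (W i) <= (1 - expR (- (2 / eps * h i)))%:E)%E.
  have cT : tri_law x \o (T ^~ i) @ \oo --> tri_law x (W i).
    apply: nondecreasing_cvg_mu => //; first exact: mW.
    move=> N M NM; apply/subsetPset => w hw n /= Mn; apply: hw; exact: leq_trans NM Mn.
  rewrite -(cvg_lim _ cT)//; apply: lime_le; first by apply/cvg_ex; eexists; exact: cT.
  apply: nearW => N; apply: (@le_trans _ _ (tri_law x (C N i))); last exact: (leave N i).2.
  apply: le_measure; rewrite ?inE; [exact: mT|exact: mC|].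
  by move=> w; apply => /=.
(* The failures seen at every scale [h i] with [i >= j]; the measure is below that of each such
   [W i], hence zero. *)
pose Z j := \bigcap_(i in [set i | (j <= i)%N]) W i.
have mZ j : measurable (Z j) by apply: bigcap_measurableType.
have Z0 j : tri_law x (Z j) = 0%E.
  apply/eqP; rewrite eq_le measure_ge0 andbT; apply/lee_addgt0Pr => e e0; rewrite add0e.
  pose i := maxn j (Num.truncn (2 / eps / e)).
  apply: (@le_trans _ _ (tri_law x (W i))).
    by apply: le_measure; rewrite ?inE// => w; apply => /=; exact: leq_maxl.
  apply: le_trans (W_le i) _; rewrite lee_fin.
  have Lh0 : 0 <= 2 / eps * h i by rewrite mulr_ge0 ?ltW ?h0//; lra.
  apply: (@le_trans _ _ (2 / eps * h i)); first by have [] := one_sub_expRN Lh0; lra.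
  rewrite /h ler_pdivrMr// [e * _]mulrC -ler_pdivrMr//.
  apply: ltW; apply: lt_le_trans (truncnS_gt _) _.
  by rewrite ler_nat ltnS leq_maxr.
exists (\bigcup_j Z j); split; first exact: bigcupT_measurable.
  apply: measure_negligible; first exact: bigcupT_measurable.
  by apply: negligible_bigcup => j; exists (Z j); split.
move=> w /= /not_implyP[]; set S := ereal_sup _ => S_fin ncv.
have s_le n : (s_ n w <= S)%E by apply: ereal_sup_ubound; exists n.
have S0 : (0 <= S)%E by exact: le_trans (s0 0%N w) (s_le 0%N).
have fS : S \is a fin_num by rewrite ge0_fin_numE.
have s_oo n : (s_ n w < +oo)%E by exact: le_lt_trans (s_le n) S_fin.
have fs n : s_ n w \is a fin_num by rewrite ge0_fin_numE.
pose r n := fine (s_ n w); pose q := fine S.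
have rq n : r n <= q by rewrite -lee_fin !fineK.
have r_nd n k : (n <= k)%N -> r n <= r k by move=> nk; rewrite -lee_fin !fineK// s_nd.
have r_lt n : r n < q.
  rewrite lt_neqAle rq andbT; apply/negP => /eqP rn; apply: ncv.
  apply: cvg_near_cst; exists n => // k /= nk.
  by rewrite -/(r k) -/q; congr tri_path; apply/eqP; rewrite eq_le rq -rn r_nd.
have r_sup e : 0 < e -> exists n, q - e < r n.
  move=> e0; have : ((q - e)%:E < S)%E by rewrite -(fineK fS) lte_fin ltrBlDr ltrDl.
  by move=> /ereal_sup_gt[_ [n _ <-]]; rewrite -(fineK (fs n)) lte_fin; exists n.
have [e e0 [y he]] := tri_path_left q w.
have [N hN] := r_sup e e0.
have rN n : (N <= n)%N -> tri_path (r n) w = y.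
  by move=> Nn; apply: he => //; rewrite (le_trans (ltW hN))// r_nd.
have yq : y <> tri_path q w.
  move=> yq; apply: ncv; apply: cvg_near_cst; exists N => // n /= Nn.
  by rewrite -/(r n) -/q rN.
have [d d0 hd] := tri_path_right q w.
exists (Num.truncn d^-1) => // i /= ji.
have hi : h i < d.
  rewrite /h -[ltRHS]invrK ltf_pV2 ?posrE ?invr_gt0//.
  by apply: lt_le_trans (truncnS_gt _) _; rewrite ler_nat.
have [M hM] := r_sup (h i) (h0 i).
exists (maxn N M) => // n /=; rewrite geq_max => /andP[Nn Mn]; split => //.
rewrite -/(r n) rN// => hq; apply: yq; rewrite -hq; apply: hd.
  by have := r_nd _ _ Mn; lra.
by have := rq n; lra.
Qed.

Lemma tri_hunt : hunt tri_process.
Proof.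
split.
- by move=> t t0; exact: tri_past_sigma.
- by move=> t t0 A [].
- by move=> u t u0 ut; exact: tri_past_mono.
- by move=> t t0; exact: tri_past_right.
- move=> t B t0 mB; split; first exact: (@measurable_tri_path (fun=> t) B).
  by move=> w w' h; rewrite /preimage /= h.
- case=> [v|] /=; rewrite tri_lawE /tri_path /=; last first.
    by rewrite (_ : [set _ | _] = setT) ?fair_coins_setT//; apply/seteqP; split.
  have mW : measurable [set s | walk eps v s 0 = v].
    exact: (measurable_walk_at eps0 eps1 v 0 (set1 v)).
  rewrite (_ : [set _ | _] = [set s | walk eps v s 0 = v]); last first.
    by apply/seteqP; split => s /=; rewrite addr0; [case|move=> ->].
  apply/eqP; rewrite eq_le; apply/andP; split.
    by rewrite -(fair_coins_setT R); apply: le_measure; rewrite ?inE.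
  have := walk_prob_ge eps0 eps1 v v (lexx 0).
  by rewrite eqxx !mulr0 oppr0 expR0 subrr !mul0r mulr0 addr0 mul1r.
- by move=> u t w u0 ut /=; rewrite /tri_path; case: w.1.
- move=> t t0; exists (fun w : Omega => (w.1, (w.2.1 + t, w.2.2))) => u w u0 /=.
  by rewrite /tri_path /=; case: w.1 => // v; rewrite addrA.
- by move=> t w t0; exact: tri_path_cvg_right.
- by move=> t w t0; exact: tri_path_cvg_left.
- move=> s [s0 s_past] A [mA hA] x t B t0 mB.
  exact: (tri_strong_markov s0 s_past x B t0 mA hA).2.
- move=> s_ hs s_nd x; apply: tri_quasi_left => //.
  + by move=> n w; have [] := hs n.
  + by move=> n t t0; have [_] := hs n; exact.
Qed.

End tri_process.

(** * The square function on three points *)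

Section weighted_diracs.
Context d (T : measurableType d) (R : realType).

Fixpoint wdirac (l : seq ({nonneg R} * T)) : {measure set T -> \bar R} :=
  if l is p :: l' then measure_add (mscale p.1 (dirac p.2)) (wdirac l') else mzero.

Lemma ge0_integral_wdirac l (f : T -> \bar R) : measurable_fun setT f ->
  (forall x, 0 <= f x)%E ->
  (\int[wdirac l]_x f x = \sum_(p <- l) p.1%:num%:E * f p.2)%E.
Proof.
move=> mf f0; elim: l => [|p l ih] /=.
  by rewrite big_nil; exact: integral_measure_zero.
rewrite big_cons ge0_integral_measure_add// ge0_integral_mscale// integral_dirac//.
by rewrite diracT mul1e ih.
Qed.

Lemma integral_wdirac l (f : T -> R) : measurable_fun setT f ->
  (\int[wdirac l]_x (f x)%:E = (\sum_(p <- l) p.1%:num * f p.2)%:E)%E.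
Proof.
move=> mf.
have mf' : measurable_fun setT (EFin \o f) by apply/measurable_EFinP.
rewrite integralE !ge0_integral_wdirac//; last 2 first.
- exact: measurable_funeneg.
- exact: measurable_funepos.
rewrite (eq_bigr (fun p => (p.1%:num * Num.max (f p.2) 0)%:E)); last first.
  by move=> p _; rewrite funeposE EFinM EFin_max.
rewrite [X in (_ - X)%E](eq_bigr (fun p => (p.1%:num * Num.max (- f p.2) 0)%:E)); last first.
  by move=> p _; rewrite funenegE EFinM EFin_max.
rewrite !sumEFin -EFinB -sumrB; congr EFin; apply: eq_bigr => p _.
rewrite -mulrBr; congr (_ * _).
by rewrite /Num.max; case: ifP; case: ifP; lra.
Qed.

Lemma wdiracE l A : measurable A -> (wdirac l A = \sum_(p <- l) p.1%:num%:E * (\1_A p.2)%:E)%E.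
Proof.
move=> mA; rewrite -[LHS]mul1e -[in LHS](setIT A) -integral_cst ?setIT//.
rewrite integral_mkcond (eq_integral (fun x => (\1_A x)%:E)) => [|x _].
  apply: ge0_integral_wdirac => [|x]; last by rewrite lee_fin.
  by apply/measurable_EFinP; exact: measurable_indic.
by rewrite patchE indicE /cst; case: ifP.
Qed.

Lemma wdirac_fin l A : measurable A -> (wdirac l A < +oo)%E.
Proof.
move=> mA; rewrite wdiracE//.
rewrite (eq_bigr (fun p => (p.1%:num * \1_A p.2)%:E)) => [|p _]; last by rewrite EFinM.
by rewrite sumEFin ltry.
Qed.

End weighted_diracs.

Section tri_space.
Variable R : realType.
Local Notation E := (tri R).

Lemma tri_continuous (T : topologicalType) (f : E -> T) : continuous f.
Proof. by move=> x A /nbhs_singleton Ax; apply: filterS (tri_nbhs x) => y ->. Qed.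

Lemma tri_locally_compact : locally_compact [set: E].
Proof.
move=> x _; rewrite /= withinET; exists setT; first exact: filterT.
by split; [exact: tri_compact|exact: tri_closed].
Qed.

Lemma tri_separable : exists S : set E, countable S /\ dense S.
Proof.
exists setT; split; first exact: finite_set_countable (tri_finite _).
by move=> O [x Ox] _; exists x.
Qed.

Lemma measurable_tri2 (C : set (borel E * borel E)) : measurable C.
Proof.
rewrite (_ : C = \bigcup_(z in C) ([set z.1] `*` [set z.2])); last first.
  apply/seteqP; split => [[x y] h|[x y] [[a b] h [/= -> ->]]] //.
  by exists (x, y).
rewrite bigcup_mkcond; apply: countable_bigcupT_measurable => [|z].
  exact: (@countableP (option bool * option bool)%type).
by case: ifP => // _; apply: measurableX; exact: measurable_tri.
Qed.

Lemma tri2_compact (C : set (E * E)) : compact C.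
Proof.
apply: finite_compact; apply: (@sub_finite_set _ _ (setT `*` setT)) => //.
by apply: finite_setX; exact: tri_finite.
Qed.

End tri_space.

Lemma radon_of_compact (R : realType) (T : topologicalType) (D : set T)
    (M : set (set T)) (mu : set T -> \bar R) :
  (forall A : set T, compact A) -> (forall A, mu A < +oo)%E ->
  (forall A B, A `<=` B -> mu A <= mu B)%E -> radon_on D M mu.
Proof.
move=> cpt fin mono; split => [K _ _|A _ _]; first exact: fin.
apply/eqP; rewrite eq_le; apply/andP; split.
  by apply: ereal_sup_ubound; exists A => //; split => //; exact: cpt.
by apply: ge_ereal_sup => _ [K [_ KA] <-]; exact: mono.
Qed.

(** * The Dirichlet form, semigroup and square function on three points *)

Section tri_setting.
Variables (R : realType) (eps : R).
Hypothesis eps0 : 0 < eps.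
Hypothesis eps1 : eps <= 1.
Local Notation E := (tri R).
Local Notation X := (tri_process eps).

Definition tri_m : {measure set (borel E) -> \bar R} :=
  @wdirac _ (borel E) R [:: (NngNum (ltW eps0), None); (1%:nng, Some true); (1%:nng, Some false)].

Definition tri_J : {measure set (borel E * borel E) -> \bar R} :=
  @wdirac _ (borel E * borel E)%type R [:: (1%:nng, (None, Some true)); (1%:nng, (None, Some false));
    (1%:nng, (Some true, None)); (1%:nng, (Some false, None))].

Lemma eps_inv_ge0 : 0 <= eps^-1. Proof. by rewrite invr_ge0 ltW. Qed.

(** Conductance over the mass of the starting point, so that integrating against [tri_m] gives
    [tri_J]. *)
Definition tri_jumps (x : borel E) : {measure set (borel E) -> \bar R} :=
  if x is Some _ then @wdirac _ (borel E) R [:: (1%:nng, None)]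
  else @wdirac _ (borel E) R [:: (NngNum eps_inv_ge0, Some true); (NngNum eps_inv_ge0, Some false)].

Lemma measurable_tri_jumps U : measurable U -> measurable_fun setT (tri_jumps ^~ U).
Proof. by move=> _; exact: measurable_fun_tri. Qed.

HB.instance Definition _ := isKernel.Build _ _ _ _ R tri_jumps measurable_tri_jumps.

Definition tri_Jk : R.-ker borel E ~> borel E := tri_jumps.

(** Each edge appears once: [tri_J] charges both directions, and the form carries the factor one
    half. *)
Definition tri_form (u v : E -> R) : R :=
  (u (Some true) - u None) * (v (Some true) - v None) +
  (u (Some false) - u None) * (v (Some false) - v None).

Definition wsum (f : E -> R) : R := eps * f None + f (Some true) + f (Some false).

Lemma integral_tri_m (f : borel E -> R) : (\int[tri_m]_x (f x)%:E = (wsum f)%:E)%E.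
Proof.
rewrite integral_wdirac; last exact: measurable_fun_tri.
by rewrite !big_cons big_nil /wsum /= !mul1r addr0 addrA.
Qed.

Lemma tri_m_gt0 (x : E) (A : set (borel E)) : A x -> (0 < tri_m A)%E.
Proof.
move=> Ax; rewrite -[tri_m A](_ : (\int[tri_m]_x (\1_A x)%:E = _)%E); last first.
  by rewrite integral_indic ?setIT//; exact: measurable_tri.
rewrite integral_tri_m lte_fin /wsum.
have i0 y : 0 <= \1_A y :> R by rewrite indicE; case: (_ \in _).
have e0 : 0 <= eps * \1_A (None : E) by rewrite mulr_ge0// ltW.
have := i0 None; have := i0 (Some true); have := i0 (Some false).
case: x Ax => [[]|] Ax h1 h2 h3.
- by have : \1_A (Some true : E) = 1 :> R; [rewrite indicE mem_set|lra].
- by have : \1_A (Some false : E) = 1 :> R; [rewrite indicE mem_set|lra].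
- have e : \1_A (None : E) = 1 :> R by rewrite indicE mem_set.
  by rewrite e mulr1; have := eps0; lra.
Qed.

Lemma ae_tri_m (P : E -> Prop) : {ae tri_m, forall x, P x} -> forall x, P x.
Proof.
move=> [N [mN N0 hN]] x; apply: contrapT => nP.
by have := tri_m_gt0 (hN x nP); rewrite N0 ltxx.
Qed.

Lemma dot_tri u v : dot tri_m u v = wsum (fun x => u x * v x).
Proof. by rewrite /dot /Rintegral integral_tri_m. Qed.

Lemma Lnorm_tri (p : R) (g : E -> R) : 0 < p ->
  'N[tri_m]_p%:E[EFin \o g]%E = (wsum (fun x => `|g x| `^ p) `^ p^-1)%:E.
Proof.
move=> p0; rewrite Lnorm.unlock /=.
by rewrite (integral_tri_m (fun x => `|g x| `^ p)) poweR_EFin.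
Qed.

Lemma Lfun_tri (p : R) (f : borel E -> R) : 0 < p -> f \in Lfun tri_m p%:E.
Proof.
move=> p0; apply/Lfun_finP => //; split; first exact: measurable_fun_tri.
by rewrite integral_tri_m ltry.
Qed.

Lemma L2_tri u : L2 tri_m u. Proof. exact: Lfun_tri. Qed.

Lemma tri_law_integral t (x : E) (F : with_cemetery E -> \bar R) : (forall y, 0 <= F y)%E ->
  (\int[tri_law (Some x)]_w F (tri_path eps t w) =
   tri_sum (fun y => F (Some y) * (prob eps t x y)%:E))%E.
Proof.
move=> F0; rewrite ge0_integral_image//; last first.
  move=> _ Y mY; rewrite setTI.
  exact: (measurable_tri_path eps0 eps1 (fun y => Y (F y)) (measurable_cst t)).
rewrite (eq_integral (fun s => F (Some (walk eps x s t)))).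
  rewrite (walk_integral eps0 eps1 x t (F := fun y => F (Some y)))//.
  by rewrite /tri_sum !setTI !probE.
by move=> s _; rewrite /tri_path /= add0r.
Qed.

Lemma Pt_tri t (f : E -> R) x : Pt X t f x = expect eps t f x.
Proof.
rewrite /Pt /Rintegral integralE.
pose Fp (y : with_cemetery E) : \bar R := (Num.max (oapp f 0 y) 0)%:E.
pose Fn (y : with_cemetery E) : \bar R := (Num.max (- oapp f 0 y) 0)%:E.
rewrite (eq_integral (fun w => Fp (tri_path eps t w))); last first.
  by move=> w _; rewrite funeposE /Fp EFin_max.
rewrite [X in (_ - X)%E](eq_integral (fun w => Fn (tri_path eps t w))); last first.
  by move=> w _; rewrite funenegE /Fn EFin_max.
rewrite !tri_law_integral; last 2 first.
- by move=> y; rewrite lee_fin le_max lexx orbT.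
- by move=> y; rewrite lee_fin le_max lexx orbT.
rewrite (_ : tri_sum _ = (tri_sum (fun y => Num.max (f y) 0 * prob eps t x y))%:E)//.
rewrite [X in (_ - X)%E](_ : _ = (tri_sum (fun y => Num.max (- f y) 0 * prob eps t x y))%:E)//.
rewrite -EFinB /= /expect /tri_sum.
have pn (a : R) : a = Num.max a 0 - Num.max (- a) 0.
  by rewrite /Num.max; case: ifP; case: ifP; lra.
rewrite [in RHS](pn (f None)) [in RHS](pn (f (Some true))) [in RHS](pn (f (Some false))).
by ring.
Qed.

Lemma wsum_ge0 f : (forall x, 0 <= f x) -> 0 <= wsum f.
Proof.
by move=> f0; rewrite /wsum !addr_ge0// mulr_ge0// ltW.
Qed.

Lemma E1_0 : E1 tri_m tri_form (fun=> 0) = 0.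
Proof. by rewrite /E1 dot_tri /tri_form /wsum; ring. Qed.

Lemma clip_dist (a b : R) :
  `|Num.min (Num.max 0 a) 1 - Num.min (Num.max 0 b) 1| <= `|a - b|.
Proof.
have h (x y : R) : x <= y -> 0 <= Num.min (Num.max 0 y) 1 - Num.min (Num.max 0 x) 1 <= y - x.
  move=> xy; rewrite /Num.min /Num.max.
  have [?|?] := ltP 0 x; have [?|?] := ltP 0 y; have [?|?] := ltP x 1;
    have [?|?] := ltP y 1; rewrite ?ltr01; lra.
wlog ba : a b / b <= a.
  by move=> H; have [/H//|/ltW/H] := leP b a; rewrite distrC [leRHS]distrC.
by have /andP[h1 h2] := h _ _ ba; rewrite !ger0_norm// subr_ge0.
Qed.

Lemma wsum_sqr_ge (f : E -> R) x : eps * `|f x| ^+ 2 <= wsum (fun y => f y * f y).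
Proof.
have h y : 0 <= f y * f y by rewrite -expr2 sqr_ge0.
have e1 := eps1; have e0 := eps0.
have h0 y : eps * (f y * f y) <= f y * f y by rewrite ler_piMl.
have h2 y : 0 <= eps * (f y * f y) by rewrite mulr_ge0// ltW.
rewrite real_normK ?num_real// expr2 /wsum.
have := h None; have := h (Some true); have := h (Some false).
have := h0 None; have := h0 (Some true); have := h0 (Some false).
have := h2 None; have := h2 (Some true); have := h2 (Some false).
by case: x => [[]|]; lra.
Qed.

Lemma tri_form_cvg (u_ : nat -> E -> R) u : (forall x, u_ n x @[n --> \oo] --> u x) ->
  (tri_form (fun x => u_ n x - u x) (fun x => u_ n x - u x) +
   dot tri_m (fun x => u_ n x - u x) (fun x => u_ n x - u x)) @[n --> \oo] --> 0.
Proof.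
move=> cu.
have c0 x : u_ n x - u x @[n --> \oo] --> 0.
  by rewrite -(subrr (u x)); apply: cvgB; [exact: cu|exact: cvg_cst].
rewrite (_ : (fun n => _) = (fun n =>
   ((u_ n (Some true) - u (Some true)) - (u_ n None - u None)) *
   ((u_ n (Some true) - u (Some true)) - (u_ n None - u None)) +
   ((u_ n (Some false) - u (Some false)) - (u_ n None - u None)) *
   ((u_ n (Some false) - u (Some false)) - (u_ n None - u None)) +
   (eps * ((u_ n None - u None) * (u_ n None - u None)) +
    (u_ n (Some true) - u (Some true)) * (u_ n (Some true) - u (Some true)) +
    (u_ n (Some false) - u (Some false)) * (u_ n (Some false) - u (Some false))))); last first.
  by apply/funext => n; rewrite dot_tri /tri_form /wsum.
have z : 0 = (0 - 0) * (0 - 0) + (0 - 0) * (0 - 0) + (eps * (0 * 0) + 0 * 0 + 0 * 0) :> R by ring.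
rewrite [X in _ --> X]z.
have c1 y : (u_ n y - u y) - (u_ n None - u None) @[n --> \oo] --> 0 - 0.
  by apply: cvgB; exact: c0.
have sq y : (u_ n y - u y) * (u_ n y - u y) @[n --> \oo] --> (0 * 0 : R).
  by apply: cvgM; exact: c0.
apply: cvgD; first by apply: cvgD; apply: cvgM; exact: c1.
apply: cvgD; last exact: sq.
apply: cvgD; last exact: sq.
by apply: cvgM; [exact: cvg_cst|exact: sq].
Qed.

Lemma tri_dirichlet_form : dirichlet_form tri_m setT tri_form.
Proof.
split.
- by move=> u _; exact: L2_tri.
- move=> u v _ _ uv; split => // w _.
  have e x : u x = v x by exact: (ae_tri_m uv).
  by rewrite /tri_form !e.
- by [].
- move=> f _ e e0; exists f => //.
  rewrite (_ : (fun x => (f x - f x)%:E) = EFin \o (fun=> 0)); last first.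
    by apply/funext => x; rewrite subrr.
  rewrite Lnorm_tri// /wsum normr0 powR0// ?pnatr_eq0// mulr0 !addr0 powR0 ?lte_fin//.
- by move=> u v _ _; rewrite /tri_form; ring.
- by move=> a u v w _ _ _; rewrite /tri_form; ring.
- by move=> u _; rewrite /tri_form -!expr2 addr_ge0// sqr_ge0.
- move=> u_ _ cauchy.
  have cv x : cvgn (u_ ^~ x).
    apply/cauchy_cvgP; apply: cauchy_exP => e e0.
    have [|N hN] := cauchy (eps * e ^+ 2); first by rewrite mulr_gt0// exprn_gt0.
    exists (u_ N x); exists N => // n /= Nn.
    have := hN N n (leqnn _) Nn; rewrite dot_tri => h.
    have h1 := wsum_sqr_ge (fun y => u_ N y - u_ n y) x.
    have h2 : 0 <= tri_form (fun y => u_ N y - u_ n y) (fun y => u_ N y - u_ n y).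
      by rewrite /tri_form -!expr2 addr_ge0// sqr_ge0.
    rewrite /ball /= -(@ltr_pXn2r _ 2)// ?nnegrE// ?ltW//.
    by rewrite -(ltr_pM2l eps0); lra.
  exists (fun x => limn (u_ ^~ x)) => //.
  by apply: tri_form_cvg => x; exact: cv.
- move=> u _; split => //; rewrite /tri_form -!expr2.
  have sq (a b : R) : `|a| <= `|b| -> a ^+ 2 <= b ^+ 2.
    by move=> h; rewrite -[a ^+ 2]real_normK ?num_real// -[b ^+ 2]real_normK ?num_real// lerXn2r ?nnegrE.
  by apply: lerD; apply: sq; exact: clip_dist.
Qed.

Lemma tri_regular : regular_form tri_m setT tri_form.
Proof.
have cc f : continuous_compact_support (f : E -> R).
  by split; [exact: tri_continuous|exact: tri_compact].
split => [u _ e e0|f _ e e0].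
  exists u; first by split.
  by rewrite (_ : (fun x => u x - u x) = fun=> 0) ?E1_0//; apply/funext => x; rewrite subrr.
by exists f; [split|move=> x; rewrite subrr normr0].
Qed.

Lemma tri_quasi_continuous u : quasi_continuous tri_m setT tri_form u.
Proof.
move=> e e0; exists set0; split; first exact: open0.
  apply: (@le_lt_trans _ _ 0%E); last by rewrite lte_fin.
  apply: ereal_inf_lbound; exists (fun=> 0); last by rewrite E1_0.
  by split => //; apply: aeW.
by rewrite setC0; apply: continuous_subspaceT; exact: tri_continuous.
Qed.

Lemma tri_pure_jump : pure_jump tri_m setT tri_form tri_J tri_Jk.
Proof.
have one (T : Type) (A : set T) x : \1_A x = (x \in A)%:R :> R by rewrite indicE.
split.
- apply: radon_of_compact; first exact: tri2_compact.
    by move=> A; apply: wdirac_fin; exact: measurable_tri2.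
  by move=> A B AB; apply: le_measure; rewrite ?inE//; exact: measurable_tri2.
- move=> C mC _; rewrite !wdiracE//; last exact: measurable_tri2.
  have e x y : \1_[set z : E * E | C (z.2, z.1)] (x, y) = \1_C (y, x) :> R by [].
  rewrite !big_cons !big_nil /= !e !mul1e !adde0.
  by rewrite addeA addeC -addeA.
- move=> C mC CO; rewrite !wdiracE//.
  have JE x : tri_jumps x (xsection C x) = (if x is Some _ then \1_C (x, None)
      else eps^-1 * \1_C (x, Some true) + eps^-1 * \1_C (x, Some false))%:E.
    have e y z : \1_(xsection C y) z = \1_C (y, z) :> R.
      by rewrite !indicE mem_xsection.
    case: x => [b|]; rewrite /tri_jumps (wdiracE _ (measurable_tri _)) !big_cons big_nil.
      by rewrite /= e mul1e adde0.
    by rewrite /= !e adde0.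
  rewrite (eq_integral (fun x : borel E => (if x is Some _ then \1_C (x, None)
      else eps^-1 * \1_C (x, Some true) + eps^-1 * \1_C (x, Some false))%:E)) => [|x _]; last first.
    exact: JE.
  rewrite integral_tri_m /wsum !big_cons big_nil /= !mul1e adde0 -!EFinD.
  by congr EFin; field; rewrite gt_eqF.
- move=> u v _ _; exists u, v; split.
  + by split; [exact: measurable_fun_tri|apply: aeW|exact: tri_quasi_continuous].
  + by split; [exact: measurable_fun_tri|apply: aeW|exact: tri_quasi_continuous].
  rewrite integral_mkcond (eq_integral (fun z : borel E * borel E => (((u z.2 - u z.1) * (v z.2 - v z.1)) *
     \1_(@offdiag E) z)%:E)); last first.
    by move=> z _; rewrite patchE indicE; case: ifP; rewrite ?mulr1 ?mulr0.
  rewrite integral_wdirac; last by move=> _ Y _; exact: measurable_tri2.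
  have o x y : (x : E) <> y -> \1_(@offdiag E) (x, y) = 1 :> R by move=> xy; rewrite indicE mem_set.
  rewrite !big_cons big_nil /= !o// -EFinM; congr EFin; rewrite /tri_form.
  by field.
Qed.

(** Orthogonality of the three modes in L^2; their squared norms are [eps + 2], [2] and
    [2 + 4 / eps]. *)
Lemma wsum_modes (a b c A B : R) :
  wsum (fun y => `|a + b * A * odd_mode R y + c * B * even_mode eps y| `^ 2) =
  (eps + 2) * a ^+ 2 + (2 * b ^+ 2 * A ^+ 2 + c ^+ 2 * B ^+ 2 * (2 + 4 / eps)).
Proof.
rewrite /wsum !powR_mulrn// !real_normK ?num_real// /odd_mode /even_mode.
by field; rewrite gt_eqF.
Qed.

Lemma tri_semigroup : L2_semigroup tri_m (Pt X).
Proof.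
have PtE t f : Pt X t f = expect eps t f by apply/funext => x; exact: Pt_tri.
have em t f v t0 := @expect_modes _ _ eps0 eps1 t f v t0.
have two0 : (0 : R) < 2 by [].
split.
- by move=> *; exact: L2_tri.
- by move=> t a f g t0 _ _; apply: aeW => x _; rewrite !Pt_tri -[g in LHS]/(fun y => g y) ;
    have := expect_lin eps t a 1 f g x; rewrite mul1r => <-; rewrite /expect /tri_sum !mul1r.
- move=> t f t0 _; rewrite (Lnorm_tri (Pt X t f) two0) (Lnorm_tri f two0) lee_fin.
  apply: ge0_ler_powR; rewrite ?nnegrE.
  + by rewrite invr_ge0.
  + by apply: wsum_ge0 => x; exact: powR_ge0.
  + by apply: wsum_ge0 => x; exact: powR_ge0.
  have A0 := expR_ge0 (- t); have B0 := expR_ge0 (- ((1 + 2 / eps) * t)).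
  have A1 : expR (- t) <= 1 by rewrite -[leRHS]expR0 ler_expR oppr_le0.
  have B1 : expR (- ((1 + 2 / eps) * t)) <= 1.
    by rewrite -[leRHS]expR0 ler_expR oppr_le0 mulr_ge0//; have := Lam_ge2 eps0 eps1; lra.
  rewrite -[in leRHS](_ : (fun y => const_coef eps f + odd_coef f * 1 * odd_mode R y +
    even_coef eps f * 1 * even_mode eps y) = f); last first.
    by apply/funext => y; rewrite (mode_decomposition eps0 eps1 f) !mulr1.
  have -> : Pt X t f = fun y => const_coef eps f + odd_coef f * expR (- t) * odd_mode R y +
    even_coef eps f * expR (- ((1 + 2 / eps) * t)) * even_mode eps y.
    by apply/funext => y; rewrite PtE em.
  rewrite !wsum_modes !expr1n !mulr1.
  have c0 : 0 <= even_coef eps f ^+ 2 * (2 + 4 / eps).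
    by rewrite mulr_ge0 ?sqr_ge0// addr_ge0// divr_ge0// ltW.
  rewrite !lerD2l//; apply: lerD.
    by apply: ler_piMr; [rewrite mulr_ge0// sqr_ge0|exact: exprn_ile1].
  by rewrite mulrAC; apply: ler_piMr => //; exact: exprn_ile1.
- by move=> f _; apply: aeW => x _; rewrite Pt_tri expect0.
- by move=> s t f s0 t0 _; apply: aeW => x _; rewrite !PtE expect_add.
- move=> t f g t0 _ _; rewrite !dot_tri /wsum !PtE !em//.
  rewrite !(mode_decomposition eps0 eps1 f) !(mode_decomposition eps0 eps1 g) /odd_mode /even_mode.
  by field; rewrite gt_eqF.
- move=> f _.
  pose g := 1 + 2 / eps; have g0 : 0 <= g by rewrite /g; have := Lam_ge2 eps0 eps1; lra.
  (* By [1 - expR (- s) <= s] in each mode, [K t^2] bounds the squared norm of [P_t f - f]. *)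
  pose K := 2 * odd_coef f ^+ 2 + even_coef eps f ^+ 2 * g ^+ 2 * (2 + 4 / eps).
  have d0 : 0 <= 2 + 4 / eps by rewrite addr_ge0// divr_ge0// ltW.
  have K0 : 0 <= K.
    by apply: addr_ge0; [rewrite mulr_ge0// sqr_ge0|rewrite mulr_ge0// mulr_ge0// sqr_ge0].
  apply: (@squeeze_cvge _ _ _ _ (fun=> 0%E) _ (fun t : R => (K `^ 2^-1 * t)%:E)).
  + near=> t; have t0 : 0 <= t by near: t; exact: nbhs_right_ge.
    rewrite (_ : (fun x => (Pt X t f x - f x)%:E) = EFin \o (fun y =>
      0 + odd_coef f * (expR (- t) - 1) * odd_mode R y +
      even_coef eps f * (expR (- (g * t)) - 1) * even_mode eps y)); last first.
      apply/funext => y; congr EFin; rewrite PtE em// [in LHS](mode_decomposition eps0 eps1 f y).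
      by rewrite -/g; ring.
    rewrite (Lnorm_tri _ two0) !lee_fin powR_ge0 /= wsum_modes.
    have -> : K `^ 2^-1 * t = (K * t ^+ 2) `^ 2^-1.
      by rewrite powRM ?sqr_ge0// -powR_mulrn// -powRrM mulfV// powRr1.
    apply: ge0_ler_powR; rewrite ?nnegrE ?invr_ge0//.
    * by rewrite expr0n mulr0 add0r; apply: addr_ge0; apply: mulr_ge0 => //;
        rewrite ?sqr_ge0// mulr_ge0// sqr_ge0.
    * by rewrite mulr_ge0// sqr_ge0.
    have sq (s : R) : 0 <= s -> (expR (- s) - 1) ^+ 2 <= s ^+ 2.
      move=> s0; have [h _] := one_sub_expRN s0.
      have : expR (- s) <= 1 by rewrite -[leRHS]expR0 ler_expR oppr_le0.
      by move=> h1; rewrite -sqrrN lerXn2r ?nnegrE; lra.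
    rewrite expr0n /= mulr0 add0r /K [leRHS]mulrDl; apply: lerD.
      by apply: ler_wpM2l; [rewrite mulr_ge0// sqr_ge0|exact: sq].
    rewrite [leRHS]mulrAC; apply: ler_wpM2r => //; rewrite -[leRHS]mulrA -[X in _ <= _ * X]exprMn.
    by apply: ler_wpM2l; [exact: sqr_ge0|apply: sq; rewrite mulr_ge0].
  + exact: cvg_cst.
  + apply: cvg_EFin; first by near=> t.
    have h : K `^ 2^-1 * t @[t --> (0 : R)^'+] --> K `^ 2^-1 * 0.
      by apply: cvgM; [exact: cvg_cst|exact: (cvg_at_right_filter cvg_id)].
    by rewrite mulr0 in h.
Unshelve. all: by end_near. Qed.

(** In the modes the quotient is a combination of [(1 - expR (- (g * t))) / t] for the two rates
    [g = 1] and [g = 1 + 2 / eps]; it converges for all functions, so the domain is everything. *)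
Lemma tri_associated : form_of_semigroup tri_m setT tri_form (Pt X).
Proof.
have PtE t f : Pt X t f = expect eps t f by apply/funext => x; exact: Pt_tri.
have em t f v t0 := @expect_modes _ _ eps0 eps1 t f v t0.
have lim (g : R) : 0 <= g -> (1 - expR (- (g * t))) / t @[t --> 0^'+] --> g.
  move=> g0; apply/cvgrPdist_le => e e0.
  near=> t; have t0 : 0 < t by near: t; exact: nbhs_right_gt.
  have gt0 : 0 <= g * t by rewrite mulr_ge0// ltW.
  have [h1 h2] := one_sub_expRN gt0.
  have -> : g - (1 - expR (- (g * t))) / t = (g * t - (1 - expR (- (g * t)))) / t.
    by field; rewrite gt_eqF.
  rewrite ger0_norm; last by rewrite divr_ge0// ltW.
  rewrite ler_pdivrMr//; apply: le_trans h2 _.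
  rewrite (_ : (g * t) ^+ 2 = (g ^+ 2 * t) * t); last by ring.
  rewrite ler_pM2r//.
  have tg : t <= e / (g ^+ 2 + 1).
    by near: t; apply: nbhs_right_le; rewrite divr_gt0// ltr_wpDl ?sqr_ge0.
  have : t * (g ^+ 2 + 1) <= e by rewrite -ler_pdivlMr// ltr_wpDl ?sqr_ge0.
  by nra.
have key u v : dot tri_m (fun x => u x - Pt X t u x) v / t @[t --> 0^'+] --> tri_form u v.
  have L2 := Lam_ge2 eps0 eps1.
  have c1 := lim 1 ler01.
  have c2 : (1 - expR (- ((1 + 2 / eps) * t))) / t @[t --> 0^'+] --> 1 + 2 / eps.
    by apply: lim; lra.
  have -> : tri_form u v = 2 * odd_coef u * odd_coef v * 1 +
      even_coef eps u * even_coef eps v * (2 + 4 / eps) * (1 + 2 / eps).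
    rewrite /tri_form !(mode_decomposition eps0 eps1 u) !(mode_decomposition eps0 eps1 v).
    by rewrite /odd_mode /even_mode; field; rewrite gt_eqF.
  apply: cvg_trans (cvgD (cvgM (cvg_cst (2 * odd_coef u * odd_coef v)) c1)
    (cvgM (cvg_cst (even_coef eps u * even_coef eps v * (2 + 4 / eps))) c2)).
  apply: near_eq_cvg; near=> t; have t0 : 0 < t by near: t; exact: nbhs_right_gt.
  transitivity (2 * odd_coef u * odd_coef v * ((1 - expR (- (1 * t))) / t) +
    even_coef eps u * even_coef eps v * (2 + 4 / eps) *
    ((1 - expR (- ((1 + 2 / eps) * t))) / t)); first by [].
  have t0' := ltW t0.
  rewrite dot_tri /wsum PtE !(em _ _ _ t0') !(mode_decomposition eps0 eps1 u)
    !(mode_decomposition eps0 eps1 v) /odd_mode /even_mode /= mul1r.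
  by field; rewrite !gt_eqF.
split => [u|u v _ _]; last exact: key.
by split => // _; split; [exact: L2_tri|exists (tri_form u u); exact: key].
Unshelve. all: by end_near. Qed.

Lemma tri_pure_jump_setting : pure_jump_setting tri_m setT tri_form tri_J tri_Jk X.
Proof.
split.
- exact: tri_locally_compact.
- exact: tri_separable.
- apply: radon_of_compact; first exact: tri_compact.
    by move=> A; apply: wdirac_fin; exact: measurable_tri.
  by move=> A B AB; apply: le_measure; rewrite ?inE//; exact: measurable_tri.
- by move=> U _ [x Ux]; exact: tri_m_gt0 Ux.
- exact: tri_dirichlet_form.
- exact: tri_regular.
- exact: tri_pure_jump.
- exact: tri_hunt.
- exact: tri_semigroup.
- exact: tri_associated.
Qed.

(** This is the constant [1] plus [odd_mode]: its evolution does not depend on [eps], while the jump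
    kernel at the centre has mass of order [1 / eps]. *)
Definition tri_f (x : E) : R := if x is Some b then (if b then 2 else 0) else 1.

Lemma Pt_tri_f t x : 0 <= t -> Pt X t tri_f x = 1 + expR (- t) * odd_mode R x.
Proof.
move=> t0; rewrite Pt_tri expect_modes// /const_coef /odd_coef /even_coef /tri_f.
by rewrite (_ : (2 + 0) / 2 - 1 = 0); [rewrite !mul0r !addr0; field|lra].
Qed.

Lemma Lnorm_tri_f (p : R) : 1 <= p ->
  ('N[tri_m]_p%:E[EFin \o tri_f] <= ((1 + 2 `^ p) `^ p^-1)%:E)%E.
Proof.
move=> p1; have p0 : 0 < p by lra.
rewrite (Lnorm_tri tri_f p0) lee_fin; apply: ge0_ler_powR.
- by rewrite invr_ge0 ltW.
- by rewrite nnegrE; apply: wsum_ge0 => x; exact: powR_ge0.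
- by rewrite nnegrE addr_ge0// powR_ge0.
rewrite /wsum /tri_f normr1 normr0 powR1 mulr1 (powR0 (lt0r_neq0 p0)) addr0.
by rewrite ger0_norm// lerD2r.
Qed.

Lemma Gtilde_center : ((expR (- 2) / eps)%:E `^ 2^-1 <= Gtilde tri_Jk X tri_f (None : E))%E.
Proof.
rewrite /Gtilde; apply: gt0_ler_poweR => //.
- by rewrite in_itv/= leey andbT lee_fin divr_ge0 ?expR_ge0// ltW.
- rewrite in_itv/= leey andbT; apply: integral_ge0 => t _; apply: integral_ge0 => y _.
  by rewrite lee_fin mulr_ge0 ?sqr_ge0 ?chi_ge0.
have m01 : measurable (`[0, 1] : set R) by exact: measurable_itv.
have inner t : 0 <= t -> (\int[tri_Jk (None : E)]_(y in [set~ (None : E)])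
    ((Pt X t tri_f y - Pt X t tri_f None) ^+ 2 *
     chi (Pt X t tri_f None) (Pt X t tri_f y))%:E = (expR (- t) ^+ 2 / eps)%:E)%E.
  move=> t0; rewrite integral_mkcond (eq_integral (fun y : borel E =>
     (((Pt X t tri_f y - Pt X t tri_f None) ^+ 2 *
       chi (Pt X t tri_f None) (Pt X t tri_f y)) * \1_([set~ (None : E)]) y)%:E)); last first.
    by move=> y _; rewrite patchE indicE; case: ifP; rewrite ?mulr1 ?mulr0.
  rewrite integral_wdirac; last exact: measurable_fun_tri.
  have o b : \1_([set~ (None : E)]) (Some b : E) = 1 :> R by rewrite indicE mem_set.
  have e0 := expR_gt0 (- t); have e1 : expR (- t) <= 1 by rewrite -[leRHS]expR0 ler_expR oppr_le0.
  rewrite !big_cons big_nil !o /= !Pt_tri_f// /odd_mode !mulr0 !addr0 !mulr1 mulrN1.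
  (* The end [Some true] has the larger value [1 + expR (- t)] and weight [0]; the end [Some false]
     has [1 - expR (- t)] and weight [1]. Only one of the two increments survives. *)
  rewrite /chi normr1 !ger0_norm; [|lra..].
  rewrite ifF; last by apply/negbTE; rewrite -leNgt; lra.
  rewrite ifF; last by apply/negbTE; rewrite lt_eqF//; lra.
  rewrite ifT; last by lra.
  by congr EFin; ring.
pose h (t : R) : \bar R := (expR (- t) ^+ 2 / eps)%:E.
have h0 t : (0 <= h t)%E by rewrite lee_fin divr_ge0 ?sqr_ge0// ltW.
have mh (A : set R) : measurable_fun A h.
  apply: measurable_funTS; apply/measurable_EFinP; apply: measurable_funM => //.
  apply: measurable_funX; apply: measurableT_comp; first exact: measurable_expR.
  exact: measurable_funN.
rewrite [leRHS](_ : _ = \int[lebesgue_measure]_(t in `[0%R, +oo[) h t)%E; last first.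
  by apply: eq_integral => t; rewrite inE /= in_itv /= andbT => t0; rewrite inner.
(* Keeping only the times up to [1], where [expR (- t) ^+ 2] is at least [expR (- 2)], gives the
   right order in [eps]. *)
apply: (@le_trans _ _ (\int[lebesgue_measure]_(t in `[0%R, 1%R]) h t)%E); last first.
  apply: ge0_subset_integral => //; first exact: mh.
  by move=> t /=; rewrite !in_itv /= andbT => /andP[].
apply: (@le_trans _ _ (\int[lebesgue_measure]_(t in `[0%R, 1%R]) (expR (- 2) / eps)%:E)%E).
  by rewrite integral_cst//= lebesgue_measure_itv /= lte_fin ltr01 oppr0 adde0 mule1.
apply: ge0_le_integral => //.
- by move=> t _; rewrite lee_fin divr_ge0 ?expR_ge0// ltW.
- exact: mh.
- move=> t; rewrite /= in_itv /= => /andP[t0 t1]; rewrite lee_fin ler_pM2r ?invr_gt0//.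
  by rewrite expr2 -expRD ler_expR; lra.
Qed.

Lemma integral_tri_m_ge (F : E -> \bar R) : (forall x, 0 <= F x)%E ->
  (eps%:E * F None <= \int[tri_m]_x F x)%E.
Proof.
move=> F0; rewrite ge0_integral_wdirac//; last exact: measurable_fun_tri.
rewrite big_cons; apply: leeDl.
by apply: sume_ge0 => q _; rewrite mule_ge0.
Qed.

Lemma Lnorm_Gtilde_ge (p : R) : 0 < p ->
  (((eps * (expR (- 2) / eps) `^ (p / 2)) `^ p^-1)%:E <= 'N[tri_m]_p%:E[Gtilde tri_Jk X tri_f])%E.
Proof.
move=> p0; have -> : ('N[tri_m]_p%:E[Gtilde tri_Jk X tri_f] =
  (\int[tri_m]_x (`|Gtilde tri_Jk X tri_f x| `^ p)) `^ p^-1)%E by rewrite Lnorm.unlock.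
rewrite -poweR_EFin.
have c0 : 0 <= expR (- 2) / eps by rewrite divr_ge0 ?expR_ge0// ltW.
have G0 x : (0 <= `|Gtilde tri_Jk X tri_f x| `^ p)%E by exact: poweR_ge0.
apply: gt0_ler_poweR.
- by rewrite invr_ge0 ltW.
- by rewrite in_itv/= leey andbT lee_fin mulr_ge0 ?powR_ge0// ltW.
- by rewrite in_itv/= leey andbT integral_ge0.
apply: (le_trans _ (integral_tri_m_ge G0)).
rewrite EFinM; apply: lee_wpmul2l; first by rewrite lee_fin ltW.
have -> : ((expR (- 2) / eps) `^ (p / 2))%:E = (((expR (- 2) / eps)%:E `^ 2^-1) `^ p)%E.
  by rewrite -poweRrM -poweR_EFin [2^-1 * _]mulrC.
apply: gt0_ler_poweR.
- exact: ltW.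
- by rewrite in_itv/= leey andbT lee_fin powR_ge0.
- by rewrite in_itv/= leey andbT abse_ge0.
by rewrite gee0_abs; [exact: Gtilde_center|exact: poweR_ge0].
Qed.

End tri_setting.

Lemma no_universal_constant (R : realType) (p C : R) : 2 < p -> 0 < C ->
  exists (E : pmetricType R) (m : {measure set (borel E) -> \bar R})
    (D : set (E -> R)) (Ef : (E -> R) -> (E -> R) -> R)
    (J : {measure set (borel E * borel E) -> \bar R})
    (Jk : R.-ker borel E ~> borel E) (X : process E) (f : borel E -> R),
    [/\ pure_jump_setting m D Ef J Jk X, f \in Lfun m p%:E &
      ~ ('N[m]_p%:E[Gtilde Jk X f] <= C%:E * 'N[m]_p%:E[EFin \o f])%E].
Proof.
move=> p2 C0; have p0 : 0 < p by lra.
pose q := p / 2 - 1; have q0 : 0 < q by rewrite /q; lra.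
pose c : R := expR (- 2); have c0 : 0 < c by exact: expR_gt0.
have cp0 : 0 < c `^ (p / 2) by rewrite powR_gt0.
pose B := C `^ p * (1 + 2 `^ p).
have B0 : 0 <= B by rewrite mulr_ge0 ?powR_ge0// addr_ge0// powR_ge0.
(* The value to be taken by [e^(1 - p/2)]: then [c^(p/2) M = c^(p/2) + B] exceeds [B], the [p]-th
   power of the bound for the right side. *)
pose M := 1 + B / c `^ (p / 2).
have M1 : 1 <= M by rewrite lerDl divr_ge0// ltW.
have M0 : 0 < M by lra.
(* Solves [e^(- q) = M]. Positivity of [q = p / 2 - 1] is where [p > 2] enters, and [M >= 1] ensures
   [e <= 1]. *)
pose e := (M `^ q^-1)^-1.
have Mq0 : 0 < M `^ q^-1 by rewrite powR_gt0.
have e0 : 0 < e by rewrite invr_gt0.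
have e1 : e <= 1.
  rewrite invf_le1//; suff: 1 `^ q^-1 <= M `^ q^-1 by rewrite powR1.
  apply: ge0_ler_powR => //.
  - by rewrite invr_ge0 ltW.
  - by rewrite nnegrE.
  - by rewrite nnegrE ltW.
exists (tri R), (tri_m e0), setT, (@tri_form R), (tri_J R), (tri_Jk e0), (tri_process e), (@tri_f R).
split; [exact: tri_pure_jump_setting|exact: Lfun_tri|move=> h].
have h1 := le_trans (Lnorm_Gtilde_ge e0 e1 p0) h.
have : (C%:E * 'N[tri_m e0]_p%:E[EFin \o @tri_f R] <= C%:E * ((1 + 2 `^ p) `^ p^-1)%:E)%E.
  by apply: lee_wpmul2l; [rewrite lee_fin ltW|apply: Lnorm_tri_f => //; lra].
move=> /(le_trans h1); rewrite -EFinM lee_fin.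
have -> : e * (c / e) `^ (p / 2) = c `^ (p / 2) * M.
  rewrite /e invrK powRM ?ltW// ?ltW// mulrCA; congr (_ * _).
  rewrite -powRrM -powRN -powRD; last by rewrite (gt_eqF M0) implybT.
  have -> : - q^-1 + q^-1 * (p / 2) = 1 by rewrite /q; field; apply/eqP; lra.
  by rewrite powRr1 // ltW.
have -> : C * (1 + 2 `^ p) `^ p^-1 = B `^ p^-1.
  rewrite /B powRM ?powR_ge0 ?addr_ge0 ?powR_ge0//.
  by rewrite -powRrM mulfV ?gt_eqF// powRr1// ltW.
have -> : c `^ (p / 2) * M = c `^ (p / 2) + B.
  by rewrite /M mulrDr mulr1 mulrCA mulfV ?mulr1// gt_eqF.
apply/negP; rewrite -ltNge; apply: gt0_ltr_powR.
- by rewrite invr_gt0.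
- by rewrite nnegrE.
- by rewrite nnegrE addr_ge0// ltW.
- by rewrite ltrDr.
Qed.

Theorem theorem1p1 (R : realType) :
  (forall p : R, 2 <= p -> exists c : R, 0 < c /\
     forall (E : pmetricType R) (m : {measure set (borel E) -> \bar R})
       (D : set (E -> R)) (Ef : (E -> R) -> (E -> R) -> R)
       (J : {measure set (borel E * borel E) -> \bar R})
       (Jk : R.-ker borel E ~> borel E) (X : process E),
     pure_jump_setting m D Ef J Jk X -> strongly_stable m X p ->
     forall f : borel E -> R, f \in Lfun m p%:E ->
     (c%:E * 'N[m]_p%:E[EFin \o f] <= 'N[m]_p%:E[Gtilde Jk X f])%E) /\
  (forall p : R, 1 < p -> p <= 2 -> exists C : R, 0 < C /\
     forall (E : pmetricType R) (m : {measure set (borel E) -> \bar R})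
       (D : set (E -> R)) (Ef : (E -> R) -> (E -> R) -> R)
       (J : {measure set (borel E * borel E) -> \bar R})
       (Jk : R.-ker borel E ~> borel E) (X : process E),
     pure_jump_setting m D Ef J Jk X -> strongly_stable m X p ->
     forall f : borel E -> R, f \in Lfun m p%:E ->
     ('N[m]_p%:E[Gtilde Jk X f] <= C%:E * 'N[m]_p%:E[EFin \o f])%E) /\
  (forall p : R, 2 < p -> ~ exists C : R, 0 < C /\
     forall (E : pmetricType R) (m : {measure set (borel E) -> \bar R})
       (D : set (E -> R)) (Ef : (E -> R) -> (E -> R) -> R)
       (J : {measure set (borel E * borel E) -> \bar R})
       (Jk : R.-ker borel E ~> borel E) (X : process E),
     pure_jump_setting m D Ef J Jk X ->
     forall f : borel E -> R, f \in Lfun m p%:E ->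
     ('N[m]_p%:E[Gtilde Jk X f] <= C%:E * 'N[m]_p%:E[EFin \o f])%E).
Proof.
split; [|split].
- move=> p p2; have p1 : 1 < p by lra.
  have p0 : 0 < p by lra.
  have L0 := lower_const_gt0 p2.
  have c0 : 0 < lower_const p `^ p^-1 by rewrite powR_gt0.
  exists (lower_const p `^ p^-1)^-1; split=> [|E m D Ef J Jk X hX hs f fp].
    by rewrite invr_gt0.
  have [A [G [[A0 G0 -> ->] [_ /(_ p2 hs) AG]]]] := setting_bounds hX p1 fp.
  by rewrite muleC lee_pdivrMr// muleC; exact: poweR_inv_le.
- move=> p p1 p2; have p0 : 0 < p by lra.
  have U0 := upper_const_gt0 p1.
  exists (upper_const p `^ p^-1); split=> [|E m D Ef J Jk X hX hs f fp].
    by rewrite powR_gt0.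
  have [A [G [[A0 G0 -> ->] [/(_ p2) GA _]]]] := setting_bounds hX p1 fp.
  exact: poweR_inv_le.
- move=> p p2 [C [C0 hC]].
  have [E [m [D [Ef [J [Jk [X [f [hX fp]]]]]]]]] := no_universal_constant p2 C0.
  by apply; exact: hC hX f fp.
Qed.
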